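(* (Direct part.) Let $(\mu=\nu+\eta,a)$ be a real-antipodal $\mathbb{R}$-symmetric FS-pair on a strip $|\operatorname{Im} z|<\sigma_\mu$, with $\eta=\sum_{\gamma\in A}b(\gamma)\boldsymbol{\delta}_\gamma$, with $\nu=\sum_{n\ge1}p_n\boldsymbol{\delta}_{q_n}$ for nonzero $p_n\in\mathbb{R}$ and distinct $q_n\in\mathbb{R}$, and such that $\operatorname{supp}\nu\cup\operatorname{supp}\eta$ has no finite limit points. Assume $\operatorname{ord}(\nu),\operatorname{ord}(\eta)\le2(k+1)$ for some integer $k\ge0$ and that $a(\cdot)$ has finite exponential growth. Then the series $$F(z)=\frac{a(0)}2+\sum_{\lambda>0}a(\lambda)e^{2\pi i\lambda z}$$ converges absolutely in some half-plane $\operatorname{Im} z>c$, thus defining a holomorphic almost periodic function there. It extends to $\mathbb{C}$ as a meromorphic map with simple poles at $\gamma\in A$ and $q_n\in\mathbb{R}$ with respective residues $-b(\gamma)/2\pi i$ and $-p_n/2\pi i$. The map $F$ satisfies $\overline{F(\overline z)}=-F(z)$ and is given explicitly by $$F(z)=\frac{(z^2+1)^k}{2\pi i}\sum_{n\ge1}\frac{1+q_nz}{q_n-z}\frac{p_n}{(1+q_n^2)^{k+1}}+\frac{(z^2+\rho^2)^k}{2\pi i}\sum_{\gamma\in A}\frac{\rho^2+\gamma z}{\gamma-z}\frac{b(\gamma)}{(\rho^2+\gamma^2)^{k+1}}+iQ_\rho(z)\qquad( * )$$ for $\rho>\sigma_\mu$ and for some real polynomial $Q_\rho(z)$ of degree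 at most $2k$. (Converse part.) Conversely, let $F$ be a meromorphic map on $\mathbb{C}$ given by $( * )$ for some integer $k\ge 0$, some $\rho>\sigma$ and some real polynomial $Q_\rho$ of degree at most $2k$, with distinct $q_n\in\mathbb{R}$, $p_n\in\mathbb{R}$, $b(\gamma)\in\mathbb{R}$, $A\subset\{z:|\operatorname{Im} z|<\sigma<\infty\}$, $A\cap\mathbb{R}=\varnothing$, $\{q_n\}\cup A$ without finite limit points, $A=\{\overline z:z\in A\}$, $b(\gamma)=b(\overline\gamma)$, satisfying $\sum_{n\ge1}\frac{|p_n|}{(1+q_n^2)^{k+1}}<\infty$ and $\sum_{\gamma\in A}\frac{|b(\gamma)|}{(1+|\gamma|^2)^{k+1}}<\infty$. Moreover, assume that $F(\cdot+ic)\in\mathcal{AP}(\mathbb{C}^+)$ for some $c>0$, and that $\lambda\mapsto\mathbb{E}F(\lambda)$ is locally summable. Then $(\nu+\eta,a)$ is a real-antipodal $\mathbb{R}$-symmetric FS-pair on the strip $|\operatorname{Im} z|<\sigma$, where $$\nu:=\sum_{n\ge1}p_n\boldsymbol{\delta}_{q_n},\quad \eta:=\sum_{\gamma\in A}b(\gamma)\boldsymbol{\delta}_\gamma,\quad a(\lambda)=\overline{a(-\lambda)}:=\mathbb{E}F(\lambda)\ \text{ for }\lambda>0,\quad a(0)=2\operatorname{Re}\mathbb{E}F(0),$$ and $\operatorname{ord}(\nu),\operatorname{ord}(\eta)\le2(k+1)$.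
   Context: Notation: $\mathbb{C}^+=\{z\in\mathbb{C}:\operatorname{Im} z>0\}$; $\boldsymbol{\delta}_\gamma$ is the unit point mass at $\gamma$; a real polynomial has real coefficients. Fourier transform: $\widehat f(\xi)=\int_{\mathbb{R}}f(t)e^{-2\pi i t\xi}\,dt$; for $\varphi\in C_c^\infty(\mathbb{R})$, $\widehat\varphi$ also denotes its entire extension to $\mathbb{C}$. Measures: a complex-valued Borel measure $\mu$ supported on a strip $\{|\operatorname{Im} z|<\sigma_\mu\}$, $0\le\sigma_\mu<\infty$ (or on $\mathbb{R}$), is strongly tempered if $\int (1+|z|^2)^{-k/2}\,d|\mu|(z)<\infty$ for some integer $k\ge0$; $\operatorname{ord}(\mu)$ is the smallest such $k$. It is admissible if $\mu=\nu+\eta$, where $\nu$ is a strongly tempered measure on $\mathbb{R}$ and $\eta=\sum_{\gamma\in A}b(\gamma)\boldsymbol{\delta}_\gamma$ is a strongly tempered discrete measure (with $A$ its set of atoms) with $A\cap\mathbb{R}=\varnothing$ and with all finite limit points of $A$, if any, lying on $\mathbb{R}$ (this decomposition is unique). A function $a:\mathbb{R}\to\mathbb{C}$ is locally summable if $\{\lambda:a(\lambda)\ne0\}$ is countable and $\sum_{|\lambda|\le T}|a(\lambda)|<\infty$ for every $T>0$. It has finite exponential growth if $\sum_{\lambda\in\mathbb{R}}|a(\lambda)|e^{-\alpha|\lambda|}<\infty$ for some $\alpha>0$. FS-pair: a Fourier summation pair on a strip is a pair $(\mu,a)$ with $a:\mathbb{R}\to\mathbb{C}$ locally summable and $\mu=\nu+\eta$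 an admissible strongly tempered measure supported on a strip $\{|\operatorname{Im} z|<\sigma_\mu<\infty\}$ such that for every $\varphi\in C_c^\infty(\mathbb{R})$ $$\sum_{\lambda\in\mathbb{R}}a(\lambda)\varphi(\lambda)=\int_{\mathbb{R}}\widehat\varphi(t)\,d\nu(t)+\sum_{\gamma\in A}b(\gamma)\widehat\varphi(\gamma).$$ It is $\mathbb{R}$-symmetric if $\gamma\in A\iff\overline\gamma\in A$ and $b(\overline\gamma)=b(\gamma)$ for all $\gamma\in A$. It is real-antipodal if $\mu$ is real-valued and $\overline{a(\lambda)}=a(-\lambda)$ for all $\lambda\in\mathbb{R}$. Almost periodicity: a continuous $f:\mathbb{R}\to\mathbb{C}$ is almost periodic if for every $\varepsilon>0$ there is a relatively dense set $\tau_\varepsilon\subset\mathbb{R}$ (there is $l>0$ such that $\tau_\varepsilon$ meets every interval $(x,x+l)$) with $\sup_{x}|f(x+t)-f(x)|<\varepsilon$ for all $t\in\tau_\varepsilon$. $\mathcal{AP}(\mathbb{C}^+)$ is the set of holomorphic $F$ on $\mathbb{C}^+$ with $\sup_{\alpha<\operatorname{Im} z<\beta}|F(z)|<\infty$ for all $0<\alpha<\beta<\infty$ and $x\mapsto F(x+iy)$ almost periodic for each $y>0$. $F$ is holomorphic almost periodic on $\operatorname{Im} z>c$ if $F(\cdot+ic)\in\mathcal{AP}(\mathbb{C}^+)$; in that case the Fourier coefficients $\mathbb{E}F(\lambda):=\lim_{T\to\infty}\frac1{2T}\int_{-T+iy}^{T+iy}F(z)e^{-2\pi i\lambda z}\,dz$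 exist and do not depend on $y>c$. *)

(* Defs.v *)
From HB Require Import structures.
From mathcomp Require Import all_boot all_order all_algebra.
From mathcomp Require Import complex.
From mathcomp Require Import all_classical all_reals all_analysis.
From mathcomp Require Import measurable_realfun.

Set Implicit Arguments.
Unset Strict Implicit.
Unset Printing Implicit Defensive.

Import Order.TTheory GRing.Theory Num.Theory.
Import numFieldNormedType.Exports.

Local Open Scope classical_set_scope.
Local Open Scope ring_scope.
Local Open Scope complex_scope.

(* The topology and the normed-module structure of a numFieldType [K] are
   carried by its copy [K^o]; hence the copy [R[i]^o] of the complex numbers.
   [complex.Re], [complex.Im] and [Normc.normc] are the [R]-valued real part,
   imaginary part and modulus. *)
Notation cplx R := (R[i]^o).

Section ComplexAnalysis.
Variable R : realType.
Local Notation C := (cplx R).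

Definition cexp (z : C) : C :=
  (expR (complex.Re z) * cos (complex.Im z)) +i*
  (expR (complex.Re z) * sin (complex.Im z)).

Definition csummable (T : choiceType) (D : set T) (f : T -> C) : Prop :=
  (\esum_(x in D) (Normc.normc (f x))%:E < +oo)%E.

(* Unordered sums, as differences of sums of positive and negative parts;
   meaningful for absolutely summable families. *)
Definition rsum (T : choiceType) (D : set T) (f : T -> R) : R :=
  fine (\esum_(x in D) (Num.max (f x) 0)%:E)
  - fine (\esum_(x in D) (Num.max (- f x) 0)%:E).

Definition csum (T : choiceType) (D : set T) (f : T -> C) : C :=
  rsum D (fun x => complex.Re (f x)) +i* rsum D (fun x => complex.Im (f x)).

Definition cintegral d (T : measurableType d) (m : {measure set T -> \bar R})
    (D : set T) (f : T -> C) : C :=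
  Rintegral m D (fun x => complex.Re (f x)) +i*
  Rintegral m D (fun x => complex.Im (f x)).

Definition holomorphic_near (F : C -> C) (z0 : C) : Prop :=
  \forall z \near z0, derivable F z 1.

(* A meromorphic map is given by a total function whose values at the poles
   are irrelevant. *)
Definition meromorphic (F : C -> C) : Prop :=
  forall z0 : C, exists (n : nat) (g : C -> C),
    holomorphic_near g z0 /\
    \forall z \near z0^', F z = g z / (z - z0) ^+ n.

Definition simple_pole_with_residue (F : C -> C) (z0 r : C) : Prop :=
  r != 0 /\
  exists g : C -> C, holomorphic_near g z0 /\
    \forall z \near z0^', F z = r / (z - z0) + g z.

Definition relatively_dense (S : set R) : Prop :=
  exists2 l : R, 0 < l & forall x : R, S `&` `]x, x + l[ !=set0.

Definition almost_periodic (f : R -> C) : Prop :=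
  continuous f /\
  forall e : R, 0 < e -> exists2 S : set R, relatively_dense S &
    forall t, S t ->
      (ereal_sup [set (Normc.normc (f (x + t) - f x))%:E | x in [set: R]]
        < e%:E)%E.

Definition AP (F : C -> C) : Prop :=
  [/\ forall z : C, 0 < complex.Im z -> derivable F z 1,
      forall alpha beta : R, 0 < alpha -> alpha < beta ->
        (ereal_sup [set (Normc.normc (F z))%:E |
           z in [set z : C | (alpha < complex.Im z < beta)%R]] < +oo)%E &
      forall y : R, 0 < y -> almost_periodic (fun x : R => F (x +i* y))].

Definition shift_up (F : C -> C) (c : R) : C -> C :=
  fun z => F (z + (0 +i* c)).

Definition fourier_mean (F : C -> C) (y l T : R) : C :=
  ((2 * T)^-1)%:C *
  cintegral lebesgue_measure `[- T, T]
    (fun x => F (x +i* y) * cexp ((0 +i* (- (2 * pi * l))) * (x +i* y))).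

(* The coefficient of frequency [l], computed on the line of height [y]. *)
Definition fourier_coef (F : C -> C) (y l : R) : C :=
  lim (fourier_mean F y l T @[T --> +oo%R]).

End ComplexAnalysis.

Section Measures.
Variable R : realType.
Local Notation C := (cplx R).

(* A complex Borel measure on the real line, in general of infinite total
   variation, is given by its polar decomposition: total variation and
   unimodular density. *)
Record cmeasure := CMeasure {
  cm_var : {measure set (measurableTypeR R) -> \bar R};
  cm_phase : R -> C;
  cm_phase_Re : measurable_fun setT
    ((fun x => complex.Re (cm_phase x)) : measurableTypeR R -> R);
  cm_phase_Im : measurable_fun setT
    ((fun x => complex.Im (cm_phase x)) : measurableTypeR R -> R);
  cm_phase1 : forall x, Normc.normc (cm_phase x) = 1 }.

Definition cm_integral (nu : cmeasure) (D : set R) (f : R -> C) : C :=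
  cintegral (cm_var nu) D (fun x => f x * cm_phase nu x).

Definition cm_val (nu : cmeasure) (B : set R) : C :=
  cm_integral nu B (fun=> 1).

Definition cm_support (nu : cmeasure) : set R :=
  [set x : R | forall e : R, 0 < e -> cm_var nu (ball x e) != 0%E].

Definition least (P : nat -> Prop) : nat :=
  xget 0%N [set m | P m /\ forall j, P j -> (m <= j)%N].

Definition tempered_at (nu : cmeasure) (m : nat) : Prop :=
  (\int[cm_var nu]_x (((1 + x ^+ 2) `^ (- (m%:R / 2)))%:E) < +oo)%E.

Definition strongly_tempered (nu : cmeasure) : Prop :=
  exists m, tempered_at nu m.

Definition ord (nu : cmeasure) : nat := least (tempered_at nu).

(* A discrete complex measure on the complex plane is given by its mass
   function [b]; its set of atoms is the set where [b] does not vanish. *)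
Definition atoms (b : C -> C) : set C := [set g | b g != 0].

Definition discrete_tempered_at (b : C -> C) (m : nat) : Prop :=
  (\esum_(g in atoms b)
     (Normc.normc (b g) * (1 + Normc.normc g ^+ 2) `^ (- (m%:R / 2)))%:E
   < +oo)%E.

Definition discrete_strongly_tempered (b : C -> C) : Prop :=
  exists m, discrete_tempered_at b m.

Definition discrete_ord (b : C -> C) : nat := least (discrete_tempered_at b).

Definition discrete_support (b : C -> C) : set C := closure (atoms b).

Definition mass_function (A : set C) (b : C -> R) : C -> C :=
  fun g => if g \in A then (b g)%:C else 0.

End Measures.

Section AtomicMeasure.
Variables (R : realType) (N : set nat) (q p : nat -> R).
Local Notation C := (cplx R).

Definition atomic_weight (n : nat) : R := if n \in N then p n else 0.

Definition atomic_negative : set R :=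
  [set q n | n in [set n | N n /\ p n < 0]].

Definition atomic_phase (x : R) : C := if x \in atomic_negative then -1 else 1.

Lemma measurable_atomic_negative :
  measurable (atomic_negative : set (measurableTypeR R)).
Proof.
suff -> : atomic_negative =
    \bigcup_(n in [set n | N n /\ p n < 0]) [set q n].
  by apply: bigcup_measurable => n _; exact: measurable_set1.
by apply/seteqP; split => [x [n Nn <-]|x [n Nn ->]]; exists n.
Qed.

Lemma atomic_phase_Re : measurable_fun setT
  ((fun x => complex.Re (atomic_phase x)) : measurableTypeR R -> R).
Proof.
rewrite (_ : (fun _ => _) = (cst 1 \- (cst 2 \* \1_atomic_negative))).
  apply: measurable_funB; first exact: measurable_cst.
  apply: measurable_funM; first exact: measurable_cst.
  by apply/measurable_indicP; exact: measurable_atomic_negative.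
apply/funext => x; rewrite /atomic_phase /= indicE.
by case: (x \in _) => /=; rewrite ?mulr1 ?mulr0 ?subr0// opprD addNKr.
Qed.

Lemma atomic_phase_Im : measurable_fun setT
  ((fun x => complex.Im (atomic_phase x)) : measurableTypeR R -> R).
Proof.
rewrite (_ : (fun _ => _) = cst 0)//.
by apply/funext => x; rewrite /atomic_phase; case: ifP => //= _; rewrite oppr0.
Qed.

Lemma atomic_phase1 x : Normc.normc (atomic_phase x) = 1.
Proof.
rewrite /atomic_phase; case: ifP => _ /=.
  by rewrite oppr0 expr0n/= addr0 sqrrN expr1n sqrtr1.
by rewrite expr0n/= addr0 expr1n sqrtr1.
Qed.

(* [\sum_(n in N) p n \delta_(q n)], for [q] injective on [N]: the total
   variation is [\sum_(n in N) `|p n| \delta_(q n)] and the density at [q n]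
   is the sign of [p n]. *)
Definition atomic_cmeasure : cmeasure R :=
  CMeasure
    (mseries (fun n => mscale `|atomic_weight n|%:nng
       (dirac (q n : measurableTypeR R))) 0)
    atomic_phase_Re atomic_phase_Im atomic_phase1.

End AtomicMeasure.

Section SummationPairs.
Variable R : realType.
Local Notation C := (cplx R).

Definition locally_summable (a : R -> C) : Prop :=
  countable [set l | a l != 0] /\
  forall T : R, 0 < T -> csummable [set l : R | `|l| <= T] a.

Definition finite_exponential_growth (a : R -> C) : Prop :=
  exists2 alpha : R, 0 < alpha &
    (\esum_(l in [set: R]) (Normc.normc (a l) * expR (- alpha * `|l|))%:E
      < +oo)%E.

Definition smooth (f : R -> R) : Prop :=
  forall (n : nat) (x : R), derivable (derive1n n f) x 1.

Definition test_function (phi : R -> C) : Prop :=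
  [/\ smooth (fun x => complex.Re (phi x)),
      smooth (fun x => complex.Im (phi x)) &
      exists M : R, forall x, M < `|x| -> phi x = 0].

(* For compactly supported [phi] the integral converges for every complex [z]
   and is the entire extension of the Fourier transform. *)
Definition fourier (phi : R -> C) (z : C) : C :=
  cintegral lebesgue_measure [set: measurableTypeR R]
    (fun t => phi t * cexp ((0 +i* (- (2 * pi * t))) * z)).

(* The measure [mu = nu + eta] is represented by the two parts of its unique
   decomposition, [eta] being given by its mass function [b]. *)
Record FS_pair (sigma : R) (nu : cmeasure R) (b : C -> C) (a : R -> C)
    : Prop := {
  FS_strip_ge0 : 0 <= sigma;
  FS_summable : locally_summable a;
  FS_nu_tempered : strongly_tempered nu;
  FS_eta_tempered : discrete_strongly_tempered b;
  FS_atoms_nonreal : forall g, atoms b g -> complex.Im g != 0;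
  FS_atoms_limit : forall g, limit_point (atoms b) g -> complex.Im g = 0;
  FS_atoms_strip : forall g, atoms b g -> `|complex.Im g| < sigma;
  FS_formula : forall phi : R -> C, test_function phi ->
    csum [set: R] (fun l => a l * phi l) =
    cm_integral nu setT (fun t => fourier phi t%:C)
    + csum (atoms b) (fun g => b g * fourier phi g) }.

Definition R_symmetric (b : C -> C) : Prop :=
  (forall g : C, atoms b g <-> atoms b g^*) /\
  (forall g : C, atoms b g -> b g^* = b g).

Definition real_antipodal (nu : cmeasure R) (b : C -> C) (a : R -> C) : Prop :=
  [/\ forall B : set R, measurable (B : set (measurableTypeR R)) ->
        bounded_set B -> complex.Im (cm_val nu B) = 0,
      forall g, complex.Im (b g) = 0 &
      forall l, (a l)^* = a (- l)].

Definition antipodal_coef (F : C -> C) (y l : R) : C :=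
  if 0 < l then fourier_coef F y l
  else if l < 0 then (fourier_coef F y (- l))^*
  else (2 * complex.Re (fourier_coef F y 0))%:C.

Definition real_term (q p : nat -> R) (k : nat) (z : C) (n : nat) : C :=
  (1 + (q n)%:C * z) / ((q n)%:C - z) * ((p n) / (1 + q n ^+ 2) ^+ k.+1)%:C.

Definition strip_term (b : C -> C) (k : nat) (rho : R) (z g : C) : C :=
  ((rho ^+ 2)%:C + g * z) / (g - z) * (b g / ((rho ^+ 2)%:C + g ^+ 2) ^+ k.+1).

(* The representation is required at every point which is neither one of the
   [q n] nor in [A], and includes the absolute convergence of both sums. *)
Definition represented (F : C -> C) (N : set nat) (q p : nat -> R)
    (A : set C) (b : C -> C) (k : nat) (rho : R) (Q : {poly R}) : Prop :=
  forall z : C, ~ ([set (q n)%:C | n in N] `|` A) z ->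
    [/\ csummable N (real_term q p k z),
        csummable A (strip_term b k rho z) &
        F z =
          (z ^+ 2 + 1) ^+ k / (0 +i* (2 * pi)) * csum N (real_term q p k z)
          + (z ^+ 2 + (rho ^+ 2)%:C) ^+ k / (0 +i* (2 * pi))
            * csum A (strip_term b k rho z)
          + (0 +i* 1) * (map_poly (real_complex R) Q).[z]].

End SummationPairs.

(* Main.v *)
Require Import Defs.
From HB Require Import structures.
From mathcomp Require Import all_boot all_order all_algebra.
From mathcomp Require Import complex.
From mathcomp Require Import all_classical all_reals all_analysis.
From mathcomp Require Import measurable_realfun finmap ring lra.

Set Implicit Arguments.
Unset Strict Implicit.
Unset Printing Implicit Defensive.

Import Order.TTheory GRing.Theory Num.Theory.
Import numFieldNormedType.Exports.

Local Open Scope classical_set_scope.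
Local Open Scope ring_scope.
Local Open Scope complex_scope.

(* Direct part.  Applied to a mollification of the truncated exponential
   [l |-> exp (2 i pi l w)], [l >= 0], the summation formula would express
   [F w] as [(2 i pi)^-1 * \sum_g m g / (g - w)], where [m] is the mass of
   [mu] at [g].  This sum need not converge, but its divided difference at
   [2 (k + 1)] points [w] does.  Fixing all the points but one and solving for
   the value at the last one gives [F] as a polynomial plus a polynomial [W]
   times the Cauchy transform of [m / W], which is meromorphic on the whole
   plane.  It differs from the kernels of the representation by a polynomial of
   degree at most [2 k], which is [i] times a real one because
   [conj (F (conj z)) = - F z].

   Converse part.  For a test function [phi], the integrals of
   [F z * fourier phi z] along the lines [Im z = y] and [Im z = - y] differ by
   [\sum_g m g * fourier phi g]; as the kernels are explicit, this only uses
   [1 / (2 i pi (g - z)) = \int_(t >= 0) exp (2 i pi t (z - g))] and Fourier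
   inversion.  Since [F] is almost periodic, the upper integral is
   [\sum_l E F l * phi l].  By symmetry the lower one is minus the same sum
   with [conj (E F (- l))].  Finally the upper integral vanishes if [phi]
   lives on the negative half-line, so that [E F l = 0] for [l < 0]. *)

(** * Complex numbers and unordered sums *)

(** The Fourier series of [F] along a line need not converge to [F]: only local summability of the
    coefficients is assumed. Pairing with a test function supported in [[- M, M]] is therefore
    split. The absolutely convergent series of the frequencies in [[- M, M]] is subtracted; what
    remains has mean zero against each of these frequencies, and [spectral_gap] shows that it pairs
    to zero. This is an averaging over differences of almost periods, which the pigeonhole principle
    supplies with positive density. In the direct part the number [2 (k + 1)] of points is the order
    of temperedness: a product of that many factors [g - w] makes the masses summable. In the
    converse part the listed points need not lie below the height [c] above which [F] is
    holomorphic, nor below the line used. Those above [c] are shown to carry no mass before lines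
    are compared. Throughout, sums are exchanged with limits and integrals, so every family carries
    a summable majorant. Real and imaginary parts are estimated separately, which produces harmless
    factors 2. *)

Section ComplexBasics.
Variable R : realType.
Local Notation C := (cplx R).
Local Notation N := (@Normc.normc R).
Local Notation Re := (@complex.Re R).
Local Notation Im := (@complex.Im R).
Implicit Types (z w : C) (r s t : R).

Lemma normcE2 z : N z = Num.sqrt (Re z ^+ 2 + Im z ^+ 2).
Proof. by case: z. Qed.

Lemma normc_norm z : `|z| = (N z)%:C.
Proof. by rewrite normc_def; case: z. Qed.

Lemma normc_ge0 z : 0 <= N z.
Proof. by rewrite normcE2 sqrtr_ge0. Qed.

Lemma normcR r : N r%:C = `|r|.
Proof. by rewrite normcE2 /= expr0n addr0 sqrtr_sqr. Qed.

Lemma normc_sqr z : N z ^+ 2 = Re z ^+ 2 + Im z ^+ 2.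
Proof. by rewrite normcE2 sqr_sqrtr ?addr_ge0 ?sqr_ge0. Qed.

Lemma normc_J z : N z^* = N z.
Proof. by rewrite !normcE2; case: z => a b /=; rewrite sqrrN. Qed.

Lemma normcX z n : N (z ^+ n) = N z ^+ n.
Proof.
elim: n => [|n IH]; first by rewrite !expr0 Normc.normc1.
by rewrite !exprS Normc.normcM IH.
Qed.

Lemma normcB z w : N (z - w) = N (w - z).
Proof. by rewrite -normcN opprB. Qed.

Lemma ler_Re_normc z : `|Re z| <= N z.
Proof.
rewrite normcE2 -sqrtr_sqr ler_wsqrtr// lerDl sqr_ge0 //.
Qed.

Lemma ler_Im_normc z : `|Im z| <= N z.
Proof.
rewrite normcE2 -sqrtr_sqr ler_wsqrtr// lerDr sqr_ge0 //.
Qed.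

Lemma normc_le_ReIm z : N z <= `|Re z| + `|Im z|.
Proof.
rewrite normcE2 -[leRHS]ger0_norm ?addr_ge0// -sqrtr_sqr ler_wsqrtr//.
rewrite sqrrD !real_normK ?num_real// lerD2r lerDl.
by rewrite mulrn_wge0 // mulr_ge0.
Qed.

Lemma normc0P z : (N z == 0) = (z == 0).
Proof.
apply/eqP/eqP => [/Normc.eq0_normc//|->]; exact: Normc.normc0.
Qed.

Lemma normc_gt0 z : (0 < N z) = (z != 0).
Proof. by rewrite lt_def normc_ge0 andbT normc0P. Qed.

Lemma ler_normcD z w a b : N z <= a -> N w <= b -> N (z + w) <= a + b.
Proof. by move=> za wb; rewrite (le_trans (le_normcD _ _))// lerD. Qed.

Lemma ler_normcB z w : N (z - w) <= N z + N w.
Proof. by rewrite (le_trans (le_normcD _ _))// normcN. Qed.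

Lemma ler_dist_normc z w : N z - N w <= N (z - w).
Proof. by rewrite lerBlDr (le_trans _ (le_normcD _ _))// subrK. Qed.

Lemma normc_sum (I : Type) (s : seq I) (P : pred I) (f : I -> C) :
  N (\sum_(i <- s | P i) f i) <= \sum_(i <- s | P i) N (f i).
Proof.
elim/big_ind2 : _ => [|a b c d ? ?|//]; first by rewrite Normc.normc0.
exact: ler_normcD.
Qed.

Lemma Re_sum (I : Type) (s : seq I) (P : pred I) (f : I -> C) :
  Re (\sum_(i <- s | P i) f i) = \sum_(i <- s | P i) Re (f i).
Proof. by apply: (big_morph Re) => // -[? ?] [? ?]. Qed.

Lemma Im_sum (I : Type) (s : seq I) (P : pred I) (f : I -> C) :
  Im (\sum_(i <- s | P i) f i) = \sum_(i <- s | P i) Im (f i).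
Proof. by apply: (big_morph Im) => // -[? ?] [? ?]. Qed.

Lemma ReD z w : Re (z + w) = Re z + Re w. Proof. by case: z; case: w. Qed.
Lemma ImD z w : Im (z + w) = Im z + Im w. Proof. by case: z; case: w. Qed.
Lemma ReN z : Re (- z) = - Re z. Proof. by case: z. Qed.
Lemma ImN z : Im (- z) = - Im z. Proof. by case: z. Qed.
Lemma ReM z w : Re (z * w) = Re z * Re w - Im z * Im w.
Proof. by case: z; case: w. Qed.
Lemma ImM z w : Im (z * w) = Re z * Im w + Im z * Re w.
Proof. by case: z => a b; case: w => c d /=. Qed.
Lemma ReRM r z : Re (r%:C * z) = r * Re z.
Proof. by rewrite ReM /= mul0r subr0. Qed.
Lemma ImRM r z : Im (r%:C * z) = r * Im z.
Proof. by rewrite ImM /= mul0r addr0. Qed.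

Lemma complex_ext z w : Re z = Re w -> Im z = Im w -> z = w.
Proof. by case: z; case: w => a b c d /= -> ->. Qed.

Lemma conj_RC r : (r%:C : C)^* = r%:C.
Proof. by rewrite /= oppr0. Qed.

Section Limits.
Context {T : Type} {F : set_system T} {FF : Filter F}.

Lemma cvg_normcP (f : T -> C) (l : C) :
  (f @ F --> l) <-> (forall e : R, 0 < e -> \forall x \near F, N (l - f x) < e).
Proof.
split.
  move=> /cvgrPdist_lt H e e0.
  have := H e%:C; rewrite ltcR => /(_ e0); apply: filterS => x.
  by rewrite normc_norm ltcR.
move=> H; apply/cvgrPdist_lt => -[e i]; rewrite ltcE /= => /andP[/eqP -> e0].
by have := H _ e0; apply: filterS => x; rewrite normc_norm ltcR.
Qed.

Lemma cvg_Re (f : T -> C) (l : C) : f @ F --> l ->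
  (fun x => Re (f x)) @ F --> Re l.
Proof.
move=> /cvg_normcP H; apply/cvgrPdist_lt => e e0; have := H _ e0.
apply: filterS => x; apply: le_lt_trans.
by rewrite -ReN -ReD ler_Re_normc.
Qed.

Lemma cvg_Im (f : T -> C) (l : C) : f @ F --> l ->
  (fun x => Im (f x)) @ F --> Im l.
Proof.
move=> /cvg_normcP H; apply/cvgrPdist_lt => e e0; have := H _ e0.
apply: filterS => x; apply: le_lt_trans.
by rewrite -ImN -ImD ler_Im_normc.
Qed.

Lemma cvg_ReIm (f : T -> C) (l : C) : 
  (fun x => Re (f x)) @ F --> Re l -> (fun x => Im (f x)) @ F --> Im l ->
  f @ F --> l.
Proof.
move=> /cvgrPdist_lt H1 /cvgrPdist_lt H2; apply/cvg_normcP => e e0.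
have e20 : 0 < e / 2 by rewrite divr_gt0.
near=> x; apply: le_lt_trans (normc_le_ReIm _) _.
rewrite ReD ReN ImD ImN [ltRHS]splitr ltrD//; near: x.
  exact: H1.
exact: H2.
Unshelve. all: by end_near. Qed.

End Limits.

Lemma nbhs_normcP (z : C) (P : set C) :
  (\forall w \near z, P w) <->
  exists2 d : R, 0 < d & forall w, N (z - w) < d -> P w.
Proof.
split.
  move=> /nbhs_ballP[[d i]] /=; rewrite [_ < _]ltcE /= => /andP[/eqP -> d0] H.
  exists d => // w zw; apply: H; rewrite -ball_normE /ball_ /=.
  by rewrite normc_norm ltcR.
move=> [d d0 H]; apply/nbhs_ballP; exists (d%:C); first by rewrite /= ltcR.
by move=> w; rewrite -ball_normE /ball_ /= normc_norm ltcR => /H.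
Qed.

Lemma dnbhs_normcP (z : C) (P : set C) :
  (\forall w \near z^', P w) <->
  exists2 d : R, 0 < d & forall w, N (z - w) < d -> w != z -> P w.
Proof.
rewrite near_withinE; split.
  by move=> /nbhs_normcP[d d0 H]; exists d.
by move=> [d d0 H]; apply/nbhs_normcP; exists d => // w zw wz; exact: H.
Qed.

Lemma continuous_Re_fun (T : topologicalType) (f : T -> C) : continuous f ->
  continuous (fun x => Re (f x)).
Proof. by move=> cf x; apply: cvg_Re; exact: cf. Qed.

Lemma continuous_Im_fun (T : topologicalType) (f : T -> C) : continuous f ->
  continuous (fun x => Im (f x)).
Proof. by move=> cf x; apply: cvg_Im; exact: cf. Qed.

Lemma continuous_ReIm (T : topologicalType) (f : T -> C) :
  continuous (fun x => Re (f x)) -> continuous (fun x => Im (f x)) ->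
  continuous f.
Proof.
move=> cr ci x; apply: cvg_ReIm; first exact: cr.
exact: ci.
Qed.

Lemma cexpD z w : cexp (z + w) = cexp z * cexp w.
Proof.
case: z w => [a b] [c d]; rewrite /cexp /= expRD cosD sinD.
by apply: complex_ext => /=; ring.
Qed.

Lemma cexp0 : cexp 0 = 1 :> C.
Proof. by rewrite /cexp /= expR0 cos0 sin0 mulr0 mulr1. Qed.

Lemma normc_cexp z : N (cexp z) = expR (Re z).
Proof.
rewrite normcE2 /= !exprMn -mulrDr cos2Dsin2 mulr1 sqrtr_sqr.
by rewrite ger0_norm ?expR_ge0.
Qed.

Lemma cexp_neq0 z : cexp z != 0.
Proof. by rewrite -normc0P normc_cexp gt_eqF ?expR_gt0. Qed.

Lemma conj_cexp z : (cexp z)^* = cexp z^*.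
Proof. by case: z => a b; rewrite /cexp /= cosN sinN mulrN. Qed.

Lemma normr_sin_le r : `|sin r| <= `|r|.
Proof.
wlog r0 : r / 0 <= r.
  move=> H; have [|r0] := leP 0 r; first exact: H.
  by rewrite -normrN -sinN -(normrN r); apply: H; rewrite oppr_ge0 ltW.
have [c _] := @MVT_segment R (@sin R) (@cos R) 0 r r0
  (fun x _ => is_derive_sin x) (continuous_subspaceT (@continuous_sin R)).
rewrite sin0 !subr0 => ->; rewrite normrM ler_piMl// ler_norml.
by rewrite cos_geN1 cos_le1.
Qed.

Lemma normc_expi_sub1 r : N (cexp (0 +i* r) - 1) <= `|r|.
Proof.
rewrite normcE2 /= expR0 !mul1r.
have -> : (cos r - 1) ^+ 2 + (sin r - 0) ^+ 2 = (2 * sin (r / 2)) ^+ 2.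
  have {1 2}-> : r = r / 2 + r / 2 by field.
  rewrite cosD sinD.
  have : cos (r / 2) ^+ 2 + sin (r/2) ^+ 2 = 1 by exact: cos2Dsin2.
  set c := cos _; set s := sin _; move=> H.
  have Hs : s ^+ 2 = 1 - c ^+ 2 by rewrite -H; ring.
  have -> : (c * c - s * s - 1) ^+ 2 + (s * c + c * s - 0) ^+ 2 =
    (c ^+ 2 - s ^+ 2 - 1) ^+ 2 + 4 * s ^+ 2 * c ^+ 2 by ring.
  rewrite exprMn Hs; ring.
rewrite sqrtr_sqr normrM ger0_norm// mulrC -ler_pdivlMr//.
by rewrite (le_trans (normr_sin_le _))// normrM (ger0_norm (_ : 0 <= 2^-1)).
Qed.

End ComplexBasics.

Section Sums.
Variable R : realType.
Local Notation C := (cplx R).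
Local Notation N := (@Normc.normc R).
Variable T : choiceType.
Implicit Types (D E : set T) (w : T -> R) (f g : T -> C) (e : R).

Definition wsum D w : R := fine (\esum_(x in D) (w x)%:E).

Definition wsummable D w : Prop := (\esum_(x in D) (w x)%:E < +oo)%E.

(** A majorant common to several families gives truncations that are uniform over all of them, which
    summability of each family separately would not. *)
Definition cdominated D w f : Prop := forall x, D x -> N (f x) <= w x.

Lemma cdominated_ge0 D w f : cdominated D w f -> forall x, D x -> 0 <= w x.
Proof. by move=> H x /H; apply: le_trans; exact: normc_ge0. Qed.

Lemma wsummable_le D w w' : (forall x, D x -> w x <= w' x) ->
  wsummable D w' -> wsummable D w.
Proof. by move=> H; apply: le_lt_trans; apply: le_esum => x /H. Qed.

Lemma wsummable_sub D E w : (forall x, E x -> 0 <= w x) -> D `<=` E ->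
  wsummable E w -> wsummable D w.
Proof.
move=> w0 DE; apply: le_lt_trans; rewrite (esumID D E) => //.
rewrite (_ : E `&` D = D) ?leeDl//; last by rewrite setIC; apply/setIidPl.
by apply: esum_ge0 => x [/w0].
Qed.

Lemma wsumE D w : (forall x, D x -> 0 <= w x) -> wsummable D w ->
  (\esum_(x in D) (w x)%:E = (wsum D w)%:E)%E.
Proof.
by move=> w0 H; rewrite /wsum fineK// ge0_fin_numE// esum_ge0// => x /w0.
Qed.

Lemma wsum_ge0 D w : (forall x, D x -> 0 <= w x) -> 0 <= wsum D w.
Proof. by move=> w0; apply: fine_ge0; apply: esum_ge0 => x /w0; rewrite lee_fin. Qed.

Lemma wsummableD D w w' : (forall x, D x -> 0 <= w x) ->
  (forall x, D x -> 0 <= w' x) -> wsummable D w -> wsummable D w' ->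
  wsummable D (fun x => w x + w' x).
Proof.
move=> w0 w'0 H H'; rewrite /wsummable.
under eq_esum do rewrite EFinD.
rewrite esumD ?lte_add_pinfty//.
Qed.

Lemma esumZ_le D w (c : R) : (forall x, D x -> 0 <= w x) -> 0 <= c ->
  wsummable D w -> (\esum_(x in D) (c * w x)%:E <= (c * wsum D w)%:E)%E.
Proof.
move=> w0 c0 H; apply: ge_ereal_sup => _ [X [finX XD]] <-.
rewrite fsumEFin// lee_fin -fsbig_distrr// ler_wpM2l//.
rewrite -lee_fin -wsumE// -fsumEFin//.
by apply: ereal_sup_ubound; exists X.
Qed.

Lemma wsummableZ D w (c : R) : (forall x, D x -> 0 <= w x) -> 0 <= c ->
  wsummable D w -> wsummable D (fun x => c * w x).
Proof. by move=> *; apply: le_lt_trans (esumZ_le _ _ _) (ltry _). Qed.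

Lemma wsumZ_le D w (c : R) : (forall x, D x -> 0 <= w x) -> 0 <= c ->
  wsummable D w -> wsum D (fun x => c * w x) <= c * wsum D w.
Proof.
move=> w0 c0 H; rewrite -lee_fin -wsumE; first exact: esumZ_le.
  by move=> x Dx; rewrite mulr_ge0// w0.
exact: wsummableZ.
Qed.

Lemma wsumID E D w : (forall x, D x -> 0 <= w x) -> wsummable D w ->
  wsum D w = wsum (D `&` E) w + wsum (D `&` ~` E) w.
Proof.
move=> w0 H; apply: EFin_inj; rewrite EFinD -!wsumE//.
- by apply: esumID => x /w0; rewrite lee_fin.
- by move=> x [/w0].
- by apply: wsummable_sub H => // x [].
- by move=> x [/w0].
- by apply: wsummable_sub H => // x [].
Qed.

Lemma wsum_fset (J : {fset T}) w : (forall x, x \in J -> 0 <= w x) ->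
  wsum [set` J] w = \sum_(x <- J) w x.
Proof.
move=> w0; rewrite /wsum esum_fset//; last by move=> x /set_mem /w0.
by rewrite fsumEFin//= fsbig_finite//= set_fsetK.
Qed.

Lemma le_wsum D w w' : (forall x, D x -> 0 <= w x <= w' x) ->
  wsummable D w' -> wsum D w <= wsum D w'.
Proof.
move=> H H'; rewrite -lee_fin -!wsumE//.
- by apply: le_esum => x /H /andP[_]; rewrite lee_fin.
- by move=> x /H /andP[h /(le_trans h)].
- by move=> x /H /andP[].
- by apply: wsummable_le H' => x /H /andP[].
Qed.

Lemma wsum_tail D w e : (forall x, D x -> 0 <= w x) -> wsummable D w -> 0 < e ->
  exists2 J : {fset T}, [set` J] `<=` D & wsum (D `&` ~` [set` J]) w < e.
Proof.
move=> w0 H e0.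
have : (ereal_sup [set \sum_(x \in A) (w x)%:E | A in fsets D] \is a fin_num)%E.
  by have := wsumE w0 H; rewrite /esum => ->.
move=> /(ub_ereal_sup_adherent e0)[_ [X [finX XD]] <-].
rewrite -/(esum D (fun x => (w x)%:E)) wsumE// fsumEFin// -EFinB lte_fin.
move=> Hlt; exists (fset_set X); rewrite fset_setK//.
move: Hlt; rewrite (wsumID X)//.
have -> : D `&` X = X by rewrite setIC; apply/setIidPl.
rewrite -[X in wsum X _ + _](fset_setK finX) wsum_fset; last first.
  by move=> x; rewrite in_fset_set// => /set_mem /XD /w0.
rewrite fsbig_finite//=; lra.
Qed.

Lemma rsum_wsum D (h : T -> R) : rsum D h =
  wsum D (fun x => Num.max (h x) 0) - wsum D (fun x => Num.max (- h x) 0).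
Proof. by []. Qed.

Let maxD (x : R) : Num.max x 0 - Num.max (- x) 0 = x.
Proof. by case: (leP x 0) => ?; case: (leP (- x) 0) => ?; lra. Qed.

Let max_le (x y : R) : `|x| <= y -> 0 <= Num.max x 0 <= y.
Proof.
move=> H; rewrite le_max lexx orbT /= ge_max (le_trans (ler_norm _) H).
by rewrite (le_trans _ H).
Qed.

Let maxN_le (x y : R) : `|x| <= y -> 0 <= Num.max (- x) 0 <= y.
Proof. by rewrite -normrN; exact: max_le. Qed.

Lemma rsumID E D (h : T -> R) w : wsummable D w ->
  (forall x, D x -> `|h x| <= w x) ->
  rsum D h = rsum (D `&` E) h + rsum (D `&` ~` E) h.
Proof.
move=> H hw; rewrite !rsum_wsum (wsumID E); first 1 last.
- by move=> x /hw /max_le /andP[].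
- by apply: wsummable_le H => x /hw /max_le /andP[].
rewrite (@wsumID E D (fun x => Num.max (- h x) 0)); first 1 last.
- by move=> x /hw /maxN_le /andP[].
- by apply: wsummable_le H => x /hw /maxN_le /andP[].
ring.
Qed.

Lemma normr_rsum D (h : T -> R) w : wsummable D w ->
  (forall x, D x -> `|h x| <= w x) -> `|rsum D h| <= wsum D w.
Proof.
move=> H hw; rewrite rsum_wsum.
have := le_wsum (fun x Dx => max_le (hw x Dx)) H.
have := le_wsum (fun x Dx => maxN_le (hw x Dx)) H.
have : 0 <= wsum D (fun x => Num.max (h x) 0).
  by apply: wsum_ge0 => x /hw /max_le /andP[].
have : 0 <= wsum D (fun x => Num.max (- h x) 0).
  by apply: wsum_ge0 => x /hw /maxN_le /andP[].
move=> a b c d; rewrite ler_norml; lra.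
Qed.

Lemma rsum_fset (J : {fset T}) (h : T -> R) :
  rsum [set` J] h = \sum_(x <- J) h x.
Proof.
rewrite rsum_wsum !wsum_fset.
- by rewrite -sumrB; apply: eq_bigr => x _; exact: maxD.
- by move=> x _; rewrite le_max lexx orbT.
- by move=> x _; rewrite le_max lexx orbT.
Qed.

Lemma csumID E D f w : wsummable D w -> cdominated D w f ->
  csum D f = csum (D `&` E) f + csum (D `&` ~` E) f.
Proof.
move=> H fw; rewrite /csum (@rsumID E D _ w)//; last first.
  by move=> x /fw; apply: le_trans; exact: ler_Re_normc.
rewrite (@rsumID E D (fun x => complex.Im (f x)) w)//.
by move=> x /fw; apply: le_trans; exact: ler_Im_normc.
Qed.

Lemma csum_fset (J : {fset T}) f : csum [set` J] f = \sum_(x <- J) f x.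
Proof.
rewrite /csum !rsum_fset; apply: complex_ext => /=.
  by rewrite Re_sum.
by rewrite Im_sum.
Qed.

(** [csum] is built from real and imaginary parts, each bounded by [wsum D w]; the factor 2 is the
    price of adding the two bounds. *)
Lemma normc_csum D f w : wsummable D w -> cdominated D w f ->
  N (csum D f) <= 2 * wsum D w.
Proof.
move=> H fw; apply: le_trans (normc_le_ReIm _) _; rewrite mulr_natl mulr2n.
apply: lerD; apply: normr_rsum => // x /fw; apply: le_trans.
  exact: ler_Re_normc.
exact: ler_Im_normc.
Qed.

Lemma csum_tail D w f (J : {fset T}) : [set` J] `<=` D -> wsummable D w ->
  cdominated D w f ->
  N (csum D f - \sum_(x <- J) f x) <= 2 * wsum (D `&` ~` [set` J]) w.
Proof.
move=> JD H fw.
rewrite (csumID [set` J] H fw) (_ : D `&` [set` J] = [set` J]); last first.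
  by rewrite setIC; apply/setIidPl.
rewrite csum_fset addrAC subrr add0r; apply: normc_csum; last by move=> x [/fw].
by apply: wsummable_sub H => [|x []//]; exact: cdominated_ge0 fw.
Qed.

(** The finite set depends on the weight alone and not on the family. One truncation thus serves
    every family in an identity, and linearity and limits reduce to finite sums. *)
Lemma csum_approx D w e : (forall x, D x -> 0 <= w x) -> wsummable D w -> 0 < e ->
  exists2 J : {fset T}, [set` J] `<=` D & forall f, cdominated D w f ->
    N (csum D f - \sum_(x <- J) f x) <= e.
Proof.
move=> w0 H e0; have e20 : 0 < e / 2 by rewrite divr_gt0.
have [J JD Je] := wsum_tail w0 H e20; exists J => // f fw.
apply: le_trans (csum_tail JD H fw) _.
by rewrite -ler_pdivlMl// mulrC ltW.
Qed.

Lemma eq_csum D f g : (forall x, D x -> f x = g x) -> csum D f = csum D g.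
Proof.
move=> H; rewrite /csum /rsum; congr (_ +i* _); congr (_ - _); congr fine;
  apply: eq_esum => x Dx; by rewrite H.
Qed.

Lemma ge0_lt_eq0 (x : R) : 0 <= x -> (forall e, 0 < e -> x <= e) -> x = 0.
Proof.
move=> x0 H; apply/eqP; rewrite eq_le x0 andbT leNgt; apply/negP => xp.
by have /H := divr_gt0 xp (ltr0n R 2); rewrite ler_pdivlMr//; lra.
Qed.

Lemma csum_lin D f g w (c : C) : wsummable D w ->
  cdominated D w f -> cdominated D w g ->
  csum D (fun x => f x + c * g x) = csum D f + c * csum D g.
Proof.
move=> H fw gw; have w0 := cdominated_ge0 fw.
(* [w'] dominates [f], [g] and [f + c g] at once, so the same [J] truncates all three sums. The
   three errors enter with weights 1, 1 and [N c], whence the division by [2 + N c] below. *)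
pose w' x := (1 + N c) * w x.
have c0 : 0 <= 1 + N c by rewrite addr_ge0// normc_ge0.
have H' : wsummable D w' by apply: wsummableZ.
have w'0 x : D x -> 0 <= w' x by move=> Dx; rewrite mulr_ge0// w0.
have ww' x : D x -> w x <= w' x.
  by move=> Dx; rewrite ler_peMl ?w0// lerDl normc_ge0.
apply/eqP; rewrite -subr_eq0 -normc0P; apply/eqP; apply: ge0_lt_eq0.
  exact: normc_ge0.
move=> e e0; have d0 : 0 < e / (2 + N c) by rewrite divr_gt0// ltr_wpDr// normc_ge0.
have [J JD HJ] := csum_approx w'0 H' d0.
have H1 := HJ _ (fun x Dx => le_trans (fw x Dx) (ww' x Dx)).
have H2 := HJ _ (fun x Dx => le_trans (gw x Dx) (ww' x Dx)).
have /HJ H3 : cdominated D w' (fun x => f x + c * g x).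
  move=> x Dx; rewrite /w' mulrDl mul1r; apply: ler_normcD; first exact: fw.
  by rewrite Normc.normcM ler_wpM2l ?normc_ge0// gw.
have -> : csum D (fun x => f x + c * g x) - (csum D f + c * csum D g) =
  (csum D (fun x => f x + c * g x) - \sum_(x <- J) (f x + c * g x)) +
  (- (csum D f - \sum_(x <- J) f x) + - (c * (csum D g - \sum_(x <- J) g x))).
  rewrite big_split /= -mulr_sumr; ring.
have -> : e = e / (2 + N c) + (e / (2 + N c) + N c * (e / (2 + N c))).
  by field; rewrite gt_eqF// ltr_wpDr// normc_ge0.
do 2 (apply: ler_normcD => //); rewrite normcN//.
by rewrite Normc.normcM ler_wpM2l ?normc_ge0.
Qed.

Lemma csum0 D : csum D (fun=> 0 : C) = 0.
Proof.
have H : wsummable D (fun=> 0) by rewrite /wsummable esum1.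
have /(normc_csum H) : cdominated D (fun=> 0) (fun=> 0).
  by move=> x _; rewrite Normc.normc0.
rewrite /wsum esum1// mulr0 => h; apply/eqP; rewrite -normc0P eq_le h.
exact: normc_ge0.
Qed.

Lemma csumZ D f w (c : C) : wsummable D w -> cdominated D w f ->
  csum D (fun x => c * f x) = c * csum D f.
Proof.
move=> H fw; have := @csum_lin D (fun=> 0) f w c H _ fw; rewrite csum0 add0r => <-.
  by apply: eq_csum => x _; rewrite add0r.
by move=> x Dx; rewrite Normc.normc0; exact: cdominated_ge0 fw _ Dx.
Qed.

Lemma csumD D f g w : wsummable D w -> cdominated D w f -> cdominated D w g ->
  csum D (fun x => f x + g x) = csum D f + csum D g.
Proof.
move=> H fw gw; rewrite -[X in _ + X]mul1r -(csum_lin _ H fw gw).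
by apply: eq_csum => x _; rewrite mul1r.
Qed.

Lemma csum_big (I : Type) (s : seq I) (h : I -> T -> C) D w : wsummable D w ->
  (forall x, D x -> 0 <= w x) ->
  (forall i, exists2 c, 0 <= c & cdominated D (fun x => c * w x) (h i)) ->
  csum D (fun x => \sum_(i <- s) h i x) = \sum_(i <- s) csum D (h i).
Proof.
move=> H w0 hw; elim: s => [|i s IH].
  by rewrite big_nil -[RHS](csum0 D); apply: eq_csum => x _; rewrite big_nil.
rewrite big_cons -IH; have [c c0 ic] := hw i.
have [c' c'0 sc] : exists2 c, 0 <= c &
    cdominated D (fun x => c * w x) (fun x => \sum_(i <- s) h i x).
  elim: s {IH} => [|j s [c' c'0 IH]].
    by exists 0 => // x _; rewrite big_nil Normc.normc0 mul0r.
  have [d d0 jd] := hw j; exists (d + c'); first exact: addr_ge0.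
  by move=> x Dx; rewrite big_cons mulrDl; apply: ler_normcD; [exact: jd|exact: IH].
rewrite -(@csumD D _ _ (fun x => (c + c') * w x)).
- by apply: eq_csum => x _; rewrite big_cons.
- by apply: wsummableZ => //; exact: addr_ge0.
- by move=> x Dx; rewrite (le_trans (ic x Dx))// ler_wpM2r ?w0// lerDl.
- by move=> x Dx; rewrite (le_trans (sc x Dx))// ler_wpM2r ?w0// lerDr.
Qed.

Lemma csum_conj D f : csum D (fun x => (f x)^*) = (csum D f)^*.
Proof.
rewrite /csum; apply: complex_ext => /=; rewrite /rsum.
  by congr (_ - _); congr fine; apply: eq_esum => x _; case: (f x).
rewrite opprB; congr (_ - _); congr fine; apply: eq_esum => x _;
  by case: (f x) => a b //=; rewrite opprK.
Qed.

Lemma csum_sub D E f : E `<=` D -> (forall x, D x -> ~ E x -> f x = 0) ->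
  csum D f = csum E f.
Proof.
move=> ED f0.
have H (h : T -> R) : (forall x, D x -> ~ E x -> h x = 0) ->
    (forall x, 0 <= h x) -> wsum D h = wsum E h.
  move=> h0 hp; rewrite /wsum (esumID E); last by move=> x _; rewrite lee_fin.
  rewrite (_ : D `&` E = E); last by rewrite setIC; apply/setIidPl.
  by rewrite (@esum1 _ _ (D `&` _)) ?adde0// => x [Dx nEx]; rewrite h0.
rewrite /csum !rsum_wsum; congr (_ +i* _); congr (_ - _); apply: H => x;
  try (by rewrite le_max lexx orbT);
  by move=> Dx nEx; rewrite f0//= ?oppr0 maxxx.
Qed.

Lemma csumD1 D f w t : wsummable D w -> cdominated D w f -> D t ->
  csum D f = f t + csum (D `\ t) f.
Proof.
move=> H fw Dt; rewrite (csumID [set t] H fw); congr (_ + _).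
rewrite (_ : D `&` [set t] = [set` [fset t]%fset]).
  by rewrite csum_fset big_seq_fset1.
apply/seteqP; split => [x [_ ->]|x]; rewrite /= inE//= => /eqP ->.
by split.
Qed.

(** Dominated convergence: off a finite set chosen from [w] all the sums are small together, and on
    that set the limit is one of finite sums. *)
Lemma csum_cvg (I : Type) (F : set_system I) (FF : Filter F) D w (h : I -> T -> C) f :
  wsummable D w -> (\forall n \near F, cdominated D w (h n)) ->
  cdominated D w f ->
  (forall x, D x -> h n x @[n --> F] --> f x) ->
  csum D (h n) @[n --> F] --> csum D f.
Proof.
move=> H hw fw hf; have w0 := cdominated_ge0 fw.
apply/cvg_normcP => e e0; have e40 : 0 < e / 4 by rewrite divr_gt0.
have [J JD HJ] := csum_approx w0 H e40.
have : \sum_(x <- J) h n x @[n --> F] --> \sum_(x <- J) f x.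
  elim: (enum_fset J) (JD : forall x, x \in enum_fset J -> D x) => [|x s IH] sD.
    rewrite big_nil; under eq_cvg do rewrite big_nil.
    exact: cvg_cst.
  rewrite big_cons; under eq_cvg do rewrite big_cons.
  apply: (@cvgD _ C); first by apply: hf; apply: sD; rewrite mem_head.
  by apply: IH => y ys; apply: sD; rewrite in_cons ys orbT.
move=> /cvg_normcP /(_ _ e40) HS.
near=> n.
have -> : csum D f - csum D (h n) = (csum D f - \sum_(x <- J) f x)
   + ((\sum_(x <- J) f x - \sum_(x <- J) h n x) +
      (- (csum D (h n) - \sum_(x <- J) h n x))) by ring.
apply: (@le_lt_trans _ _ (e/4 + (e/4 + e/4))); last by lra.
apply: ler_normcD; first exact: HJ.
apply: ler_normcD; first by rewrite ltW//; near: n.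
by rewrite normcN HJ//; near: n.
Unshelve. all: by end_near. Qed.

End Sums.

Lemma reindex_csum (R : realType) (T T' : choiceType) (D : set T) (D' : set T')
  (e : T -> T') (f : T' -> cplx R) : set_bij D D' e ->
  csum D' f = csum D (f \o e).
Proof.
move=> he; rewrite /csum /rsum; congr (_ +i* _); congr (_ - _); congr fine;
 exact: (reindex_esum D D' e).
Qed.

Lemma reindex_wsummable (R : realType) (T T' : choiceType) (D : set T) (D' : set T')
  (e : T -> T') (w : T' -> R) : (forall x, 0 <= w x) -> set_bij D D' e ->
  wsummable D' w -> wsummable D (w \o e).
Proof.
by move=> w0 he; rewrite /wsummable (reindex_esum D D' e).
Qed.

(** * Complex-valued integrals *)

Section ComplexIntegrals.
Context d (T : measurableType d) (R : realType).
Variable mu : {measure set T -> \bar R}.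
Local Notation C := (cplx R).
Local Notation N := (@Normc.normc R).
Local Notation Re := (@complex.Re R).
Local Notation Im := (@complex.Im R).
Implicit Types (D : set T) (f g : T -> C) (H : T -> R).

Definition cmeasurable D f : Prop :=
  measurable_fun D (fun x => Re (f x)) /\ measurable_fun D (fun x => Im (f x)).

Definition rintegrable D H : Prop := mu.-integrable D (EFin \o H).

Definition cintegrable D f : Prop :=
  rintegrable D (fun x => Re (f x)) /\ rintegrable D (fun x => Im (f x)).

Lemma cmeasurable_cst D (c : C) : cmeasurable D (fun=> c).
Proof. by split; exact: measurable_cst. Qed.

Lemma cmeasurableD D f g : cmeasurable D f -> cmeasurable D g ->
  cmeasurable D (fun x => f x + g x).
Proof.
move=> [f1 f2] [g1 g2]; split.
  by under eq_fun do rewrite ReD; exact: measurable_funD.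
by under eq_fun do rewrite ImD; exact: measurable_funD.
Qed.

Lemma cmeasurableM D f g : cmeasurable D f -> cmeasurable D g ->
  cmeasurable D (fun x => f x * g x).
Proof.
move=> [f1 f2] [g1 g2]; split.
  under eq_fun do rewrite ReM.
  by apply: measurable_funB; exact: measurable_funM.
under eq_fun do rewrite ImM.
by apply: measurable_funD; exact: measurable_funM.
Qed.

Lemma cmeasurable_sum D (I : Type) (s : seq I) (f : I -> T -> C) :
  (forall i, cmeasurable D (f i)) ->
  cmeasurable D (fun x => \sum_(i <- s) f i x).
Proof.
move=> mf; elim: s => [|i s IH].
  by under eq_fun do rewrite big_nil; exact: cmeasurable_cst.
by under eq_fun do rewrite big_cons; exact: cmeasurableD.
Qed.

Lemma cmeasurable_real D H : measurable_fun D H ->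
  cmeasurable D (fun x => (H x)%:C).
Proof. by move=> mH; split => //; exact: measurable_cst. Qed.

Lemma cmeasurable_conj D f : cmeasurable D f -> cmeasurable D (fun x => (f x)^*).
Proof.
move=> [f1 f2]; split.
  by rewrite (_ : (fun x => _) = (fun x => Re (f x)))//; apply/funext => x; case: (f x).
rewrite (_ : (fun x => Im _) = (fun x => - Im (f x))); first exact: measurable_funN.
by apply/funext => x; case: (f x).
Qed.

Lemma eq_cmeasurable D f g : (forall x, D x -> f x = g x) ->
  cmeasurable D f -> cmeasurable D g.
Proof.
move=> fg [f1 f2]; split.
  by apply: eq_measurable_fun f1 => x /set_mem /fg ->.
by apply: eq_measurable_fun f2 => x /set_mem /fg ->.
Qed.

Lemma cintegrable_measurable D f : cintegrable D f -> cmeasurable D f.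
Proof.
move=> [/integrableP[/measurable_EFinP f1 _] /integrableP[/measurable_EFinP f2 _]].
by split.
Qed.

Lemma rintegrable_le D H H' : measurable D -> measurable_fun D H ->
  (forall x, D x -> `|H x| <= H' x) -> rintegrable D H' -> rintegrable D H.
Proof.
move=> mD mH HH'; apply: le_integrable => //; first exact/measurable_EFinP.
move=> x Dx /=; rewrite lee_fin (le_trans (HH' x Dx))// ler_norm//.
Qed.

Lemma cintegrable_dom D f H : measurable D -> cmeasurable D f ->
  rintegrable D H -> (forall x, D x -> N (f x) <= H x) -> cintegrable D f.
Proof.
move=> mD [f1 f2] iH fH; split; apply: rintegrable_le iH => // x Dx;
  apply: le_trans (fH x Dx); [exact: ler_Re_normc|exact: ler_Im_normc].
Qed.

Lemma cintegrable_norm D f : measurable D -> cintegrable D f ->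
  rintegrable D (fun x => N (f x)).
Proof.
move=> mD [f1 f2]; have [m1 m2] : cmeasurable D f by apply: cintegrable_measurable.
apply: (@rintegrable_le D _ (fun x => `|Re (f x)| + `|Im (f x)|)) => //.
- under eq_fun do rewrite normcE2.
  have ms : measurable_fun setT (@Num.sqrt R).
    by apply: continuous_measurable_fun; exact: sqrt_continuous.
  exact: (measurableT_comp ms (measurable_funD (measurable_funX 2 m1) (measurable_funX 2 m2))).
- by move=> x _; rewrite ger0_norm ?normc_ge0// normc_le_ReIm.
- have := integrableD mD (integrable_norm f1) (integrable_norm f2).
  by apply: eq_integrable.
Qed.

Lemma rintegrableD D H H' : measurable D -> rintegrable D H -> rintegrable D H' ->
  rintegrable D (fun x => H x + H' x).
Proof.
move=> mD i1 i2; have := integrableD mD i1 i2; exact: eq_integrable.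
Qed.

Lemma rintegrableZ D H c : measurable D -> rintegrable D H ->
  rintegrable D (fun x => c * H x).
Proof.
move=> mD i1; have := integrableZl mD c i1; exact: eq_integrable.
Qed.

Lemma eq_cintegrable D f g : measurable D -> (forall x, D x -> f x = g x) ->
  cintegrable D f -> cintegrable D g.
Proof.
move=> mD fg [f1 f2]; split.
  by apply: eq_integrable f1 => //= x /set_mem /fg /= ->.
by apply: eq_integrable f2 => //= x /set_mem /fg /= ->.
Qed.

Lemma eq_cintegral D f g : (forall x, D x -> f x = g x) ->
  cintegral mu D f = cintegral mu D g.
Proof.
by move=> fg; rewrite /cintegral; congr (_ +i* _); apply: eq_Rintegral => x /set_mem /fg ->.
Qed.

Lemma cintegrableD D f g : measurable D -> cintegrable D f -> cintegrable D g ->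
  cintegrable D (fun x => f x + g x).
Proof.
move=> mD [f1 f2] [g1 g2]; split.
  by under eq_fun do rewrite ReD; exact: rintegrableD.
by under eq_fun do rewrite ImD; exact: rintegrableD.
Qed.

Lemma cintegralD D f g : measurable D -> cintegrable D f -> cintegrable D g ->
  cintegral mu D (fun x => f x + g x) = cintegral mu D f + cintegral mu D g.
Proof.
move=> mD [f1 f2] [g1 g2]; rewrite /cintegral; apply: complex_ext => /=.
  by under eq_Rintegral do rewrite ReD; rewrite RintegralD.
by under eq_Rintegral do rewrite ImD; rewrite RintegralD.
Qed.

Lemma cintegrableZ D f (c : C) : measurable D -> cintegrable D f ->
  cintegrable D (fun x => c * f x).
Proof.
move=> mD [f1 f2]; split.
  under eq_fun do rewrite ReM -mulNr.
  by apply: rintegrableD => //; exact: rintegrableZ.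
under eq_fun do rewrite ImM.
by apply: rintegrableD => //; exact: rintegrableZ.
Qed.

Lemma cintegralZ D f (c : C) : measurable D -> cintegrable D f ->
  cintegral mu D (fun x => c * f x) = c * cintegral mu D f.
Proof.
move=> mD [f1 f2]; rewrite /cintegral; apply: complex_ext; rewrite ?ReM ?ImM /=.
  under eq_Rintegral do rewrite ReM.
  by rewrite RintegralB ?RintegralZl//; exact: rintegrableZ.
under eq_Rintegral do rewrite ImM.
by rewrite RintegralD ?RintegralZl//; exact: rintegrableZ.
Qed.

Lemma cintegrableN D f : measurable D -> cintegrable D f ->
  cintegrable D (fun x => - f x).
Proof.
move=> mD fi; under eq_fun do rewrite -mulN1r; exact: cintegrableZ.
Qed.

Lemma cintegralN D f : measurable D -> cintegrable D f ->
  cintegral mu D (fun x => - f x) = - cintegral mu D f.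
Proof.
move=> mD fi; rewrite -mulN1r -cintegralZ//; apply: eq_cintegral => x _.
by rewrite mulN1r.
Qed.

Lemma cintegrableB D f g : measurable D -> cintegrable D f -> cintegrable D g ->
  cintegrable D (fun x => f x - g x).
Proof. by move=> mD fi gi; apply: cintegrableD => //; exact: cintegrableN. Qed.

Lemma cintegralB D f g : measurable D -> cintegrable D f -> cintegrable D g ->
  cintegral mu D (fun x => f x - g x) = cintegral mu D f - cintegral mu D g.
Proof.
by move=> mD fi gi; rewrite cintegralD// ?cintegralN//; exact: cintegrableN.
Qed.

Lemma cintegral0 D : cintegral mu D (fun=> 0) = 0.
Proof.
by rewrite /cintegral /Rintegral /= integral0.
Qed.

Lemma cintegrable0 D : measurable D -> cintegrable D (fun=> 0).
Proof. by move=> mD; split; exact: integrable0. Qed.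

Lemma cintegrable_sum D (I : Type) (s : seq I) (f : I -> T -> C) : measurable D ->
  (forall i, cintegrable D (f i)) -> cintegrable D (fun x => \sum_(i <- s) f i x).
Proof.
move=> mD fi; elim: s => [|i s IH].
  by under eq_fun do rewrite big_nil; exact: cintegrable0.
by under eq_fun do rewrite big_cons; exact: cintegrableD.
Qed.

Lemma cintegral_sum D (I : Type) (s : seq I) (f : I -> T -> C) : measurable D ->
  (forall i, cintegrable D (f i)) ->
  cintegral mu D (fun x => \sum_(i <- s) f i x) =
  \sum_(i <- s) cintegral mu D (f i).
Proof.
move=> mD fi; elim: s => [|i s IH].
  by under eq_fun do rewrite big_nil; rewrite cintegral0 big_nil.
under eq_fun do rewrite big_cons; rewrite big_cons -IH cintegralD//.
exact: cintegrable_sum.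
Qed.

Lemma normc_cintegral D f H : measurable D -> cmeasurable D f ->
  rintegrable D H -> (forall x, D x -> N (f x) <= H x) ->
  N (cintegral mu D f) <= 2 * Rintegral mu D H.
Proof.
move=> mD mf iH fH; have [i1 i2] := cintegrable_dom mD mf iH fH.
apply: le_trans (normc_le_ReIm _) _; rewrite mulr_natl mulr2n /=.
by apply: lerD; apply: le_trans (le_normr_Rintegral _ _) _ => //;
  apply: le_Rintegral => //; rewrite -/(rintegrable _ _);
  try (by apply: integrable_norm); move=> x Dx; apply: le_trans (fH x Dx);
  [exact: ler_Re_normc|exact: ler_Im_normc].
Qed.

Lemma cintegral_conj D f : measurable D -> cintegrable D f ->
  cintegral mu D (fun x => (f x)^*) = (cintegral mu D f)^*.
Proof.
move=> mD [i1 i2]; rewrite /cintegral; apply: complex_ext => /=.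
  by apply: eq_Rintegral => x _; case: (f x).
rewrite -mulN1r -RintegralZl//; apply: eq_Rintegral => x _.
by rewrite mulN1r; case: (f x).
Qed.

Lemma cintegrable_conj D f : measurable D -> cintegrable D f ->
  cintegrable D (fun x => (f x)^*).
Proof.
move=> mD fi; apply: (@cintegrable_dom D _ (fun x => N (f x))) => //.
- exact/cmeasurable_conj/cintegrable_measurable.
- exact: cintegrable_norm.
- by move=> x _; rewrite normc_J.
Qed.

Lemma cintegrableS (E D : set T) f : measurable E -> measurable D ->
  D `<=` E -> cintegrable E f -> cintegrable D f.
Proof. by move=> mE mD DE [f1 f2]; split; [exact: integrableS f1|exact: integrableS f2]. Qed.

Lemma cintegral_setU (D E : set T) f : measurable D -> measurable E ->
  cintegrable (D `|` E) f -> [disjoint D & E] ->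
  cintegral mu (D `|` E) f = cintegral mu D f + cintegral mu E f.
Proof.
move=> mD mE [f1 f2] DE; rewrite /cintegral; apply: complex_ext => /=;
exact: Rintegral_setU.
Qed.

Definition crestrict D f := fun x => if x \in D then f x else 0.

Lemma cintegral_restrict D f : cintegral mu D f =
  cintegral mu setT (crestrict D f).
Proof.
rewrite /cintegral; apply: complex_ext => /=; rewrite [LHS]Rintegral_mkcond;
  by apply: eq_Rintegral => x _; rewrite /crestrict patchE; case: (x \in D).
Qed.

Lemma cintegrable_restrict D f : measurable D ->
  cintegrable D f <-> cintegrable setT (crestrict D f).
Proof.
move=> mD; rewrite /cintegrable /rintegrable.
have E (h : C -> R) : h 0 = 0 -> (EFin \o (fun x => h (f x))) \_ D =
    EFin \o (fun x => h (crestrict D f x)).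
  move=> h0; apply/funext => x; rewrite /crestrict patchE /=.
  by case: ifP => // _; rewrite h0.
by rewrite -!E// -!integrable_mkcond.
Qed.

Lemma cmeasurable_restrict D f : measurable D -> cmeasurable D f ->
  cmeasurable setT (crestrict D f).
Proof.
move=> mD [f1 f2]; split.
  rewrite (_ : (fun x => _) = (fun x => Re (f x)) \_ D).
    exact/(measurable_restrictT _ mD).1.
  by apply/funext => x; rewrite /crestrict patchE; case: ifP.
rewrite (_ : (fun x => Im _) = (fun x => Im (f x)) \_ D).
  exact/(measurable_restrictT _ mD).1.
by apply/funext => x; rewrite /crestrict patchE; case: ifP.
Qed.

(** For a majorant of product form the tail factors, so a truncation chosen from [w] is good for all
    values of the parameter hidden in [h]. *)
Lemma csum_prod_tail (S : choiceType) (E : set S) (w : S -> R) (f : S -> C)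
  (h : R) (s : {fset S}) : wsummable E w -> (forall t, E t -> 0 <= w t) ->
  0 <= h -> (forall t, E t -> N (f t) <= w t * h) -> [set` s] `<=` E ->
  N (csum E f - \sum_(t <- s) f t) <= 2 * wsum (E `&` ~` [set` s]) w * h.
Proof.
move=> sw w0 h0 fh sE.
have wh : (fun t => w t * h) = (fun t => h * w t).
  by apply/funext => t; rewrite mulrC.
have sH : wsummable E (fun t => w t * h) by rewrite wh; exact: wsummableZ.
apply: le_trans (csum_tail sE sH fh) _; rewrite -mulrA ler_wpM2l// wh mulrC.
apply: wsumZ_le => //; first by move=> t [/w0].
by apply: wsummable_sub sw => // t [].
Qed.

(** The sum is a pointwise limit of finite sums over sets whose [w]-tails are below [1 / (n + 1)].
    These sets do not depend on [x], so each partial sum is a single measurable function. *)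
Lemma cmeasurable_csum (S : choiceType) (E : set S) (w : S -> R) (f : S -> T -> C) D H :
  measurable D -> wsummable E w -> (forall t, E t -> 0 <= w t) ->
  (forall t, E t -> cmeasurable D (f t)) -> (forall x, D x -> 0 <= H x) ->
  (forall t x, E t -> D x -> N (f t x) <= w t * H x) ->
  cmeasurable D (fun x => csum E (fun t => f t x)).
Proof.
move=> mD sw w0 mf H0 fH.
have J n : {J : {fset S} | [set` J] `<=` E & wsum (E `&` ~` [set` J]) w < n.+1%:R^-1}.
  by apply: cid2; apply: wsum_tail => //; rewrite invr_gt0.
pose g n x := \sum_(t <- s2val (J n)) f t x.
have mg n : cmeasurable D (g n).
  rewrite /g; case: (J n) => /= s sE _.
  elim: (enum_fset s) (sE : forall x, x \in enum_fset s -> E x) => [|i l IH] lE.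
    by under eq_fun do rewrite big_nil; exact: cmeasurable_cst.
  under eq_fun do rewrite big_cons; apply: cmeasurableD.
    by apply: mf; apply: lE; rewrite mem_head.
  by apply: IH => y yl; apply: lE; rewrite in_cons yl orbT.
have gf x : D x -> g n x @[n --> \oo] --> csum E (fun t => f t x).
  move=> Dx; apply/cvg_normcP => e e0.
  have d1 : 0 < 1 + 2 * H x by rewrite ltr_pwDl// mulr_ge0// H0.
  have d0 : 0 < e / (1 + 2 * H x) by rewrite divr_gt0.
  near=> n.
  rewrite /g; case: (J n) => /= s sE sn.
  apply: le_lt_trans (csum_prod_tail sw w0 (H0 _ Dx) (fun t Et => fH t x Et Dx) sE) _.
  apply: (@le_lt_trans _ _ (2 * n.+1%:R^-1 * H x)).
    by rewrite ler_wpM2r ?H0// ler_wpM2l// ltW.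
  apply: (@lt_le_trans _ _ ((1 + 2 * H x) * n.+1%:R^-1)).
    have : 0 < n.+1%:R^-1 :> R by rewrite invr_gt0.
    by set v := _^-1; nra.
  rewrite -ler_pdivlMl// mulrC ltW//.
  near: n; exact: near_infty_natSinv_lt (PosNum d0).
split.
  apply: (@measurable_fun_cvg _ _ _ _ (fun n x => Re (g n x))).
  - by move=> n; exact: (mg n).1.
  - by move=> x Dx; apply: cvg_Re; exact: gf.
apply: (@measurable_fun_cvg _ _ _ _ (fun n x => Im (g n x))).
- by move=> n; exact: (mg n).2.
- by move=> x Dx; apply: cvg_Im; exact: gf.
Unshelve. all: by end_near. Qed.

(** Fubini between an unordered sum and an integral, obtained by truncating both sides with a set
    given by the product majorant [w t * H x]. *)
Lemma cintegral_csum (S : choiceType) (E : set S) (w : S -> R) (f : S -> T -> C) D H :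
  measurable D -> wsummable E w -> (forall t, E t -> 0 <= w t) ->
  (forall t, E t -> cmeasurable D (f t)) -> rintegrable D H ->
  (forall x, D x -> 0 <= H x) ->
  (forall t x, E t -> D x -> N (f t x) <= w t * H x) ->
  cintegrable D (fun x => csum E (fun t => f t x)) /\
  cintegral mu D (fun x => csum E (fun t => f t x)) =
  csum E (fun t => cintegral mu D (f t)).
Proof.
move=> mD sw w0 mf iH H0 fH.
have mc := cmeasurable_csum mD sw w0 mf H0 fH.
have cH x (s : {fset S}) : D x -> [set` s] `<=` E ->
    N (csum E (fun t => f t x) - \sum_(t <- s) f t x) <=
    2 * wsum (E `&` ~` [set` s]) w * H x.
  by move=> Dx sE; apply: csum_prod_tail => //; [exact: H0|move=> t Et; exact: fH].
have if_ t : E t -> cintegrable D (f t).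
  move=> Et; apply: (@cintegrable_dom _ _ (fun x => w t * H x)) => //.
  - exact: mf.
  - exact: rintegrableZ.
  - by move=> x Dx; exact: fH.
have ic : cintegrable D (fun x => csum E (f^~ x)).
  apply: (@cintegrable_dom _ _ (fun x => 2 * wsum E w * H x)) => //.
    exact: rintegrableZ.
  move=> x Dx; have := cH x fset0 Dx; rewrite big_seq_fset0 subr0.
  by rewrite set_fset0 setC0 setIT; apply.
pose I := Rintegral mu D H.
have I0 : 0 <= I by apply: Rintegral_ge0.
have fI t : E t -> N (cintegral mu D (f t)) <= 2 * I * w t.
  move=> Et; rewrite -mulrA (mulrC I) /I -RintegralZl//.
  apply: normc_cintegral => //; first exact: mf.
    exact: rintegrableZ.
  by move=> x Dx; exact: fH.
have sw2 : wsummable E (fun t => 2 * I * w t) by apply: wsummableZ => //; rewrite mulr_ge0.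
have w2 t : E t -> 0 <= 2 * I * w t by move=> Et; rewrite !mulr_ge0 ?w0.
split=> //; apply/eqP; rewrite -subr_eq0 -normc0P; apply/eqP; apply: ge0_lt_eq0.
  exact: normc_ge0.
move=> e e0.
(* Truncating under the integral and truncating the sum of integrals cost [4 * I * e1] each: one
   factor 2 from the sum, one from the integral. *)
pose e1 := e / (1 + 8 * I).
have d0 : 0 < 1 + 8 * I by rewrite ltr_pwDl// mulr_ge0.
have e10 : 0 < e1 by rewrite divr_gt0.
have [J JE HJ] := wsum_tail w0 sw e10.
have tail0 : 0 <= wsum (E `&` ~` [set` J]) w by apply: wsum_ge0 => t [/w0].
(* The lemmas on finite sums ask for integrability at every index; outside [J] the summand is
   replaced by 0. *)
have iJ (i : S) : cintegrable D (fun x => if i \in J then f i x else 0).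
  by case: (boolP (i \in J)) => [/JE/if_ //|_]; exact: cintegrable0.
have -> : cintegral mu D (fun x => csum E (f^~ x)) - csum E (fun t => cintegral mu D (f t))
  = cintegral mu D (fun x => csum E (f^~ x) - \sum_(t <- J) (if t \in J then f t x else 0))
   - (csum E (fun t => cintegral mu D (f t)) - \sum_(t <- J) cintegral mu D (f t)).
  rewrite cintegralB//; last exact: cintegrable_sum.
  rewrite cintegral_sum//.
  have -> : \sum_(i <- J) cintegral mu D (fun x => if i \in J then f i x else 0)
    = \sum_(t <- J) cintegral mu D (f t).
    by apply: eq_big_seq => t tJ; rewrite tJ.
  ring.
apply: (@le_trans _ _ (8 * I * e1)); last first.
  by rewrite /e1 mulrA ler_pdivrMr// mulrC ler_pM2l//; lra.
apply: (@le_trans _ _ (4 * I * e1 + 4 * I * e1)); last by lra.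
apply: ler_normcD.
  apply: (@le_trans _ _ (2 * Rintegral mu D (fun x => 2 * e1 * H x))).
    apply: normc_cintegral => //.
    - apply: cmeasurableD => //; under eq_fun do rewrite -mulN1r.
      apply: cmeasurableM; first exact: cmeasurable_cst.
      by apply: cmeasurable_sum => i; exact: cintegrable_measurable (iJ i).
    - exact: rintegrableZ.
    - move=> x Dx; rewrite (_ : \sum_(t <- J) _ = \sum_(t <- J) f t x).
        apply: le_trans (cH x J Dx JE) _; rewrite ler_wpM2r ?H0//.
        by rewrite ler_wpM2l// ltW.
      by apply: eq_big_seq => t tJ; rewrite tJ.
  by rewrite RintegralZl// -/I; lra.
rewrite normcN; apply: le_trans (csum_tail JE sw2 fI) _.
apply: (@le_trans _ _ (2 * (2 * I * wsum (E `&` ~` [set` J]) w))).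
  rewrite ler_wpM2l//; apply: wsumZ_le; first by move=> t [/w0].
    by rewrite mulr_ge0.
  by apply: wsummable_sub sw => // t [].
have : I * wsum (E `&` ~` [set` J]) w <= I * e1 by rewrite ler_wpM2l// ltW.
lra.
Qed.

End ComplexIntegrals.

(** * Fubini's theorem under a product majorant *)

Section ComplexFubini.
Context d1 d2 (T1 : measurableType d1) (T2 : measurableType d2) (R : realType).
Variable m1 : {sigma_finite_measure set T1 -> \bar R}.
Variable m2 : {sigma_finite_measure set T2 -> \bar R}.
Local Notation C := (cplx R).
Local Notation N := (@Normc.normc R).

(** Joint integrability follows by Tonelli from the product bound, which also makes every section
    integrable, so that the inner integrals are finite at every point. *)
Lemma rfubini (f : T1 * T2 -> R) (H1 : T1 -> R) (H2 : T2 -> R) :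
  measurable_fun setT f -> rintegrable m1 setT H1 -> rintegrable m2 setT H2 ->
  (forall x y, `|f (x, y)| <= H1 x * H2 y) ->
  [/\ Rintegral m1 setT (fun x => Rintegral m2 setT (fun y => f (x, y))) =
      Rintegral m2 setT (fun y => Rintegral m1 setT (fun x => f (x, y))),
     measurable_fun setT (fun x => Rintegral m2 setT (fun y => f (x, y))) &
     measurable_fun setT (fun y => Rintegral m1 setT (fun x => f (x, y)))].
Proof.
move=> mf i1 i2 fH.
have mfx x : measurable_fun setT (fun y => f (x, y)) by exact: measurableT_comp.
have mfy y : measurable_fun setT (fun x => f (x, y)) by exact: measurableT_comp.
have ix x : rintegrable m2 setT (fun y => f (x, y)).
  apply: (@rintegrable_le _ _ _ _ _ _ (fun y => H1 x * H2 y)) => //.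
  exact: rintegrableZ.
have iy y : rintegrable m1 setT (fun x => f (x, y)).
  apply: (@rintegrable_le _ _ _ _ _ _ (fun x => H2 y * H1 x)) => //.
    by move=> x _; rewrite mulrC.
  exact: rintegrableZ.
have mE : measurable_fun setT (EFin \o f) by exact/measurable_EFinP.
have iF : (m1 \x m2)%E.-integrable setT (EFin \o f).
  apply/integrable12ltyP => //.
  have [I2 I2E] : exists I2 : R, (\int[m2]_y `|(H2 y)%:E| = I2%:E)%E.
    exists (fine (\int[m2]_y `|(H2 y)%:E|)%E); rewrite fineK//.
    by have /integrableP[_] := i2; rewrite ge0_fin_numE// integral_ge0.
  apply: (@le_lt_trans _ _ (\int[m1]_x (`|H1 x|%:E * I2%:E))%E).
    apply: ge0_le_integral => //.
    - by move=> x _; exact: integral_ge0.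
    - by apply: (measurable_fun_fubini_tonelli_F (abse \o (EFin \o f))) => //=; exact: measurableT_comp.
    - apply: emeasurable_funM => //.
      by apply: measurableT_comp => //; apply: measurableT_comp => //;
         have /integrableP[/measurable_EFinP] := i1.
    - move=> x _; rewrite -I2E -ge0_integralZl//; last first.
        by apply: measurableT_comp => //; have /integrableP[] := i2.
      apply: ge0_le_integral => //.
      + by apply: measurableT_comp => //; exact/measurable_EFinP.
      + apply: emeasurable_funM => //.
        by apply: measurableT_comp => //; have /integrableP[] := i2.
      + by move=> y _; rewrite /= lee_fin -normrM (le_trans (fH x y))// ler_norm.
  rewrite ge0_integralZr//.
  - apply: lte_mul_pinfty; first exact: integral_ge0.
      by have /integrableP[_ h] := i1; rewrite ge0_fin_numE ?integral_ge0.
    exact: ltry.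
  - apply: measurableT_comp => //; apply: measurableT_comp => //.
    by have /integrableP[/measurable_EFinP] := i1.
  - by rewrite -I2E integral_ge0.
have EF : EFin \o (fun x => Rintegral m2 setT (fun y => f (x, y))) =
    (fun x => \int[m2]_y (EFin \o f) (x, y))%E.
  by apply/funext => x /=; rewrite /Rintegral fineK//; exact: integrable_fin_num (ix x).
have EG : EFin \o (fun y => Rintegral m1 setT (fun x => f (x, y))) =
    (fun y => \int[m1]_x (EFin \o f) (x, y))%E.
  by apply/funext => x /=; rewrite /Rintegral fineK//; exact: integrable_fin_num (iy x).
split.
- rewrite /Rintegral; congr fine.
  under eq_integral => x _ do rewrite -/((EFin \o (fun x => Rintegral m2 setT (fun y => f (x, y)))) x) EF.
  under [RHS]eq_integral => y _ do rewrite -/((EFin \o (fun y => Rintegral m1 setT (fun x => f (x, y)))) y) EG.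
  exact: Fubini.
- by apply/measurable_EFinP; rewrite EF; exact: (measurable_fubini_F iF).
- by apply/measurable_EFinP; rewrite EG; exact: (measurable_fubini_G iF).
Qed.

Lemma cfubini (f : T1 * T2 -> C) (H1 : T1 -> R) (H2 : T2 -> R) :
  cmeasurable setT f -> rintegrable m1 setT H1 -> rintegrable m2 setT H2 ->
  (forall x y, N (f (x, y)) <= H1 x * H2 y) ->
  [/\ cintegral m1 setT (fun x => cintegral m2 setT (fun y => f (x, y))) =
      cintegral m2 setT (fun y => cintegral m1 setT (fun x => f (x, y))),
     cmeasurable setT (fun x => cintegral m2 setT (fun y => f (x, y))) &
     cmeasurable setT (fun y => cintegral m1 setT (fun x => f (x, y)))].
Proof.
move=> [f1 f2] i1 i2 fH.
have [a1 b1 c1] := rfubini f1 i1 i2 (fun x y => le_trans (ler_Re_normc _) (fH x y)).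
have [a2 b2 c2] := rfubini f2 i1 i2 (fun x y => le_trans (ler_Im_normc _) (fH x y)).
by split; rewrite ?/cintegral /= ?a1 ?a2//; split.
Qed.

End ComplexFubini.

(** * Calculus and changes of variable on the real line *)

Section RealLine.
Variable R : realType.
Local Notation C := (cplx R).
Local Notation N := (@Normc.normc R).
Local Notation Re := (@complex.Re R).
Local Notation Im := (@complex.Im R).
Local Notation mu := (@lebesgue_measure R).
Local Notation mR := (measurableTypeR R).
Local Notation "'\cint' D f" := (@cintegral _ _ mR mu D f) (at level 10, D at level 0, f at level 0).

Lemma cmeasurable_continuous (D : set mR) (f : R -> C) : measurable D ->
  continuous f -> cmeasurable (D : set mR) f.
Proof.
move=> mD cf; split; apply: measurable_funS (measurableT) (@subsetT _ _) _;
  apply: continuous_measurable_fun.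
  exact: continuous_Re_fun.
exact: continuous_Im_fun.
Qed.

Lemma rintegrable_bounded (a b : R) (M : R) (H : mR -> R) :
  measurable_fun (`[a, b]%classic : set mR) H ->
  (forall x, a <= x <= b -> `|H x| <= M) -> rintegrable mu `[a, b]%classic H.
Proof.
move=> mH HM; apply: measurable_bounded_integrable => //.
  by rewrite /= lebesgue_measure_itv /=; case: ifP => // _; rewrite -EFinB ltry.
exists M; split; first exact: num_real.
move=> x Mx y /=; rewrite in_itv /= => /HM /le_trans; apply; exact: ltW.
Qed.

Lemma continuous_itv_bounded (f : R -> C) (a b : R) : continuous f ->
  exists M : R, forall x, a <= x <= b -> N (f x) <= M.
Proof.
move=> cf; have [ab|ba] := leP a b; last first.
  by exists 0 => x /andP[ax xb]; have := le_trans ax xb; rewrite leNgt ba.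
have cN : {within `[a, b], continuous (fun x => N (f x))}.
  apply: continuous_subspaceT => x.
  under eq_fun do rewrite normcE2 !expr2.
  have c1 := continuous_Re_fun cf; have c2 := continuous_Im_fun cf.
  apply: continuous_comp; last exact: sqrt_continuous.
  by apply: cvgD; apply: cvgM; solve [exact: c1|exact: c2].
have [c _ Hc] := EVT_max ab cN; exists (N (f c)) => x xab; apply: Hc.
by rewrite in_itv.
Qed.

Lemma cintegrable_itv (f : R -> C) (a b : R) : continuous f ->
  cintegrable mu (`[a, b]%classic : set mR) f.
Proof.
move=> cf; have [M HM] := continuous_itv_bounded a b cf.
apply: (@cintegrable_dom _ _ _ _ _ _ (fun=> M)) => //.
- exact: cmeasurable_continuous.
- by apply: (@rintegrable_bounded _ _ `|M|); first exact: measurable_cst.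
Qed.

(** Both measures agree on half-open intervals, and this determines Lebesgue measure. *)
Lemma lebesgue_measure_shift (c : R) (A : set mR) : measurable A ->
  pushforward mu (fun x : mR => (x + c : mR)) A = mu A.
Proof.
have mphi : measurable_fun [set: mR] (fun x : mR => (x + c : mR)).
  by apply: measurable_funD => //; exact: measurable_cst.
move=> mA; apply/esym/lebesgue_measure_unique => //= _ [[a b]] _ <-.
rewrite /pushforward (_ : _ @^-1` _ = `]a - c, b - c]%classic); last first.
  by apply/seteqP; split => x /=; rewrite !in_itv /= => /andP[? ?]; apply/andP; lra.
rewrite !lebesgue_measure_itv/= !lte_fin ltrD2r; case: ifP => // _.
by rewrite -!EFinD; congr (_%:E); ring.
Qed.

Section Preserving.
Variables (phi psi : mR -> mR).
Hypotheses (mphi : measurable_fun setT phi) (mpsi : measurable_fun setT psi).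
Hypothesis phiK : cancel psi phi.
Hypothesis phi_mu : forall A, measurable A -> pushforward mu phi A = mu A.
Hypothesis psi_mu : forall A, measurable A -> pushforward mu psi A = mu A.

(** Integrability of [f \o phi] is that of [f], read through the pushforward by [psi], which is
    again Lebesgue measure. *)
Let rintegrable_preserving (f : mR -> R) : rintegrable mu setT f ->
  rintegrable mu setT (f \o phi).
Proof.
move=> fi; have mf : measurable_fun setT f by have /integrableP[/measurable_EFinP] := fi.
have mfp : measurable_fun setT (f \o phi) by exact: measurableT_comp.
have /integrableP[_ H] : (pushforward mu psi).-integrable setT (EFin \o (f \o phi)).
  apply: integrable_pushforward => //; first exact/measurable_EFinP.
  rewrite preimage_setT (_ : _ \o psi = EFin \o f)//.
  by apply/funext => x /=; rewrite phiK.
apply/integrableP; split; first exact/measurable_EFinP.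
rewrite (eq_measure_integral (pushforward mu psi))// => A mA _; exact/esym/psi_mu.
Qed.

Lemma cintegrable_preserving (f : mR -> C) : cintegrable mu setT f ->
  cintegrable mu setT (f \o phi).
Proof.
by move=> [f1 f2]; split; [exact: rintegrable_preserving f1|exact: rintegrable_preserving f2].
Qed.

Lemma cintegral_preserving (f : mR -> C) : cintegrable mu setT f ->
  cintegral mu setT (f \o phi) = cintegral mu setT f.
Proof.
have H (g : mR -> R) : rintegrable mu setT g ->
    Rintegral mu setT (g \o phi) = Rintegral mu setT g.
  move=> gi; rewrite /Rintegral; congr fine.
  have := @integral_pushforward _ _ _ _ R phi mphi mu setT (EFin \o g).
  rewrite preimage_setT => <- //.
  - by apply: eq_measure_integral => A mA _; exact: phi_mu.
  - by have /integrableP[] := gi.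
  - exact: rintegrable_preserving.
by move=> [f1 f2]; rewrite /cintegral; congr (_ +i* _); [exact: H f1|exact: H f2].
Qed.

End Preserving.

Let mshift (c : R) : measurable_fun [set: mR] (fun x : mR => (x + c : mR)).
Proof. by apply: measurable_funD => //; exact: measurable_cst. Qed.

Lemma cintegral_shift (f : mR -> C) (c : R) : cintegrable mu setT f ->
  cintegral mu setT (fun x => f (x + c)) = cintegral mu setT f.
Proof.
apply: (@cintegral_preserving (fun x => x + c) (fun x => x - c)) => //.
- by move=> x; rewrite subrK.
- exact: lebesgue_measure_shift.
- exact: lebesgue_measure_shift.
Qed.

Lemma cintegrable_shift (f : mR -> C) (c : R) : cintegrable mu setT f ->
  cintegrable mu setT (fun x => f (x + c)).
Proof.
apply: (@cintegrable_preserving (fun x => x + c) (fun x => x - c)) => //.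
- by move=> x; rewrite subrK.
- exact: lebesgue_measure_shift.
Qed.

Lemma cintegral_opp (f : mR -> C) : cintegrable mu setT f ->
  cintegral mu setT (fun x => f (- x)) = cintegral mu setT f.
Proof.
apply: (@cintegral_preserving -%R -%R) => //.
- by move=> x; rewrite opprK.
- exact: lebesgue_measureN.
- exact: lebesgue_measureN.
Qed.

Lemma cintegrable_opp (f : mR -> C) : cintegrable mu setT f ->
  cintegrable mu setT (fun x => f (- x)).
Proof.
apply: (@cintegrable_preserving -%R -%R) => //.
- by move=> x; rewrite opprK.
- exact: lebesgue_measureN.
Qed.

(** The derivative in a real variable is taken componentwise, so that the differential calculus of
    real functions applies to each component. *)
Definition cderiv (F f : R -> C) : Prop := forall x : R,
  is_derive x (1 : R) (fun t => Re (F t)) (Re (f x)) /\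
  is_derive x (1 : R) (fun t => Im (F t)) (Im (f x)).

Lemma cderiv_continuous F f : cderiv F f -> continuous F.
Proof.
move=> H; apply: continuous_ReIm => x.
  have [[h _] _] := H x.
  exact/differentiable_continuous/derivable1_diffP.
have [_ [h _]] := H x.
exact/differentiable_continuous/derivable1_diffP.
Qed.

Lemma rFTC (F f : R -> R) (a b : R) : a <= b ->
  (forall x : R, is_derive x (1 : R) F (f x)) -> continuous f ->
  Rintegral mu (`[a, b]%classic : set mR) f = F b - F a.
Proof.
rewrite le_eqVlt => /predU1P[->|ab] dF cf.
  by rewrite set_itv1 Rintegral_set1 subrr.
have cF x : {for x, continuous F}.
  by have [h _] := dF x; exact/differentiable_continuous/derivable1_diffP.
rewrite /Rintegral (@continuous_FTC2 _ f F a b)//.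
- exact: continuous_subspaceT.
- split.
  + by move=> x _; have [] := dF x.
  + exact/cvg_at_right_filter/cF.
  + exact/cvg_at_left_filter/cF.
- by move=> x _; rewrite derive1E; have [] := dF x.
Qed.

Lemma cFTC F f (a b : R) : a <= b -> cderiv F f -> continuous f ->
  cintegral mu (`[a, b]%classic : set mR) f = F b - F a.
Proof.
move=> ab dF cf; rewrite /cintegral; apply: complex_ext; rewrite ?ReD ?ImD ?ReN ?ImN /=.
  apply: (rFTC (F := fun x => Re (F x))) => //; last exact: continuous_Re_fun.
  by move=> x; have [] := dF x.
apply: (rFTC (F := fun x => Im (F x))) => //; last exact: continuous_Im_fun.
by move=> x; have [] := dF x.
Qed.

Lemma cderivM F f G g : cderiv F f -> cderiv G g ->
  cderiv (fun x => F x * G x) (fun x => f x * G x + F x * g x).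
Proof.
move=> dF dG x; have [f1 f2] := dF x; have [g1 g2] := dG x; split.
  under eq_fun do rewrite ReM; rewrite ReD !ReM.
  apply: is_derive_eq; rewrite /GRing.scale /=; ring.
under eq_fun do rewrite ImM; rewrite ImD !ImM.
apply: is_derive_eq; rewrite /GRing.scale /=; ring.
Qed.

Lemma cderiv_cexp (w : C) : cderiv (fun x => cexp (w * x%:C)) (fun x => w * cexp (w * x%:C)).
Proof.
case: w => a b x; split; rewrite /cexp.
  under eq_fun do rewrite /= !mulr0 subr0 add0r.
  rewrite ReM /= !mulr0 subr0 add0r.
  apply: is_derive_eq; rewrite /GRing.scale /=; ring.
under eq_fun do rewrite /= !mulr0 subr0 add0r.
rewrite ImM /= !mulr0 subr0 add0r.
apply: is_derive_eq; rewrite /GRing.scale /=; ring.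
Qed.

Lemma cintegral_subset_cvg (f : mR -> C) (D : (set mR)^nat) :
  cintegrable mu setT f -> (forall n, measurable (D n)) ->
  (forall x, \forall n \near \oo, D n x) ->
  cintegral mu (D n) f @[n --> \oo] --> cintegral mu setT f.
Proof.
move=> [f1 f2] mD Dx.
have H (g : mR -> R) : rintegrable mu setT g ->
    Rintegral mu (D n) g @[n --> \oo] --> Rintegral mu setT g.
  move=> gi; have mg : measurable_fun setT (EFin \o g) by have /integrableP[] := gi.
  have [] := @dominated_convergence _ mR R mu setT measurableT
    (fun n => (EFin \o g) \_ (D n)) (EFin \o g) (abse \o (EFin \o g)).
  - move=> n; apply: (measurable_restrictT (EFin \o g) (mD n)).1.
    exact: (measurable_funTS mg).
  - exact: mg.
  - apply: aeW => x _; apply: cvg_near_cst.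
    by apply: filterS (Dx x) => n Dnx; rewrite patchE mem_set.
  - exact: integrable_abse.
  - apply: aeW => x n _; rewrite patchE; case: ifP => // _.
    by rewrite abse0 abse_ge0.
  move=> _ _ h; rewrite [X in _ --> X]/Rintegral.
  have -> : (fun n => Rintegral mu (D n) g) =
    fine \o [sequence (\int[mu]_x ((EFin \o g) \_ (D n)) x)%E]_n.
    by apply/funext => n /=; rewrite /Rintegral integral_mkcond.
  apply: fine_cvg; rewrite fineK//; exact: integrable_fin_num.
apply: cvg_ReIm; [exact: H f1|exact: H f2].
Qed.

Definition expo (w : C) (s : R) : C := cexp (w * s%:C).

Lemma Re_expo w s : Re (expo w s) = expR (Re w * s) * cos (Im w * s).
Proof. by rewrite /expo /cexp /= ReM ImM /= !mulr0 subr0 add0r. Qed.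

Lemma Im_expo w s : Im (expo w s) = expR (Re w * s) * sin (Im w * s).
Proof. by rewrite /expo /cexp /= ReM ImM /= !mulr0 subr0 add0r. Qed.

Lemma continuous_expo w : continuous (expo w).
Proof. exact: cderiv_continuous (cderiv_cexp w). Qed.

Lemma normc_expo w s : N (expo w s) = expR (Re w * s).
Proof. by rewrite /expo normc_cexp mulrC ReRM mulrC. Qed.

Lemma expoD w s t : expo w (s + t) = expo w s * expo w t.
Proof. by rewrite /expo -cexpD -mulrDr rmorphD. Qed.

Lemma expo_add w v s : expo (w + v) s = expo w s * expo v s.
Proof. by rewrite /expo -cexpD -mulrDl. Qed.

Lemma expo0 w : expo w 0 = 1. Proof. by rewrite /expo mulr0 cexp0. Qed.

Lemma cintegral_expo (w : C) (a b : R) : a <= b -> w != 0 ->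
  cintegral mu (`[a, b]%classic : set mR) (expo w) = (expo w b - expo w a) / w.
Proof.
move=> ab w0; rewrite -[LHS](mulKf w0) mulrC; congr (_ * _).
rewrite -cintegralZ//; last exact/cintegrable_itv/continuous_expo.
apply: (cFTC ab (cderiv_cexp w)) => x.
by apply: (@cvgM C); [exact: cvg_cst|exact: continuous_expo].
Qed.

Let cvgnyE (f : R -> C) (l : C) :
  (forall e : R, 0 < e -> exists K : R, forall x, K <= x -> N (l - f x) <= e) ->
  f (n%:R) @[n --> \oo] --> l.
Proof.
move=> H; apply/cvg_normcP => e e0; have e20 : 0 < e / 2 by rewrite divr_gt0.
have [K HK] := H _ e20.
near=> n; apply: (@le_lt_trans _ _ (e/2)); last by lra.
apply: HK; near: n; exact: nbhs_infty_ger.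
Unshelve. all: by end_near. Qed.

Lemma expRN_small (c e : R) : 0 < c -> 0 < e -> exists2 K : R, 0 < K &
  forall x, K <= x -> expR (- c * x) <= e.
Proof.
(* Since [1 + c * x <= exp (c * x)], the exponential exceeds [e^-1] as soon as [x] reaches
   [1 / (c * e)]. *)
move=> c0 e0; exists (c^-1 * e^-1) => [|x Kx]; first by rewrite mulr_gt0// invr_gt0.
rewrite mulNr expRN -[leRHS]invrK lef_pV2 ?posrE ?invr_gt0 ?expR_gt0//.
apply: le_trans (expR_ge1Dx _); move: Kx; rewrite ler_pdivrMl// => Kx.
by rewrite (le_trans Kx)// lerDr.
Qed.

Lemma rintegrable_exp (c : R) : 0 < c ->
  rintegrable mu (`[0, +oo[%classic : set mR) (fun x => expR (- c * x)).
Proof.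
move=> c0.
have cc : continuous (fun x : R => expR (- c * x)).
  move=> x; apply: continuous_comp; last exact: continuous_expR.
  by apply: cvgM; [exact: cvg_cst|exact: cvg_id].
apply/integrableP; split.
  by apply/measurable_EFinP/measurable_funTS; exact: continuous_measurable_fun.
under eq_integral do rewrite /= ger0_norm ?expR_ge0//.
rewrite (@ge0_continuous_FTC2y _ _ (fun x => - c^-1 * expR (- c * x)) _ 0).
- by rewrite -EFinB ltry.
- by move=> x _; exact: expR_ge0.
- exact: continuous_subspaceT.
- rewrite -[X in _ --> X](mulr0 (- c^-1)); apply: cvgM; first exact: cvg_cst.
  apply/cvgrPdist_le => e e0; have [K K0 HK] := expRN_small c0 e0.
  near=> x; rewrite sub0r normrN ger0_norm ?expR_ge0//; apply: HK; near: x.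
  by apply: nbhs_pinfty_ge; exact: num_real.
- by move=> x _; apply: ex_derive.
- apply: cvg_at_right_filter; apply: cvgM; first exact: cvg_cst.
  exact: cc.
- move=> x _; rewrite derive1E; apply: derive_val.
  have h : is_derive x (1 : R) (fun y : R => expR (- c * y)) (- c * expR (- c * x)).
    by apply: is_derive_eq; rewrite /GRing.scale /=; ring.
  have := is_deriveZ (- c^-1) h; rewrite /GRing.scale /= mulrA mulrNN mulVf ?mul1r//.
  by rewrite gt_eqF.
Unshelve. all: by end_near. Qed.

Lemma cintegral_exp_half (w : C) : Re w < 0 ->
  cintegrable mu (`[0, +oo[%classic : set mR) (expo w) /\
  cintegral mu (`[0, +oo[%classic : set mR) (expo w) = - w^-1.
Proof.
move=> w0; have wn0 : w != 0.
  by apply: contraTN w0 => /eqP ->; rewrite ltxx.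
have c0 : 0 < - Re w by rewrite oppr_gt0.
have mD : measurable (`[0, +oo[%classic : set mR) by [].
have iw : cintegrable mu (`[0, +oo[%classic : set mR) (expo w).
  apply: (@cintegrable_dom _ _ _ _ _ _ (fun x : mR => expR (- - Re w * x))) => //.
  - by apply: cmeasurable_continuous => //; exact: continuous_expo.
  - exact: rintegrable_exp.
  - by move=> x _; rewrite normc_expo opprK.
split => //.
have iT := (cintegrable_restrict mu (expo w) mD).1 iw.
rewrite cintegral_restrict.
(* The exhausting sets must eventually contain every real number, hence the passage through
   [[- n, n]]; the restricted integrand vanishes to the left of 0. *)
have H1 : cintegral mu (`[0, n%:R]%classic : set mR)
    (crestrict (`[0, +oo[%classic : set mR) (expo w)) @[n --> \oo] -->
    cintegral mu setT (crestrict (`[0, +oo[%classic : set mR) (expo w)).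
  have := @cintegral_subset_cvg (crestrict (`[0, +oo[%classic : set mR) (expo w))
    (fun n => `[- n%:R, n%:R]%classic) iT (fun n => measurable_itv _).
  have -> : (fun n : nat => cintegral mu (`[- n%:R, n%:R]%classic : set mR)
      (crestrict (`[0, +oo[%classic : set mR) (expo w))) =
    (fun n : nat => cintegral mu (`[0, n%:R]%classic : set mR)
      (crestrict (`[0, +oo[%classic : set mR) (expo w))).
    apply/funext => n; rewrite cintegral_restrict [RHS]cintegral_restrict.
    apply: eq_cintegral => x _; rewrite /crestrict !mem_setE !in_itv /= andbT.
    case: (leP 0 x) => x0; last by rewrite !if_same.
    by rewrite (le_trans _ x0)// oppr_le0.
  apply=> x; near=> n.
  rewrite /= in_itv /= -ler_norml; near: n; exact: nbhs_infty_ger.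
have E n : cintegral mu (`[0, n%:R]%classic : set mR)
    (crestrict (`[0, +oo[%classic : set mR) (expo w)) = (expo w n%:R - 1) / w.
  rewrite -(expo0 w) -cintegral_expo//; apply: eq_cintegral => x /=.
  by rewrite in_itv /= => /andP[x0 _]; rewrite /crestrict mem_set//= in_itv /= x0.
have H2 : (fun n : nat => (expo w n%:R - 1) / w) @ \oo --> - w^-1.
  apply: (cvgnyE (f := fun x => (expo w x - 1) / w)) => e e0.
  have Nw : 0 < N w by rewrite normc_gt0.
  have [K K0 HK] := expRN_small c0 (mulr_gt0 e0 Nw).
  exists K => x Kx.
  have -> : - w^-1 - (expo w x - 1) / w = - expo w x / w by ring.
  rewrite Normc.normcM Normc.normcV ler_pdivrMr// normcN normc_expo.
  by rewrite -[Re w]opprK; exact: HK.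
move: H1; under eq_fun do rewrite E; move=> H1.
exact: (cvg_unique _ H1 H2).
Unshelve. all: by end_near. Qed.

Definition e1 (t : R) : C := cexp (0 +i* (2 * pi * t)).

Lemma normc_e1 t : N (e1 t) = 1. Proof. by rewrite normc_cexp expR0. Qed.

Lemma e1D s t : e1 (s + t) = e1 s * e1 t.
Proof. by rewrite /e1 -cexpD; congr cexp; apply: complex_ext; rewrite /=; ring. Qed.

Lemma e1_0 : e1 0 = 1.
Proof. by rewrite /e1 mulr0 cexp0. Qed.

Lemma conj_e1 t : (e1 t)^* = e1 (- t).
Proof. by rewrite /e1 conj_cexp /= mulrN. Qed.

Lemma e1_expo l t : e1 (l * t) = expo (0 +i* (2 * pi * l)) t.
Proof.
by rewrite /e1 /expo; congr cexp; apply: complex_ext; rewrite /=; ring.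
Qed.

Lemma continuous_e1 (l : R) : continuous (fun t : R => e1 (l * t)).
Proof. under eq_fun do rewrite e1_expo; exact: continuous_expo. Qed.

Lemma cmeasurable_e1M : cmeasurable (setT : set (mR * mR)) (fun z => e1 (z.1 * z.2)).
Proof.
rewrite /e1 /cexp; split => /=.
  under eq_fun do rewrite expR0 mul1r.
  apply: measurableT_comp; first by apply: continuous_measurable_fun; exact: continuous_cos.
  apply: measurable_funM; first exact: measurable_cst.
  by apply: measurable_funM; [exact: measurable_fst|exact: measurable_snd].
under eq_fun do rewrite expR0 mul1r.
apply: measurableT_comp; first by apply: continuous_measurable_fun; exact: continuous_sin.
apply: measurable_funM; first exact: measurable_cst.
by apply: measurable_funM; [exact: measurable_fst|exact: measurable_snd].
Qed.

(* The exponent has the sign of the inverse Fourier transform. *)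
Definition ft (u : R -> C) (x : R) : C :=
  cintegral mu (setT : set mR) (fun y => u y * e1 (x * y)).

Lemma cintegrableMe1 (u : R -> C) (x : R) : cintegrable mu (setT : set mR) u ->
  cintegrable mu (setT : set mR) (fun y => u y * e1 (x * y)).
Proof.
move=> iu; apply: (@cintegrable_dom _ _ _ _ _ _ (fun y : mR => N (u y))) => //.
- apply: cmeasurableM; first exact: cintegrable_measurable iu.
  by apply: cmeasurable_continuous => //; exact: continuous_e1.
- exact: cintegrable_norm.
- by move=> y _; rewrite Normc.normcM normc_e1 mulr1.
Qed.

(** Fubini, the kernel being unimodular and symmetric in its two variables. Inversion and the
    averaging argument for spectral gaps both start from this formula. *)
Lemma ft_multiplication (u v : R -> C) : cintegrable mu (setT : set mR) u ->
  cintegrable mu (setT : set mR) v ->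
  cintegral mu (setT : set mR) (fun x => u x * ft v x) =
  cintegral mu (setT : set mR) (fun y => ft u y * v y).
Proof.
move=> iu iv.
have mu_ := cintegrable_measurable iu; have mv_ := cintegrable_measurable iv.
have mf : cmeasurable (setT : set (mR * mR)) (fun z => u z.1 * v z.2 * e1 (z.1 * z.2)).
  apply: cmeasurableM; last exact: cmeasurable_e1M.
  apply: cmeasurableM.
    by split; [exact: measurableT_comp mu_.1 measurable_fst|
               exact: measurableT_comp mu_.2 measurable_fst].
  by split; [exact: measurableT_comp mv_.1 measurable_snd|
               exact: measurableT_comp mv_.2 measurable_snd].
have [] := @cfubini _ _ mR mR R mu mu _ _ _ mf (cintegrable_norm measurableT iu)
  (cintegrable_norm measurableT iv).
  by move=> x y; rewrite /= !Normc.normcM normc_e1 mulr1.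
move=> H _ _; move: H => /=.
under eq_cintegral => x _.
  under eq_cintegral => y _ do rewrite -mulrA.
  rewrite cintegralZ//; last exact: cintegrableMe1.
  over.
move=> ->.
apply: eq_cintegral => y _.
rewrite mulrC /ft -cintegralZ//; last exact: cintegrableMe1.
by apply: eq_cintegral => x _; rewrite (mulrC x y) mulrCA mulrA.
Qed.

End RealLine.

(** * Test functions and Fourier inversion *)

Section Smooth.
Variable R : realType.
Implicit Types (f g : R -> R) (n : nat).

(** Finite-order version of [smooth]. Stability under products is an induction on the order, because
    the derivative of a product still contains the factors themselves, now needed to one order
    less. *)
Definition cn n f := forall j, (j < n)%N -> forall x, derivable (derive1n j f) x 1.

Lemma smoothP f : smooth f <-> forall n, cn n f.
Proof.
split=> [h n j _ x|h n x]; first exact: h.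
by apply: (h n.+1).
Qed.

Lemma cnS n f : cn n.+1 f <-> (forall x, derivable f x 1) /\ cn n (derive1 f).
Proof.
split=> [h|[h1 h2] [|j] jn x].
  split=> [x|j jn x]; first exact: (h 0%N).
  by have := h j.+1 jn x; rewrite /derive1n iterSr.
  exact: h1.
by have := h2 j jn x; rewrite /derive1n iterSr.
Qed.

Lemma cnW n f : cn n.+1 f -> cn n f.
Proof. by move=> h j jn; apply: h; rewrite ltnS ltnW. Qed.

Lemma smooth_derivable f : smooth f -> forall x, derivable f x 1.
Proof. by move=> h x; exact: (h 0%N). Qed.

Lemma smooth_derive1 f : smooth f -> smooth (derive1 f).
Proof. by move=> h n x; have := h n.+1 x; rewrite /derive1n iterSr. Qed.

(** A coinduction principle: it is enough to exhibit a class of derivable functions that contains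
    [f] and is closed under differentiation. Affine substitutions, exponential, sine, cosine and
    flat functions are treated in this way. *)
Lemma smooth_ind (P : (R -> R) -> Prop) :
  (forall f, P f -> (forall x, derivable f x 1) /\ P (derive1 f)) ->
  forall f, P f -> smooth f.
Proof.
move=> H f Pf; apply/smoothP => n; elim: n f Pf => [|n IH] f Pf; first by move=> [].
by have [h1 h2] := H f Pf; apply/cnS; split => //; exact: IH.
Qed.

Lemma cnD n f g : cn n f -> cn n g -> cn n (fun x => f x + g x).
Proof.
elim: n f g => [|n IH] f g; first by move=> _ _ [].
move=> /cnS[f1 f2] /cnS[g1 g2]; apply/cnS; split.
  by move=> x; exact: derivableD.
rewrite (_ : derive1 (fun x => _) = fun x => derive1 f x + derive1 g x); first exact: IH.
by apply/funext => x; rewrite !derive1E deriveD.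
Qed.

Lemma cnM n f g : cn n f -> cn n g -> cn n (fun x => f x * g x).
Proof.
elim: n f g => [|n IH] f g; first by move=> _ _ [].
move=> f0 g0; have [f1 f2] := (cnS _ _).1 f0; have [g1 g2] := (cnS _ _).1 g0.
apply/cnS; split.
  by move=> x; exact: derivableM.
rewrite (_ : derive1 (fun x => _) = fun x => f x * derive1 g x + g x * derive1 f x).
  by apply: cnD; apply: IH; [exact: cnW|exact: g2|exact: cnW|exact: f2].
by apply/funext => x; rewrite !derive1E deriveM.
Qed.

Lemma smoothD f g : smooth f -> smooth g -> smooth (fun x => f x + g x).
Proof. by move=> /smoothP sf /smoothP sg; apply/smoothP => n; exact: cnD. Qed.

Lemma smoothM f g : smooth f -> smooth g -> smooth (fun x => f x * g x).
Proof. by move=> /smoothP sf /smoothP sg; apply/smoothP => n; exact: cnM. Qed.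

Lemma smooth_cst c : smooth (fun=> c : R).
Proof.
apply: (smooth_ind (P := fun h => exists c, h = fun=> c)); last by exists c.
move=> h [d ->]; split; first by move=> x; exact: derivable_cst.
by exists 0; apply/funext => x; rewrite derive1_cst.
Qed.

Lemma smoothN f : smooth f -> smooth (fun x => - f x).
Proof.
move=> sf; rewrite (_ : (fun x => - f x) = fun x => (-1) * f x).
  by apply: smoothM; [exact: smooth_cst|exact: sf].
by apply/funext => x; rewrite mulN1r.
Qed.

Lemma smooth_affine f (a b : R) : smooth f -> smooth (fun x => f (a * x + b)).
Proof.
move=> sf; apply: (smooth_ind (P := fun h => exists2 c : R, True & exists2 f,
   smooth f & h = fun x => c * f (a * x + b))); last first.
  by exists 1 => //; exists f => //; apply/funext => x; rewrite mul1r.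
move=> h [c _ [g sg ->]].
have D x : is_derive x (1 : R) (fun x => c * g (a * x + b)) (c * (a * derive1 g (a * x + b))).
  have h1 : is_derive (a * x + b) (1 : R) g (derive1 g (a * x + b)).
    by rewrite derive1E; apply/derivableP/smooth_derivable.
  have h2 : is_derive x (1 : R) (fun x : R => a * x + b) a.
    by apply: is_derive_eq; rewrite /GRing.scale /=; ring.
  apply: is_deriveZ; rewrite mulrC.
  exact: (@is_derive1_comp _ g (fun x => a * x + b) x _ _ h1 h2).
split; first by move=> x; have [] := D x.
exists (c * a) => //; exists (derive1 g); first exact: smooth_derive1.
by apply/funext => x; rewrite derive1E; have [_ ->] := D x; rewrite mulrA.
Qed.

Lemma smooth_expR : smooth (@expR R).
Proof.
apply: (smooth_ind (P := fun h => h = @expR R)) => // h ->.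
split; first by move=> x; exact: derivable_expR.
by apply/funext => x; rewrite derive1E derive_val.
Qed.

Lemma smooth_sin_cos : smooth (@sin R) /\ smooth (@cos R).
Proof.
pose P (h : R -> R) := exists c, [\/ h = (fun x => c * sin x) | h = (fun x => c * cos x)].
have PP h : P h -> smooth h.
  apply: smooth_ind => {}h [c [->|->]]; split.
  - by move=> x; apply: derivableM => //; exact: derivable_sin.
  - exists c; right; apply/funext => x; rewrite derive1E.
    by have [_ ->] := is_deriveZ c (is_derive_sin x).
  - by move=> x; apply: derivableM => //; exact: derivable_cos.
  - exists (- c); left; apply/funext => x; rewrite derive1E.
    by have [_ ->] := is_deriveZ c (is_derive_cos x); rewrite /GRing.scale /= mulrN mulNr.
split; apply: PP; exists 1.
  by left; apply/funext => x; rewrite mul1r.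
by right; apply/funext => x; rewrite mul1r.
Qed.

Lemma smooth_continuous f : smooth f -> continuous f.
Proof. by move=> sf x; apply/differentiable_continuous/derivable1_diffP/smooth_derivable. Qed.

(* The functions [p (1 / x) exp (- 1 / x)] form a class closed under
   differentiation. *)
Definition flat (p : {poly R}) (x : R) : R :=
  if 0 < x then p.[x^-1] * expR (- x^-1) else 0.

(** [y ^+ i / i!] is a term of the exponential series, so a monomial costs its coefficient times
    [i!]. *)
Lemma horner_expR_bound (p : {poly R}) : exists2 c : R, 0 <= c &
  forall y, 0 <= y -> `|p.[y]| <= c * expR y.
Proof.
exists (\sum_(i < size p) `|p`_i| * i`!%:R).
  by apply: sumr_ge0 => i _; rewrite mulr_ge0.
move=> y y0; rewrite horner_coef mulr_suml; apply: le_trans (ler_norm_sum _ _ _) _.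
apply: ler_sum => i _; rewrite normrM -mulrA ler_wpM2l//.
rewrite ger0_norm ?exprn_ge0// -ler_pdivrMl ?ltr0n ?fact_gt0// mulrC.
case: (i : nat) => [|n].
  by rewrite expr0 fact0 divr1 -expR0 ler_expR.
by apply: le_trans (expR_ge1Dxn n y0); rewrite lerDr.
Qed.

(** The previous bound for ['X ^+ 2 * p] at [1 / x]. Quadratic decay at 0 makes [flat p] derivable
    there, with derivative 0. *)
Lemma flat_bound (p : {poly R}) : exists2 c : R, 0 <= c &
  forall x, `|flat p x| <= c * `|x| ^+ 2.
Proof.
have [c c0 Hc] := horner_expR_bound ('X ^+ 2 * p); exists c => // x.
rewrite /flat; case: ifP => x0; last by rewrite normr0 mulr_ge0.
have y0 : 0 <= x^-1 by rewrite invr_ge0 ltW.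
have := Hc _ y0; rewrite hornerM hornerXn expr2 !normrM (ger0_norm y0) => H.
rewrite (ger0_norm (expR_ge0 _)) expRN ler_pdivrMr ?expR_gt0// (gtr0_norm x0).
have xn0 : x != 0 by rewrite gt_eqF.
have -> : `|p.[x^-1]| = x ^+ 2 * (x^-1 * x^-1 * `|p.[x^-1]|) by field.
rewrite [leRHS](_ : _ = x ^+ 2 * (c * expR x^-1)); last by ring.
by rewrite ler_wpM2l// sqr_ge0.
Qed.

(** For [x > 0] the chain rule brings out [x ^- 2], which is ['X ^+ 2] evaluated at [1 / x]; at 0
    the quadratic bound takes over. *)
Lemma is_derive_flat (p : {poly R}) (x : R) :
  is_derive x (1 : R) (flat p) (flat ('X ^+ 2 * (p - p^`())) x).
Proof.
have [x0|x0|->] := ltgtP x 0.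
- rewrite {2}/flat ltNge (ltW x0) /=.
  apply: (@near_eq_is_derive _ _ _ (fun=> 0)) => //.
  near=> y; rewrite /flat ltNge (_ : y <= 0)//.
  by apply: ltW; near: y; exact: lt_nbhsl.
- rewrite {2}/flat x0.
  apply: (@near_eq_is_derive _ _ _ (fun x : R => p.[x^-1] * expR (- x^-1))) => //.
    near=> y; rewrite /flat (_ : 0 < y)//; near: y; exact: lt_nbhsr.
  have xn0 : x != 0 by rewrite gt_eqF.
  have h : is_derive x (1 : R) (fun y : R => y^-1) (- x ^- 2).
    have di : derivable (id : R -> R) x 1 by exact: derivable_id.
    apply: DeriveDef; first exact: derivableV xn0 di.
    by rewrite (deriveV xn0 di) derive_id /GRing.scale /= mulr1.
  have h1 : is_derive (x^-1) (1 : R) (fun y => p.[y]) (p^`().[x^-1]).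
    apply: DeriveDef; first exact: derivable_horner.
    by rewrite -derive1E -derivE.
  have h2 := is_derive1_comp h1 h.
  have h3 := @is_derive1_comp _ expR (fun y => - y^-1) x _ _ (is_derive_expR (- x^-1)) (is_deriveN h).
  have := is_deriveM h2 h3; rewrite /GRing.scale /=.
  set d := (X in is_derive _ _ _ X).
  suff -> : d = ('X^2 * (p - p^`())).[x^-1] * expR (- x^-1) by [].
  rewrite /d hornerM hornerXn hornerD hornerN -exprVn; ring.
- rewrite {2}/flat ltxx.
  have [c c0 Hc] := flat_bound p.
  have f0 : flat p 0 = 0 by rewrite /flat ltxx.
  have H : (fun h : R => h^-1 *: (flat p (h *: 1 + 0) - flat p 0)) @ 0^' --> (0 : R).
    apply/cvgrPdist_le => e e0; near=> h.
    rewrite f0 sub0r normrN subr0 addr0 /GRing.scale /= mulr1.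
    rewrite normrM normfV ler_pdivrMl; last first.
      by rewrite normr_gt0; near: h; exact: nbhs_dnbhs_neq.
    apply: le_trans (Hc h) _; rewrite expr2 mulrCA ler_wpM2l//.
    have : `|h| <= e / (c + 1).
      near: h; apply: dnbhs0_le; rewrite divr_gt0// ltr_wpDl//.
    rewrite ler_pdivlMr ?ltr_wpDl// mulrDr mulr1 mulrC => /(le_trans _); apply.
    by rewrite lerDl.
  apply: DeriveDef; first by apply/cvg_ex; exists 0.
  exact: cvg_lim H.
Unshelve. all: by end_near. Qed.

Lemma smooth_flat (p : {poly R}) : smooth (flat p).
Proof.
apply: (smooth_ind (P := fun h => exists p, h = flat p)); last by exists p.
move=> h [q ->]; split; first by move=> x; have [] := is_derive_flat q x.
exists ('X ^+ 2 * (q - q^`())); apply/funext => x.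
by rewrite derive1E; have [_ ->] := is_derive_flat q x.
Qed.

End Smooth.

(** * Decay of the Fourier transforms of test functions *)

Section TestFunctions.
Variable R : realType.
Local Notation C := (cplx R).
Local Notation N := (@Normc.normc R).
Local Notation Re := (@complex.Re R).
Local Notation Im := (@complex.Im R).
Local Notation mu := (@lebesgue_measure R).
Local Notation mR := (measurableTypeR R).
Implicit Types (phi psi : R -> C).

Definition csmooth phi := smooth (fun x => Re (phi x)) /\ smooth (fun x => Im (phi x)).

Definition csupp phi (M : R) := forall x : R, M < `|x| -> phi x = 0.

Lemma test_functionP phi : test_function phi <-> csmooth phi /\ exists M, csupp phi M.
Proof. by split=> [[? ? ?]|[[? ?] ?]]; split. Qed.

Definition cder phi (x : R) : C := derive1 (fun t => Re (phi t)) x +i* derive1 (fun t => Im (phi t)) x.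

Lemma csmooth_cderiv phi : csmooth phi -> cderiv phi (cder phi).
Proof.
move=> [s1 s2] x; rewrite /cder /= !derive1E.
by split; apply/derivableP/smooth_derivable.
Qed.

Lemma csmooth_cder phi : csmooth phi -> csmooth (cder phi).
Proof. by move=> [s1 s2]; split => /=; exact: smooth_derive1. Qed.

Lemma csmooth_continuous phi : csmooth phi -> continuous phi.
Proof. by move=> /csmooth_cderiv /cderiv_continuous. Qed.

Lemma csmoothD phi psi : csmooth phi -> csmooth psi -> csmooth (fun x => phi x + psi x).
Proof.
move=> [a b] [c d]; split.
  by under eq_fun do rewrite ReD; exact: smoothD.
by under eq_fun do rewrite ImD; exact: smoothD.
Qed.

Lemma csmoothM phi psi : csmooth phi -> csmooth psi -> csmooth (fun x => phi x * psi x).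
Proof.
move=> [a b] [c d]; split.
  under eq_fun do rewrite ReM.
  by apply: smoothD; [exact: smoothM|apply: smoothN; exact: smoothM].
by under eq_fun do rewrite ImM; apply: smoothD; exact: smoothM.
Qed.

Lemma csmooth_cst c : csmooth (fun=> c).
Proof. by split; exact: smooth_cst. Qed.

Lemma csmooth_real (f : R -> R) : smooth f -> csmooth (fun x => (f x)%:C).
Proof. by move=> sf; split; [exact: sf|exact: smooth_cst]. Qed.

Lemma csmooth_expo w : csmooth (expo w).
Proof.
have [ss sc] := smooth_sin_cos R.
have aff f c : smooth f -> smooth (fun x : R => f (c * x)).
  by move=> /(@smooth_affine _ f c 0); under eq_fun do rewrite addr0.
split.
  under eq_fun do rewrite Re_expo.
  by apply: smoothM; apply: aff; [exact: smooth_expR|exact: sc].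
under eq_fun do rewrite Im_expo.
by apply: smoothM; apply: aff; [exact: smooth_expR|exact: ss].
Qed.

Lemma cder_eq0 phi (U : set R) : open U -> (forall x, U x -> phi x = 0) ->
  forall x, U x -> cder phi x = 0.
Proof.
move=> oU H x Ux.
have E (h : C -> R) : h 0 = 0 -> derive1 (fun t => h (phi t)) x = 0.
  move=> h0; rewrite derive1E (@near_eq_derive _ _ _ _ (cst 0)) ?derive_cst//.
  have := open_nbhs_nbhs (conj oU Ux); apply: filterS => y /H ->; exact: h0.
by rewrite /cder !E.
Qed.

Lemma open_csupp (M : R) : open [set x : R | M < `|x|].
Proof.
apply: (@open_comp _ _ (fun x : R => `|x|) [set x | M < x]); last exact: open_gt.
by move=> x _; exact: norm_continuous.
Qed.

Lemma test_cder phi : test_function phi -> test_function (cder phi).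
Proof.
move=> /test_functionP[s [M H]]; apply/test_functionP; split.
  exact: csmooth_cder.
exists M.
exact: (cder_eq0 (open_csupp (M := M)) H).
Qed.

Lemma test_continuous phi : test_function phi -> continuous phi.
Proof. by move=> /test_functionP[/csmooth_continuous]. Qed.

Lemma csupp_itv (f : R -> C) M : csupp f M ->
  cintegral mu (setT : set mR) f = cintegral mu (`[- M, M]%classic : set mR) f.
Proof.
move=> H; rewrite [RHS]cintegral_restrict; apply: eq_cintegral => x _.
rewrite /crestrict mem_setE in_itv /= -ler_norml.
by case: leP => // /H ->.
Qed.

Lemma csupp_cintegrable (f : R -> C) M : continuous f -> csupp f M ->
  cintegrable mu (setT : set mR) f.
Proof.
move=> cf H; have mD : measurable (`[- M, M]%classic : set mR) by [].
have := (cintegrable_restrict mu f mD).1 (cintegrable_itv (- M) M cf).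
apply: eq_cintegrable => // x _; rewrite /crestrict mem_setE in_itv /= -ler_norml.
by case: leP => // /H ->.
Qed.

Lemma csupp_le (f : R -> C) M M' : M <= M' -> csupp f M -> csupp f M'.
Proof. by move=> MM' H x /(le_lt_trans MM')/H. Qed.

Lemma csuppM (f g : R -> C) M : csupp f M -> csupp (fun x => f x * g x) M.
Proof. by move=> H x /H ->; rewrite mul0r. Qed.

(** The complex frequency for which the Fourier kernel at [z] becomes the exponential [expo (kz z)]
    of a real variable. *)
Definition kz (z : C) : C := (0 +i* (- (2 * pi))) * z.

Lemma fourierE phi z : fourier phi z =
  cintegral mu (setT : set mR) (fun t => phi t * expo (kz z) t).
Proof.
apply: eq_cintegral => t _; congr (_ * cexp _).
by rewrite /kz; case: z => a b; apply: complex_ext => /=; ring.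
Qed.

Lemma continuousMc (f g : R -> C) : continuous f -> continuous g ->
  continuous (fun x => f x * g x).
Proof. by move=> cf cg x; apply: (@cvgM C); [exact: cf|exact: cg]. Qed.

Lemma continuousDc (f g : R -> C) : continuous f -> continuous g ->
  continuous (fun x => f x + g x).
Proof. by move=> cf cg x; apply: (@cvgD _ C); [exact: cf|exact: cg]. Qed.

Lemma test_fourier_integrable phi z : test_function phi ->
  cintegrable mu (setT : set mR) (fun t => phi t * expo (kz z) t).
Proof.
move=> tphi; have [_ [M HM]] := (test_functionP _).1 tphi.
apply: (@csupp_cintegrable _ M); last exact: csuppM.
by apply: continuousMc; [exact: test_continuous|exact: continuous_expo].
Qed.

Lemma cintegral_cderiv0 (F f : R -> C) M : cderiv F f -> continuous f ->
  csupp F M -> csupp f M -> cintegral mu (setT : set mR) f = 0.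
Proof.
move=> dF cf sF sf; pose M' := `|M| + 1.
have MM' : M < M' by rewrite /M' (le_lt_trans (ler_norm M))// ltrDl.
rewrite (csupp_itv (csupp_le (ltW MM') sf)).
have M0 : 0 <= M' by rewrite addr_ge0.
have M2 : - M' <= M' by rewrite -subr_ge0 opprK addr_ge0.
rewrite (cFTC M2 dF cf).
by rewrite !sF ?normrN ?ger0_norm// subrr.
Qed.

(** Integration by parts; there are no boundary terms because the support is bounded. *)
Lemma fourier_cder phi z : test_function phi ->
  fourier (cder phi) z = - kz z * fourier phi z.
Proof.
move=> tphi; have tc := test_cder tphi.
have [sphi [M HM]] := (test_functionP _).1 tphi.
have HM' : csupp (cder phi) M.
  exact: (cder_eq0 (open_csupp (M := M)) HM).
apply/eqP; rewrite mulNr -subr_eq0 opprK; apply/eqP.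
rewrite !fourierE -cintegralZ//; last exact: test_fourier_integrable.
rewrite -cintegralD//; last 2 first.
- exact: test_fourier_integrable.
- by apply: cintegrableZ => //; exact: test_fourier_integrable.
have d := cderivM (csmooth_cderiv sphi) (cderiv_cexp (kz z)).
rewrite -[RHS](@cintegral_cderiv0 _ _ M d).
- by apply: eq_cintegral => x _; rewrite /expo; ring.
- apply: continuousDc.
    by apply: continuousMc; [exact: test_continuous|exact: continuous_expo].
  apply: continuousMc; first exact: test_continuous.
  by apply: continuousMc; [move=> ?; exact: cvg_cst|exact: continuous_expo].
- exact: csuppM.
- by move=> x Mx; rewrite HM'// HM// !mul0r addr0.
Qed.

Lemma kz_neq0 : (0 +i* (- (2 * pi)) : C) != 0.
Proof. by rewrite eq_complex /= eqxx /= oppr_eq0 mulf_neq0// gt_eqF// pi_gt0. Qed.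

(* [psi] is the image of [phi] under a differential operator, which does not
   enlarge the support. *)
Lemma fourier_poly phi (p : {poly C}) : test_function phi ->
  exists psi, [/\ test_function psi,
    forall U : set R, open U -> (forall x, U x -> phi x = 0) ->
      forall x, U x -> psi x = 0 &
    forall z, fourier psi z = p.[z] * fourier phi z].
Proof.
move=> tphi; elim/poly_ind: p => [|p c [psi [tpsi spsi H]]].
  exists (fun=> 0); split => //.
    apply/test_functionP; split; first exact: csmooth_cst.
    by exists 0.
  move=> z; rewrite horner0 mul0r fourierE -[RHS](cintegral0 mu (setT : set mR)).
  by apply: eq_cintegral => x _; rewrite mul0r.
pose a : C := - (0 +i* (- (2 * pi)))^-1.
have [s1 [M1 h1]] := (test_functionP _).1 (test_cder tpsi).
have [s2 [M2 h2]] := (test_functionP _).1 tphi.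
exists (fun x => a * cder psi x + c * phi x); split.
- apply/test_functionP; split.
    by apply: csmoothD; apply: csmoothM;
      [exact: csmooth_cst|exact: s1|exact: csmooth_cst|exact: s2].
  exists (Num.max M1 M2) => x; rewrite gt_max => /andP[/h1 -> /h2 ->].
  by rewrite !mulr0 addr0.
- move=> U oU HU x Ux; rewrite (cder_eq0 oU (spsi U oU HU) Ux) HU//.
  by rewrite !mulr0 addr0.
- move=> z; rewrite hornerMXaddC mulrDl fourierE.
  under eq_cintegral do rewrite mulrDl -2!mulrA.
  rewrite cintegralD//; try (by apply: cintegrableZ => //;
    apply: test_fourier_integrable => //; exact: test_cder).
  rewrite !cintegralZ//; try (by apply: test_fourier_integrable => //; exact: test_cder).
  rewrite -!fourierE fourier_cder// H /a /kz; congr (_ + _).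
  have := kz_neq0; set k := (0 +i* _) => k0.
  by field.
Qed.

Lemma Re_kz z : Re (kz z) = 2 * pi * Im z.
Proof. by rewrite /kz ReM /= mul0r add0r mulNr opprK. Qed.

Lemma test_fourier_bound phi (s : R) : test_function phi ->
  exists2 c : R, 0 <= c & forall z, `|Im z| <= s -> N (fourier phi z) <= c.
Proof.
move=> tphi; have [_ [M HM]] := (test_functionP _).1 tphi.
have cphi := test_continuous tphi.
have iphi := csupp_cintegrable cphi HM.
pose K := expR (2 * pi * `|s| * `|M|).
have iN : rintegrable mu (setT : set mR) (fun x : mR => K * N (phi x)).
  by apply: rintegrableZ => //; exact: cintegrable_norm.
exists (2 * Rintegral mu (setT : set mR) (fun x : mR => K * N (phi x))).
  by rewrite mulr_ge0//; apply: Rintegral_ge0 => x _; rewrite mulr_ge0 ?expR_ge0 ?normc_ge0.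
move=> z zs; rewrite fourierE; apply: normc_cintegral => //.
  apply: cmeasurable_continuous; first exact: measurableT.
  by apply: continuousMc; [exact: cphi|exact: continuous_expo].
move=> x _; have [Mx|xM] := ltP M `|x|.
  by rewrite HM// mul0r Normc.normc0 mulr0.
rewrite Normc.normcM normc_expo Re_kz mulrC ler_wpM2r ?normc_ge0// ler_expR.
rewrite -!mulrA ler_wpM2l// ler_wpM2l ?pi_ge0//.
apply: (le_trans (ler_norm _)); rewrite normrM ler_pM//.
  by rewrite (le_trans zs)// ler_norm.
by rewrite (le_trans xM)// ler_norm.
Qed.

(** [z^2 + r^2] factors as [(z - i r) (z + i r)]. In the strip the square of the modulus of each
    factor controls [1 + |z|^2]; the two estimates are multiplied and a square root is taken. *)
Lemma normc_sqr_add_ge (s r : R) : 0 <= s < r -> exists2 c : R, 0 < c &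
  forall z : C, `|Im z| <= s -> 1 + N z ^+ 2 <= c * N (z ^+ 2 + (r ^+ 2)%:C).
Proof.
move=> /andP[s0 sr]; pose c := 1 + (1 + s ^+ 2) / (r - s) ^+ 2.
have rs : 0 < (r - s) ^+ 2 by rewrite exprn_gt0// subr_gt0.
have c1 : 1 <= c by rewrite lerDl divr_ge0 ?addr_ge0 ?sqr_ge0.
exists c => [|z]; first by lra.
case: z => x y ys; have {}ys : `|y| <= s by [].
have E : (x +i* y : C) ^+ 2 + (r ^+ 2)%:C = (x +i* (y - r)) * (x +i* (y + r)).
  by rewrite expr2; apply: complex_ext => /=; ring.
(* [t] stands for [y - r] and for [y + r], both of modulus at least [r - s]. *)
have K t : (r - s) ^+ 2 <= t ^+ 2 -> 1 + N (x +i* y) ^+ 2 <= c * N (x +i* t) ^+ 2.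
  move=> Ht; rewrite !normc_sqr /= {1}/c mulrDl mul1r.
  have : (1 + s ^+ 2) <= (1 + s ^+ 2) / (r - s) ^+ 2 * (x ^+ 2 + t ^+ 2).
    rewrite mulrAC ler_pdivlMr// ler_wpM2l ?addr_ge0 ?sqr_ge0//.
    by rewrite (le_trans Ht)// lerDr sqr_ge0.
  have : y ^+ 2 <= s ^+ 2 by rewrite -(real_normK (num_real y)) lerXn2r ?nnegrE.
  have : 0 <= t ^+ 2 by exact: sqr_ge0.
  lra.
move: ys; rewrite ler_norml => /andP[y1 y2].
have K1 : 1 + N (x +i* y) ^+ 2 <= c * N (x +i* (y - r)) ^+ 2.
  apply: K; rewrite -[leRHS]sqrrN opprB lerXn2r ?nnegrE; lra.
have K2 : 1 + N (x +i* y) ^+ 2 <= c * N (x +i* (y + r)) ^+ 2.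
  by apply: K; rewrite lerXn2r ?nnegrE; lra.
rewrite E Normc.normcM.
set u := N (x +i* (y - r)) in K1 *; set v := N (x +i* (y + r)) in K2 *.
set w := N (x +i* y) in K1 K2 *.
have u0 : 0 <= u := normc_ge0 _. have v0 : 0 <= v := normc_ge0 _.
have w1 : 0 <= 1 + w ^+ 2 by rewrite addr_ge0 ?sqr_ge0.
have cuv : 0 <= c * (u * v) by rewrite !mulr_ge0//; lra.
rewrite -(@ler_pXn2r _ 2) ?nnegrE// (_ : (c * (u * v)) ^+ 2 = (c * u ^+ 2) * (c * v ^+ 2)).
  by rewrite [leLHS]expr2 ler_pM.
ring.
Qed.

(** [(z^2 + r^2)^m] times the transform is the transform of another test function, hence bounded on
    the strip; as [r] exceeds [|s|], the polynomial can be divided out. *)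
Lemma test_fourier_decay phi (s : R) (m : nat) : test_function phi ->
  exists2 c : R, 0 <= c & forall z, `|Im z| <= s ->
    N (fourier phi z) <= c * ((1 + N z ^+ 2) ^+ m)^-1.
Proof.
move=> tphi; pose r := `|s| + 1.
have sr : 0 <= `|s| < r by rewrite normr_ge0 /r ltrDl ltr01.
have [d d0 Hd] := normc_sqr_add_ge sr.
have [psi [tpsi _ Hpsi]] := fourier_poly (('X ^+ 2 + ((r ^+ 2)%:C)%:P) ^+ m) tphi.
have [c c0 Hc] := test_fourier_bound s tpsi.
exists (d ^+ m * c) => [|z zs]; first by rewrite mulr_ge0// exprn_ge0// ltW.
have w1 : 0 < 1 + N z ^+ 2 by rewrite ltr_pwDl// sqr_ge0.
rewrite ler_pdivlMr ?exprn_gt0//.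
have := Hc z zs; rewrite Hpsi horner_exp hornerD hornerXn hornerC Normc.normcM normcX => H.
have zs' : `|Im z| <= `|s| by rewrite (le_trans zs)// ler_norm.
apply: le_trans (ler_wpM2l _ H); last by rewrite exprn_ge0// ltW.
rewrite mulrA -exprMn mulrC ler_wpM2r ?normc_ge0//.
by rewrite lerXn2r ?nnegrE ?Hd//; [exact: ltW|rewrite mulr_ge0 ?normc_ge0// ltW].
Qed.

Lemma exists_mollifier (e : R) : 0 < e -> exists k : R -> R,
  [/\ smooth k, forall x, 0 <= k x, forall x, k (- x) = k x,
     forall x, e < `|x| -> k x = 0 & 0 < k 0] /\
  (rintegrable mu (setT : set mR) k /\ Rintegral mu (setT : set mR) k = 1).
Proof.
move=> e0; pose b (x : R) := flat 1%:P (1 * x + e) * flat 1%:P (-1 * x + e).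
have sb : smooth b by apply: smoothM; apply: smooth_affine; exact: smooth_flat.
have fl0 x : 0 <= flat (1%:P : {poly R}) x.
  by rewrite /flat; case: ifP => // _; rewrite hornerC mul1r expR_ge0.
have b0 x : 0 <= b x by rewrite mulr_ge0.
have be x : b (- x) = b x by rewrite /b mulrC !mul1r !mulN1r opprK.
have bs x : e < `|x| -> b x = 0.
  rewrite /b /flat !mul1r !mulN1r; case: (ler0P x) => x0 ex.
    by rewrite (_ : 0 < x + e = false) ?mul0r//; apply/negbTE; rewrite -leNgt; lra.
  by rewrite (_ : 0 < - x + e = false) ?mulr0//; apply/negbTE; rewrite -leNgt; lra.
(* A lower bound on the middle half of the support, which makes the integral positive so that [b]
   can be normalised: for [t >= e / 2] the flat function [exp (- 1 / t)] is at least
   [exp (- 2 / e)]. *)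
have bb x : `|x| <= e / 2 -> expR (- (2 / e)) ^+ 2 <= b x.
  rewrite ler_norml => /andP[x1 x2].
  have H t : e / 2 <= t -> expR (- (2 / e)) <= flat 1%:P t.
    move=> et; have t0 : 0 < t by lra.
    rewrite /flat t0 hornerC mul1r ler_expR lerN2 -[2 / e]invrK invf_div.
    by rewrite lef_pV2// posrE; lra.
  by rewrite expr2 /b; apply: ler_pM; rewrite ?expR_ge0// H//; lra.
have ib : rintegrable mu (setT : set mR) b.
  have := @csupp_cintegrable (fun x => (b x)%:C) e.
  case=> //; first exact/csmooth_continuous/csmooth_real.
  by move=> x /bs ->.
pose I := Rintegral mu (setT : set mR) b.
have I0 : 0 < I.
  pose c := expR (- (2 / e)) ^+ 2.
  have c0 : 0 < c by rewrite exprn_gt0 ?expR_gt0.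
  pose J : set mR := `[- (e / 2), e / 2]%classic.
  have mJ : measurable J by exact: measurable_itv.
  have : Rintegral mu J (fun=> c) <= I.
    rewrite /I Rintegral_mkcond; apply: le_Rintegral => //.
    - rewrite -restrict_EFin; apply: (integrable_mkcond _ mJ).1.
      by apply: (@rintegrable_bounded _ _ _ `|c|); first exact: measurable_cst.
    - move=> x _; rewrite patchE; have [xJ|_] := boolP (x \in J); last exact: b0.
      by move/set_mem: xJ; rewrite /J /= in_itv /= -ler_norml => /bb.
  apply: lt_le_trans; rewrite Rintegral_cst// /J /= lebesgue_measure_itv /=.
  have h0 : 0 < e / 2 by rewrite divr_gt0.
  rewrite lte_fin ifT /=; last by lra.
  by rewrite opprK mulr_gt0// addr_gt0.
exists (fun x => I^-1 * b x); split; [split|split].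
- by apply: smoothM; [exact: smooth_cst|exact: sb].
- by move=> x; rewrite mulr_ge0// invr_ge0 ltW.
- by move=> x; rewrite be.
- by move=> x /bs ->; rewrite mulr0.
- rewrite mulr_gt0 ?invr_gt0//; apply: lt_le_trans (bb _ _).
    by rewrite exprn_gt0 ?expR_gt0.
  by rewrite normr0 divr_ge0// ltW.
- exact: rintegrableZ.
- by rewrite RintegralZl// mulVf// gt_eqF.
Qed.

End TestFunctions.

(** * The Poisson kernel and Fourier inversion *)

Section FourierInversion.
Variable R : realType.
Local Notation C := (cplx R).
Local Notation N := (@Normc.normc R).
Local Notation Re := (@complex.Re R).
Local Notation Im := (@complex.Im R).
Local Notation mu := (@lebesgue_measure R).
Local Notation mR := (measurableTypeR R).
Local Notation half := (`[0, +oo[%classic : set mR).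
Implicit Types (phi psi : R -> C).

Lemma cintegral_halves (f : mR -> C) : cintegrable mu (setT : set mR) f ->
  cintegral mu (setT : set mR) f =
  cintegral mu half f + cintegral mu half (fun x => f (- x)).
Proof.
move=> fi; have mh : measurable half by exact: measurable_itv.
have mp : measurable (`]0, +oo[%classic : set mR) by exact: measurable_itv.
have mn : measurable (`]-oo, 0[%classic : set mR) by exact: measurable_itv.
have TE : (setT : set mR) = half `|` (`]-oo, 0[%classic : set mR).
  by apply/seteqP; split => x //= _; rewrite !in_itv /= andbT; case: leP; [left|right].
rewrite [in LHS]TE cintegral_setU//; last 2 first.
- by rewrite -TE.
- by apply/disj_setPS => x [] /=; rewrite !in_itv /= andbT => /le_lt_trans h /h; rewrite ltxx.
congr (_ + _).
have fn := cintegrable_opp fi.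
have E : cintegral mu half (fun x => f (- x)) =
    cintegral mu (`]0, +oo[%classic : set mR) (fun x => f (- x)).
  have [f1 f2] : cintegrable mu (`]0, +oo[%classic : set mR) (fun x => f (- x)).
    exact: cintegrableS fn.
  by rewrite /cintegral; congr (_ +i* _); apply/esym/Rintegral_itv_obnd_cbnd.
rewrite E cintegral_restrict [RHS]cintegral_restrict -cintegral_opp; last first.
  by apply: (cintegrable_restrict mu f mn).1; exact: cintegrableS fi.
apply: eq_cintegral => x _.
by rewrite /crestrict !mem_setE !in_itv /= andbT oppr_lt0.
Qed.

Lemma rintegrable_even (f : R -> R) : measurable_fun (setT : set mR) f ->
  (forall x, 0 <= f x) -> (forall x, f (- x) = f x) -> rintegrable mu half f ->
  rintegrable mu (setT : set mR) f.
Proof.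
move=> mf f0 fe fi; have mh : measurable half by exact: measurable_itv.
have i1 : cintegrable mu half (fun x => (f x)%:C).
  by split; [exact: fi|exact: integrable0].
have i2 := (cintegrable_restrict mu (fun x => (f x)%:C) mh).1 i1.
(* The restriction of [f] to the half-line plus its reflection dominates [f]; at 0 both contribute,
   hence only an inequality. *)
have [j1 _] := cintegrableD measurableT i2 (cintegrable_opp i2).
apply: rintegrable_le j1 => //= x _; rewrite (ger0_norm (f0 x)) /crestrict !mem_setE !in_itv /= !andbT.
rewrite ReD; case: (leP 0 x) => x0.
  by rewrite /= lerDl; case: ifP => _ //=; rewrite f0.
by rewrite oppr_ge0 (ltW x0) /= add0r fe.
Qed.

Lemma rintegrable_cauchy : rintegrable mu (setT : set mR) (fun x : R => (1 + x ^+ 2)^-1).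
Proof.
have p (x : R) : 0 < 1 + x ^+ 2 by rewrite ltr_pwDl// sqr_ge0.
have c : continuous (fun x : R => (1 + x ^+ 2)^-1).
  move=> x; apply: cvgV; first by rewrite gt_eqF.
  by apply: cvgD; [exact: cvg_cst|exact: exprn_continuous].
apply: rintegrable_even.
- exact: continuous_measurable_fun.
- by move=> x; rewrite invr_ge0 ltW.
- by move=> x; rewrite sqrrN.
apply/integrableP; split.
  by apply/measurable_EFinP/measurable_funTS; exact: continuous_measurable_fun.
under eq_integral do rewrite /= ger0_norm ?invr_ge0 ?ltW//.
rewrite (@ge0_continuous_FTC2y _ _ (@atan R) _ (pi / 2)).
- by rewrite -EFinB ltry.
- by move=> x _; rewrite invr_ge0 ltW.
- exact: continuous_subspaceT.
- exact: cvgy_atan.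
- by move=> x _; exact: derivable_atan.
- by apply: cvg_at_right_filter; exact: continuous_atan.
- by move=> x _; rewrite derive1_atan.
Qed.

Lemma rintegrable_exp_abs (c : R) : 0 < c ->
  rintegrable mu (setT : set mR) (fun x : R => expR (- c * `|x|)).
Proof.
move=> c0; apply: rintegrable_even.
- apply: measurableT_comp; first by apply: continuous_measurable_fun; exact: continuous_expR.
  apply: measurable_funM; first exact: measurable_cst.
  by apply: continuous_measurable_fun; exact: norm_continuous.
- by move=> x; exact: expR_ge0.
- by move=> x; rewrite normrN.
- have := rintegrable_exp c0; apply: eq_integrable => //= x.
  by rewrite mem_setE in_itv /= andbT => x0; rewrite ger0_norm.
Qed.

Definition poisson (e t : R) : R := pi^-1 * (e / (e ^+ 2 + t ^+ 2)).

(** The two half-lines contribute [(2 pi)^-1 / (e - i t)] and its complex conjugate. *)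
Lemma ft_exp_abs (e t : R) : 0 < e ->
  ft (fun x => (expR (- (2 * pi * e) * `|x|))%:C) t = (poisson e t)%:C.
Proof.
move=> e0; have pi0 := @pi_gt0 R; have c0 : 0 < 2 * pi * e by rewrite !mulr_gt0.
have ie : cintegrable mu (setT : set mR) (fun x => (expR (- (2 * pi * e) * `|x|))%:C).
  by split; [exact: rintegrable_exp_abs|exact: integrable0].
rewrite /ft cintegral_halves; last exact: cintegrableMe1.
have H (s : R) : cintegral mu half (fun y : mR => expo ((- (2 * pi * e)) +i* (2 * pi * s)) y)
    = (2 * pi)^-1%:C * ((e -i* s))^-1.
  rewrite (cintegral_exp_half _).2; last by rewrite /= oppr_lt0.
  have -> : (- (2 * pi * e)) +i* (2 * pi * s) = - ((2 * pi)%:C * (e -i* s)) :> C.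
    by apply: complex_ext => /=; ring.
  by rewrite invrN opprK invfM fmorphV.
have E1 : cintegral mu half (fun y => (expR (- (2 * pi * e) * `|y|))%:C * e1 (t * y)) =
    cintegral mu half (fun y : mR => expo ((- (2 * pi * e)) +i* (2 * pi * t)) y).
  apply: eq_cintegral => y; rewrite /= in_itv /= andbT => y0.
  rewrite ger0_norm// /e1 /expo /cexp; apply: complex_ext => /=.
    by rewrite !mulr0 !subr0 add0r expR0 !mul1r mul0r subr0 mulrA.
  by rewrite !mulr0 !subr0 add0r expR0 !mul1r mul0r addr0 mulrA.
have E2 : cintegral mu half (fun y => (expR (- (2 * pi * e) * `|- y|))%:C * e1 (t * - y)) =
    cintegral mu half (fun y : mR => expo ((- (2 * pi * e)) +i* (2 * pi * - t)) y).
  apply: eq_cintegral => y; rewrite /= in_itv /= andbT => y0.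
  rewrite normrN ger0_norm// mulrN -mulNr /e1 /expo /cexp; apply: complex_ext => /=.
    by rewrite !mulr0 !subr0 add0r expR0 !mul1r mul0r subr0 mulrA.
  by rewrite !mulr0 !subr0 add0r expR0 !mul1r mul0r addr0 mulrA.
rewrite E1 E2 !H /poisson.
have n0 : e ^+ 2 + t ^+ 2 != 0 by rewrite gt_eqF// ltr_pwDl ?exprn_gt0// sqr_ge0.
have pn0 : pi != 0 :> R by rewrite gt_eqF.
apply: complex_ext; rewrite /= ?sqrrN ?opprK.
  move: pn0; move: (@pi R) => P P0; field.
  by rewrite n0 P0.
ring.
Qed.

Lemma cintegral_supp2 (f : R -> C) (a b : R) :
  (forall x, x < a \/ b < x -> f x = 0) ->
  cintegral mu (setT : set mR) f = cintegral mu (`[a, b]%classic : set mR) f.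
Proof.
move=> H; rewrite [RHS]cintegral_restrict; apply: eq_cintegral => x _.
rewrite /crestrict mem_setE in_itv /=.
case: (leP a x) => ax /=; last by rewrite H//; left.
by case: (leP x b) => bx //=; rewrite H//; right.
Qed.

Lemma continuous_poisson (e a : R) : 0 < e -> continuous (fun y : R => poisson e (y - a)).
Proof.
move=> e0 x; apply: cvgM; first exact: cvg_cst.
apply: cvgM; first exact: cvg_cst.
apply: cvgV; first by rewrite gt_eqF// ltr_pwDl ?exprn_gt0// sqr_ge0.
apply: cvgD; first exact: cvg_cst.
apply: (@continuous_comp _ _ _ (fun y : R => y - a) (fun y => y ^+ 2)).
  by apply: cvgB; [exact: cvg_id|exact: cvg_cst].
exact: exprn_continuous.
Qed.

Lemma integral_poisson (e a X : R) : 0 < e -> 0 <= X ->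
  Rintegral mu (`[a - X, a + X]%classic : set mR) (fun y => poisson e (y - a)) =
  2 / pi * atan (X / e).
Proof.
move=> e0 X0; have en0 : e != 0 by rewrite gt_eqF.
have pn0 : pi != 0 :> R by rewrite gt_eqF// pi_gt0.
have le_aX : a - X <= a + X by rewrite lerD2l -subr_ge0 opprK addr_ge0.
have D x : is_derive x (1 : R) (fun y => pi^-1 * atan ((y - a) / e)) (poisson e (x - a)).
  have h : is_derive x (1 : R) (fun y : R => (y - a) / e) e^-1.
    by apply: is_derive_eq; rewrite /GRing.scale /=; ring.
  have h2 := @is_derive1_comp _ (@atan R) (fun y => (y - a) / e) x _ _ (is_derive1_atan _) h.
  have := is_deriveZ pi^-1 h2; rewrite /GRing.scale /=.
  set d := (X in is_derive _ _ _ X).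
  suff -> : d = poisson e (x - a) by [].
  rewrite /d /poisson; move: pn0; move: (@pi R) => P P0; field; rewrite en0 P0 /=.
  have p : e ^+ 2 + (x - a) ^+ 2 != 0.
    by rewrite gt_eqF// ltr_pwDl ?exprn_gt0// sqr_ge0.
  by rewrite ?p ?andbT//.
rewrite (rFTC le_aX D (@continuous_poisson e a e0)).
have -> : (a + X - a) / e = X / e by ring.
have -> : (a - X - a) / e = - (X / e) by ring.
by rewrite atanN; ring.
Qed.

Lemma poisson_ge0 (e t : R) : 0 < e -> 0 <= poisson e t.
Proof.
move=> e0; rewrite mulr_ge0 ?invr_ge0 ?pi_ge0// divr_ge0 ?(ltW e0)//.
by rewrite addr_ge0 ?sqr_ge0.
Qed.

Lemma atan_small (d : R) : 0 < d -> exists2 K : R, 0 < K &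
  forall x, K <= x -> 1 - 2 / pi * atan x <= d.
Proof.
move=> d0; have pi0 := @pi_gt0 R.
have d1 : 0 < d * pi / 2 by rewrite !mulr_gt0.
have /cvgrPdist_le /(_ _ d1) [K [_ HK]] := @cvgy_atan R.
exists (Num.max K 0 + 1) => [|x Kx]; first by rewrite ltr_wpDl// le_max lexx orbT.
have /HK : K < x by rewrite (lt_le_trans _ Kx)// (@le_lt_trans _ _ (Num.max K 0)) ?ltrDl// le_max lexx.
move=> /(le_trans (ler_norm _)) H.
have -> : 1 - 2 / pi * atan x = (pi / 2 - atan x) * (2 / pi)   by move: pi0; move: (@pi R) => P P0; field; rewrite gt_eqF.
by rewrite -ler_pdivlMr ?divr_gt0// invf_div mulrA.
Qed.

(** The Poisson kernel is an approximate identity. Its primitive is an arctangent, so its mass over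
    an interval is explicit; the mass 1 is only approached, which accounts for the separate term
    [1 - 2 / pi * atan (X / e)]. *)
Lemma poisson_approx (phi : R -> C) (M a eta : R) : continuous phi ->
  csupp phi M -> 0 < eta -> exists2 e0 : R, 0 < e0 & forall e, 0 < e -> e <= e0 ->
  N (cintegral mu (setT : set mR) (fun y => (poisson e (y - a))%:C * phi y) - phi a) <= eta.
Proof.
move=> cphi sphi eta0; have pi0 := @pi_gt0 R.
(* Makes [[a - X, a + X]] contain the support of [phi]. *)
pose X := `|M| + `|a| + 1.
have X0 : 0 < X by rewrite ltr_wpDl// addr_ge0.
have [B0 HB0] := continuous_itv_bounded (a - X) (a + X) cphi.
pose B := Num.max B0 1.
have B1 : 0 < B by rewrite lt_max ltr01 orbT.
have HB y : a - X <= y <= a + X -> N (phi y) <= B.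
  by move=> /HB0 h; rewrite le_max h.
have NB : N (phi a) <= B by apply: HB; apply/andP; split; rewrite ?lerBlDr ?lerDl ltW.
have e40 : 0 < eta / 8 by rewrite divr_gt0.
have /cvg_normcP/(_ _ e40) := cphi a.
move=> /nbhs_ballP[d /= d0 Hd].
have d20 : 0 < d / 2 by rewrite divr_gt0.
have [K K0 HK] := atan_small (divr_gt0 (divr_gt0 eta0 (ltr0n R 4)) B1).
(* At distance at least [d] from [a] the kernel is at most [e / (pi * (d / 2) ^+ 2)] and [phi]
   differs from [phi a] by at most [2 * B], so [e * c] bounds the integrand there. *)
pose c := 2 * B / (pi * (d / 2) ^+ 2).
have c0 : 0 < c by rewrite divr_gt0 ?mulr_gt0 ?exprn_gt0.
exists (Num.min (X / K) (eta / (16 * X * c))).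
  have c16 : 0 < 16 * X * c by rewrite mulr_gt0// mulr_gt0.
  by rewrite lt_min; apply/andP; split; exact: divr_gt0.
move=> e e0; rewrite le_min => /andP[eK eE].
rewrite (@cintegral_supp2 _ (a - X) (a + X)); last first.
  move=> x xX; rewrite sphi ?mulr0//.
  have : `|a| < `|M| + `|a| + 1 by rewrite addrAC ltrDr ltr_wpDl.
  have := ler_norm M; have := ler_norm a; have := ler_norm (- a); have := ler_norm x.
  have := ler_norm (- x); rewrite !normrN; rewrite /X in xX; case: xX; lra.
set J := (`[a - X, a + X]%classic : set mR).
have mJ : measurable J by exact: measurable_itv.
have cP := @continuous_poisson e a e0.
have cPC : continuous (fun y => (poisson e (y - a))%:C : C).
  by apply: continuous_ReIm; [exact: cP|move=> ?; exact: cvg_cst].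
have iP : rintegrable mu J (fun y => poisson e (y - a)).
  exact: (cintegrable_itv (a - X) (a + X) cPC).1.
have i1 : cintegrable mu J (fun y => (poisson e (y - a))%:C).
  by split; [exact: iP|exact: integrable0].
have I1 : cintegral mu J (fun y => (poisson e (y - a))%:C) = (2 / pi * atan (X / e))%:C.
  rewrite /cintegral /= integral_poisson ?(ltW X0)//; congr (_ +i* _).
  by rewrite /Rintegral integral0.
have -> : cintegral mu J (fun y => (poisson e (y - a))%:C * phi y) - phi a =
   cintegral mu J (fun y => (poisson e (y - a))%:C * (phi y - phi a)) +
   - ((1 - 2 / pi * atan (X / e))%:C * phi a).
  under [X in _ = X + _]eq_cintegral do rewrite mulrBr.
  rewrite cintegralB//.
  - under [X in _ = _ - X + _]eq_cintegral do rewrite mulrC.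
    by rewrite cintegralZ// I1 rmorphB /=; ring.
  - by apply: cintegrable_itv; exact: continuousMc.
  - by apply: cintegrable_itv; apply: continuousMc; [exact: cPC|move=> ?; exact: cvg_cst].
apply: (@le_trans _ _ (eta / 2 + eta / 4)); last by lra.
apply: ler_normcD; last first.
  have Xe : K <= X / e by rewrite ler_pdivlMr// mulrC -ler_pdivlMr.
  rewrite normcN Normc.normcM normcR ger0_norm; last first.
    have := atan_ltpi2 (X / e); rewrite subr_ge0 mulrAC ler_pdivrMr// mul1r; lra.
  apply: (@le_trans _ _ (eta / 4 / B * B)); last by rewrite divfK// gt_eqF.
  by apply: ler_pM; rewrite ?normc_ge0 ?HK//;
    have := atan_ltpi2 (X / e); rewrite subr_ge0 mulrAC ler_pdivrMr// mul1r; lra.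
pose H := fun y : mR => eta / 8 * poisson e (y - a) + e * c.
have iH : rintegrable mu J H.
  apply: rintegrableD => //; first exact: rintegrableZ.
  by apply: (@rintegrable_bounded _ _ _ `|e * c|); first exact: measurable_cst.
apply: (@le_trans _ _ (2 * Rintegral mu J H)).
  apply: normc_cintegral => //.
    apply: cmeasurable_continuous; first exact: mJ.
    apply: continuousMc; first exact: cPC.
    by apply: continuousDc; [exact: cphi|move=> ?; exact: cvg_cst].
  move=> y; rewrite /J /= in_itv /= => yX.
  rewrite Normc.normcM normcR (ger0_norm (poisson_ge0 _ e0)) /H.
  have [yd|dy] := ltP `|y - a| d.
    rewrite mulrC -[leLHS]addr0; apply: lerD; last by rewrite mulr_ge0// ltW.
    rewrite ler_wpM2r ?poisson_ge0// normcB ltW//; apply: Hd.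
    by rewrite -ball_normE /ball_ /= distrC.
  rewrite -[leLHS]add0r; apply: lerD; first by rewrite mulr_ge0 ?poisson_ge0// ltW.
  apply: (@le_trans _ _ (poisson e (y - a) * (2 * B))).
    rewrite ler_wpM2l ?poisson_ge0// mulr_natl mulr2n.
    by apply: le_trans (ler_normcB _ _) _; rewrite lerD// HB.
  rewrite /poisson /c.
  have -> : e * (2 * B / (pi * (d / 2) ^+ 2)) = pi^-1 * (e / (d / 2) ^+ 2) * (2 * B).
    by move: pi0 d0; move: (@pi R) => P P0 d0; field; rewrite !gt_eqF.
  rewrite ler_wpM2r ?mulr_ge0 ?(ltW B1)// ler_wpM2l ?invr_ge0 ?(ltW pi0)//.
  rewrite ler_wpM2l ?(ltW e0)// lef_pV2 ?posrE ?exprn_gt0//; last first.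
    by rewrite ltr_pwDl ?exprn_gt0// sqr_ge0.
  rewrite -[leLHS]add0r lerD ?sqr_ge0// -(real_normK (num_real (y - a))).
  by rewrite lerXn2r ?nnegrE//; lra.
rewrite RintegralD//; first last.
- by apply: (@rintegrable_bounded _ _ _ `|e * c|); first exact: measurable_cst.
- exact: rintegrableZ.
rewrite RintegralZl// integral_poisson ?(ltW X0)// Rintegral_cst//.
have -> : fine (mu J) = a + X - (a - X).
  by rewrite /J /= lebesgue_measure_itv /= lte_fin ifT//; rewrite ltrD2l; lra.
have : 2 / pi * atan (X / e) <= 1.
  by have := atan_ltpi2 (X / e); rewrite mulrAC ler_pdivrMr// mul1r; lra.
have : e * c * (a + X - (a - X)) <= eta / 8.
  rewrite (_ : a + X - (a - X) = 2 * X); last by ring.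
  have h16 : 0 < 16 * X * c by rewrite mulr_gt0// mulr_gt0.
  have h : e * (16 * X * c) <= eta by rewrite -ler_pdivlMr.
  have -> : e * c * (2 * X) = (e * (16 * X * c)) / 8 by field.
  by rewrite ler_wpM2r.
move: (2 / pi * _) => t; nra.
Qed.

(** With this weight the transform of [phi] along the line at height [y] becomes a transform along
    the real line, see [fourier_ft]. *)
Definition gauge phi (y : R) (t : R) : C := phi t * expo (2 * pi * y)%:C t.

Lemma test_gauge phi y : test_function phi -> test_function (gauge phi y).
Proof.
move=> /test_functionP[s [M H]]; apply/test_functionP; split.
  by apply: csmoothM; [exact: s|exact: csmooth_expo].
by exists M; exact: csuppM.
Qed.

Lemma gauge0 phi : gauge phi 0 = phi.
Proof. by apply/funext => t; rewrite /gauge mulr0 /expo mul0r cexp0 mulr1. Qed.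

Lemma fourier_ft phi (x y : R) : fourier phi (x +i* y) = ft (gauge phi y) (- x).
Proof.
rewrite fourierE /ft; apply: eq_cintegral => t _; rewrite /gauge -mulrA; congr (_ * _).
have -> : kz (x +i* y) = (2 * pi * y)%:C + (0 +i* (2 * pi * - x)).
  by rewrite /kz; apply: complex_ext => /=; ring.
by rewrite expo_add e1_expo.
Qed.

(** The support being bounded, [ft u] is Lipschitz, with a constant proportional to [|M|] times the
    integral of the modulus of [u]. *)
Lemma ft_continuous (u : R -> C) (M : R) :
  cintegrable mu (setT : set mR) u -> csupp u M ->
  continuous (ft u).
Proof.
move=> iu su.
have iN : rintegrable mu (setT : set mR) (fun t : mR => 2 * pi * `|M| * N (u t)).
  by apply: rintegrableZ => //; exact: cintegrable_norm.
pose c := 2 * Rintegral mu (setT : set mR) (fun t : mR => 2 * pi * `|M| * N (u t)).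
have c0 : 0 <= c.
  rewrite mulr_ge0//; apply: Rintegral_ge0 => t _.
  by rewrite !mulr_ge0 ?pi_ge0 ?normc_ge0.
have H (x x' : R) : N (ft u x - ft u x') <= `|x - x'| * c.
  rewrite /ft -cintegralB//; try exact: cintegrableMe1.
  rewrite /c mulrCA -RintegralZl//; apply: normc_cintegral => //.
  - by apply: cintegrable_measurable; apply: cintegrableB => //; exact: cintegrableMe1.
  - exact: rintegrableZ.
  move=> t _; have [Mt|tM] := ltP M `|t|.
    by rewrite su// !mul0r subrr Normc.normc0 mulr0 mulr0.
  have -> : u t * e1 (x * t) - u t * e1 (x' * t) =
     e1 (x' * t) * (u t * (e1 ((x - x') * t) - 1)).
    by rewrite -[in e1 (x * t)](subrK x' x) mulrDl e1D; ring.
  rewrite !Normc.normcM normc_e1 mul1r mulrC.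
  rewrite [leRHS](_ : _ = (`|x - x'| * (2 * pi * `|M|)) * N (u t)); last by ring.
  rewrite ler_wpM2r ?normc_ge0// (le_trans (normc_expi_sub1 _))//.
  rewrite !normrM !(ger0_norm (ler0n _ _)) (ger0_norm (pi_ge0 R)).
  rewrite [leLHS](_ : _ = `|x - x'| * (2 * pi * `|t|)); last by ring.
  by rewrite ler_wpM2l// ler_wpM2l ?mulr_ge0 ?pi_ge0// (le_trans tM)// ler_norm.
move=> x; apply/cvg_normcP => e e0.
near=> x'.
apply: le_lt_trans (H _ _) _.
have : `|x - x'| < e / (c + 1).
  near: x'; apply/nbhs_ballP; exists (e / (c + 1)) => //=.
  by rewrite divr_gt0// ltr_wpDl.
rewrite ltr_pdivlMr ?ltr_wpDl//; apply: le_lt_trans.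
by rewrite ler_wpM2l// lerDl.
Unshelve. all: by end_near. Qed.

Lemma test_fourier_line phi (y : R) : test_function phi ->
  continuous (fun x : R => fourier phi (x +i* y)) /\
  forall m, exists2 c : R, 0 <= c & forall x : R,
    N (fourier phi (x +i* y)) <= c * ((1 + x ^+ 2) ^+ m)^-1.
Proof.
move=> tphi; split; last first.
  move=> m; have [c c0 Hc] := test_fourier_decay `|y| m tphi.
  exists c => // x; apply: le_trans (Hc (x +i* y) _) _ => //.
  rewrite ler_wpM2l// lef_pV2 ?posrE ?exprn_gt0 ?ltr_pwDl ?sqr_ge0//.
  rewrite lerXn2r ?nnegrE ?addr_ge0 ?sqr_ge0// lerD2l normc_sqr /=.
  by rewrite lerDl sqr_ge0.
have tg := test_gauge y tphi; have [_ [M HM]] := (test_functionP _).1 tg.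
under eq_fun do rewrite fourier_ft.
move=> x; apply: (@continuous_comp _ _ _ -%R (ft (gauge phi y))).
  by apply: cvgN; exact: cvg_id.
exact: (ft_continuous (csupp_cintegrable (test_continuous tg) HM) HM).
Qed.

Lemma rintegrable_cauchyZ (c : R) :
  rintegrable mu (setT : set mR) (fun x : R => c * (1 + x ^+ 2)^-1).
Proof. by apply: rintegrableZ => //; exact: rintegrable_cauchy. Qed.

Lemma cintegrable_cauchy (f : R -> C) (c : R) : continuous f ->
  (forall x, N (f x) <= c * (1 + x ^+ 2)^-1) -> cintegrable mu (setT : set mR) f.
Proof.
move=> cf H; apply: (@cintegrable_dom _ _ _ _ _ _ (fun x : mR => c * (1 + x ^+ 2)^-1)).
- exact: measurableT.
- exact: cmeasurable_continuous.
- exact: rintegrable_cauchyZ.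
- by move=> x _; exact: H.
Qed.

Lemma cintegrable_test_fourier phi (y : R) : test_function phi ->
  cintegrable mu (setT : set mR) (fun x => fourier phi (x +i* y)).
Proof.
move=> tphi; have [cf /(_ 1%N)[c c0 Hc]] := test_fourier_line y tphi.
by apply: (cintegrable_cauchy cf (c := c)) => x; have := Hc x; rewrite expr1.
Qed.

(** The integral is regularised by [exp (- 2 pi e |x|)], whose transform is the Poisson kernel. The
    multiplication formula turns the regularised integral into a Poisson mean of [phi], and [e] is
    taken small. *)
Lemma fourier_inversion0 phi (l : R) : test_function phi ->
  cintegral mu (setT : set mR) (fun x => ft phi x * e1 (- l * x)) = phi l.
Proof.
move=> tphi; have [_ [M HM]] := (test_functionP _).1 tphi.
have cphi := test_continuous tphi; have iphi := csupp_cintegrable cphi HM.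
have cft := ft_continuous (csupp_cintegrable cphi HM) HM.
(* Decay of order 4: one factor [1 + x ^+ 2] makes the integral converge, the other absorbs the
   [|x|] of [1 - exp (- 2 pi e |x|) <= 2 pi e |x|]. *)
have [c c0 Hc] : exists2 c : R, 0 <= c &
    forall x : R, N (ft phi x) <= c * ((1 + x ^+ 2) ^+ 2)^-1.
  have [_ /(_ 2%N)[c c0 Hc]] := test_fourier_line 0 tphi.
  by exists c => // x; have := Hc (- x); rewrite fourier_ft gauge0 opprK sqrrN.
have p (x : R) : 0 < 1 + x ^+ 2 by rewrite ltr_pwDl// sqr_ge0.
have ift : cintegrable mu (setT : set mR) (ft phi).
  apply: (cintegrable_cauchy cft (c := c)) => x; apply: le_trans (Hc x) _.
  have w1 : 1 <= 1 + x ^+ 2 by rewrite lerDl sqr_ge0.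
  have := p x; move: (1 + x ^+ 2) w1 => w w1 w0.
  by rewrite ler_wpM2l// lef_pV2 ?posrE ?exprn_gt0// expr2 ler_peMl// ltW.
have ce l' : continuous (fun x : R => e1 (l' * x)) by exact: continuous_e1.
pose I := Rintegral mu (setT : set mR) (fun x : R => (1 + x ^+ 2)^-1).
have I0 : 0 <= I by apply: Rintegral_ge0 => x _; rewrite invr_ge0 ltW.
apply/eqP; rewrite -subr_eq0 -normc0P; apply/eqP; apply: ge0_lt_eq0.
  exact: normc_ge0.
move=> eta eta0; have eta2 : 0 < eta / 2 by rewrite divr_gt0.
have pi0 := @pi_gt0 R.
have [e0 e00 He0] := poisson_approx l cphi HM eta2.
pose k := 2 * (2 * pi * c) * I + 1.
have k0 : 0 < k by rewrite ltr_wpDl// !mulr_ge0// ltW.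
pose e := Num.min e0 (eta / 2 / k).
have ep : 0 < e by rewrite lt_min e00 divr_gt0.
have ee0 : e <= e0 by rewrite ge_min lexx.
have eek : e * k <= eta / 2 by rewrite -ler_pdivlMr// ge_min lexx orbT.
pose u (x : R) : C := (expR (- (2 * pi * e) * `|x|))%:C * e1 (- l * x).
have c2 : 0 < 2 * pi * e by rewrite !mulr_gt0.
have iu : cintegrable mu (setT : set mR) u.
  by apply: cintegrableMe1; split; [exact: rintegrable_exp_abs|exact: integrable0].
have ftu y : ft u y = (poisson e (y - l))%:C.
  rewrite -(ft_exp_abs _ ep) /ft; apply: eq_cintegral => x _.
  rewrite (_ : (y - l) * x = - l * x + y * x); last by ring.
  by rewrite /u e1D mulrA.
have cu : continuous u.
  apply: continuousMc; last exact: ce.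
  apply: continuous_ReIm; last by move=> ?; exact: cvg_cst.
  move=> x /=; apply: continuous_comp; last exact: continuous_expR.
  by apply: cvgM; [exact: cvg_cst|exact: norm_continuous].
have E : cintegral mu (setT : set mR) (fun x => ft phi x * e1 (- l * x)) - phi l =
   cintegral mu (setT : set mR) (fun x => ft phi x * (e1 (- l * x) - u x)) +
   (cintegral mu (setT : set mR) (fun y => (poisson e (y - l))%:C * phi y) - phi l).
  under [X in _ = _ + (X - _)]eq_cintegral do rewrite -ftu.
  rewrite [X in _ = _ + (X - _)](_ : _ =
      cintegral mu (setT : set mR) (fun x => u x * ft phi x)); last exact/esym/ft_multiplication.
  under [X in _ = X + _]eq_cintegral do rewrite mulrBr.
  rewrite cintegralB//; last 2 first.
  - exact: cintegrableMe1.
  - apply: (@cintegrable_dom _ _ _ _ _ _ (fun x : mR => N (ft phi x))) => //.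
    + by apply: cmeasurable_continuous; [exact: measurableT|exact: continuousMc].
    + exact: cintegrable_norm.
    + move=> x _; rewrite Normc.normcM ler_piMr ?normc_ge0// /u Normc.normcM normc_e1 mulr1.
      rewrite normcR ger0_norm ?expR_ge0// -[leRHS]expR0 ler_expR mulNr oppr_le0.
      by rewrite mulr_ge0 ?normr_ge0 ?(ltW c2).
  under [X in _ = _ - X + _]eq_cintegral do rewrite mulrC.
  by ring.
rewrite E (splitr eta); apply: ler_normcD; last exact: He0.
apply: le_trans eek.
apply: (@le_trans _ _ (2 * Rintegral mu (setT : set mR) (fun x : R => (e * (2 * pi * c)) * (1 + x ^+ 2)^-1))).
  apply: normc_cintegral.
  - exact: measurableT.
  - apply: cmeasurable_continuous; first exact: measurableT.
    apply: continuousMc; first exact: cft.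
    apply: continuousDc; first exact: ce.
    by move=> x; apply: (@cvgN _ C); exact: cu.
  - exact: rintegrable_cauchyZ.
  move=> x _; rewrite Normc.normcM.
  have H1 : N (e1 (- l * x) - u x) <= 2 * pi * e * `|x|.
    have -> : e1 (- l * x) - u x = (1 - expR (- (2 * pi * e) * `|x|))%:C * e1 (- l * x).
      by rewrite /u rmorphB /= mulrBl mul1r.
    rewrite Normc.normcM normc_e1 mulr1 normcR ger0_norm.
      by have := expR_ge1Dx (- (2 * pi * e) * `|x|); lra.
    rewrite subr_ge0 -[leRHS]expR0 ler_expR mulNr oppr_le0.
    by rewrite mulr_ge0 ?normr_ge0 ?(ltW c2).
  apply: le_trans (ler_pM (normc_ge0 _) (normc_ge0 _) (Hc x) H1) _.
  rewrite [leRHS](_ : _ = c * (2 * pi * e) * (1 + x ^+ 2)^-1); last by ring.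
  rewrite mulrACA ler_wpM2l//; first by rewrite mulr_ge0// ltW.
  rewrite expr2 invfM -mulrA ger_pMr ?invr_gt0//.
  rewrite mulrC ler_pdivrMr// mul1r.
  have := sqr_ge0 (`|x| - 1); rewrite -(real_normK (num_real x)).
  have := normr_ge0 x; nra.
rewrite RintegralZl//; last exact: rintegrable_cauchy.
rewrite -/I /k; nra.
Qed.

(** Inversion on the real line for [gauge phi y]; the weight is undone by the modulus
    [exp (- 2 pi l y)] of the exponential on the line at height [y]. *)
Lemma fourier_inversion phi (y l : R) : test_function phi ->
  cintegral mu (setT : set mR)
    (fun x => fourier phi (x +i* y) * cexp ((0 +i* (2 * pi * l)) * (x +i* y))) = phi l.
Proof.
move=> tphi; have tg := test_gauge y tphi.
have := fourier_inversion0 l tg; rewrite /gauge.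
set I := (X in X = _ -> _) => H.
have -> : phi l = expo (- (2 * pi * y))%:C l * (phi l * expo (2 * pi * y)%:C l).
  by rewrite mulrCA -expo_add -rmorphD /= addNr /expo mul0r cexp0 mulr1.
rewrite -H /I -cintegralZ//; last first.
  apply: cintegrableMe1.
  have := cintegrable_opp (cintegrable_test_fourier y tphi).
  apply: eq_cintegrable; first exact: measurableT.
  by move=> x _; rewrite fourier_ft opprK.
rewrite -[LHS]cintegral_opp; last first.
  apply: (@cintegrable_dom _ _ _ _ _ _ (fun x : mR => expR (- (2 * pi * l * y)) * N (fourier phi (x +i* y)))).
  - exact: measurableT.
  - apply: cmeasurableM; first exact: cintegrable_measurable (cintegrable_test_fourier y tphi).
    apply: cmeasurable_continuous; first exact: measurableT.
    have -> : (fun x : R => cexp ((0 +i* (2 * pi * l)) * (x +i* y))) =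
        (fun x => (expR (- (2 * pi * l * y)))%:C * e1 (l * x)).
      by apply/funext => x; rewrite /e1 /cexp; apply: complex_ext => /=;
        rewrite !(mul0r,mulr0,add0r,addr0,subr0,sub0r,expR0,mul1r) mulrA.
    by apply: continuousMc; [move=> ?; exact: cvg_cst|exact: continuous_e1].
  - by apply: rintegrableZ => //; apply: cintegrable_norm => //; exact: cintegrable_test_fourier.
  - move=> x _; rewrite Normc.normcM mulrC normc_cexp /=.
    by rewrite mul0r sub0r.
apply: eq_cintegral => x _; rewrite fourier_ft opprK /gauge mulrCA; congr (_ * _).
rewrite /e1 /expo -cexpD; congr (cexp _).
by apply: complex_ext => /=; ring.
Qed.

End FourierInversion.

(** * Almost periodic functions *)

Section IntervalIntegrals.
Variable R : realType.
Local Notation C := (cplx R).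
Local Notation N := (@Normc.normc R).
Local Notation mu := (@lebesgue_measure R).
Local Notation mR := (measurableTypeR R).
Implicit Types (f g h : R -> C) (a b c L X : R).

Definition cint f a b : C := cintegral mu (`[a, b]%classic : set mR) f.

Lemma cint_cat f a b c : continuous f -> a <= b -> b <= c ->
  cint f a c = cint f a b + cint f b c.
Proof.
move=> cf ab bc; have [i1 i2] := cintegrable_itv a c cf.
have [j1 j2] : cintegrable mu (`]b, c]%classic : set mR) f.
  apply: (cintegrableS _ _ _ (cintegrable_itv b c cf)).
  - exact: measurable_itv.
  - exact: measurable_itv.
  - by apply: subset_itv; rewrite bnd_simp.
have H (g : mR -> R) : rintegrable mu (`[a, c]%classic : set mR) g ->
    rintegrable mu (`]b, c]%classic : set mR) g ->
    Rintegral mu (`[a, c]%classic : set mR) g =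
    Rintegral mu (`[a, b]%classic : set mR) g + Rintegral mu (`[b, c]%classic : set mR) g.
  move=> ig jg; rewrite -(@Rintegral_itv_obnd_cbnd _ b (BRight c))//.
  rewrite -(@Rintegral_itvB _ g (BLeft a) (BRight c) b)//.
  by rewrite addrC subrK.
by rewrite /cint /cintegral; apply: complex_ext; rewrite ?ReD ?ImD /=; exact: H.
Qed.

Lemma cint_shift f a b c : continuous f ->
  cint f (a + c) (b + c) = cint (fun x => f (x + c)) a b.
Proof.
move=> cf; rewrite /cint cintegral_restrict [RHS]cintegral_restrict.
rewrite -(@cintegral_shift _ _ c); last first.
  apply: (cintegrable_restrict mu f (measurable_itv _)).1.
  exact: cintegrable_itv.
apply: eq_cintegral => x _.
by rewrite /crestrict !mem_setE !in_itv /= !lerD2r.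
Qed.

Lemma normc_cint f a b (B : R) : continuous f -> a <= b ->
  (forall x, a <= x <= b -> N (f x) <= B) -> N (cint f a b) <= 2 * B * (b - a).
Proof.
move=> cf ab HB.
have B0 : 0 <= B by apply: le_trans (HB a _); rewrite ?lexx ?ab ?normc_ge0.
have mJ : measurable (`[a, b]%classic : set mR) by exact: measurable_itv.
apply: (@le_trans _ _ (2 * Rintegral mu (`[a, b]%classic : set mR) (fun=> B))).
  apply: normc_cintegral => //.
  - exact: cmeasurable_continuous.
  - by apply: (@rintegrable_bounded _ _ _ `|B|); first exact: measurable_cst.
rewrite Rintegral_cst//= lebesgue_measure_itv /= lte_fin.
move: ab; rewrite le_eqVlt => /predU1P[->|->].
  by rewrite ltxx subrr !mulr0.
by rewrite -EFinB /= mulrA.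
Qed.

Lemma cintD f g a b : continuous f -> continuous g ->
  cint (fun x => f x + g x) a b = cint f a b + cint g a b.
Proof. by move=> cf cg; apply: cintegralD; [exact: measurable_itv|exact: cintegrable_itv..]. Qed.

Lemma cintZ f a b (k : C) : continuous f ->
  cint (fun x => k * f x) a b = k * cint f a b.
Proof. by move=> cf; apply: cintegralZ; [exact: measurable_itv|exact: cintegrable_itv]. Qed.

Lemma cintB f g a b : continuous f -> continuous g ->
  cint (fun x => f x - g x) a b = cint f a b - cint g a b.
Proof. by move=> cf cg; apply: cintegralB; [exact: measurable_itv|exact: cintegrable_itv..]. Qed.

Lemma cint_cst (k : C) a b : a <= b -> cint (fun=> k) a b = (b - a)%:C * k.
Proof.
move=> ab; rewrite /cint /cintegral !Rintegral_cst//; try exact: measurable_itv.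
rewrite /= lebesgue_measure_itv /= lte_fin.
have -> : fine (if a < b then (b%:E - a%:E)%E else 0%E) = b - a.
  by move: ab; rewrite le_eqVlt => /predU1P[->|->//]; rewrite ltxx subrr.
by case: k => x y; apply: complex_ext => /=; ring.
Qed.

Lemma continuous_shiftr f c : continuous f -> continuous (fun x => f (x + c)).
Proof.
move=> cf x; apply: (@continuous_comp _ _ _ (fun x => x + c) f).
  by apply: cvgD; [exact: cvg_id|exact: cvg_cst].
exact: cf.
Qed.

Lemma continuousBc f g : continuous f -> continuous g ->
  continuous (fun x => f x - g x).
Proof. by move=> cf cg x; apply: (@cvgB _ C); [exact: cf|exact: cg]. Qed.

Lemma continuous_cstc (k : C) : continuous (fun _ : R => k).
Proof. by move=> x; exact: cvg_cst. Qed.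

(** The interval is cut into pieces of length [L]; the last, incomplete piece is responsible for
    [2 * B * L]. *)
Lemma cint_chop f L e (B : R) : continuous f -> 0 < L -> 0 <= e ->
  (forall x, N (f x) <= B) -> (forall a, N (cint f a (a + L)) <= e * L) ->
  forall a X, 0 <= X -> N (cint f a (a + X)) <= e * X + 2 * B * L.
Proof.
move=> cf L0 e0 HB He a X X0.
have B0 : 0 <= B := le_trans (normc_ge0 _) (HB 0).
have H n : forall a X, 0 <= X -> X <= n%:R * L -> N (cint f a (a + X)) <= e * X + 2 * B * L.
  elim: n => [|n IH] {}a {}X {}X0 Xn.
    have XE : X = 0 by apply/eqP; rewrite eq_le X0 andbT; move: Xn; rewrite mul0r.
    rewrite XE addr0 mulr0 add0r.
    apply: le_trans (normc_cint cf (lexx a) (fun x _ => HB x)) _.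
    by rewrite subrr mulr0 !mulr_ge0// ltW.
  have [XL|LX] := leP X L.
    have aX : a <= a + X by rewrite lerDl.
    apply: le_trans (normc_cint cf aX (fun x _ => HB x)) _.
    rewrite addrAC subrr add0r -[leLHS]add0r lerD ?mulr_ge0//.
    by rewrite ler_wpM2l ?mulr_ge0.
  rewrite (@cint_cat f a (a + L))//; last 2 first.
  - by rewrite lerDl ltW.
  - by rewrite lerD2l ltW.
  have -> : e * X + 2 * B * L = e * L + (e * (X - L) + 2 * B * L) by ring.
  apply: ler_normcD; first exact: He.
  have -> : a + X = (a + L) + (X - L) by ring.
  apply: IH; first by rewrite subr_ge0 ltW.
  by rewrite lerBlDr; move: Xn; rewrite -natr1 mulrDl mul1r.
have XL : 0 <= X / L by rewrite divr_ge0// ltW.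
have /andP[_ h] := truncn_itv XL.
apply: (H (Num.truncn (X / L)).+1) => //.
by rewrite -ler_pdivrMr// ltW.
Qed.

(** By additivity the difference reduces to two integrals over intervals of length [|u|], each at
    most [2 * B * |u|]. *)
Lemma cint_move f (B : R) u L : continuous f -> (forall x, N (f x) <= B) -> 0 <= L ->
  N (cint f u (u + L) - cint f 0 L) <= 4 * B * `|u|.
Proof.
move=> cf HB L0; have B0 : 0 <= B := le_trans (normc_ge0 _) (HB 0).
have bd a b : a <= b -> N (cint f a b) <= 2 * B * (b - a).
  by move=> ab; exact: normc_cint.
have [u0|u0] := leP 0 u.
  have H1 := @cint_cat f 0 u (u + L) cf u0 _.
  have H2 := @cint_cat f 0 L (u + L) cf L0 _.
  have -> : cint f u (u + L) - cint f 0 L = cint f L (u + L) - cint f 0 u.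
    have := H1 _; rewrite H2 ?lerDr// => /(_ _); rewrite lerDl => /(_ L0) E.
    by rewrite -(addKr (cint f 0 u) (cint f u (u + L))) -E; ring.
  apply: le_trans (ler_normcB _ _) _.
  have -> : 4 * B * `|u| = 2 * B * (u + L - L) + 2 * B * (u - 0).
    by rewrite ger0_norm//; ring.
  by apply: lerD; apply: bd; rewrite ?lerDr.
have uL : u + L <= L by rewrite gerDr ltW.
have H1 := @cint_cat f u 0 L cf (ltW u0) L0.
have H2 := @cint_cat f u (u + L) L cf _ uL.
have -> : cint f u (u + L) - cint f 0 L = cint f u 0 - cint f (u + L) L.
  have := H2 _; rewrite H1 lerDl => /(_ L0) E.
  by rewrite -(addrK (cint f (u + L) L) (cint f u (u + L))) -E; ring.
apply: le_trans (ler_normcB _ _) _.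
have -> : 4 * B * `|u| = 2 * B * (0 - u) + 2 * B * (L - (u + L)).
  by rewrite ltr0_norm//; ring.
by apply: lerD; apply: bd => //; exact: ltW.
Qed.

Lemma cvg_pinfty_cauchy (g : R -> R) :
  (forall e, 0 < e -> exists X0 : R, forall X Y, X0 <= X -> X0 <= Y -> `|g X - g Y| <= e) ->
  exists l, forall e, 0 < e -> exists X0 : R, forall X, X0 <= X -> `|g X - l| <= e.
Proof.
move=> H.
have : cvg (g x @[x --> +oo%R]).
  apply/cauchy_cvgP/cauchyP => e e0; have e20 : 0 < e / 2 by rewrite divr_gt0.
  have [X0 HX] := H _ e20; exists (g X0).
  suff : \forall X \near +oo%R, ball (g X0) e (g X) by [].
  near=> X.
  have HXX : `|g X0 - g X| < e.
    apply: (@le_lt_trans _ _ (e / 2)); last by lra.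
    by apply: HX => //; near: X; apply: nbhs_pinfty_ge; exact: num_real.
  by rewrite -ball_normE.
move=> cg; exists (lim (g x @[x --> +oo%R])) => e e0.
have [K [_ HK]] := (@cvgrPdist_le _ _ _ _ _ _ _).1 cg e e0.
exists (K + 1) => X KX; rewrite distrC; apply: HK.
by rewrite (lt_le_trans _ KX)// ltrDl.
Unshelve. all: by end_near. Qed.

End IntervalIntegrals.

(** * Bochner's condition *)

Section TotallyBoundedTranslates.
Variable R : realType.
Local Notation C := (cplx R).
Local Notation N := (@Normc.normc R).
Local Notation mu := (@lebesgue_measure R).
Local Notation mR := (measurableTypeR R).
Implicit Types (f g h : R -> C) (a b c L X : R).

Definition close_translates (e : R) f (t u : R) := forall x, N (f (x + t) - f (x + u)) <= e.

(* Bochner's condition; unlike Bohr's it is evidently stable under sums. *)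
Definition tb f := forall e : R, 0 < e ->
  exists U : seq R, forall t, exists2 u, u \in U & close_translates e f t u.

Lemma close_trans e e' f t u v : close_translates e f t u ->
  close_translates e' f u v -> close_translates (e + e') f t v.
Proof.
move=> H1 H2 x; rewrite (_ : _ - _ = (f (x + t) - f (x + u)) + (f (x + u) - f (x + v))).
  exact: ler_normcD.
ring.
Qed.

Lemma close_sym e f t u : close_translates e f t u -> close_translates e f u t.
Proof. by move=> H x; rewrite normcB. Qed.

Lemma tb_common f g e : tb f -> tb g -> 0 < e -> exists W : seq R, forall t,
  exists2 w, w \in W & close_translates e f t w /\ close_translates e g t w.
Proof.
move=> tf tg e0; have e20 : 0 < e / 2 by rewrite divr_gt0.
have [U HU] := tf _ e20; have [V HV] := tg _ e20.
pose P (p : R * R) t := close_translates (e / 2) f t p.1 /\ close_translates (e / 2) g t p.2.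
(* No single translate need be close to both members of a pair of centres. Each pair that occurs is
   replaced by one [t] realising it, at the cost of doubling the error; the default 0 only concerns
   pairs that do not occur. *)
pose rep p := xget 0 [set t | P p t].
exists [seq rep p | p <- [seq (u, v) | u <- U, v <- V]] => t.
have [u uU Hu] := HU t; have [v vV Hv] := HV t.
have [r1 r2] : P (u, v) (rep (u, v)) by apply: (@xgetPex _ 0 [set t | P (u, v) t]); exists t.
exists (rep (u, v)).
  by apply/mapP; exists (u, v) => //; apply/allpairsP; exists (u, v).
by rewrite (splitr e); split; apply: close_trans (close_sym _); eassumption.
Qed.

Lemma tbD f g : tb f -> tb g -> tb (fun x => f x + g x).
Proof.
move=> tf tg e e0; have e20 : 0 < e / 2 by rewrite divr_gt0.
have [W HW] := tb_common tf tg e20; exists W => t.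
have [w wW [H1 H2]] := HW t; exists w => // x.
rewrite opprD addrACA (splitr e); exact: ler_normcD.
Qed.

Lemma tb_bounded f : tb f -> exists2 B : R, 0 < B & forall x, N (f x) <= B.
Proof.
move=> tf; have [U HU] := tf 1 ltr01.
exists (1 + \sum_(u <- U) N (f u)).
  by rewrite ltr_pwDl// sumr_ge0// => i _; exact: normc_ge0.
move=> x; have [u uU Hu] := HU x.
have := Hu 0; rewrite !add0r => H.
rewrite -(subrK (f u) (f x)); apply: ler_normcD => //.
rewrite (big_rem u)//= lerDl; apply: sumr_ge0 => i _; exact: normc_ge0.
Qed.

Lemma tbM f g : tb f -> tb g -> tb (fun x => f x * g x).
Proof.
move=> tf tg e e0; have [A A0 HA] := tb_bounded tf; have [B B0 HB] := tb_bounded tg.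
have d0 : 0 < e / (A + B) by rewrite divr_gt0// addr_gt0.
have [W HW] := tb_common tf tg d0; exists W => t.
have [w wW [H1 H2]] := HW t; exists w => // x.
have -> : f (x + t) * g (x + t) - f (x + w) * g (x + w) =
  f (x + t) * (g (x + t) - g (x + w)) + (f (x + t) - f (x + w)) * g (x + w) by ring.
have -> : e = A * (e / (A + B)) + e / (A + B) * B.
  by field; rewrite gt_eqF// addr_gt0.
by apply: ler_normcD; rewrite Normc.normcM ler_pM ?normc_ge0.
Qed.

Lemma tb_cst (k : C) : tb (fun=> k).
Proof. by move=> e e0; exists [:: 0] => t; exists 0; rewrite ?mem_seq1// => x; rewrite subrr Normc.normc0 ltW. Qed.

Lemma tb_limit f : (forall e : R, 0 < e -> exists2 g, tb g & forall x, N (f x - g x) <= e) ->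
  tb f.
Proof.
move=> H e e0; have e30 : 0 < e / 3 by rewrite divr_gt0.
have [g tg fg] := H _ e30; have [U HU] := tg _ e30; exists U => t.
have [u uU Hu] := HU t; exists u => // x.
have -> : f (x + t) - f (x + u) = (f (x + t) - g (x + t)) +
  ((g (x + t) - g (x + u)) - (f (x + u) - g (x + u))) by ring.
have -> : e = e / 3 + (e / 3 + e / 3) by field.
apply: ler_normcD => //; apply: ler_normcD => //.
by rewrite normcN.
Qed.

Lemma e1_1 : e1 1 = 1 :> C.
Proof.
rewrite /e1 /cexp mulr1 /= expR0 !mul1r; apply: complex_ext => /=.
  by rewrite mulr_natl cos2pi.
by rewrite mulr_natl sin2pi.
Qed.

Lemma e1_int (m : int) : e1 m%:~R = 1 :> C.
Proof.
have H (n : nat) : e1 n%:R = 1 :> C.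
  by elim: n => [|n IH]; rewrite ?e1_0// -natr1 e1D IH e1_1 mulr1.
case: m => n; first exact: H.
by rewrite NegzE mulrNz -conj_e1 H; apply: complex_ext; rewrite /= ?oppr0.
Qed.

Lemma normc_e1_sub1 (s : R) : N (e1 s - 1) <= 2 * pi * `|s|.
Proof.
apply: le_trans (normc_expi_sub1 _) _.
by rewrite !normrM !(ger0_norm (ler0n _ _)) (ger0_norm (pi_ge0 R)).
Qed.

(** A translate by [t] depends only on [l * t] modulo 1, so the multiples of [1 / n] in [[0, 1[],
    divided by [l], form a finite net; [n] exceeds [2 pi / e] because [e1] is [2 pi]-Lipschitz. *)
Lemma tb_e1 (l : R) : tb (fun x => e1 (l * x)).
Proof.
move=> e e0; have [->|l0] := eqVneq l 0.
  exists [:: 0] => t; exists 0; rewrite ?mem_seq1// => x.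
  by rewrite !mul0r subrr Normc.normc0 ltW.
have pi0 := @pi_gt0 R.
pose n := (Num.truncn (2 * pi / e)).+1.
have n0 : 0 < n%:R :> R by rewrite ltr0n.
have ne : 2 * pi / n%:R <= e.
  rewrite ler_pdivrMr// [leRHS]mulrC -ler_pdivrMr//.
  have ge0 : 0 <= 2 * pi / e by rewrite divr_ge0 ?mulr_ge0 ?(ltW pi0) ?(ltW e0).
  by have /andP[_ /ltW] := truncn_itv ge0.
exists [seq (k%:R / n%:R) / l | k <- iota 0 n] => t.
pose s := l * t - (Num.floor (l * t))%:~R.
have s0 : 0 <= s by rewrite subr_ge0 floor_le.
have s1 : s < 1 by rewrite ltrBlDr addrC -[1]/(1%:~R) -intrD floorD1_gt.
pose k := Num.truncn (s * n%:R).
have sn0 : 0 <= s * n%:R by rewrite mulr_ge0// ltW.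
have /andP[k1 k2] := truncn_itv sn0.
exists ((k%:R / n%:R) / l).
  apply/mapP; exists k => //; rewrite mem_iota /= add0n -(ltr_nat R).
  by rewrite (le_lt_trans k1)// gtr_pMl.
move=> x.
have -> : e1 (l * (x + t)) - e1 (l * (x + k%:R / n%:R / l)) =
   e1 (l * x) * e1 (k%:R / n%:R) * (e1 (s - k%:R / n%:R) - 1).
  have -> : l * (x + t) = l * x + (k%:R / n%:R + ((s - k%:R / n%:R) + (Num.floor (l * t))%:~R)).
    by rewrite /s; ring.
  have -> : l * (x + k%:R / n%:R / l) = l * x + k%:R / n%:R.
    by field; rewrite l0 gt_eqF.
  by rewrite !e1D e1_int; ring.
rewrite !Normc.normcM !normc_e1 !mul1r (le_trans (normc_e1_sub1 _))//.
apply: le_trans ne; rewrite ler_wpM2l ?mulr_ge0 ?(ltW pi0)//.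
rewrite ger0_norm; last by rewrite subr_ge0 ler_pdivrMr.
rewrite lerBlDr -[X in X + _]mul1r -mulrDl ler_pdivlMr// addrC natr1.
exact: ltW.
Qed.

Lemma compact_uniform_continuity f (a b e : R) : continuous f -> 0 < e ->
  exists2 d : R, 0 < d & forall x s, a <= x <= b -> `|s| <= d ->
    N (f (x + s) - f x) <= e.
Proof.
move=> cf e0; have e20 : 0 < e / 2 by rewrite divr_gt0.
have /compact_near_coveringP H := @segment_compact R a b.
have : \forall s \near (0 : R), `[a, b] `<=` [set x | N (f (x + s) - f x) <= e].
  apply: (H _ (nbhs (0 : R)) (fun s x => N (f (x + s) - f x) <= e)) => x _.
  have /cvg_normcP/(_ _ e20)/nbhs_ballP[d /= d0 Hd] := cf x.
  have d20 : 0 < d / 2 by rewrite divr_gt0.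
  exists (ball x (d / 2), ball (0 : R) (d / 2)); first by split; exact: nbhsx_ballx.
  move=> [y s] /= []; rewrite -!ball_normE /ball_ /= => xy s0.
  rewrite (splitr e) (_ : _ - _ = (f (y + s) - f x) - (f y - f x)); last by ring.
  have nb z : `|x - z| < d -> N (f z - f x) <= e / 2 by move=> h; rewrite normcB ltW//; apply: Hd; rewrite -ball_normE.
  apply: le_trans (ler_normcB _ _) (lerD _ _); apply: nb; last by lra.
  have -> : x - (y + s) = (x - y) + (0 - s) by ring.
  by apply: le_lt_trans (ler_normD _ _) _; lra.
move=> /nbhs_ballP[d /= d0 Hd]; exists (d / 2); first by rewrite divr_gt0.
move=> x s xab sd; apply: (Hd s); last by rewrite /= in_itv.
by rewrite -ball_normE /ball_ /= sub0r normrN; lra.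
Qed.

End TotallyBoundedTranslates.

(** * Uniform mean values *)

Section Means.
Variable R : realType.
Local Notation C := (cplx R).
Local Notation N := (@Normc.normc R).
Local Notation Re := (@complex.Re R).
Local Notation Im := (@complex.Im R).
Local Notation mu := (@lebesgue_measure R).
Local Notation mR := (measurableTypeR R).
Implicit Types (f g h : R -> C) (a b c L X e : R) (m : C).

(** The mean is required to be uniform in the initial point [a]. Continuous functions satisfying
    [tb] have such a mean, and the uniformity is what allows long intervals to be chopped. *)
Definition has_mean f m := forall e, 0 < e -> exists2 L0 : R, 0 < L0 &
  forall L, L0 <= L -> forall a, N (cint f a (a + L) - L%:C * m) <= e * L.

Lemma ub_seq (U : seq R) : exists2 B : R, 0 < B & forall u, u \in U -> `|u| <= B.
Proof.
exists (1 + \sum_(u <- U) `|u|); first by rewrite ltr_pwDl// sumr_ge0.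
move=> u uU; rewrite (big_rem u)//= addrCA lerDl addr_ge0// sumr_ge0//.
Qed.

(** The translate by [a] is close to the one by a member [u] of a finite net. The [u] are bounded,
    so moving from [u] to 0 costs a fixed amount, which a large [L] absorbs. *)
Lemma cint_translate_close f e B : continuous f -> tb f -> (forall x, N (f x) <= B) ->
  0 < B -> 0 < e -> exists2 L1 : R, 0 < L1 & forall L, L1 <= L -> forall a,
  N (cint f a (a + L) - cint f 0 L) <= e * L.
Proof.
move=> cf tf HB B0 e0; have e40 : 0 < e / 4 by rewrite divr_gt0.
have [U HU] := tf _ e40; have [K K0 HK] := ub_seq U.
exists (8 * B * K / e); first by rewrite divr_gt0// !mulr_gt0.
move=> L LL a.
have L0 : 0 < L by apply: lt_le_trans LL; rewrite divr_gt0// !mulr_gt0.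
have [u uU Hu] := HU a.
have E1 t : cint f t (t + L) = cint (fun x => f (x + t)) 0 L.
  by rewrite -cint_shift// add0r addrC.
have -> : cint f a (a + L) - cint f 0 L =
   (cint f a (a + L) - cint f u (u + L)) + (cint f u (u + L) - cint f 0 L) by ring.
have -> : e * L = e / 2 * L + e / 2 * L by field.
apply: ler_normcD.
  rewrite !E1 -cintB; [|exact: continuous_shiftr..].
  apply: le_trans (normc_cint (B := e / 4) _ (ltW L0) _) _.
  - apply: continuousBc; exact: continuous_shiftr.
  - by move=> x _; exact: Hu.
  - by rewrite subr0; lra.
apply: le_trans (cint_move u cf HB (ltW L0)) _.
have := HK _ uU; move: LL; rewrite ler_pdivrMr// => LL uK.
have : 4 * B * `|u| <= 4 * B * K by rewrite ler_wpM2l// mulr_ge0// ltW.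
lra.
Qed.

(** All averages over intervals of one suitable length [L] are close to the average over [[0, L]];
    chopping carries this over to all long intervals. *)
Lemma tb_almost_mean f e : continuous f -> tb f -> 0 < e -> exists m,
  exists2 L0 : R, 0 < L0 &
  forall L, L0 <= L -> forall a, N (cint f a (a + L) - L%:C * m) <= e * L.
Proof.
move=> cf tf e0; have [B B0 HB] := tb_bounded tf.
have e20 : 0 < e / 2 by rewrite divr_gt0.
have [L L0 HL] := cint_translate_close cf tf HB B0 e20.
pose m : C := L^-1%:C * cint f 0 L; exists m.
pose B' := B + N m.
have B'0 : 0 < B' by rewrite ltr_pwDl// normc_ge0.
have cc : continuous (fun _ : R => m) by exact: continuous_cstc.
have ch : continuous (fun x => f x - m) by exact: continuousBc.
have E a X : 0 <= X -> cint (fun x => f x - m) a (a + X) = cint f a (a + X) - X%:C * m.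
  by move=> X0; rewrite cintB// cint_cst ?lerDl// addrAC subrr add0r.
have LC : L%:C != 0 :> C by rewrite -normc0P normcR normr_eq0 gt_eqF.
have H := @cint_chop _ (fun x => f x - m) L (e / 2) B' ch L0 (ltW e20).
exists (4 * B' * L / e); first by rewrite divr_gt0// !mulr_gt0.
move=> X XX a.
have X0 : 0 < X by apply: lt_le_trans XX; rewrite divr_gt0// !mulr_gt0.
rewrite -E ?(ltW X0)//; apply: (le_trans (H _ _ a X (ltW X0))).
- by move=> x; apply: le_trans (ler_normcB _ _) _; rewrite lerD2r.
- move=> b; rewrite E ?(ltW L0)// (_ : L%:C * m = cint f 0 L).
    exact: HL.
  by rewrite /m mulrA -rmorphM /= divff ?gt_eqF// mul1r.
- by move: XX; rewrite ler_pdivrMr// => XX; lra.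
Qed.

Lemma tb_has_mean f : continuous f -> tb f -> exists m, has_mean f m.
Proof.
move=> cf tf.
have am e : 0 < e -> exists m, exists2 L0 : R, 0 < L0 & forall L, L0 <= L ->
    N (L^-1%:C * cint f 0 L - m) <= e /\
    forall a, N (cint f a (a + L) - L%:C * m) <= e * L.
  move=> e0; have [m [L0 L00 H]] := tb_almost_mean cf tf e0.
  exists m; exists L0 => // L LL; split; last exact: H.
  have Lp : 0 < L by exact: lt_le_trans LL.
  have := H L LL 0; rewrite add0r.
  have -> : cint f 0 L - L%:C * m = L%:C * (L^-1%:C * cint f 0 L - m).
    by rewrite mulrBr mulrA -rmorphM /= divff ?gt_eqF// mul1r.
  by rewrite Normc.normcM normcR gtr0_norm// mulrC ler_pM2r.
(* [p] is [Re] or [Im]: the Cauchy criterion is applied to each real component. *)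
have part (p : C -> R) : (forall z w, `|p z - p w| <= N (z - w)) ->
    exists l, forall e, 0 < e -> exists X0 : R, forall X, X0 <= X ->
    `|p (X^-1%:C * cint f 0 X) - l| <= e.
  move=> Hp; apply: cvg_pinfty_cauchy => e e0.
  have e20 : 0 < e / 2 by rewrite divr_gt0.
  have [m [L0 _ H]] := am _ e20; exists L0 => X Y HX HY.
  apply: le_trans (Hp _ _) _.
  rewrite (_ : _ - _ = (X^-1%:C * cint f 0 X - m) - (Y^-1%:C * cint f 0 Y - m)); last by ring.
  by apply: le_trans (ler_normcB _ _) _; rewrite (splitr e) lerD//; apply: (H _ _).1.
have [|lr Hr] := part Re; first by move=> z w; rewrite -ReN -ReD ler_Re_normc.
have [|li Hi] := part Im; first by move=> z w; rewrite -ImN -ImD ler_Im_normc.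
exists (lr +i* li) => e e0.
have e40 : 0 < e / 4 by rewrite divr_gt0.
have [m [L0 L00 H]] := am _ e40; have [X1 H1] := Hr _ e40; have [X2 H2] := Hi _ e40.
exists L0 => // L LL a; have Lp : 0 < L by exact: lt_le_trans LL.
pose X := Num.max L0 (Num.max X1 X2).
have mX : N (m - (lr +i* li)) <= 3 / 4 * e.
  have [|h _] := H X; first by rewrite le_max lexx.
  have h1 : `|Re (X^-1%:C * cint f 0 X) - lr| <= e / 4.
    by apply: H1; rewrite !le_max lexx orbT.
  have h2 : `|Im (X^-1%:C * cint f 0 X) - li| <= e / 4.
    by apply: H2; rewrite !le_max lexx !orbT.
  set v := X^-1%:C * cint f 0 X in h h1 h2.
  rewrite (_ : m - _ = (v - (lr +i* li)) - (v - m)); last by ring.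
  apply: le_trans (ler_normcB _ _) _.
  have : N (v - (lr +i* li)) <= e / 4 + e / 4.
    apply: le_trans (normc_le_ReIm _) _; rewrite ReD ImD ReN ImN /=; exact: lerD.
  lra.
rewrite (_ : _ - _ = (cint f a (a + L) - L%:C * m) + L%:C * (m - (lr +i* li))); last by ring.
have -> : e * L = e / 4 * L + L * (3 / 4 * e) by field.
apply: ler_normcD; first exact: (H L LL).2.
by rewrite Normc.normcM normcR gtr0_norm// ler_wpM2l// ltW.
Qed.

Lemma has_meanD f g m m' : continuous f -> continuous g -> has_mean f m ->
  has_mean g m' -> has_mean (fun x => f x + g x) (m + m').
Proof.
move=> cf cg H H' e e0; have e20 : 0 < e / 2 by rewrite divr_gt0.
have [L0 L00 HL] := H _ e20; have [L1 L10 HL'] := H' _ e20.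
exists (Num.max L0 L1) => [|L]; first by rewrite lt_max L00.
rewrite ge_max => /andP[h h'] a.
rewrite cintD// (_ : _ - _ = (cint f a (a + L) - L%:C * m) + (cint g a (a + L) - L%:C * m')); last by ring.
by rewrite (splitr e) mulrDl; apply: ler_normcD; [exact: HL|exact: HL'].
Qed.

Lemma has_meanZ f m (k : C) : continuous f -> has_mean f m ->
  has_mean (fun x => k * f x) (k * m).
Proof.
move=> cf H e e0; have k0 : 0 < N k + 1 by rewrite ltr_wpDl ?normc_ge0.
have e20 : 0 < e / (N k + 1) by rewrite divr_gt0.
have [L0 L00 HL] := H _ e20; exists L0 => // L LL a.
rewrite cintZ// (_ : _ - _ = k * (cint f a (a + L) - L%:C * m)); last by ring.
have Lp : 0 < L by exact: lt_le_trans LL.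
rewrite Normc.normcM; apply: le_trans (ler_wpM2l (normc_ge0 _) (HL _ LL a)) _.
rewrite mulrA ler_pM2r// mulrCA ger_pMr// ler_pdivrMr// mul1r.
by rewrite lerDl.
Qed.

Lemma has_mean_limit f m : continuous f -> (forall e, 0 < e -> exists g, exists2 m',
  [/\ continuous g, has_mean g m' & forall x, N (f x - g x) <= e] & N (m - m') <= e) ->
  has_mean f m.
Proof.
move=> cf H e e0; have e40 : 0 < e / 4 by rewrite divr_gt0.
have [g [m' [cg gm' fg] mm']] := H _ e40.
have [L0 L00 HL] := gm' _ e40; exists L0 => // L LL a.
have Lp : 0 < L by exact: lt_le_trans LL.
rewrite (_ : _ - _ = (cint f a (a + L) - cint g a (a + L)) +
  ((cint g a (a + L) - L%:C * m') - L%:C * (m - m'))); last by ring.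
have -> : e * L = e / 2 * L + (e / 4 * L + L * (e / 4)) by field.
apply: ler_normcD.
  rewrite -cintB//; apply: le_trans (normc_cint (B := e / 4) _ _ (fun x _ => fg x)) _.
  - exact: continuousBc.
  - by rewrite lerDl ltW.
  - lra.
apply: le_trans (ler_normcB _ _) _; apply: lerD; first exact: HL.
by rewrite Normc.normcM normcR gtr0_norm// ler_wpM2l// ltW.
Qed.

(** For [l != 0] the integral over any interval is at most [2 / N w], whatever its length. *)
Lemma has_mean_e1 (l : R) : has_mean (fun x => e1 (l * x)) (l == 0)%:R.
Proof.
have [->|l0] := eqVneq l 0.
  move=> e e0; exists 1 => // L L1 a.
  have L0 : 0 < L by exact: lt_le_trans L1.
  have -> : cint (fun x : R => e1 (0 * x)) a (a + L) = L%:C * 1 :> C.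
    rewrite /cint; under eq_cintegral do rewrite mul0r e1_0.
    by rewrite -/(cint (fun=> 1) a (a + L)) cint_cst ?lerDl ?ltW// addrAC subrr add0r.
  by rewrite subrr Normc.normc0 mulr_ge0 ?ltW.
move=> e e0; pose w : C := 0 +i* (2 * pi * l).
have w0 : w != 0.
  by rewrite eq_complex /= eqxx /= !mulf_neq0// gt_eqF// pi_gt0.
have W0 : 0 < N w by rewrite normc_gt0.
exists (2 / N w / e); first by rewrite !divr_gt0.
move=> L LL a; rewrite mulr0 subr0.
have L0 : 0 < L by apply: lt_le_trans LL; rewrite !divr_gt0.
rewrite /cint; under eq_cintegral do rewrite e1_expo.
rewrite cintegral_expo ?lerDl ?(ltW L0)// Normc.normcM Normc.normcV -!e1_expo.
apply: le_trans (_ : 2 / N w <= _); last by move: LL; rewrite ler_pdivrMr// [L * e]mulrC.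
rewrite ler_pM2r ?invr_gt0//; apply: le_trans (ler_normcB _ _) _.
by rewrite !normc_e1.
Qed.

Lemma has_mean_cvg f m : has_mean f m ->
  ((2 * T)^-1%:C * cint f (- T) T) @[T --> +oo%R] --> m.
Proof.
move=> H; apply/cvg_normcP => e e0; have e20 : 0 < e / 2 by rewrite divr_gt0.
have [L0 L00 HL] := H _ e20; near=> T.
have TL : L0 <= T by near: T; apply: nbhs_pinfty_ge; exact: num_real.
have T0 : 0 < T by exact: lt_le_trans TL.
have T20 : 0 < 2 * T by rewrite mulr_gt0.
have := HL (2 * T) _ (- T); rewrite (_ : - T + 2 * T = T); last by ring.
have TT : L0 <= 2 * T by lra.
move=> /(_ TT).
have -> : cint f (- T) T - (2 * T)%:C * m = (2 * T)%:C * ((2 * T)^-1%:C * cint f (- T) T - m).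
  by rewrite mulrBr mulrA -rmorphM /= divff ?gt_eqF// mul1r.
rewrite Normc.normcM normcR gtr0_norm// mulrC ler_pM2r// normcB => h.
by apply: le_lt_trans h _; lra.
Unshelve. all: by end_near. Qed.

End Means.

(** * Bohr's condition, and means that vanish uniformly in the frequency *)

Section Bohr.
Variable R : realType.
Local Notation C := (cplx R).
Local Notation N := (@Normc.normc R).
Local Notation mu := (@lebesgue_measure R).
Local Notation mR := (measurableTypeR R).
Implicit Types (f g h : R -> C) (a b c L X e : R) (m : C).

Lemma ap_translations f e : almost_periodic f -> 0 < e ->
  exists2 S : set R, relatively_dense S & forall t, S t -> close_translates e f t 0.
Proof.
move=> [_ H] e0; have [S rS HS] := H _ e0; exists S => // t St x.
rewrite addr0 -lee_fin; apply: le_trans (ltW (HS t St)).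
by apply: ereal_sup_ubound; exists x.
Qed.

(** An almost period carries [x] into a fixed compact interval, where uniform continuity is
    available. *)
Lemma ap_uniform_continuity f e : almost_periodic f -> 0 < e ->
  exists2 d : R, 0 < d & forall x s, `|s| <= d -> N (f (x + s) - f x) <= e.
Proof.
move=> apf e0; have e30 : 0 < e / 3 by rewrite divr_gt0.
have [S [l l0 Sl] HS] := ap_translations apf e30.
have [d d0 Hd] := compact_uniform_continuity 0 l apf.1 e30.
exists d => // x s sd; have [t [St]] := Sl (- x).
rewrite /= in_itv /= => /andP[t1 t2].
have := HS t St (x + s); have := HS t St x; rewrite !addr0 => h1 h2.
have h3 : N (f (x + t + s) - f (x + t)) <= e / 3 by apply: Hd => //; apply/andP; lra.
rewrite (_ : _ - _ = (f (x + t + s) - f (x + t)) + ((f (x + t) - f x) - (f (x + s + t) - f (x + s)))).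
  have -> : e = e / 3 + (e / 3 + e / 3) by field.
  by apply: ler_normcD => //; apply: ler_normcD => //; rewrite normcN.
by rewrite (addrAC x t s); ring.
Qed.

(** An almost period brings [t] into [[0, l]], where uniform continuity replaces it by a multiple of
    [d]. *)
Lemma ap_tb f : almost_periodic f -> tb f.
Proof.
move=> apf e e0; have e20 : 0 < e / 2 by rewrite divr_gt0.
have [S [l l0 Sl] HS] := ap_translations apf e20.
have [d d0 Hd] := ap_uniform_continuity apf e20.
pose K := (Num.truncn (l / d)).+1.
exists [seq k%:R * d | k <- iota 0 K] => t.
have [r [Sr]] := Sl (- t); rewrite /= in_itv /= => /andP[r1 r2].
have rd : 0 <= (t + r) / d by rewrite divr_ge0 ?(ltW d0)//; lra.
have /andP[k1 k2] := truncn_itv rd; set k := Num.truncn _ in k1 k2.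
have kK : k \in iota 0 K.
  rewrite mem_iota /= add0n /K ltnS.
  by apply: le_truncn; rewrite ler_pM2r ?invr_gt0//; lra.
exists (k%:R * d); first exact: (map_f (fun k : nat => k%:R * d) kK).
move=> x; have := HS r Sr (x + t); rewrite addr0 => h1.
have h2 : N (f (x + k%:R * d + (t + r - k%:R * d)) - f (x + k%:R * d)) <= e / 2.
  apply: Hd; rewrite ger0_norm; last by rewrite subr_ge0 -ler_pdivlMr.
  by move: k2; rewrite ltr_pdivrMr// -natr1 mulrDl mul1r; lra.
rewrite (_ : _ - _ = (f (x + k%:R * d + (t + r - k%:R * d)) - f (x + k%:R * d)) -
   (f (x + t + r) - f (x + t))).
  by apply: le_trans (ler_normcB _ _) _; rewrite (splitr e) lerD.
have -> : x + k%:R * d + (t + r - k%:R * d) = x + t + r by ring.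
by ring.
Qed.

(** If the translate by [t] is close to the one by [u], then [t - u] is an almost period. The net
    being bounded by [K], every interval of length [2 * K + 2] contains such a difference. *)
Lemma tb_ap f : continuous f -> tb f -> almost_periodic f.
Proof.
move=> cf tf; split=> // e e0; have e20 : 0 < e / 2 by rewrite divr_gt0.
have [U HU] := tf _ e20; have [K K0 HK] := ub_seq U.
exists [set t | close_translates (e / 2) f t 0].
  exists (2 * K + 2); first by rewrite addr_gt0// mulr_gt0.
  move=> x; have [u uU Hu] := HU (x + K + 1); exists (x + K + 1 - u).
  have := HK u uU; rewrite ler_norml => /andP[u1 u2].
  split; last by rewrite /= in_itv /=; apply/andP; lra.
  move=> y; have := Hu (y - u); rewrite addr0 subrK.
  by rewrite (_ : y - u + _ = y + (x + K + 1 - u)) //; ring.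
move=> t St; apply: (@le_lt_trans _ _ (e / 2)%:E); last by rewrite lte_fin; lra.
apply: ub_ereal_sup => _ [x _ <-]; rewrite lee_fin.
by have := St x; rewrite addr0.
Qed.

(** Compactness of [[- M, M]]. For [l] near [l0], the factor [e1 ((l0 - l) * (x - a))] stays close
    to 1 over an interval of length [L], so the estimate at [l0] persists on intervals of that
    length; chopping extends it to all large [X]. *)
Lemma uniform_zero_mean h (M e : R) : continuous h -> tb h ->
  (forall l, `|l| <= M -> has_mean (fun x => h x * e1 (- l * x)) 0) -> 0 < e ->
  exists2 X0 : R, 0 < X0 & forall X, X0 <= X -> forall l, `|l| <= M -> forall a,
    N (cint (fun x => h x * e1 (- l * x)) a (a + X)) <= e * X.
Proof.
move=> ch th H e0; have [B B0 HB] := tb_bounded th.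
have e20 : 0 < e / 2 by rewrite divr_gt0.
have e40 : 0 < e / 4 by rewrite divr_gt0.
have pi0 := @pi_gt0 R.
have ce (l : R) : continuous (fun x => h x * e1 (- l * x)).
  by apply: continuousMc; [exact: ch|exact: continuous_e1].
have bh (l : R) x : N (h x * e1 (- l * x)) <= B by rewrite Normc.normcM normc_e1 mulr1.
have /compact_near_coveringP cov := @segment_compact R (- M) M.
have [X1 [_ HX]] : \forall X \near +oo%R, `[- M, M] `<=` [set l | forall a,
     N (cint (fun x => h x * e1 (- l * x)) a (a + X)) <= e * X].
  apply: (cov _ +oo%R (fun X l => forall a, N (cint (fun x => h x * e1 (- l * x)) a (a + X)) <= e * X)).
  move=> l0 /=; rewrite in_itv /= -ler_norml => l0M.
  have [L L0 HL] := H l0 l0M _ e40.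
  have {HL} HL a : N (cint (fun x => h x * e1 (- l0 * x)) a (a + L)) <= e / 4 * L.
    by have := HL L (lexx L) a; rewrite mulr0 subr0.
  (* For [|l - l0| < d] the replacement error over an interval of length [L] is at most
     [4 * pi * B * d * L ^+ 2], which is [e / 4 * L]. *)
  pose d := e / (16 * B * pi * L).
  have d0 : 0 < d by rewrite divr_gt0// !mulr_gt0.
  exists (ball l0 d, [set X | 4 * B * L / e <= X]).
    split => /=; first exact: nbhsx_ballx.
    by apply: nbhs_pinfty_ge; exact: num_real.
  move=> [l X] /= []; rewrite -ball_normE /ball_ /= => ll XX b.
  have X0 : 0 <= X by apply: le_trans XX; rewrite divr_ge0 ?(ltW e0)// !mulr_ge0 ?(ltW B0) ?(ltW L0).
  have key a : N (cint (fun x => h x * e1 (- l * x)) a (a + L)) <= e / 2 * L.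
    have aL : a <= a + L by rewrite lerDl ltW.
    have -> : cint (fun x => h x * e1 (- l * x)) a (a + L) =
      e1 ((l0 - l) * a) * (cint (fun x => h x * e1 (- l0 * x)) a (a + L) +
      cint (fun x => h x * e1 (- l0 * x) * (e1 ((l0 - l) * (x + - a)) - 1)) a (a + L)).
      have c1 : continuous (fun x => e1 ((l0 - l) * (x + - a)) : C).
        by have := @continuous_shiftr _ _ (- a) (@continuous_e1 R (l0 - l)).
      have c2 : continuous (fun x : R => e1 ((l0 - l) * (x + - a)) - 1 : C).
        by apply: continuousBc; [exact: c1|exact: continuous_cstc].
      have c3 : continuous (fun x => h x * e1 (- l0 * x) * (e1 ((l0 - l) * (x + - a)) - 1)).
        by apply: continuousMc; [exact: ce|exact: c2].
      rewrite -(cintD _ _ (ce l0) c3) -(cintZ _ _ _ (continuousDc (ce l0) c3)).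
      apply: eq_cintegral => x _.
      have -> : - l * x = (l0 - l) * a + (- l0 * x + (l0 - l) * (x + - a)) by ring.
      by rewrite !e1D; ring.
    rewrite Normc.normcM normc_e1 mul1r.
    have -> : e / 2 * L = e / 4 * L + e / 4 * L by field.
    apply: ler_normcD; first exact: HL.
    apply: le_trans (normc_cint (B := B * (2 * pi * (d * L))) _ aL _) _.
    - apply: continuousMc; first exact: ce.
      apply: continuousBc; last exact: continuous_cstc.
      by have := @continuous_shiftr _ _ (- a) (@continuous_e1 R (l0 - l)).
    - move=> x /andP[x1 x2]; rewrite Normc.normcM ler_pM ?normc_ge0//.
      apply: le_trans (normc_e1_sub1 _) _; rewrite ler_wpM2l ?mulr_ge0 ?(ltW pi0)//.
      rewrite normrM ler_pM// ?(ltW ll)// ger0_norm; lra.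
    - rewrite addrAC subrr add0r /d; move: (@pi R) pi0 => P P0.
      by rewrite [leLHS](_ : _ = e / 4 * L)//; field; rewrite !gt_eqF.
  apply: le_trans (cint_chop (ce l) L0 (ltW e20) (bh l) key b X0) _.
  by move: XX; rewrite ler_pdivrMr// => XX; lra.
exists (`|X1| + 1); first by rewrite ltr_wpDl.
move=> X XX l lM a; apply: (HX X); last by rewrite /= in_itv /= -ler_norml.
by apply: lt_le_trans XX; rewrite ltr_pwDr// ler_norm.
Qed.

Lemma pigeonhole (T : eqType) (U : seq T) (cl : nat -> T) (s : seq nat) :
  (forall j, cl j \in U) -> (0 < size s)%N ->
  exists2 u, u \in U & (size s <= count (fun j => cl j == u) s * size U)%N.
Proof.
move=> H s0.
have H1 : (size s <= \sum_(u <- U) count (fun j => cl j == u) s)%N.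
  elim: s {s0} => //= j s IH; rewrite big_split /= -addn1 addnC leq_add//.
  by rewrite (big_rem (cl j))//= eqxx.
apply/hasP; case: (boolP (has _ U)) => // /hasPn nU.
have U0 : (0 < size U)%N by have := H 0%N; case: (U).
suff : (\sum_(u <- U) count (fun j => cl j == u) s * size U < size U * size s)%N.
  by rewrite -big_distrl /= [X in (X < _)%N]mulnC ltn_mul2l [X in _ && X]ltnNge H1 andbF.
apply: (@leq_ltn_trans (\sum_(u <- U) (size s).-1)%N).
  rewrite big_seq [leqRHS]big_seq; apply: leq_sum => u /nU.
  by rewrite -ltnNge -{1}(prednK s0) ltnS.
by rewrite big_const_seq count_predT iter_addn_0 mulnC ltn_mul2l U0 ltn_predL.
Qed.

End Bohr.

(** * Almost periodic functions with a spectral gap *)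

Section SpectralGap.
Variable R : realType.
Local Notation C := (cplx R).
Local Notation N := (@Normc.normc R).
Local Notation Re := (@complex.Re R).
Local Notation Im := (@complex.Im R).
Local Notation mu := (@lebesgue_measure R).
Local Notation mR := (measurableTypeR R).
Implicit Types (f g h u theta : R -> C) (e s : R).

(** The squared modulus of an exponential sum over [S], see [dirichlet2E]; the double sum is the
    form in which it arises from shifts by differences of elements of [S]. *)
Definition dirichlet2 (S : seq nat) (t : R) : C :=
  \sum_(i <- S) \sum_(j <- S) e1 ((i%:R - j%:R) * t).

Lemma dirichlet2E S t : dirichlet2 S t = (N (\sum_(i <- S) e1 (i%:R * t)) ^+ 2)%:C.
Proof.
have H (w : C) : (N w ^+ 2)%:C = w * w^*.
  by rewrite normc_sqr; apply: complex_ext; rewrite ?ReM ?ImM /=; case: w => x y /=; ring.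
transitivity ((\sum_(i <- S) e1 (i%:R * t) : C) * \sum_(j <- S) e1 (- (j%:R * t))); last first.
  rewrite H; congr (_ * _); apply/esym; rewrite (rmorph_sum (@conjc R)).
  by apply: eq_bigr => j _; exact: conj_e1.
rewrite /dirichlet2 big_distrl /=; apply: eq_bigr => i _.
rewrite big_distrr /=; apply: eq_bigr => j _.
by rewrite -e1D -mulNr -mulrDl.
Qed.

Lemma continuous_sumc (I : Type) (r : seq I) (f : I -> R -> C) :
  (forall i, continuous (f i)) -> continuous (fun x => \sum_(i <- r) f i x).
Proof.
move=> cf; elim: r => [|i r IH].
  by under eq_fun do rewrite big_nil; exact: continuous_cstc.
under eq_fun do rewrite big_cons.
by apply: continuousDc; [exact: cf|exact: IH].
Qed.

Lemma continuous_dirichlet2 S : continuous (dirichlet2 S).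
Proof. by do 2! apply: continuous_sumc => ?; exact: continuous_e1. Qed.

Lemma cint_e1_int (k : int) (m : nat) :
  cint (fun t => e1 (k%:~R * t)) (- m%:R) m%:R = (2 * m%:R * (k == 0)%:R)%:C :> C.
Proof.
have mm : - m%:R <= m%:R :> R by rewrite (@le_trans _ _ 0) ?oppr_le0 ?ler0n.
have [->|k0] := eqVneq k 0.
  rewrite /cint; under eq_cintegral do rewrite mul0r e1_0.
  rewrite -/(cint (fun=> 1) (- m%:R) m%:R) cint_cst// !mulr1; congr (_ %:C); ring.
rewrite /cint; under eq_cintegral do rewrite e1_expo.
rewrite cintegral_expo//; last first.
  by rewrite eq_complex /= eqxx /= !mulf_neq0 ?intr_eq0// gt_eqF// pi_gt0.
rewrite -!e1_expo mulrN.
have e1m : e1 (k%:~R * m%:R) = 1 :> C by rewrite -[m%:R]/(m%:~R) -intrM e1_int.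
by rewrite -conj_e1 e1m conj_RC subrr mul0r mulr0.
Qed.

(** Orthogonality over whole periods leaves the diagonal. The mass is linear in [size S], although
    the double sum has [size S] squared terms: this is the gain of the averaging. *)
Lemma cint_dirichlet2 (S : seq nat) (m : nat) : uniq S ->
  cint (dirichlet2 S) (- m%:R) m%:R = (2 * m%:R * (size S)%:R)%:C.
Proof.
move=> uS; have mI : measurable (`[- m%:R, m%:R]%classic : set mR) by exact: measurable_itv.
have ci l : cintegrable mu (`[- m%:R, m%:R]%classic : set mR) (fun t : R => e1 (l * t)).
  by apply: cintegrable_itv; exact: continuous_e1.
rewrite /cint /dirichlet2 cintegral_sum//; last by move=> i; exact: cintegrable_sum.
transitivity (\sum_(i <- S) (2 * m%:R : R)%:C).
  rewrite big_seq [RHS]big_seq; apply: eq_bigr => i iS.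
  rewrite cintegral_sum// (bigD1_seq i)//= big1 => [|j ji].
    by rewrite subrr addr0 (_ : 0 = 0%:~R)// -/(cint _ _ _) cint_e1_int mulr1.
  rewrite (_ : i%:R - j%:R = (i%:Z - j%:Z)%:~R); last by rewrite rmorphB.
  by rewrite -/(cint _ _ _) cint_e1_int subr_eq0 eqz_nat eq_sym (negbTE ji) mulr0.
by rewrite big_const_seq count_predT iter_addr_0 -(raddfMn (real_complex R)) -[_ *+ size S]mulr_natr.
Qed.

Lemma cintegrable_mul u f (b : R) : cintegrable mu (setT : set mR) u ->
  continuous f -> (forall x, N (f x) <= b) ->
  cintegrable mu (setT : set mR) (fun x => u x * f x).
Proof.
move=> iu cf fb; apply: (@cintegrable_dom _ _ _ _ _ _ (fun x : mR => b * N (u x))).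
- exact: measurableT.
- apply: cmeasurableM; first exact: cintegrable_measurable iu.
  by apply: cmeasurable_continuous; first exact: measurableT.
- by apply: rintegrableZ => //; exact: cintegrable_norm.
- by move=> x _; rewrite Normc.normcM mulrC ler_wpM2r ?normc_ge0.
Qed.

Section Pairing.
Variables (theta : R -> C) (M : R).
Hypotheses (ttheta : test_function theta) (stheta : csupp theta M).
Let psi (x : R) : C := ft theta (- x).

Lemma test_ft_line : continuous psi /\ exists2 c : R, 0 <= c & forall x,
  N (psi x) <= c * ((1 + x ^+ 2) ^+ 2)^-1.
Proof.
have [h1 /(_ 2%N)[c c0 h2]] := test_fourier_line 0 ttheta.
have E : (fun x : R => fourier theta (x +i* 0)) = psi.
  by apply/funext => x; rewrite fourier_ft gauge0.
rewrite -E; split=> //; exists c => // x; exact: h2.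
Qed.

Lemma itheta : cintegrable mu (setT : set mR) theta.
Proof. exact: csupp_cintegrable (test_continuous ttheta) stheta. Qed.

Lemma ft_modulate s x : ft theta (s - x) = ft (fun t => theta t * e1 (s * t)) (- x).
Proof. by apply: eq_cintegral => t _; rewrite mulrDl e1D mulrA. Qed.

Lemma ft_bounded u : cintegrable mu (setT : set mR) u ->
  exists b : R, forall x, N (ft u x) <= b.
Proof.
move=> iu; exists (2 * Rintegral mu (setT : set mR) (fun t => N (u t))) => x.
apply: normc_cintegral; first exact: measurableT.
- by apply: cintegrable_measurable; exact: cintegrableMe1.
- by apply: cintegrable_norm => //; exact: measurableT.
- by move=> t _; rewrite Normc.normcM normc_e1 mulr1.
Qed.

(** A shift of [u] becomes a modulation of [theta] on the transform side, and the modulations add up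
    to [dirichlet2]. *)
Lemma sum_shifted_pairing u (S : seq nat) : cintegrable mu (setT : set mR) u ->
  \sum_(i <- S) \sum_(j <- S)
    cintegral mu (setT : set mR) (fun x => u (x + (i%:R - j%:R)) * psi x) =
  cintegral mu (setT : set mR)
    (fun t => ft (fun x => u (- x)) t * (theta t * dirichlet2 S t)).
Proof.
move=> iu; have ct := test_continuous ttheta.
have cte s : continuous (fun t => theta t * e1 (s * t)).
  by apply: continuousMc; [exact: ct|exact: continuous_e1].
have ite s : cintegrable mu (setT : set mR) (fun t => theta t * e1 (s * t)).
  exact: cintegrableMe1 itheta.
have cft s : continuous (fun x : R => ft (fun t => theta t * e1 (s * t)) (- x)).
  move=> x; apply: (@continuous_comp _ _ _ (fun x : R => - x) (ft _)).
    by apply: cvgN; exact: cvg_id.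
  by apply: (ft_continuous (ite s) (M := M)); exact: csuppM.
have iuf s : cintegrable mu (setT : set mR)
    (fun x => u x * ft (fun t => theta t * e1 (s * t)) (- x)).
  have [b Hb] := ft_bounded (ite s); 
  by apply: (cintegrable_mul (b := b) iu (cft s)) => x; exact: Hb.
have E s : cintegral mu (setT : set mR) (fun x => u (x + s) * psi x) =
    cintegral mu (setT : set mR) (fun x => u x * ft (fun t => theta t * e1 (s * t)) (- x)).
  rewrite -(cintegral_shift s (iuf s)); apply: eq_cintegral => x _.
  by rewrite -ft_modulate /psi opprD addrCA subrr addr0.
have mT := @measurableT _ mR.
under eq_bigr do under eq_bigr do rewrite E.
have ED : cintegral mu (setT : set mR) (fun x => u x * ft (fun t => theta t * dirichlet2 S t) (- x))
   = \sum_(i <- S) \sum_(j <- S) cintegral mu (setT : set mR)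
     (fun x => u x * ft (fun t => theta t * e1 ((i%:R - j%:R) * t)) (- x)).
  under [RHS]eq_bigr do rewrite -cintegral_sum//.
  rewrite -cintegral_sum//; last by move=> i; exact: cintegrable_sum.
  apply: eq_cintegral => x _; under eq_bigr do rewrite -mulr_sumr.
  rewrite -mulr_sumr; congr (_ * _).
  rewrite /ft; under eq_cintegral do rewrite /dirichlet2 mulr_sumr mulr_suml.
  rewrite cintegral_sum//.
    apply: eq_bigr => i _; under eq_cintegral do rewrite mulr_sumr mulr_suml.
    by rewrite cintegral_sum// => j; exact: cintegrableMe1.
  move=> i; apply: (@eq_cintegrable _ _ _ _ _ (fun t : mR => \sum_(j <- S)
     (theta t * e1 ((i%:R - j%:R) * t) * e1 (- x * t)))) => //.
    by move=> t _; rewrite mulr_sumr mulr_suml.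
  by apply: cintegrable_sum => // j; exact: cintegrableMe1.
rewrite -ED; set v := fun t => theta t * dirichlet2 S t.
have cv : continuous v by apply: continuousMc; [exact: ct|exact: continuous_dirichlet2].
have sv : csupp v M by exact: csuppM.
have iv := csupp_cintegrable cv sv.
rewrite -(ft_multiplication (cintegrable_opp iu) iv).
rewrite -[RHS]cintegral_opp.
  by apply: eq_cintegral => x _; rewrite opprK.
have [b Hb] := ft_bounded iv.
exact: (cintegrable_mul (cintegrable_opp iu) (ft_continuous iv sv) Hb).
Qed.

(** Where [x + s] lies in the window, the error is [e], as [s] is almost a period. Elsewhere
    [|x| >= J] because [|s| <= J], and half of the decay of [psi] gives the factor
    [1 / (1 + J ^+ 2)]. *)
Lemma window_close h (B c e : R) (J : R) s : continuous h -> (forall x, N (h x) <= B) ->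
  (forall x, N (psi x) <= c * ((1 + x ^+ 2) ^+ 2)^-1) -> 0 <= c -> 0 <= e -> 0 <= J ->
  `|s| <= J -> (forall x, N (h (x + s) - h x) <= e) ->
  N (cintegral mu (setT : set mR) (fun x => h x * psi x) -
     cintegral mu (setT : set mR)
       (fun x => crestrict (`[- (2 * J), 2 * J]%classic : set mR) h (x + s) * psi x)) <=
  2 * ((e + B / (1 + J ^+ 2)) * c * Rintegral mu (setT : set mR) (fun x : R => (1 + x ^+ 2)^-1)).
Proof.
move=> ch HB Hc c0 e0 J0 sJ He; have mT := @measurableT _ mR.
have B0 : 0 <= B := le_trans (normc_ge0 _) (HB 0).
have [cpsi _] := test_ft_line.
have p (x : R) : 0 < 1 + x ^+ 2 by rewrite ltr_pwDl ?sqr_ge0.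
have p1 (x : R) : 1 <= 1 + x ^+ 2 by rewrite lerDl sqr_ge0.
have Hc1 x : N (psi x) <= c * (1 + x ^+ 2)^-1.
  apply: le_trans (Hc x) _; rewrite ler_wpM2l// lef_pV2 ?posrE ?exprn_gt0//.
  by rewrite [leRHS]expr2 ler_pMr.
have bpsi x : N (psi x) <= c.
  by apply: le_trans (Hc1 x) _; rewrite ler_piMr// invf_le1.
have i1 : cintegrable mu (setT : set mR) (fun x => h x * psi x).
  apply: (@cintegrable_cauchy _ _ (B * c)).
    by apply: continuousMc; [exact: ch|exact: cpsi].
  by move=> x; rewrite Normc.normcM -mulrA ler_pM ?normc_ge0.
have i2 : cintegrable mu (setT : set mR)
    (fun x => crestrict (`[- (2 * J), 2 * J]%classic : set mR) h (x + s) * psi x).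
  apply: (cintegrable_mul (b := c)) => //; apply: cintegrable_shift.
  by apply/(cintegrable_restrict mu h (measurable_itv _)); exact: cintegrable_itv.
rewrite -cintegralB// -RintegralZl//; last exact: rintegrable_cauchy.
apply: normc_cintegral => //.
- exact: cintegrable_measurable (cintegrableB mT i1 i2).
- exact: rintegrable_cauchyZ.
move=> x _; rewrite -mulrBl Normc.normcM /crestrict.
have -> : (x + s \in (`[- (2 * J), 2 * J]%classic : set R)) = (`|x + s| <= 2 * J).
  by rewrite mem_setE in_itv /= -ler_norml.
have q0 : 0 <= B / (1 + J ^+ 2) by rewrite divr_ge0// ltW.
have [xs|xs] := leP `|x + s| (2 * J).
  rewrite normcB -mulrA ler_pM ?normc_ge0//.
  by apply: le_trans (He x) _; rewrite lerDl.
rewrite subr0; apply: (@le_trans _ _ (B * (c * ((1 + x ^+ 2) ^+ 2)^-1))).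
  by rewrite ler_pM ?normc_ge0.
have Jx : J <= `|x| by have := ler_normD x s; lra.
have Jx2 : (1 + x ^+ 2)^-1 <= (1 + J ^+ 2)^-1.
  rewrite lef_pV2 ?posrE// lerD2l -(real_normK (num_real x)).
  by rewrite ler_sqr ?nnegrE.
rewrite mulrA expr2 invfM mulrA ler_wpM2r ?invr_ge0 ?(ltW (p x))//.
rewrite mulrAC ler_wpM2r//; apply: (@le_trans _ _ (B / (1 + J ^+ 2))).
  by rewrite ler_wpM2l.
by rewrite lerDr.
Qed.

(** On the support of [theta] the product [ft u * theta] is at most [E * T], and the remaining
    factor is nonnegative with an explicit mass. *)
Lemma dirichlet2_bound h u (S : seq nat) (m : nat) (E T J : R) : uniq S -> 
  0 <= E -> M <= m%:R -> (forall t, N (theta t) <= T) -> 0 <= J ->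
  cintegrable mu (setT : set mR) u ->  csupp u J ->
  (forall t, `|t| <= M -> N (ft u t) <= E) ->
  N (cintegral mu (setT : set mR) (fun t => ft u t * (theta t * dirichlet2 S t))) <=
  2 * (E * T * (2 * m%:R * (size S)%:R)).
Proof.
move=> uS E0 Mm HT J0 iu su HE.
have T0 : 0 <= T := le_trans (normc_ge0 _) (HT 0).
have cd := @continuous_dirichlet2 S.
have mI : measurable (`[- m%:R, m%:R]%classic : set mR) by exact: measurable_itv.
have iD : rintegrable mu (`[- m%:R, m%:R]%classic : set mR) (fun t => N (dirichlet2 S t)).
  by apply: cintegrable_norm => //; exact: cintegrable_itv.
have -> : (2 * m%:R * (size S)%:R) =
    Rintegral mu (`[- m%:R, m%:R]%classic : set mR) (fun t => N (dirichlet2 S t)).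
  have := cint_dirichlet2 m uS; rewrite /cint /cintegral => /(congr1 Re) /= <-.
  apply: eq_Rintegral => t _; rewrite dirichlet2E normcR /= ger0_norm//.
  exact: sqr_ge0.
have s1 : csupp (fun t => ft u t * (theta t * dirichlet2 S t)) m%:R.
  by move=> t tm; rewrite stheta ?mul0r ?mulr0// (le_lt_trans Mm).
rewrite (csupp_itv s1) -RintegralZl//; apply: normc_cintegral => //.
- apply: cmeasurable_continuous; first exact: mI.
  apply: continuousMc.
    exact: ft_continuous iu su.
  by apply: continuousMc; [exact: (test_continuous ttheta)|exact: cd].
- exact: rintegrableZ.
move=> t _; have [tM|Mt] := leP `|t| M.
  rewrite !Normc.normcM mulrA ler_wpM2r ?normc_ge0// ler_pM ?normc_ge0//.
  exact: HE.
by rewrite stheta// mul0r mulr0 Normc.normc0 !mulr_ge0 ?normc_ge0.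
Qed.

Lemma csupp_bounded (f : R -> C) K : continuous f -> csupp f K ->
  exists2 T : R, 0 <= T & forall x, N (f x) <= T.
Proof.
move=> cf sf; have [T HT] := continuous_itv_bounded (- K) K cf.
exists `|T| => // x; have [xK|Kx] := leP `|x| K.
  by rewrite (le_trans (HT x _)) ?ler_norm// -ler_norml.
by rewrite sf// Normc.normc0.
Qed.

(* Averaging [h] over the differences of a set of almost periods of positive
   density replaces [theta] by [theta] times the square of an exponential sum,
   whose mass is inversely proportional to the size of that set. *)
Lemma spectral_gap h : continuous h -> tb h ->
  (forall l, `|l| <= M -> has_mean (fun x => h x * e1 (- l * x)) 0) ->
  cintegral mu (setT : set mR) (fun x => h x * psi x) = 0.
Proof.
move=> ch th H0; set I := cintegral _ _ _.
apply/eqP; rewrite -normc0P; apply/eqP; apply: ge0_lt_eq0; first exact: normc_ge0.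
move=> e e_gt0; have [B B0 HB] := tb_bounded th.
have [cpsi [c c0 Hc]] := test_ft_line.
have [T T0 HT] := csupp_bounded (test_continuous ttheta) stheta.
pose D := c * Rintegral mu (setT : set mR) (fun x : R => (1 + x ^+ 2)^-1).
have D0 : 0 <= D.
  rewrite mulr_ge0//; apply: Rintegral_ge0 => x _.
  by rewrite invr_ge0 addr_ge0// sqr_ge0.
have D1 : 0 < D + 1 by rewrite ltr_wpDl.
pose m := (Num.truncn `|M|).+1.
have Mm : M <= m%:R.
  have /andP[_ /ltW] := truncn_itv (normr_ge0 M).
  by apply: le_trans; exact: ler_norm.
(* Differences of elements of [S] are almost periods up to [2 * eps1], which contributes
   [4 * eps1 * D <= e / 3] in [window_close]. *)
pose eps1 := e / (12 * (D + 1)).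
have eps10 : 0 < eps1 by rewrite divr_gt0// mulr_gt0.
have [U HU] := th _ eps10.
pose G := T * m%:R * (size U)%:R.
have G0 : 0 <= G by rewrite !mulr_ge0.
have G1 : 0 < G + 1 by rewrite ltr_wpDl.
pose eps2 := e / (48 * (G + 1)).
have eps20 : 0 < eps2 by rewrite divr_gt0// mulr_gt0.
have [X0 X00 HX] := uniform_zero_mean ch th H0 eps20.
(* [J > Y] makes the window long enough for [uniform_zero_mean], and the error
   [2 * B * D / (1 + J ^+ 2)] outside the window at most [e / 3]. *)
pose Y := X0 + 6 * B * D / e.
have BD0 : 0 <= 6 * B * D / e.
  by rewrite divr_ge0 ?(ltW e_gt0)// mulr_ge0// mulr_ge0// ltW.
have Y0 : 0 <= Y by rewrite addr_ge0// ltW.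
pose Jn := (Num.truncn Y).+1; pose J : R := Jn%:R.
have YJ : Y < J by have /andP[] := truncn_itv Y0.
have J0 : 0 < J by rewrite ltr0n.
have J1 : 1 <= J by rewrite ler1n.
(* Colours each integer by a nearby element of the finite net. Integers of one colour differ by
   almost periods, and some colour class [S] among the integers up to [Jn] has at least [J / size U]
   elements. *)
pose cl j := xget 0 [set u : R | u \in U /\ close_translates eps1 h j%:R u].
have Hcl j : cl j \in U /\ close_translates eps1 h j%:R (cl j).
  have [u uU Hu] := HU j%:R.
  by apply: (@xgetPex _ 0 [set u : R | u \in U /\ close_translates eps1 h j%:R u]); exists u.
have [|u uU] := @pigeonhole _ U cl (iota 0 Jn.+1) (fun j => (Hcl j).1).
  by rewrite size_iota.
rewrite size_iota -size_filter; set S := (X in (size X * _)%N) => HS.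
have uS : uniq S by rewrite filter_uniq// iota_uniq.
have SJ i : i \in S -> (i <= Jn)%N /\ close_translates eps1 h i%:R u.
  rewrite mem_filter mem_iota add0n ltnS => /andP[/eqP <- iJ]; split=> //.
  exact: (Hcl i).2.
pose n := (size S)%:R : R.
have nJ : J <= n * (size U)%:R by rewrite -natrM ler_nat ltnW.
have n0 : 0 < n.
  rewrite ltr0n; case: (size S) HS => //.
pose hJ := crestrict (`[- (2 * J), 2 * J]%classic : set mR) h.
have ihJ : cintegrable mu (setT : set mR) hJ.
  by apply/(cintegrable_restrict mu h (measurable_itv _)); exact: cintegrable_itv.
pose II i j := cintegral mu (setT : set mR) (fun x => hJ (x + (i%:R - j%:R)) * psi x).
have HII i j : i \in S -> j \in S -> N (I - II i j) <= e / 3 + e / 3.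
  move=> /SJ[iJ ci] /SJ[jJ cj]; apply: le_trans (window_close (e := 2 * eps1) ch HB Hc c0 _ (ltW J0) _ _) _.
  - by rewrite mulr_ge0// ltW.
  - have iJ' : i%:R <= J by rewrite ler_nat.
    have jJ' : j%:R <= J by rewrite ler_nat.
    have := ler0n R i; have := ler0n R j; rewrite ler_norml => ? ?; apply/andP; lra.
  - move=> x; have := ci (x - j%:R); have := cj (x - j%:R); rewrite subrK => h1 h2.
    rewrite (_ : x + _ = x - j%:R + i%:R); last by ring.
    rewrite (_ : _ - _ = (h (x - j%:R + i%:R) - h (x - j%:R + u)) - (h x - h (x - j%:R + u))); last by ring.
    by apply: le_trans (ler_normcB _ _) _; lra.
  rewrite -mulrA -/D (_ : 2 * _ = 2 * (2 * eps1 * D) + 2 * (B / (1 + J ^+ 2) * D)); last by ring.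
  apply: lerD.
    rewrite /eps1 (_ : 2 * _ = e / 3 * (D / (D + 1))); last by field; rewrite gt_eqF.
    by rewrite ler_piMr ?divr_ge0 ?(ltW e_gt0)// ler_pdivrMr// mul1r lerDl.
  have J2 : J <= 1 + J ^+ 2 by rewrite expr2; nra.
  have J20 : 0 < 1 + J ^+ 2 by apply: lt_le_trans J2.
  rewrite [leLHS](_ : _ = 2 * B * D / (1 + J ^+ 2)); last by field; rewrite gt_eqF.
  rewrite ler_pdivrMr//; have : 6 * B * D <= e * J.
    by rewrite [leRHS]mulrC -ler_pdivrMr// (le_trans _ (ltW YJ))// lerDr ltW.
  by nra.
pose W := \sum_(i <- S) \sum_(j <- S) II i j.
have dbl (z : C) : \sum_(i <- S) \sum_(j <- S) z = n%:C * n%:C * z.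
  rewrite !big_const_seq !count_predT !iter_addr_0 -mulrA.
  by rewrite (_ : n%:C = (size S)%:R) ?mulr_natl// /n rmorph_nat.
have E1 : n%:C * n%:C * I - W = \sum_(i <- S) \sum_(j <- S) (I - II i j).
  under [RHS]eq_bigr do rewrite sumrB.
  by rewrite sumrB -/W dbl.
have H1 : N (n%:C * n%:C * I - W) <= n * (n * (e / 3 + e / 3)).
  rewrite E1 big_seq; apply: le_trans (normc_sum _ _ _) _.
  apply: (@le_trans _ _ (\sum_(i <- S | i \in S) n * (e / 3 + e / 3))); last first.
    by rewrite -big_seq big_const_seq count_predT iter_addr_0 -[_ *+ _]mulr_natl.
  apply: ler_sum => i iS; rewrite big_seq; apply: le_trans (normc_sum _ _ _) _.
  apply: (@le_trans _ _ (\sum_(j <- S | j \in S) (e / 3 + e / 3))).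
    by apply: ler_sum => j jS; exact: HII.
  by rewrite -big_seq big_const_seq count_predT iter_addr_0 -[_ *+ _]mulr_natl.
(* The transform of the truncated [h] is at most [eps2 * (4 * J)] on [[- M, M]] and the mass of
   [dirichlet2] is proportional to [n]. The bound is linear in [n] and in [J]; [nJ] then trades [J]
   for [n], up to the factor [size U] included in [G]. *)
have H2 : N W <= n * (n * (e / 3)).
  rewrite /W /II (sum_shifted_pairing S ihJ).
  have su : csupp (fun x => hJ (- x)) (2 * J).
    move=> x xJ; rewrite /hJ /crestrict mem_setE in_itv /= -ler_norml normrN.
    by rewrite leNgt xJ.
  apply: le_trans (dirichlet2_bound (m := m) (E := eps2 * (4 * J)) h uS _ Mm HT _
    (cintegrable_opp ihJ) su _) _.
  - by rewrite mulr_ge0 ?(ltW eps20)// mulr_ge0// ltW.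
  - by rewrite mulr_ge0// ltW.
  - move=> t tM; have JX : X0 <= 4 * J.
      have : X0 <= Y by rewrite lerDl.
      lra.
    have := HX (4 * J) JX t tM (- (2 * J)).
    rewrite (_ : - (2 * J) + 4 * J = 2 * J); last by ring.
    rewrite /cint cintegral_restrict -cintegral_opp; last first.
      apply/(cintegrable_restrict mu _ (measurable_itv _)); apply: cintegrable_itv.
      by apply: continuousMc; [exact: ch|exact: continuous_e1].
    congr (N _ <= _); apply: eq_cintegral => x _; rewrite /hJ /crestrict.
    by case: ifP => _; rewrite ?mul0r// mulrNN.
  rewrite -/n /eps2.
  rewrite [leLHS](_ : _ = n * J * (T * m%:R * (e / 3 / (G + 1)))); last by field; rewrite gt_eqF.
  rewrite -mulrA ler_wpM2l ?(ltW n0)//.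
  have q0 : 0 <= T * m%:R * (e / 3 / (G + 1)).
    by rewrite mulr_ge0// ?divr_ge0 ?mulr_ge0 ?(ltW e_gt0) ?(ltW G1).
  apply: le_trans (ler_wpM2r q0 nJ) _; rewrite -[n * _ * _]mulrA ler_wpM2l ?(ltW n0)//.
  rewrite [leLHS](_ : _ = e / 3 * (G / (G + 1))); last by rewrite /G; field; rewrite gt_eqF.
  by rewrite ler_piMr ?divr_ge0 ?(ltW e_gt0)// ler_pdivrMr// mul1r lerDl.
have : N (n%:C * n%:C * I) <= n * (n * e).
  rewrite -(subrK W (_ * I)); have -> : n * (n * e) = n * (n * (e / 3 + e / 3)) + n * (n * (e / 3)) by field.
  exact: ler_normcD.
rewrite -mulrA !Normc.normcM normcR gtr0_norm//.
by rewrite !ler_pM2l.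
Qed.

End Pairing.

End SpectralGap.

(** * Pairing an almost periodic function with a test function *)

Section FourierSeries.
Variable R : realType.
Local Notation C := (cplx R).
Local Notation N := (@Normc.normc R).
Local Notation Re := (@complex.Re R).
Local Notation Im := (@complex.Im R).
Local Notation mu := (@lebesgue_measure R).
Local Notation mR := (measurableTypeR R).
Implicit Types (f g h u theta : R -> C) (e s : R) (D : set R) (c : R -> C).

Lemma continuous_uniform_limit f :
  (forall e, 0 < e -> exists2 g, continuous g & forall x, N (f x - g x) <= e) ->
  continuous f.
Proof.
move=> H x; apply/cvg_normcP => e e0; have e40 : 0 < e / 4 by rewrite divr_gt0.
have [g cg fg] := H _ e40.
have /cvg_normcP/(_ _ e40) := cg x; apply: filterS => y gxy.
rewrite (_ : _ - _ = (f x - g x) + ((g x - g y) - (f y - g y))); last by ring.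
apply: (@le_lt_trans _ _ (e / 4 + (e / 4 + e / 4))); last by lra.
apply: ler_normcD => //; apply: le_trans (ler_normcB _ _) _.
by apply: lerD; [exact: ltW|exact: fg].
Qed.

Lemma tb_sum (I : Type) (r : seq I) (f : I -> R -> C) : (forall i, tb (f i)) ->
  tb (fun x => \sum_(i <- r) f i x).
Proof.
move=> tf; elim: r => [|i r IH].
  by under eq_fun do rewrite big_nil; exact: tb_cst.
by under eq_fun do rewrite big_cons; exact: tbD.
Qed.

Lemma has_mean_sum (I : Type) (r : seq I) (f : I -> R -> C) (m : I -> C) :
  (forall i, continuous (f i)) -> (forall i, has_mean (f i) (m i)) ->
  has_mean (fun x => \sum_(i <- r) f i x) (\sum_(i <- r) m i).
Proof.
move=> cf mf; elim: r => [|i r IH].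
  under eq_fun do rewrite big_nil; rewrite big_nil => e e0.
  exists 1 => // L L1 a; have L0 : 0 <= L by exact: le_trans L1.
  by rewrite cint_cst ?lerDl// !mulr0 subrr Normc.normc0 mulr_ge0// ltW.
under eq_fun do rewrite big_cons; rewrite big_cons.
by apply: has_meanD; [exact: cf|exact: continuous_sumc|exact: mf|exact: IH].
Qed.

Section Series.
Variables (D : set R) (c : R -> C).
Hypothesis wc : wsummable D (fun l => N (c l)).
Let p (x : R) : C := csum D (fun l => c l * e1 (l * x)).

(** The second clause applies to the same [J] a functional with values [k l] of modulus at most 1 on
    characters; it is used with the mean against one fixed character. *)
Lemma trig_series_approx e : 0 < e -> exists J : {fset R},
  (forall x, N (p x - \sum_(l <- J) c l * e1 (l * x)) <= e) /\
  (forall k : R -> C, (forall l, N (k l) <= 1) ->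
     N (csum D (fun l => c l * k l) - \sum_(l <- J) c l * k l) <= e).
Proof.
move=> e0; have [J JD HJ] := csum_approx (fun x _ => normc_ge0 (c x)) wc e0.
exists J; split=> [x|k k1]; apply: HJ => l _; rewrite Normc.normcM.
  by rewrite normc_e1 mulr1.
by rewrite ler_piMr ?normc_ge0.
Qed.

Let ce l : continuous (fun x : R => c l * e1 (l * x)).
Proof. by apply: continuousMc; [exact: continuous_cstc|exact: continuous_e1]. Qed.

Let te l : tb (fun x : R => c l * e1 (l * x)).
Proof. by apply: tbM; [exact: tb_cst|exact: tb_e1]. Qed.

Lemma trig_series_continuous : continuous p.
Proof.
apply: continuous_uniform_limit => e e0; have [J [HJ _]] := trig_series_approx e0.
by exists (fun x => \sum_(l <- J) c l * e1 (l * x)); first exact: continuous_sumc.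
Qed.

Lemma trig_series_tb : tb p.
Proof.
apply: tb_limit => e e0; have [J [HJ _]] := trig_series_approx e0.
by exists (fun x => \sum_(l <- J) c l * e1 (l * x)) => //; exact: tb_sum.
Qed.

Lemma csum_delta l : D l -> csum D (fun l' => c l' * (l' - l == 0)%:R) = c l.
Proof.
move=> Dl; rewrite (@csum_sub _ _ _ [set` [fset l]%fset]).
- by rewrite csum_fset big_seq_fset1 subrr eqxx mulr1.
- by move=> x /=; rewrite inE => /eqP ->.
- move=> x _ /= /negP; rewrite inE => xl.
  by rewrite subr_eq0 (negbTE xl) mulr0.
Qed.

Lemma trig_series_mean l : D l -> has_mean (fun x => p x * e1 (- l * x)) (c l).
Proof.
move=> Dl; apply: has_mean_limit.
  by apply: continuousMc; [exact: trig_series_continuous|exact: continuous_e1].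
move=> e e0; have [J [HJ Hk]] := trig_series_approx e0.
exists (fun x => \sum_(l' <- J) c l' * e1 ((l' - l) * x)).
have cl' l' : continuous (fun x : R => e1 ((l' - l) * x) : C) by exact: continuous_e1.
exists (\sum_(l' <- J) c l' * (l' - l == 0)%:R); last first.
  rewrite -[X in X - _](csum_delta Dl); apply: Hk => l'.
  by case: eqP => _; rewrite ?Normc.normc1 ?Normc.normc0.
split.
- apply: continuous_sumc => l'.
  by apply: continuousMc; [exact: continuous_cstc|exact: cl'].
- apply: has_mean_sum => l'.
    by apply: continuousMc; [exact: continuous_cstc|exact: cl'].
  by apply: has_meanZ; [exact: cl'|exact: has_mean_e1].
- move=> x; have := HJ x.
  rewrite (_ : _ - \sum_(l' <- J) c l' * e1 ((l' - l) * x) =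
     (p x - \sum_(l' <- J) c l' * e1 (l' * x)) * e1 (- l * x)).
    by rewrite Normc.normcM normc_e1 mulr1.
  rewrite mulrBl; congr (_ - _); rewrite mulr_suml; apply: eq_bigr => l' _.
  by rewrite mulrDl e1D mulrA.
Qed.

End Series.

(** The series [p] over [|l| <= M] has the same means as [f] at these frequencies, so [f - p] has a
    spectral gap and pairs to 0. As [p] converges absolutely, it is paired term by term, using
    inversion. *)
Lemma ap_pairing f c theta (M : R) : continuous f -> tb f ->
  test_function theta -> csupp theta M ->
  wsummable [set l : R | `|l| <= M] (fun l => N (c l)) ->
  (forall l, `|l| <= M -> has_mean (fun x => f x * e1 (- l * x)) (c l)) ->
  cintegral mu (setT : set mR) (fun x => f x * ft theta (- x)) =
  csum [set l : R | `|l| <= M] (fun l => c l * theta l).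
Proof.
move=> cf tf tt st wc mf; have mT := @measurableT _ mR.
set D := [set l : R | _] in wc *.
pose p (x : R) : C := csum D (fun l => c l * e1 (l * x)).
have cp : continuous p by exact: trig_series_continuous.
have tp : tb p by exact: trig_series_tb.
have [cpsi [k k0 Hk]] := test_ft_line tt.
have ceM l : continuous (fun x : R => e1 (- l * x) : C) by exact: continuous_e1.
have p1 (x : R) : 1 <= 1 + x ^+ 2 by rewrite lerDl sqr_ge0.
have p0 (x : R) : 0 < 1 + x ^+ 2 by exact: lt_le_trans (p1 x).
have Hk1 x : N (ft theta (- x)) <= k * (1 + x ^+ 2)^-1.
  apply: le_trans (Hk x) _; rewrite ler_wpM2l// lef_pV2 ?posrE ?exprn_gt0//.
  by rewrite [leRHS]expr2 ler_pMr.
have int g : continuous g -> tb g ->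
    cintegrable mu (setT : set mR) (fun x => g x * ft theta (- x)).
  move=> cg tg; have [B B0 HB] := tb_bounded tg.
  apply: (@cintegrable_cauchy _ _ (B * k)).
    by apply: continuousMc; [exact: cg|exact: cpsi].
  by move=> x; rewrite Normc.normcM -mulrA ler_pM ?normc_ge0.
have cN1p : continuous (fun x => -1 * p x).
  by apply: continuousMc; [exact: continuous_cstc|exact: cp].
have ch : continuous (fun x => f x + -1 * p x) by exact: continuousDc.
have th : tb (fun x => f x + -1 * p x).
  by apply: tbD => //; apply: tbM => //; exact: tb_cst.
have hm l : `|l| <= M -> has_mean (fun x => (f x + -1 * p x) * e1 (- l * x)) 0.
  move=> lM; rewrite (_ : (fun _ => _) =
    (fun x => f x * e1 (- l * x) + -1 * (p x * e1 (- l * x)))); last first.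
    by apply/funext => x; ring.
  rewrite (_ : 0 = c l + -1 * c l); last by ring.
  have c1 : continuous (fun x => p x * e1 (- l * x)).
    by apply: continuousMc; [exact: cp|exact: ceM].
  apply: has_meanD; [|by apply: continuousMc; [exact: continuous_cstc|exact: c1]|exact: mf|].
    by apply: continuousMc; [exact: cf|exact: ceM].
  by apply: has_meanZ; [exact: c1|exact: trig_series_mean].
have := spectral_gap tt st ch th hm.
under eq_cintegral do rewrite mulrDl -mulrA.
rewrite cintegralD; [|exact: mT|exact: int|by apply: cintegrableZ; [exact: mT|exact: int]].
rewrite cintegralZ; [|exact: mT|exact: int].
rewrite mulN1r => /eqP; rewrite subr_eq0 => /eqP ->.
rewrite /p; under eq_cintegral do rewrite mulrC.
have H0 x : 0 <= k * (1 + x ^+ 2)^-1 by rewrite mulr_ge0// invr_ge0 ltW.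
have E x : ft theta (- x) * csum D (fun l => c l * e1 (l * x)) =
   csum D (fun l => c l * (e1 (l * x) * ft theta (- x))).
  rewrite -(@csumZ _ _ _ _ (fun l => N (c l))) => //.
    by apply: eq_csum => l _; ring.
  by move=> l _; rewrite Normc.normcM normc_e1 mulr1.
under eq_cintegral do rewrite E.
have cm l : D l -> cmeasurable (setT : set mR) (fun x => c l * (e1 (l * x) * ft theta (- x))).
  move=> _; apply: cmeasurable_continuous; first exact: mT.
  apply: continuousMc; first exact: continuous_cstc.
  by apply: continuousMc; [exact: continuous_e1|exact: cpsi].
have bd l x : D l -> [set: mR] x ->
    N (c l * (e1 (l * x) * ft theta (- x))) <= N (c l) * (k * (1 + x ^+ 2)^-1).
  by move=> _ _; rewrite !Normc.normcM normc_e1 mul1r ler_wpM2l ?normc_ge0.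
have [_ ->] := cintegral_csum mT wc (fun l _ => normc_ge0 _) cm (rintegrable_cauchyZ k)
  (fun x _ => H0 x) bd.
apply: eq_csum => l Dl; rewrite cintegralZ; first last.
- by apply: int; [exact: continuous_e1|exact: tb_e1].
- exact: mT.
congr (_ * _); rewrite -(fourier_inversion0 l tt) -[RHS]cintegral_opp.
  by apply: eq_cintegral => x _; rewrite mulrNN mulrC.
apply: cintegrableMe1.
have := cintegrable_opp (int (fun=> 1) (@continuous_cstc _ 1) (@tb_cst _ 1)).
by apply: eq_cintegrable => // x _; rewrite mul1r opprK.
Qed.

(** The exponential in [fourier_mean] is taken at the point [x + i y] rather than at [x], whence the
    factor [exp (2 pi l y)]. *)
Lemma fourier_coefE (F : C -> C) (y l : R) (m : C) :
  has_mean (fun x : R => F (x +i* y) * e1 (- l * x)) m ->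
  continuous (fun x : R => F (x +i* y)) ->
  fourier_coef F y l = (expR (2 * pi * l * y))%:C * m.
Proof.
move=> mm cF; rewrite /fourier_coef.
have E T : fourier_mean F y l T = (expR (2 * pi * l * y))%:C *
    ((2 * T)^-1%:C * cint (fun x : R => F (x +i* y) * e1 (- l * x)) (- T) T).
  rewrite /fourier_mean mulrCA; congr (_ * _); rewrite -cintZ; last first.
    by apply: continuousMc; [exact: cF|exact: continuous_e1].
  apply: eq_cintegral => x _; rewrite mulrCA; congr (_ * _).
  by rewrite /e1 /cexp; apply: complex_ext => /=;
    rewrite !(mul0r,mulr0,add0r,addr0,subr0,sub0r,expR0,mul1r) !(mulNr,mulrN,opprK) !mulrA.
apply: cvg_lim => //.
rewrite (_ : fourier_mean F y l = (fun T => (expR (2 * pi * l * y))%:C *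
   ((2 * T)^-1%:C * cint (fun x : R => F (x +i* y) * e1 (- l * x)) (- T) T))); last first.
  by apply/funext => T; exact: E.
apply: (@cvgM C); first exact: cvg_cst.
exact: has_mean_cvg.
Qed.

End FourierSeries.

(** * Partial fractions *)

Section CauchyTransform.
Variable R : realType.
Local Notation C := (cplx R).
Local Notation N := (@Normc.normc R).
Local Notation Re := (@complex.Re R).
Local Notation Im := (@complex.Im R).
Implicit Types (z g : C) (D : set C) (F G : C -> C) (p W : {poly C}).

Lemma limit_point_sub (D E : set C) : D `<=` E -> limit_point E = set0 ->
  limit_point D = set0.
Proof.
move=> DE E0; apply/seteqP; split=> // z Dz; rewrite -E0 => U /Dz[y [yz Dy Uy]].
by exists y; split=> //; exact: DE.
Qed.

Lemma limit_point0_sep D z : limit_point D = set0 ->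
  exists2 d : R, 0 < d & forall g, D g -> g != z -> d <= N (g - z).
Proof.
move=> D0; have : ~ limit_point D z by rewrite D0.
rewrite not_limit_pointE => -[U /nbhs_normcP[d d0 Hd] DU].
exists d => // g Dg gz; rewrite leNgt; apply/negP => gd.
by move: gz; rewrite (DU g _) ?eqxx//; split=> //; apply: Hd; rewrite normcB.
Qed.

(** [|g|] exceeds [|g - z'|] by at most a constant depending on [z] and [d], and [|g - z'| >= d / 2]
    turns that constant into a multiple of [|g - z'|]. *)
Lemma near_pole_bound (d : R) z z' g : 0 < d -> d <= N (g - z) -> N (z - z') <= d / 2 ->
  d / 2 <= N (g - z') /\ 1 + N g <= (1 + (1 + N z + d) / (d / 2)) * N (g - z').
Proof.
move=> d0 gz zz; have H1 : d / 2 <= N (g - z').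
  have := ler_dist_normc (g - z) (z' - z).
  rewrite (_ : g - z - (z' - z) = g - z'); last by ring.
  by rewrite (normcB z' z); lra.
split=> //; have d20 : 0 < d / 2 by rewrite divr_gt0.
have : N g <= N (g - z') + (N z + d / 2).
  rewrite [X in N X <= _](_ : g = (g - z') + (z - (z - z'))); last by ring.
  apply: ler_normcD => //; apply: le_trans (ler_normcB _ _) _; lra.
rewrite mulrDl mul1r mulrAC => h.
have h2 : 1 + N z + d <= (1 + N z + d) * N (g - z') / (d / 2).
  by rewrite ler_pdivlMr// ler_wpM2l// addr_ge0 ?(ltW d0)// addr_ge0// normc_ge0.
have := d0; lra.
Qed.

Definition cauchyt D (v : C -> C) z : C := csum D (fun g => v g / (g - z)).

Section OnePoint.
Variables (D : set C) (w : C -> R) (v : C -> C).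
Hypotheses (w0 : forall g, D g -> 0 <= w g) (ws : wsummable D w).
Hypothesis vw : forall g, D g -> N (v g) <= w g * (1 + N g).
Variables (z : C) (d : R).
Hypotheses (d0 : 0 < d) (sep : forall g, D g -> d <= N (g - z)).
Let K := 1 + (1 + N z + d) / (d / 2).

Let K0 : 0 < K.
Proof. by rewrite ltr_pwDl// divr_ge0 ?divr_ge0 ?(ltW d0)// !addr_ge0 ?normc_ge0 ?(ltW d0). Qed.

Lemma cauchyt_term_bound z' g : D g -> N (z - z') <= d / 2 ->
  g - z' != 0 /\ N (v g / (g - z')) <= K * w g.
Proof.
move=> Dg zz; have [h1 h2] := near_pole_bound d0 (sep Dg) zz.
have gz0 : 0 < N (g - z') by apply: lt_le_trans h1; rewrite divr_gt0.
split; first by rewrite -normc_gt0.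
rewrite Normc.normcM Normc.normcV ler_pdivrMr// (le_trans (vw Dg))//.
by rewrite mulrC -mulrA mulrCA [leLHS]mulrC ler_wpM2l ?w0.
Qed.

Lemma wsummable_cauchyt : wsummable D (fun g => K * w g).
Proof. by apply: wsummableZ => //; exact: ltW. Qed.

Lemma cauchyt_summable : cdominated D (fun g => K * w g) (fun g => v g / (g - z)).
Proof.
move=> g Dg; apply: (cauchyt_term_bound Dg _).2.
by rewrite subrr Normc.normc0 divr_ge0 ?(ltW d0).
Qed.

(** The difference quotient is the sum of [v g / ((g - z) (g - z - h))], dominated uniformly for
    [|h| <= d / 2], so it converges by [csum_cvg]. *)
Lemma cauchyt_derivable : derivable (cauchyt D v) z 1.
Proof.
have nz : N (z - z) <= d / 2 by rewrite subrr Normc.normc0 divr_ge0 ?(ltW d0).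
have d20 : 0 < d / 2 by rewrite divr_gt0.
have KKs : wsummable D (fun g => K * (K * w g)).
  by apply: wsummableZ wsummable_cauchyt => [g Dg|]; rewrite ?mulr_ge0 ?w0 ?ltW.
pose K2 := 2 / d.
have K20 : 0 <= K2 by rewrite divr_ge0// ltW.
have sK2 : wsummable D (fun g => K2 * (K * w g)).
  by apply: wsummableZ wsummable_cauchyt => // g Dg; rewrite mulr_ge0 ?w0 ?ltW.
pose h0 (h : C) g : C := v g / (g - z) / (g - (z + h)).
have bnd h : N h <= d / 2 -> cdominated D (fun g => K2 * (K * w g)) (h0 h).
  move=> hd g Dg; have zh : N (z - (z + h)) <= d / 2.
    by rewrite opprD addrA subrr add0r normcN.
  have [h1 _] := near_pole_bound d0 (sep Dg) zh.
  have [h2 h3] := cauchyt_term_bound Dg nz.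
  rewrite /h0 Normc.normcM Normc.normcV mulrC ler_pM ?invr_ge0 ?normc_ge0//.
  rewrite /K2 -[2 / d](invf_div) lef_pV2 ?posrE//; exact: lt_le_trans h1.
have E h : h != 0 -> N h <= d / 2 ->
    h^-1 * (cauchyt D v (z + h) - cauchyt D v z) = csum D (h0 h).
  move=> hn hd; have zh : N (z - (z + h)) <= d / 2.
    by rewrite opprD addrA subrr add0r normcN.
  have D1 : cdominated D (fun g => K * w g) (fun g => v g / (g - (z + h))).
    by move=> g Dg; exact: (cauchyt_term_bound Dg zh).2.
  rewrite /cauchyt -[- csum _ _]mulN1r -(csum_lin _ wsummable_cauchyt D1 cauchyt_summable).
  rewrite -(@csumZ _ _ _ _ (fun g => N h * (K2 * (K * w g)))); first last.
  - move=> g Dg; have [/negPf g1 _] := cauchyt_term_bound Dg zh; have [/negPf g2 _] := cauchyt_term_bound Dg nz.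
    have -> : v g / (g - (z + h)) + -1 * (v g / (g - z)) = h * h0 h g.
      by rewrite /h0; field; rewrite g1 g2.
    by rewrite Normc.normcM ler_wpM2l ?normc_ge0//; exact: bnd.
  - apply: wsummableZ sK2 => [g Dg|]; last exact: normc_ge0.
    by rewrite (mulr_ge0 K20)// mulr_ge0 ?w0// ltW.
  apply: eq_csum => g Dg; have [/negPf g1 _] := cauchyt_term_bound Dg zh; have [/negPf g2 _] := cauchyt_term_bound Dg nz.
  by rewrite /h0; field; rewrite g1 g2 hn.
apply/cvg_ex; exists (csum D (h0 0)).
have small : \forall h \near (0 : C)^', h != 0 /\ N h <= d / 2.
  apply/dnbhs_normcP; exists (d / 2) => // h; rewrite sub0r normcN => hd hn.
  by split=> //; exact: ltW.
apply: (@cvg_trans _ ((fun h => csum D (h0 h)) @ (0 : C)^')).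
  apply: near_eq_cvg; near=> h.
  have [hn hd] : h != 0 /\ N h <= d / 2 by near: h; exact: small.
  rewrite -E//; congr (_ * (cauchyt D v _ - _)).
  by rewrite /= addrC; congr (_ + _); rewrite [_%:A]mulr1.
apply: (csum_cvg _ sK2).
- by apply: filterS small => h [_ hd]; exact: bnd.
- by apply: bnd; rewrite Normc.normc0 ltW.
move=> g Dg; apply: (@cvgM C); first exact: cvg_cst.
apply: (@cvgV C); first by rewrite addr0; exact: (cauchyt_term_bound Dg nz).1.
apply: (@cvgB C); first exact: cvg_cst.
apply: (@cvgD C); first exact: cvg_cst.
exact: (@nbhs_dnbhs C).
Unshelve. all: by end_near. Qed.

End OnePoint.

End CauchyTransform.

(** * Poles of a polynomial times a Cauchy transform, and interpolation *)

Section PartialFractions.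
Variable R : realType.
Local Notation C := (cplx R).
Local Notation N := (@Normc.normc R).
Local Notation Re := (@complex.Re R).
Local Notation Im := (@complex.Im R).
Implicit Types (z g : C) (D : set C) (F G : C -> C) (p W : {poly C}).

Lemma poly_derivable p z : derivable (fun x : C => p.[x]) z 1.
Proof.
elim/poly_ind: p => [|p c IH].
  by under eq_fun do rewrite horner0; exact: derivable_cst.
under eq_fun do rewrite hornerMXaddC.
apply: derivableD; last exact: derivable_cst.
by apply: derivableM; [exact: IH|exact: derivable_id].
Qed.

Lemma notin_near D z0 : limit_point D = set0 -> \forall z \near z0, D z -> z = z0.
Proof.
move=> D0; have [d d0 Hd] := limit_point0_sep z0 D0.
apply/nbhs_normcP; exists d => // z zd Dz; apply/eqP/negPn/negP => zz.
by have := Hd z Dz zz; rewrite normcB leNgt zd.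
Qed.

Section Poles.
Variables (D : set C) (w : C -> R) (v : C -> C) (p W : {poly C}).
Hypotheses (w0 : forall g, D g -> 0 <= w g) (ws : wsummable D w).
Hypothesis vw : forall g, D g -> N (v g) <= w g * (1 + N g).
Hypothesis D0 : limit_point D = set0.
Let F (z : C) : C := p.[z] + W.[z] * cauchyt D v z.

(** Stated for subsets of [D] because one pole has to be removed from the sum in order to study the
    others near it. *)
Let pf_deriv (E : set C) z : E `<=` D -> ~ E z ->
  derivable (fun z => W.[z] * cauchyt E v z) z 1.
Proof.
move=> ED Ez; have [d d0 Hd] := limit_point0_sep z (limit_point_sub ED D0).
apply: derivableM; first exact: poly_derivable.
apply: (@cauchyt_derivable _ E w v _ _ _ z d) => //.
- by move=> g /ED; exact: w0.
- exact: wsummable_sub ED ws.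
- by move=> g /ED; exact: vw.
- by move=> g Eg; apply: Hd => //; apply/eqP => gz; rewrite -gz in Ez.
Qed.

Lemma pf_derivable z : ~ D z -> derivable F z 1.
Proof.
by move=> Dz; apply: derivableD; [exact: poly_derivable|exact: pf_deriv].
Qed.

(** With [W = W.[g0] + q * ('X - g0)], the term of index [g0] splits into its polar part and the
    polynomial [- q * v g0]; the sum over the other points is holomorphic near [g0]. *)
Lemma pf_pole_part g0 : D g0 -> exists gg : C -> C, holomorphic_near gg g0 /\
  \forall z \near g0^', F z = - (W.[g0] * v g0) / (z - g0) + gg z.
Proof.
move=> Dg0; have : root (W - W.[g0]%:P) g0 by rewrite /root !hornerE subrr.
move=> /factor_theorem[q Wq].
have WE z : W.[z] = W.[g0] + q.[z] * (z - g0).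
  by have := congr1 (fun u : {poly C} => u.[z]) Wq; rewrite !hornerE => <-; ring.
exists (fun z => (p.[z] - q.[z] * v g0) + W.[z] * cauchyt (D `\ g0) v z); split.
  have := notin_near g0 (limit_point_sub (@subDsetl _ D [set g0]) D0).
  apply: filterS => z Hz; apply: derivableD.
    apply: derivableB; first exact: poly_derivable.
    by apply: derivableM; [exact: poly_derivable|exact: derivable_cst].
  by apply: pf_deriv => [g []//|Dz]; move: (Dz) (Hz Dz) => [_ ?].
have := notin_near g0 D0; move=> /nbhs_normcP[d d0 Hd].
apply/dnbhs_normcP; exists d => // z zd zg.
have Dz : ~ D z by move=> /(Hd z zd)/eqP; rewrite (negPf zg).
have [e e0 He] := limit_point0_sep z D0.
have He' g : D g -> e <= N (g - z).
  by move=> Dg; apply: He => //; apply/eqP => gz; rewrite -gz in Dz.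
rewrite /F /cauchyt.
rewrite (csumD1 (@wsummable_cauchyt _ _ _ w0 ws z e e0) (@cauchyt_summable _ _ _ _ w0 vw z e e0 He') Dg0).
rewrite -/(cauchyt _ _ _) mulrDr {1}WE.
have zg' : z - g0 != 0 by rewrite subr_eq0.
rewrite -(opprB z g0) invrN; field.
by rewrite zg'.
Qed.

Lemma pf_pole g0 : D g0 -> W.[g0] * v g0 != 0 ->
  simple_pole_with_residue F g0 (- (W.[g0] * v g0)).
Proof. by move=> Dg0 r0; split; [rewrite oppr_eq0|exact: pf_pole_part]. Qed.

Lemma pf_meromorphic : meromorphic F.
Proof.
move=> z0; have [Dz|Dz] := pselect (D z0).
  have [gg [hgg Hgg]] := pf_pole_part Dz.
  exists 1%N, (fun z => - (W.[z0] * v z0) + (z - z0) * gg z); split.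
    apply: filterS hgg => z dz; apply: derivableD; first exact: derivable_cst.
    apply: derivableM; last exact: dz.
    by apply: derivableB; [exact: derivable_id|exact: derivable_cst].
  move: Hgg => /dnbhs_normcP[d d0 Hd]; apply/dnbhs_normcP; exists d => // z zd zz.
  rewrite Hd// expr1; field.
  by rewrite subr_eq0.
exists 0%N, F; split.
  apply: filterS (notin_near z0 D0) => z Hz; apply: pf_derivable => Dz'.
  by apply: Dz; rewrite -(Hz Dz').
by apply: nearW => z; rewrite expr0 divr1.
Qed.

End Poles.

Definition Wpoly (s : seq C) : {poly C} := \prod_(u <- s) ('X - u%:P).

(** The Lagrange basis polynomial of the node [w], not normalised to take the value 1 there. *)
Definition lag (s : seq C) (w : C) : {poly C} := Wpoly (rem w s).

Lemma Wpoly_eq0 s z : ((Wpoly s).[z] == 0) = (z \in s).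
Proof. by rewrite -root_prod_XsubC. Qed.

Lemma Wpoly_lag s w : w \in s -> Wpoly s = ('X - w%:P) * lag s w.
Proof. by move=> ws; rewrite /Wpoly (big_rem w). Qed.

Lemma size_lag s w : w \in s -> size (lag s w) = size s.
Proof.
move=> ws; rewrite size_prod_XsubC size_rem// prednK//.
by case: s ws.
Qed.

Lemma lag_neq0 s w : uniq s -> w \in s -> (lag s w).[w] != 0.
Proof. by move=> us ws; rewrite Wpoly_eq0 rem_filter// mem_filter /= eqxx. Qed.

Lemma lag_eq0 s w u : uniq s -> u \in s -> u != w -> (lag s w).[u] = 0.
Proof.
by move=> us us' uw; apply/eqP; rewrite Wpoly_eq0 rem_filter// mem_filter /= uw.
Qed.

Lemma lagrange s p : uniq s -> (size p <= size s)%N ->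
  p = \sum_(w <- s) (p.[w] / (lag s w).[w]) *: lag s w.
Proof.
move=> us sp; apply/eqP; rewrite -subr_eq0; apply/negPn/negP => d0.
have := max_poly_roots d0 (rs := s) _ us; rewrite ltnNge => /(_ _)/negP; apply.
  apply/allP => u us'; rewrite /root !hornerE horner_sum (bigD1_seq u)//= big1_seq.
    by rewrite addr0 hornerZ mulfVK ?lag_neq0// subrr.
  move=> w /andP[wu ws]; have uw : u != w by rewrite eq_sym.
  by rewrite hornerZ (lag_eq0 us us' uw) mulr0.
apply: leq_trans (size_polyD _ _) _; rewrite geq_max sp size_polyN.
apply: leq_trans (size_sum _ _ _) _; apply/bigmax_leqP_seq => w ws _.
by apply: leq_trans (size_scale_leq _ _) _; rewrite size_lag.
Qed.

Lemma lagrangeE s p z : uniq s -> (size p <= size s)%N ->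
  p.[z] = \sum_(w <- s) p.[w] * ((lag s w).[z] / (lag s w).[w]).
Proof.
move=> us sp; rewrite {1}(lagrange us sp) horner_sum; apply: eq_bigr => w _.
by rewrite hornerZ mulrAC mulrA.
Qed.

(** Lagrange interpolation of the constant 1, evaluated at [g]. *)
Lemma partial_fraction s g : uniq s -> (0 < size s)%N -> g \notin s ->
  ((Wpoly s).[g])^-1 = \sum_(w <- s) ((lag s w).[w])^-1 / (g - w).
Proof.
move=> us s0 gs; have W0 : (Wpoly s).[g] != 0 by rewrite Wpoly_eq0.
apply: (mulfI W0); rewrite divff// mulr_sumr.
rewrite -[LHS](hornerC 1 g) [LHS](lagrangeE g us) ?size_poly1//.
rewrite big_seq [RHS]big_seq; apply: eq_bigr => w ws.
have gw : g - w != 0 by rewrite subr_eq0; apply: contraNneq gs => ->.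
rewrite hornerC (Wpoly_lag ws) hornerM hornerXsubC; field.
by rewrite gw lag_neq0.
Qed.

Lemma lag_cons_head z s : lag (z :: s) z = Wpoly s.
Proof. by rewrite /lag /= eqxx. Qed.

Lemma lag_cons z s w : z != w -> lag (z :: s) w = ('X - z%:P) * lag s w.
Proof. by move=> zw; rewrite /lag /= (negPf zw) /Wpoly big_cons. Qed.

(** One formula for the terms of both sums of the representation, with the factor [(z^2 + r^2)^k]
    brought inside: [r] is 1 for the real points and [rho] for the others. *)
Definition kern (k : nat) (r : R) (z g : C) : C :=
  (z ^+ 2 + (r ^+ 2)%:C) ^+ k * (((r ^+ 2)%:C + g * z) / (g - z)) /
  ((r ^+ 2)%:C + g ^+ 2) ^+ k.+1.

(* As functions of [z], both kernels have residue [-1] at [g], so their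
   difference is a polynomial, determined by its values at the nodes. *)
Lemma kern_nodes k r s z g : uniq s -> size s = (2 * k).+1 -> g \notin s ->
  z != g -> (r ^+ 2)%:C + g ^+ 2 != 0 ->
  kern k r z g = (Wpoly s).[z] / ((Wpoly s).[g] * (g - z)) +
    \sum_(w <- s) kern k r w g * ((lag s w).[z] / (lag s w).[w]).
Proof.
move=> us ss gs zg rg; set c1 := (Wpoly s).[g]; set c2 := ((r ^+ 2)%:C + g ^+ 2) ^+ k.+1.
have c10 : c1 != 0 by rewrite Wpoly_eq0.
have c20 : c2 != 0 by rewrite expf_neq0.
pose u : {poly C} := ('X ^+ 2 + (r ^+ 2)%:C%:P) ^+ k * ((r ^+ 2)%:C%:P + g%:P * 'X).
(* The numerator of the difference of the two kernels. It vanishes at [g], where [u] is [c2] and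
   [Wpoly s] is [c1]. The quotient [q] has degree at most [2 * k], hence is recovered from its
   values at the [2 * k + 1] nodes, where [Wpoly s] vanishes. *)
pose P := c1 *: u - c2 *: Wpoly s.
have uE x : u.[x] = (x ^+ 2 + (r ^+ 2)%:C) ^+ k * ((r ^+ 2)%:C + g * x).
  by rewrite /u !hornerE.
have PE x : P.[x] = c1 * u.[x] - c2 * (Wpoly s).[x] by rewrite /P !hornerE.
have : root P g.
  by rewrite /root PE uE -/c1 /c2 (exprS _ k) (addrC (g ^+ 2)); apply/eqP; ring.
move=> /factor_theorem[q Pq].
have qE x : P.[x] = q.[x] * (x - g) by rewrite Pq !hornerE.
have sq : (size q <= size s)%N.
  have [->|q0] := eqVneq q 0; first by rewrite size_poly0.
  have : size P = (size q).+1.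
    by rewrite Pq size_Mmonic ?monicXsubC// size_XsubC addnS addn1.
  suff : (size P <= (size s).+1)%N by move=> + E; rewrite E ltnS.
  apply: leq_trans (size_polyD _ _) _; rewrite geq_max size_polyN; apply/andP; split.
    apply: leq_trans (size_scale_leq _ _) _; apply: leq_trans (size_polyMleq _ _) _.
    have h1 : (size (('X ^+ 2 + (r ^+ 2)%:C%:P : {poly C}) ^+ k) <= (2 * k).+1)%N.
      apply: leq_trans (size_poly_exp_leq _ _) _; rewrite ltnS leq_mul2r.
      apply/orP; right; rewrite -subn1 leq_subLR (leq_trans (size_polyD _ _))//.
      by rewrite geq_max size_polyXn (leq_trans (size_polyC_leq1 _)).
    have h2 : (size (((r ^+ 2)%:C)%:P + g%:P * 'X)%R <= 2)%N.
      apply: leq_trans (size_polyD _ _) _; rewrite geq_max (leq_trans (size_polyC_leq1 _))//=.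
      by rewrite mul_polyC (leq_trans (size_scale_leq _ _))// size_polyX.
    rewrite ss; apply: (@leq_trans ((2 * k).+1 + 2).-1); first by rewrite -!subn1 leq_sub2r// leq_add.
    by rewrite addn2.
  by apply: leq_trans (size_scale_leq _ _) _; rewrite size_prod_XsubC.
have gz : g - z != 0 by rewrite subr_eq0 eq_sym.
have kE x : kern k r x g * (g - x) * c2 = if x == g then 0 else u.[x].
  case: eqP => [->|/eqP xg]; first by rewrite subrr mulr0 mul0r.
  rewrite /kern -/c2 uE; field.
  by rewrite c20 subr_eq0 eq_sym.
have Kw w : w \in s -> kern k r w g = - q.[w] / (c1 * c2).
  move=> ws; have wg : w != g by apply: contraNneq gs => <-.
  have gw : g - w != 0 by rewrite subr_eq0 eq_sym.
  have := kE w; rewrite (negPf wg) => h; have := qE w.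
  rewrite PE -h (_ : (Wpoly s).[w] = 0); last by apply/eqP; rewrite Wpoly_eq0.
  move=> h2; apply: (mulIf gw); apply: (mulIf (mulf_neq0 c10 c20)).
  rewrite (_ : - q.[w] / _ * _ * _ = q.[w] * (w - g)); last by field; rewrite c10 c20.
  by rewrite -h2; ring.
have -> : \sum_(w <- s) kern k r w g * ((lag s w).[z] / (lag s w).[w]) = - q.[z] / (c1 * c2).
  rewrite (lagrangeE z us sq) -sumrN mulr_suml big_seq [RHS]big_seq.
  by apply: eq_bigr => w ws; rewrite Kw// mulrAC mulNr.
have := kE z; rewrite (negPf zg) => h; have := qE z; rewrite PE -h => h2.
apply: (mulIf gz); apply: (mulIf c20); apply: (mulfI c10).
rewrite [RHS](_ : _ = c2 * (Wpoly s).[z] + q.[z] * (z - g)); last first.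
  by field; rewrite c10 c20 gz.
by rewrite -h2; ring.
Qed.

End PartialFractions.

(** * Atomic measures and kernels *)

Section AtomicMeasures.
Variable R : realType.
Local Notation C := (cplx R).
Local Notation N := (@Normc.normc R).
Local Notation Re := (@complex.Re R).
Local Notation Im := (@complex.Im R).
Local Notation mR := (measurableTypeR R).
Variables (I : set nat) (q p : nat -> R).
Local Notation nu := (atomic_cmeasure I q p).

Lemma ge0_integral_atomic (f : mR -> R) : measurable_fun setT f ->
  (forall x, 0 <= f x) ->
  (\int[cm_var nu]_x (f x)%:E = \esum_(n in I) (`|p n| * f (q n))%:E)%E.
Proof.
move=> mf f0; rewrite /= ge0_integral_measure_series//; last 2 first.
- by move=> x _; rewrite lee_fin.
- exact/measurable_EFinP.
have mE : measurable_fun setT (EFin \o f) by exact/measurable_EFinP.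
under eq_eseriesr => n _.
  rewrite ge0_integral_mscale//; last by move=> x _; rewrite /= lee_fin.
  rewrite integral_dirac// diracT mul1e /= -EFinM; over.
rewrite nneseries_esumT; last first.
  by move=> n; rewrite lee_fin mulr_ge0.
rewrite esum_mkcond [RHS]esum_mkcond; apply: eq_esum => n _.
by rewrite in_setT /atomic_weight; case: ifP => //; rewrite normr0 mul0r.
Qed.

Lemma atomic_phase_at n : {in I &, injective q} -> I n ->
  atomic_phase I q p (q n) = if p n < 0 then -1 else 1.
Proof.
move=> qi In; rewrite /atomic_phase; congr (if _ then _ else _).
apply/idP/idP => [/set_mem[m [Im pm] /qi mn]|pn].
  by rewrite -(mn (mem_set Im) (mem_set In)).
by apply: mem_set; exists n.
Qed.

(** [pr] is [Re] or [Im]. Positive and negative parts are integrated separately; a sign [s] with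
    [s ^+ 2 = 1] treats both at once. *)
Lemma Rintegral_atomic (f : R -> C) (pr : C -> R) : {in I &, injective q} ->
  (forall x : R, forall z, pr (x%:C * z) = x * pr z) ->
  measurable_fun (setT : set mR) (fun x => pr (f x * atomic_phase I q p x)) ->
  (forall z, `|pr z| <= N z) ->
  wsummable I (fun n => N (f (q n)) * `|p n|) ->
  Rintegral (cm_var nu) (setT : set mR) (fun x => pr (f x * atomic_phase I q p x)) =
  rsum I (fun n => pr (f (q n) * (p n)%:C)).
Proof.
move=> qi prZ mf prN ws; set h := fun x => pr _ in mf *.
have E (s : R) n : I n -> s ^+ 2 = 1 ->
    `|p n| * Num.max (s * h (q n)) 0 = Num.max (s * pr (f (q n) * (p n)%:C)) 0.
  move=> In s1; rewrite /h atomic_phase_at// [f (q n) * (p n)%:C]mulrC prZ.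
  rewrite maxr_pMr// mulr0; congr (Num.max _ _).
  have [pn|pn] := ltP (p n) 0.
    rewrite ltr0_norm// (_ : f (q n) * -1 = (-1)%:C * f (q n)) ?prZ; last by ring.
    by ring.
  by rewrite ger0_norm// mulr1; ring.
have mM (s : R) : measurable_fun setT (fun x : mR => Num.max (s * h x) 0).
  by apply: measurable_maxr; [exact: measurable_funM|exact: measurable_cst].
have fin (s : R) : s ^+ 2 = 1 ->
    (\int[cm_var nu]_x (Num.max (s * h x) 0)%:E =
     \esum_(n in I) (Num.max (s * pr (f (q n) * (p n)%:C)) 0)%:E)%E.
  move=> s1; rewrite ge0_integral_atomic//; last by move=> x; rewrite le_max lexx orbT.
  by apply: eq_esum => n In; rewrite E.
have lt (s : R) : s ^+ 2 = 1 ->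
   (\esum_(n in I) (Num.max (s * pr (f (q n) * (p n)%:C)) 0)%:E < +oo)%E.
  move=> s1; apply: le_lt_trans ws; apply: le_esum => n In; rewrite lee_fin ge_max.
  rewrite mulr_ge0 ?normc_ge0// andbT (le_trans (ler_norm _))// normrM.
  have -> : `|s| = 1 by apply/eqP; rewrite -sqrp_eq1// real_normK ?num_real// s1.
  by rewrite mul1r (le_trans (prN _))// Normc.normcM normcR.
have fine_part (s : R) : s ^+ 2 = 1 ->
   (\int[cm_var nu]_x (Num.max (s * h x) 0)%:E \is a fin_num)%E.
  move=> s1; rewrite fin// ge0_fin_numE ?lt// esum_ge0// => n _.
  by rewrite lee_fin le_max lexx orbT.
have N1 : (-1 : R) ^+ 2 = 1 by rewrite sqrrN expr1n.
have P1 : (\int[cm_var nu]_x ((EFin \o h)^\+ x) = \int[cm_var nu]_x (Num.max (1 * h x) 0)%:E)%E.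
  by apply: eq_integral => x _; rewrite mul1r funeposE EFin_max.
have P2 : (\int[cm_var nu]_x ((EFin \o h)^\- x) = \int[cm_var nu]_x (Num.max (-1 * h x) 0)%:E)%E.
  by apply: eq_integral => x _; rewrite mulN1r funenegE EFin_max.
rewrite /Rintegral -/(EFin \o h) integralE P1 P2 fineB ?fine_part ?expr1n//.
rewrite !fin ?expr1n// /rsum.
congr (fine _ - fine _); apply: eq_esum => n _; by rewrite ?mul1r ?mulN1r.
Qed.

Lemma cm_integral_atomic (f : R -> C) : {in I &, injective q} ->
  cmeasurable (setT : set mR) f -> wsummable I (fun n => N (f (q n)) * `|p n|) ->
  cm_integral nu setT f = csum I (fun n => f (q n) * (p n)%:C).
Proof.
move=> qi mf ws; rewrite /cm_integral /cintegral /csum.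
have [mr mi] : cmeasurable (setT : set mR) (fun x => f x * atomic_phase I q p x).
  by apply: cmeasurableM => //; split; [exact: atomic_phase_Re|exact: atomic_phase_Im].
apply: complex_ext => /=; apply: Rintegral_atomic => //.
- by move=> x z; rewrite ReRM.
- exact: ler_Re_normc.
- by move=> x z; rewrite ImRM.
- exact: ler_Im_normc.
Qed.

Lemma atomic_tempered_at (m : nat) : tempered_at nu m <->
  wsummable I (fun n => `|p n| * (1 + q n ^+ 2) `^ (- (m%:R / 2))).
Proof.
rewrite /tempered_at ge0_integral_atomic//; last by move=> x; exact: powR_ge0.
apply: (@measurableT_comp _ _ _ _ _ _ (fun y : R => y `^ (- (m%:R / 2)))).
  exact: measurable_powR.
by apply: measurable_funD; [exact: measurable_cst|exact: measurable_funX].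
Qed.

Lemma atomic_support n : I n -> p n != 0 -> cm_support nu (q n).
Proof.
move=> In pn e e0; rewrite gt_eqF//.
have mb : measurable (ball (q n) e : set mR) by exact: measurable_ball.
apply: (@lt_le_trans _ _ (`|p n|%:E)); first by rewrite lte_fin normr_gt0.
rewrite /= /mseries.
apply: le_trans (nneseries_lim_ge n.+1 _); last by move=> k _ _; exact: measure_ge0.
rewrite (@big_cat_nat _ _ _ n)//= big_nat1 -[leLHS]add0e leeD//.
  by apply: sume_ge0 => k _; exact: measure_ge0.
by rewrite /mscale /= diracE mem_set ?mule1 /atomic_weight ?mem_set//; exact: ballxx.
Qed.

Lemma atomic_real (B : set R) : Im (cm_val nu B) = 0.
Proof.
rewrite /cm_val /cm_integral /cintegral /=.
rewrite (@eq_Rintegral _ _ _ _ _ (cst 0)) ?Rintegral_cst0//.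
  by rewrite /Rintegral integral0.
by move=> x _; rewrite mul1r /atomic_phase; case: ifP => //= _; rewrite oppr0.
Qed.

End AtomicMeasures.

Section Orders.
Variable R : realType.
Local Notation C := (cplx R).
Local Notation N := (@Normc.normc R).

Lemma leastP (P : nat -> Prop) : (exists m, P m) ->
  P (least P) /\ forall j, P j -> (least P <= j)%N.
Proof.
move=> [m Pm]; have ex : exists m, `[< P m >] by exists m; exact/asboolP.
case: (ex_minnP ex) => m0 /asboolP Pm0 min.
apply: (@xgetPex _ 0%N [set m | P m /\ forall j, P j -> (m <= j)%N]).
by exists m0; split=> // j Pj; apply: min; exact/asboolP.
Qed.

Lemma powR_half (x : R) (m : nat) : 0 <= x ->
  (1 + x) `^ (- ((2 * m)%:R / 2)) = ((1 + x) ^+ m)^-1.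
Proof.
by move=> x0; rewrite natrM mulrC mulKf// powRN powR_mulrn// addr_ge0.
Qed.

Lemma ler_powR_half (x : R) (m m' : nat) : 0 <= x -> (m <= m')%N ->
  (1 + x) `^ (- (m'%:R / 2)) <= (1 + x) `^ (- (m%:R / 2)).
Proof.
move=> x0 mm; rewrite ler_powR ?lerDl// lerN2 ler_pM2r ?invr_gt0//.
by rewrite ler_nat.
Qed.

Lemma tempered_atW (nu : cmeasure R) (m m' : nat) : (m <= m')%N ->
  tempered_at nu m -> tempered_at nu m'.
Proof.
move=> mm; apply: le_lt_trans; apply: ge0_le_integral => //.
- by move=> x _; rewrite lee_fin powR_ge0.
- apply/measurable_EFinP; apply: (@measurableT_comp _ _ _ _ _ _ (fun y : R => y `^ _)).
    exact: measurable_powR.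
  by apply: measurable_funD; [exact: measurable_cst|exact: measurable_funX].
- apply/measurable_EFinP; apply: (@measurableT_comp _ _ _ _ _ _ (fun y : R => y `^ _)).
    exact: measurable_powR.
  by apply: measurable_funD; [exact: measurable_cst|exact: measurable_funX].
- by move=> x _; rewrite lee_fin ler_powR_half// sqr_ge0.
Qed.

Lemma discrete_tempered_atW (b : C -> C) (m m' : nat) : (m <= m')%N ->
  discrete_tempered_at b m -> discrete_tempered_at b m'.
Proof.
move=> mm; apply: le_lt_trans; apply: le_esum => g _; rewrite lee_fin.
by rewrite ler_wpM2l ?normc_ge0// ler_powR_half// sqr_ge0.
Qed.

(** Temperedness is monotone in the exponent; [strongly_tempered] ensures that [ord] is a true
    minimum and not the default value of [least]. *)
Lemma ord_tempered (nu : cmeasure R) m : strongly_tempered nu -> (ord nu <= m)%N ->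
  tempered_at nu m.
Proof. by move=> /leastP[h _] om; exact: tempered_atW h. Qed.

Lemma discrete_ord_tempered (b : C -> C) m : discrete_strongly_tempered b ->
  (discrete_ord b <= m)%N -> discrete_tempered_at b m.
Proof. by move=> /leastP[h _] om; exact: discrete_tempered_atW h. Qed.

End Orders.

(** * Estimates for the kernels *)

Section KernelBounds.
Variable R : realType.
Local Notation C := (cplx R).
Local Notation N := (@Normc.normc R).
Local Notation Re := (@complex.Re R).
Local Notation Im := (@complex.Im R).
Implicit Types (z g : C) (r s d : R).

(** [kern] without the factor [(z^2 + r^2)^k], which stands before the sums in the
    representation. *)
Definition kern1 (k : nat) (r : R) z g : C :=
  ((r ^+ 2)%:C + g * z) / (g - z) / ((r ^+ 2)%:C + g ^+ 2) ^+ k.+1.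

Lemma kernE k r z g : kern k r z g = (z ^+ 2 + (r ^+ 2)%:C) ^+ k * kern1 k r z g.
Proof. by rewrite /kern /kern1 !mulrA. Qed.

(** From [r^2 + g z = (z^2 + r^2) + z (g - z)]: only the first part keeps the pole. *)
Lemma kern1E k r z g : g != z ->
  kern1 k r z g = ((z ^+ 2 + (r ^+ 2)%:C) / (g - z) + z) / ((r ^+ 2)%:C + g ^+ 2) ^+ k.+1.
Proof.
move=> gz; rewrite /kern1; congr (_ / _).
by field; rewrite subr_eq0.
Qed.

(** Bounds [(z^2 + r^2) / (g - z) + z] when [g] is at distance at least [d] from [z]. *)
Definition kern_growth (r d : R) z : R := (N z ^+ 2 + r ^+ 2) / d + N z.

Let q0 r z : 0 <= N z ^+ 2 + r ^+ 2.
Proof. by rewrite addr_ge0 ?sqr_ge0. Qed.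

Lemma kern_growth_ge0 r d z : 0 <= d -> 0 <= kern_growth r d z.
Proof. by move=> d0; rewrite addr_ge0 ?normc_ge0// divr_ge0. Qed.

Lemma kern_growth_mono r r' d z : 0 <= r -> r <= r' -> 0 < d ->
  kern_growth r d z <= kern_growth r' d z.
Proof.
move=> r0 rr d0; rewrite lerD2r ler_pM2r ?invr_gt0// lerD2l.
by rewrite ler_sqr ?nnegrE// (le_trans r0).
Qed.

Lemma normc_sqrD_le z r : N (z ^+ 2 + (r ^+ 2)%:C) <= N z ^+ 2 + r ^+ 2.
Proof. by apply: ler_normcD; rewrite ?normcX// normcR ger0_norm ?sqr_ge0. Qed.

(** As the radius exceeds the half-width of the strip, [r^2 + g^2] is bounded below by a multiple of
    [1 + |g|^2]; its power [k + 1] gives the weight of a measure of order [2 (k + 1)]. *)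
Lemma kern1_bound k s r : 0 <= s < r -> exists2 c : R, 0 < c &
  forall g, `|Im g| <= s -> (r ^+ 2)%:C + g ^+ 2 != 0 /\
  forall z d, 0 < d -> d <= N (g - z) ->
  N (kern1 k r z g) <= c * kern_growth r d z * ((1 + N g ^+ 2) ^+ k.+1)^-1.
Proof.
move=> sr; have [c c0 Hc] := normc_sqr_add_ge sr; exists (c ^+ k.+1).
  by rewrite exprn_gt0.
move=> g gs; have p0 : 0 < 1 + N g ^+ 2 by rewrite ltr_pwDl ?sqr_ge0.
have Hg := Hc g gs; rewrite (addrC (g ^+ 2)) in Hg.
have rg0 : 0 < N ((r ^+ 2)%:C + g ^+ 2).
  by rewrite -(pmulr_rgt0 _ c0); exact: lt_le_trans p0 _.
split; first by rewrite -normc_gt0.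
move=> z d d0 dg; have gz0 : 0 < N (g - z) by exact: lt_le_trans dg.
have gz : g != z by rewrite -subr_eq0 -normc_gt0.
rewrite kern1E// Normc.normcM Normc.normcV normcX.
have -> : c ^+ k.+1 * kern_growth r d z / (1 + N g ^+ 2) ^+ k.+1 =
   kern_growth r d z * (c / (1 + N g ^+ 2)) ^+ k.+1 by rewrite expr_div_n; ring.
rewrite ler_pM ?invr_ge0 ?exprn_ge0 ?normc_ge0//.
  apply: ler_normcD => //; rewrite Normc.normcM Normc.normcV ler_pM ?invr_ge0 ?normc_ge0//.
    exact: normc_sqrD_le.
  by rewrite lef_pV2 ?posrE.
rewrite -exprVn lerXn2r ?nnegrE ?invr_ge0 ?normc_ge0 ?divr_ge0 ?(ltW p0) ?(ltW c0)//.
by rewrite -[leLHS]mul1r ler_pdivrMr// mulrAC ler_pdivlMr// mul1r.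
Qed.

End KernelBounds.

(** * Real and non-real points as one family *)

Section Points.
Variable R : realType.
Local Notation C := (cplx R).
Local Notation N := (@Normc.normc R).
Local Notation Re := (@complex.Re R).
Local Notation Im := (@complex.Im R).
Implicit Types (z g : C) (r s d : R).
Variables (I : set nat) (q p : nat -> R) (A : set C) (b : C -> C).
Hypotheses (qi : {in I &, injective q}) (AI : forall g, A g -> Im g != 0).

Definition pts : set C := [set (q n)%:C | n in I] `|` A.

(* The real and the non-real points are merged into a single family, with the
   masses [mass] and with [radius] in the role of the [rho] of the kernel, so
   that both sums of the representation are instances of the same one. *)
Definition mass (g : C) : C :=
  if Im g == 0 then (p (xget 0%N [set n | I n /\ q n = Re g]))%:C else b g.

Definition radius (rho : R) (g : C) : R := if Im g == 0 then 1 else rho.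

Lemma mass_real n : I n -> mass (q n)%:C = (p n)%:C.
Proof.
move=> In; rewrite /mass /= eqxx; congr ((p _)%:C).
have [Im mn] : [set m | I m /\ q m = q n] (xget 0%N [set m | I m /\ q m = q n]).
  by apply: (@xgetPex _ 0%N [set m | I m /\ q m = q n]); exists n.
by apply: qi => //; exact: mem_set.
Qed.

Lemma mass_strip g : A g -> mass g = b g.
Proof. by move=> /AI/negPf; rewrite /mass => ->. Qed.

Lemma radius_real rho x : radius rho x%:C = 1. Proof. by rewrite /radius /= eqxx. Qed.

Lemma radius_strip rho g : A g -> radius rho g = rho.
Proof. by move=> /AI/negPf; rewrite /radius => ->. Qed.

Let realpts : set C := [set (q n)%:C | n in I].

Let bij_realpts : set_bij I realpts (fun n => (q n)%:C).
Proof.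
split; first by move=> n In; exists n.
  by move=> m n mI nI [] /qi; exact.
by move=> _ [n In <-]; exists n.
Qed.

Let ptsA : pts `&` A = A.
Proof. by apply/seteqP; split=> g; [case|move=> Ag; split=> //; right]. Qed.

Let ptsnA : pts `&` ~` A = realpts.
Proof.
apply/seteqP; split=> g; first by case=> -[].
by move=> [n In <-]; split; [left; exists n|move=> /AI; rewrite /= eqxx].
Qed.

Lemma csum_pts (f : C -> C) (w : C -> R) : wsummable pts w -> cdominated pts w f ->
  csum pts f = csum I (fun n => f (q n)%:C) + csum A f.
Proof.
move=> ws fw; rewrite (csumID A ws fw) ptsA ptsnA addrC; congr (_ + _).
exact: reindex_csum bij_realpts.
Qed.

Lemma wsummable_pts (w : C -> R) : (forall g, 0 <= w g) ->
  wsummable I (fun n => w (q n)%:C) -> wsummable A w -> wsummable pts w.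
Proof.
move=> w0 wI wA; rewrite /wsummable (esumID A); last by move=> g _; rewrite lee_fin.
rewrite ptsA ptsnA lte_add_pinfty//.
by rewrite (reindex_esum I realpts (fun n => (q n)%:C)).
Qed.

Lemma wsummable_pts_real (w : C -> R) : (forall g, 0 <= w g) -> wsummable pts w ->
  wsummable I (fun n => w (q n)%:C).
Proof.
move=> w0 ws; apply: (reindex_wsummable w0 bij_realpts).
by apply: wsummable_sub ws => // g Hg; left.
Qed.

Lemma wsummable_pts_strip (w : C -> R) : (forall g, 0 <= w g) -> wsummable pts w ->
  wsummable A w.
Proof. by move=> w0; apply: wsummable_sub => // g Hg; right. Qed.

Variables (k : nat) (s : R).
Hypotheses (s0 : 0 <= s) (As : forall g, A g -> `|Im g| <= s).

Definition pts_weight (g : C) : R := N (mass g) * ((1 + N g ^+ 2) ^+ k.+1)^-1.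

Lemma pts_weight_ge0 g : 0 <= pts_weight g.
Proof. by rewrite mulr_ge0 ?normc_ge0// invr_ge0 exprn_ge0// addr_ge0// sqr_ge0. Qed.

Lemma pts_weight_summable :
  wsummable I (fun n => `|p n| * ((1 + q n ^+ 2) ^+ k.+1)^-1) ->
  wsummable A (fun g => N (b g) * ((1 + N g ^+ 2) ^+ k.+1)^-1) ->
  wsummable pts pts_weight.
Proof.
move=> wI wA; apply: wsummable_pts; first exact: pts_weight_ge0.
  apply: wsummable_le wI => n In.
  by rewrite /pts_weight mass_real// !normcR real_normK ?num_real.
by apply: wsummable_le wA => g Ag; rewrite /pts_weight mass_strip.
Qed.

Lemma pts_strip g : pts g -> `|Im g| <= s.
Proof. by case=> [[n In <-]|/As//]; rewrite /= normr0. Qed.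

Hypothesis ws : wsummable pts pts_weight.

Lemma pts_kern1_bound rho : s < rho -> exists c r1 : R, [/\ 0 < c, 0 <= r1,
  forall g, pts g -> ((radius rho g) ^+ 2)%:C + g ^+ 2 != 0,
  forall g, 0 <= radius rho g <= r1 &
  forall z d g, 0 < d -> pts g -> d <= N (g - z) ->
  N (kern1 k (radius rho g) z g * mass g) <= c * kern_growth r1 d z * pts_weight g].
Proof.
move=> srho; have rho0 : 0 < rho by exact: le_lt_trans srho.
(* Real points lie in the strip of half-width 0, so radius 1 is admissible for them whatever [s]
   is. *)
have [|c c0 Hc] := @kern1_bound R k 0 1; first by rewrite lexx ltr01.
have [|c' c'0 Hc'] := @kern1_bound R k s rho; first by rewrite s0.
exists (Num.max c c'), (Num.max 1 rho); split.
- by rewrite lt_max c0.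
- by rewrite le_max ler01.
- move=> g [[n In <-]|Ag].
    by rewrite radius_real; apply: (Hc _ _).1; rewrite /= normr0.
  by rewrite radius_strip//; apply: (Hc' _ _).1; exact: As.
- by move=> g; rewrite /radius; case: ifP => _; rewrite le_max lexx ?orbT andbT ?(ltW rho0).
move=> z d g d0 Dg Hd.
have key c1 r : 0 < c1 -> c1 <= Num.max c c' -> 0 <= r -> r <= Num.max 1 rho ->
    N (kern1 k r z g) <= c1 * kern_growth r d z * ((1 + N g ^+ 2) ^+ k.+1)^-1 ->
    N (kern1 k r z g * mass g) <= Num.max c c' * kern_growth (Num.max 1 rho) d z * pts_weight g.
  move=> c10 c1m r0 rm h; rewrite Normc.normcM /pts_weight mulrCA mulrC ler_wpM2l ?normc_ge0//.
  apply: le_trans h _; rewrite ler_wpM2r ?invr_ge0 ?exprn_ge0 ?addr_ge0 ?sqr_ge0//.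
  rewrite ler_pM ?(ltW c10) ?kern_growth_ge0 ?(ltW d0)//.
  exact: kern_growth_mono.
case: (Dg) => [[n In gE]|Ag].
  have rE : radius rho g = 1 by rewrite -gE radius_real.
  rewrite rE; apply: (key c) => //; rewrite ?le_max ?lexx//.
  by apply: (Hc g _).2 => //; rewrite -gE /= normr0.
rewrite radius_strip//; apply: (key c') => //; rewrite ?le_max ?lexx ?orbT ?(ltW rho0)//.
by apply: (Hc' g _).2 => //; exact: As.
Qed.

Lemma pts_kern_bound rho : s < rho -> exists c r1 : R, [/\ 0 < c, 0 <= r1 &
  forall z d g, 0 < d -> pts g -> d <= N (g - z) ->
  N (kern k (radius rho g) z g * mass g) <=
    (N z ^+ 2 + r1 ^+ 2) ^+ k * (c * kern_growth r1 d z) * pts_weight g].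
Proof.
move=> srho; have [c [r1 [c0 r10 _ rr Hk]]] := pts_kern1_bound srho.
exists c, r1; split=> // z d g d0 Dg Hd; have /andP[g0 g1] := rr g.
rewrite kernE -mulrA Normc.normcM -mulrA ler_pM ?normc_ge0//; last exact: Hk.
rewrite normcX lerXn2r ?nnegrE ?normc_ge0 ?addr_ge0 ?sqr_ge0//.
apply: le_trans (normc_sqrD_le _ _) _.
by rewrite lerD2l ler_sqr ?nnegrE// (le_trans g0).
Qed.

Definition twopii : C := 0 +i* (2 * pi).

Lemma twopii_neq0 : twopii != 0.
Proof. by rewrite eq_complex /= eqxx /= mulf_neq0// gt_eqF// pi_gt0. Qed.

(** The two series merge into one sum over [pts]. The absolute convergence demanded by [represented]
    follows from the weights, so it does not reappear on the right. *)
Lemma representedP rho Q (F : C -> C) : s < rho -> limit_point pts = set0 ->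
  represented F I q p A b k rho Q <-> forall z, ~ pts z ->
  F z = twopii^-1 * csum pts (fun g => kern k (radius rho g) z g * mass g) +
    (0 +i* 1) * (map_poly (real_complex R) Q).[z].
Proof.
move=> srho lp.
have [c [r1 [c0 r10 _ _ Hk]]] := pts_kern1_bound srho.
have [c' [r1' [c'0 r1'0 Hk']]] := pts_kern_bound srho.
have conv z : ~ pts z -> [/\ csummable I (real_term q p k z),
      csummable A (strip_term b k rho z) &
    csum pts (fun g => kern k (radius rho g) z g * mass g) =
    (z ^+ 2 + 1) ^+ k * csum I (real_term q p k z) +
    (z ^+ 2 + (rho ^+ 2)%:C) ^+ k * csum A (strip_term b k rho z)].
  move=> nz; have [d d0 Hd'] := limit_point0_sep z lp.
  have Hd g : pts g -> d <= N (g - z).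
    by move=> Dg; apply: Hd' => //; apply/eqP => gz; apply: nz; rewrite -gz.
  set u := c * kern_growth r1 d z.
  have u0 : 0 <= u by rewrite mulr_ge0 ?(ltW c0) ?kern_growth_ge0 ?(ltW d0).
  have su : wsummable pts (fun g => u * pts_weight g).
    by apply: wsummableZ => // g _; exact: pts_weight_ge0.
  have uw0 g : 0 <= u * pts_weight g by rewrite mulr_ge0 ?pts_weight_ge0.
  have dk : cdominated pts (fun g => u * pts_weight g) (fun g => kern1 k (radius rho g) z g * mass g).
    by move=> g Dg; exact: Hk d0 Dg (Hd g Dg).
  have E1 n : I n -> kern1 k (radius rho (q n)%:C) z (q n)%:C * mass (q n)%:C =
      real_term q p k z n.
    move=> In; rewrite radius_real mass_real// /kern1 /real_term expr1n.
    rewrite -[LHS]mulrA; congr (_ * _).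
    rewrite (_ : 1%:C + (q n)%:C ^+ 2 = (1 + q n ^+ 2)%:C); last first.
      by rewrite (rmorphD (real_complex R)) (rmorphXn (real_complex R)).
    rewrite -(rmorphXn (real_complex R)) -(fmorphV (real_complex R)) mulrC.
    by rewrite -(rmorphM (real_complex R)).
  have E2 g : A g -> kern1 k (radius rho g) z g * mass g = strip_term b k rho z g.
    by move=> Ag; rewrite radius_strip// mass_strip// /kern1 /strip_term; ring.
  have s1 : csummable I (real_term q p k z).
    apply: wsummable_le (wsummable_pts_real uw0 su) => n In.
    by rewrite -E1//; apply: dk; left; exists n.
  have s2 : csummable A (strip_term b k rho z).
    apply: wsummable_le (wsummable_pts_strip uw0 su) => g Ag.
    by rewrite -E2//; apply: dk; right.
  split=> //; rewrite (csum_pts (w := fun g => (N z ^+ 2 + r1' ^+ 2) ^+ k *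
     (c' * kern_growth r1' d z) * pts_weight g)); first last.
  - by move=> g Dg; exact: Hk' d0 Dg (Hd g Dg).
  - apply: wsummableZ => // [g _|]; first exact: pts_weight_ge0.
    rewrite mulr_ge0 ?exprn_ge0 ?addr_ge0 ?sqr_ge0// mulr_ge0 ?(ltW c'0)//.
    by rewrite kern_growth_ge0// ltW.
  rewrite -(csumZ _ s1 (fun n _ => lexx _)) -(csumZ _ s2 (fun n _ => lexx _)); congr (_ + _).
    apply: eq_csum => n In; rewrite kernE -mulrA E1//; congr ((_ + _) ^+ _ * _).
    by rewrite radius_real expr1n.
  by apply: eq_csum => g Ag; rewrite kernE -mulrA E2// radius_strip.
split=> H z nz.
  have [_ _ ->] := H z nz; have [_ _ ->] := conv z nz.
  by rewrite /twopii; ring.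
have [s1 s2 E] := conv z nz; split=> //.
by rewrite H// E /twopii; ring.
Qed.

End Points.

(** * The meromorphic extension of a summation pair *)

Section Mollifiers.
Variable R : realType.
Local Notation C := (cplx R).
Local Notation N := (@Normc.normc R).
Local Notation Re := (@complex.Re R).
Local Notation Im := (@complex.Im R).
Local Notation mu := (@lebesgue_measure R).
Local Notation mR := (measurableTypeR R).
Implicit Types (k : R -> R) (e : R) (f : R -> C).

Lemma conjCM (z w : C) : conjc (z * w) = conjc z * conjc w :> C.
Proof. exact: (rmorphM (@conjc R)). Qed.

Definition mollifier e k : Prop :=
  [/\ smooth k, forall x, 0 <= k x, forall x, k (- x) = k x,
     forall x, e < `|x| -> k x = 0 & 0 < k 0] /\
  (rintegrable mu (setT : set mR) k /\ Rintegral mu (setT : set mR) k = 1).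

Lemma mollifier_seq : exists k : nat -> R -> R, forall n, mollifier n.+1%:R^-1 (k n).
Proof.
have H n : exists k, mollifier n.+1%:R^-1 k.
  by apply: exists_mollifier; rewrite invr_gt0 ltr0n.
exists (fun n => projT1 (cid (H n))) => n; exact: projT2 (cid (H n)).
Qed.

Section One.
Variables (e : R) (k : R -> R).
Hypothesis (mk : mollifier e k).
Let K (t : R) : C := (k t)%:C.

Lemma mollifier_shift_test (t : R) : test_function (fun l => K (l - t)).
Proof.
have [[sk _ _ supp _] _] := mk; apply/test_functionP; split.
  apply: (csmooth_real (f := fun l => k (l - t))).
  have := @smooth_affine R k 1 (- t) sk.
  by under eq_fun do rewrite mul1r.
exists (`|e| + `|t|) => x xt; rewrite /K supp//.
have := ler_dist_dist x t; have := ler_norm e; have := ler_norm (`|x| - `|t|); lra.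
Qed.

Lemma mollifier_test : test_function K.
Proof. by have := mollifier_shift_test 0; under eq_fun do rewrite subr0. Qed.

Lemma mollify_integrable f (B : R) : cmeasurable (setT : set mR) f ->
  (forall t, `|t| <= e -> N (f t) <= B) ->
  cintegrable mu (setT : set mR) (fun t => K t * f t).
Proof.
move=> mf fB; have [[sk k0 _ supp _] [ik _]] := mk.
have mK : cmeasurable (setT : set mR) K.
  apply: cmeasurable_real; apply: continuous_measurable_fun; exact: smooth_continuous.
apply: (@cintegrable_dom _ _ _ _ _ _ (fun t : mR => B * k t)).
- exact: measurableT.
- exact: cmeasurableM.
- by apply: rintegrableZ => //; exact: measurableT.
move=> t _; rewrite Normc.normcM normcR ger0_norm// mulrC.
by have [te|te] := leP `|t| e; [rewrite ler_wpM2r// fB|rewrite supp// !mulr0].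
Qed.

Lemma mollify_bound f (B : R) : cmeasurable (setT : set mR) f ->
  (forall t, `|t| <= e -> N (f t) <= B) ->
  N (cintegral mu (setT : set mR) (fun t => K t * f t)) <= 2 * B.
Proof.
move=> mf fB; have [[sk k0 _ supp _] [ik ik1]] := mk.
have mT := @measurableT _ mR.
have -> : B = Rintegral mu (setT : set mR) (fun t => B * k t).
  by rewrite RintegralZl// ik1 mulr1.
apply: normc_cintegral => //.
- by apply: cintegrable_measurable; exact: mollify_integrable mf fB.
- exact: rintegrableZ.
move=> t _; rewrite Normc.normcM normcR ger0_norm// mulrC.
by have [te|te] := leP `|t| e; [rewrite ler_wpM2r// fB|rewrite supp// !mulr0].
Qed.

Lemma mollifier_integral : cintegral mu (setT : set mR) K = 1.
Proof.
have [_ [_ ik1]] := mk; apply: complex_ext => //=.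
by rewrite /Rintegral integral0.
Qed.

Lemma mollify_approx f (v : C) (B : R) : cmeasurable (setT : set mR) f ->
  (forall t, `|t| <= e -> N (f t - v) <= B) ->
  N (cintegral mu (setT : set mR) (fun t => K t * f t) - v) <= 2 * B.
Proof.
move=> mf fB; have mT := @measurableT _ mR.
have mc := @cmeasurable_cst _ _ _ (setT : set mR) v.
have mfv : cmeasurable (setT : set mR) (fun t => f t - v).
  have := cmeasurableD mf (@cmeasurable_cst _ _ _ (setT : set mR) (- v)).
  exact.
have fB' t : `|t| <= e -> N (f t) <= B + N v.
  by move=> te; rewrite -(subrK v (f t)); apply: ler_normcD => //; exact: fB.
have i1 := mollify_integrable mf fB'.
have i2 := mollify_integrable mc (fun t _ => lexx _).
have -> : v = cintegral mu (setT : set mR) (fun t => K t * v).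
  under eq_cintegral do rewrite mulrC.
  rewrite cintegralZ ?mollifier_integral ?mulr1//.
  by split; [exact: (mk.2).1|exact: (cintegrable0 mu mT).1].
rewrite -cintegralB//.
under eq_cintegral do rewrite -mulrBr.
exact: mollify_bound mfv fB.
Qed.

(** Evenness of the real [k] makes its transform commute with conjugation; this is what reflects the
    mollified identity into the lower half-plane. *)
Lemma mollifier_even_fourier (g : C) : conjc (fourier K g) = fourier K (conjc g).
Proof.
have [[_ _ ev _ _] _] := mk; rewrite !fourierE.
have ti := test_fourier_integrable g mollifier_test.
rewrite -cintegral_conj//.
rewrite -cintegral_opp; last by apply: cintegrable_conj => //; exact: measurableT.
apply: eq_cintegral => t _; rewrite /expo conjCM conj_cexp conj_RC /K ev.
congr (_ * cexp _).
by apply: complex_ext; rewrite /kz /=; case: g {ti} => x y /=; ring.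
Qed.

Lemma fourier_mollifier_shift (t : R) (g : C) :
  fourier (fun l => K (l - t)) g = fourier K g * expo (kz g) t.
Proof.
rewrite !fourierE; have ti := test_fourier_integrable g mollifier_test.
rewrite -(cintegral_shift (- t) ti) mulrC -cintegralZ; last first.
- exact: (cintegrable_shift (f := fun x => K x * expo (kz g) x) (- t) ti).
- exact: measurableT.
apply: eq_cintegral => l _; rewrite mulrCA; congr (_ * _).
by rewrite -expoD addrC subrK.
Qed.

End One.

(** The bound is uniform in [e <= 1], as required of a majorant when the mollification is
    removed. *)
Lemma mollified_fourier (s : R) (g : C) (e : R) k : 0 <= s -> `|Im g| <= s ->
  mollifier e k -> e <= 1 -> N (fourier (fun t => (k t)%:C) g) <= 2 * expR (2 * pi * s).
Proof.
move=> s0 gs mk e1; rewrite fourierE; apply: (mollify_bound mk).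
  by apply: cmeasurable_continuous; [exact: measurableT|exact: continuous_expo].
move=> t te; rewrite normc_expo Re_kz ler_expR -!mulrA ler_wpM2l// ler_wpM2l ?pi_ge0//.
apply: le_trans (ler_norm _) _; rewrite normrM -[leRHS]mulr1 ler_pM//.
exact: le_trans te _.
Qed.

Lemma expo_near (v : C) (l eta : R) : 0 < eta -> exists2 d : R, 0 < d &
  forall t, `|t| <= d -> N (expo v (l + t) - expo v l) <= eta.
Proof.
move=> eta0; have /cvg_normcP/(_ _ eta0)/nbhs_ballP[d d0 Hd] := @continuous_expo R v l.
have {}d0 : (0 : R) < d := d0.
exists (d / 2); first by rewrite divr_gt0.
move=> t td; rewrite normcB ltW//; apply: Hd.
by rewrite -ball_normE /ball_ /= opprD addrA subrr add0r normrN; lra.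
Qed.

Lemma mollified_fourier_cvg (k : nat -> R -> R) (g : C) :
  (forall n, mollifier n.+1%:R^-1 (k n)) ->
  fourier (fun t => (k n t)%:C) g @[n --> \oo] --> (1 : C).
Proof.
move=> mk; apply/cvg_normcP => eta eta0.
have eta40 : 0 < eta / 4 by rewrite divr_gt0.
have [d d0 Hd] := expo_near (kz g) 0 eta40.
near=> n; rewrite normcB fourierE.
apply: (@le_lt_trans _ _ (2 * (eta / 4))); last by lra.
apply: (mollify_approx (mk n)).
  by apply: cmeasurable_continuous; [exact: measurableT|exact: continuous_expo].
move=> t tn; rewrite -[X in _ - X](expo0 (kz g)) -{1}(add0r t); apply: Hd.
apply: le_trans tn _; apply: ltW; near: n; exact: (near_infty_natSinv_lt (PosNum d0)).
Unshelve. all: by end_near. Qed.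

(* The value at [0] is the limit of symmetric mollifications; it is the origin
   of the coefficient [1 / 2] of [a 0]. *)
Definition heaviside (l : R) : C := if 0 < l then 1 else if l < 0 then 0 else 1 / 2.

Section HalfTransform.
Variables (w : C) (c0 alpha : R).
Hypotheses (alpha0 : 0 < alpha) (c0alpha : alpha <= 2 * pi * c0) (wc : c0 < Im w).
Let v : C := twopii R * w.
Let u (t : R) : C := if 0 <= t then expo v t else 0.

(** The convolution at [l] of the mollifier with the exponential of frequency [w] truncated to
    [t >= 0]. *)
Definition halft (k : R -> R) (l : R) : C :=
  cintegral mu (`[0, +oo[%classic : set mR) (fun t => (k (l - t))%:C * expo v t).

Let c00 : 0 < c0.
Proof.
have p2 : 0 < 2 * pi :> R by rewrite mulr_gt0// pi_gt0.
by rewrite -(pmulr_rgt0 _ p2) (lt_le_trans alpha0).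
Qed.

Lemma Re_twopii (z : C) : Re (twopii R * z) = - (2 * pi * Im z).
Proof. by rewrite /twopii; case: z => x y /=; ring. Qed.

Let mu_ : cmeasurable (setT : set mR) u.
Proof.
have mh : measurable (`[0, +oo[%classic : set mR) by exact: measurable_itv.
have := cmeasurable_restrict mh (cmeasurable_continuous mh (@continuous_expo _ v)).
by apply: eq_cmeasurable => t _; rewrite /crestrict mem_setE in_itv /= andbT.
Qed.

Let mul (l : R) : cmeasurable (setT : set mR) (fun t => u (l - t)).
Proof.
have mf : measurable_fun (setT : set mR) (fun t : mR => (l - t : mR)).
  by apply: continuous_measurable_fun => x; apply: cvgB; [exact: cvg_cst|exact: cvg_id].
by split; [apply: (measurableT_comp mu_.1 mf)|apply: (measurableT_comp mu_.2 mf)].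
Qed.

(** Where [u (l - t)] does not vanish, [|l| <= l - t + 1]. The unit of slack costs [exp (2 pi c0)],
    and [alpha <= 2 pi c0] converts the decay at height [c0] into the rate [alpha]. *)
Let ub (l t : R) : `|t| <= 1 -> N (u (l - t)) <= expR (2 * pi * c0) * expR (- alpha * `|l|).
Proof.
move=> t1; rewrite /u; case: ifP => [lt|_]; last first.
  by rewrite Normc.normc0 mulr_ge0 ?expR_ge0.
rewrite normc_expo Re_twopii -expRD ler_expR.
have Hlt : `|l| <= l - t + 1 by have := ler_norm t; have := ler_norm (- t); rewrite normrN ler_norml => ? ?; apply/andP; lra.
have p2 : 0 < 2 * pi :> R by rewrite mulr_gt0// pi_gt0.
apply: (@le_trans _ _ (- (2 * pi * c0) * (l - t))).
  by rewrite !mulNr lerN2 ler_wpM2r// ler_pM2l// ltW.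
apply: (@le_trans _ _ (2 * pi * c0 + - (2 * pi * c0) * `|l|)).
  have : 2 * pi * c0 * `|l| <= 2 * pi * c0 * (l - t + 1) by rewrite ler_pM2l// mulr_gt0.
  lra.
by rewrite lerD2l !mulNr lerN2 ler_wpM2r.
Qed.

Lemma halftE e k l : mollifier e k -> e <= 1 ->
  halft k l = cintegral mu (setT : set mR) (fun t => (k t)%:C * u (l - t)).
Proof.
move=> mk e1; have i1 := mollify_integrable mk (@mul l) (fun t te => @ub l t (le_trans te e1)).
have [[_ _ ev _ _] _] := mk.
rewrite /halft cintegral_restrict -(cintegral_opp i1).
rewrite -(cintegral_shift (- l) (cintegrable_opp i1)).
apply: eq_cintegral => t _; rewrite /crestrict mem_setE in_itv /= andbT /u.
rewrite opprD opprK [- t + l]addrC (_ : l - (l - t) = t); last by ring.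
by case: ifP => _; rewrite ?mulr0.
Qed.

Lemma halft_bound e k l : mollifier e k -> e <= 1 ->
  N (halft k l) <= 2 * (expR (2 * pi * c0) * expR (- alpha * `|l|)).
Proof.
move=> mk e1; rewrite (halftE l mk e1); apply: (mollify_bound mk (@mul l)) => t te.
exact: ub (le_trans te e1).
Qed.

Lemma halft_cvg (k : nat -> R -> R) (l : R) : (forall n, mollifier n.+1%:R^-1 (k n)) ->
  halft (k n) l @[n --> \oo] --> heaviside l * expo v l.
Proof.
move=> mk; apply/cvg_normcP => eta eta0; have eta40 : 0 < eta / 4 by rewrite divr_gt0.
have [d d0 Hd] := expo_near v l eta40.
have n1 n : n.+1%:R^-1 <= 1 :> R by rewrite invf_le1 ?ler1n// ltr0n.
have small (x : R) : 0 < x -> \forall n \near \oo, forall t, `|t| <= n.+1%:R^-1 -> `|t| < x.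
  move=> x0; near=> n => t tn; apply: le_lt_trans tn _.
  by near: n; exact: (near_infty_natSinv_lt (PosNum x0)).
have fin (x : R) : x <= 2 * (eta / 4) -> x < eta by lra.
have [l0|l0|l0] := ltgtP l 0; last first.
- near=> n; rewrite normcB (halftE l (mk n) (n1 n)) /heaviside l0 ltxx; apply: fin.
  pose h (t : R) : C := if 0 <= t then 1 else 0.
  have mh : cmeasurable (setT : set mR) h.
    have hm : measurable (`[0, +oo[%classic : set mR) by exact: measurable_itv.
    have := cmeasurable_restrict hm (@cmeasurable_cst _ _ _ _ (1 : C)).
    by apply: eq_cmeasurable => t _; rewrite /crestrict mem_setE in_itv /= andbT.
  have mhN : cmeasurable (setT : set mR) (fun t => h (0 - t)).
    have mf : measurable_fun (setT : set mR) (fun t : mR => (0 - t : mR)).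
      by apply: continuous_measurable_fun => x; apply: cvgB; [exact: cvg_cst|exact: cvg_id].
    by split; [apply: (measurableT_comp mh.1 mf)|apply: (measurableT_comp mh.2 mf)].
  have hb t : `|t| <= n.+1%:R^-1 -> N (h (0 - t)) <= 1.
    by move=> _; rewrite /h; case: ifP => _; rewrite ?Normc.normc1 ?Normc.normc0.
  have ih := mollify_integrable (mk n) mhN hb.
  have iu := mollify_integrable (mk n) (@mul 0) (fun t te => @ub 0 t (le_trans te (n1 n))).
  (* By evenness half of the mass of the mollifier lies on each side of 0. *)
  have half : cintegral mu (setT : set mR) (fun t => (k n t)%:C * h (0 - t)) = 1 / 2.
    have [[_ _ ev _ _] _] := mk n.
    rewrite -(cintegral_opp ih).
    have hm : measurable (`[0, +oo[%classic : set mR) by exact: measurable_itv.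
    have -> : cintegral mu (setT : set mR) (fun x => (k n (- x))%:C * h (0 - - x)) =
        cintegral mu (`[0, +oo[%classic : set mR) (fun t => (k n t)%:C).
      rewrite [RHS]cintegral_restrict; apply: eq_cintegral => t _.
      rewrite ev /crestrict mem_setE in_itv /= andbT /h sub0r opprK.
      by case: ifP => _; rewrite ?mulr1 ?mulr0.
    have iK : cintegrable mu (setT : set mR) (fun t => (k n t)%:C).
      have := mollify_integrable (mk n) (@cmeasurable_cst _ _ _ (setT : set mR) 1) (fun t _ => lexx _).
      by apply: eq_cintegrable => // t _; rewrite mulr1.
    have := cintegral_halves iK; rewrite (mollifier_integral (mk n)).
    under [X in _ = _ + X]eq_cintegral do rewrite ev.
    move=> E; apply: (@mulfI _ 2); first by rewrite pnatr_eq0.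
    by rewrite mul1r divff ?pnatr_eq0// mulrC mulr_natr mulr2n -E.
  rewrite expo0 mulr1 -half -cintegralB//.
  under eq_cintegral do rewrite -mulrBr.
  apply: (mollify_bound (mk n)).
    have := cmeasurableD (@mul 0) (cmeasurableM (@cmeasurable_cst _ _ _ (setT : set mR) (- 1)) mhN).
    by apply: eq_cmeasurable => t _; rewrite mulN1r.
  move=> t tn; rewrite /u /h; case: ifP => _; last by rewrite subrr Normc.normc0 ltW.
  rewrite -[X in _ - X](expo0 v) -l0; apply: Hd; rewrite normrN; apply: ltW.
  move: t tn; near: n; exact: small.
- near=> n; rewrite normcB (halftE l (mk n) (n1 n)) /heaviside l0 mul1r; apply: fin.
  apply: (mollify_approx (mk n) (@mul l)) => t tn.
  have tl : `|t| < l by move: t tn; near: n; exact: small.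
  have td : `|t| <= d by apply: ltW; move: t tn {tl}; near: n; exact: small.
  rewrite /u ifT; first by apply: Hd; rewrite normrN.
  by have := ler_norm t; lra.
- near=> n; rewrite normcB (halftE l (mk n) (n1 n)) /heaviside (lt_gtF l0) l0 mul0r; apply: fin.
  apply: (mollify_approx (mk n) (@mul l)) => t tn.
  have tl : `|t| < - l by move: t tn; near: n; apply: small; rewrite oppr_gt0.
  rewrite /u ifF; first by rewrite subrr Normc.normc0 ltW.
  by apply/negP => h; have := ler_norm (- t); rewrite normrN; lra.
Unshelve. all: by end_near. Qed.

End HalfTransform.

End Mollifiers.

(** * The summation formula applied to mollified exponentials *)

Section DirectIdentity.
Variable R : realType.
Local Notation C := (cplx R).
Local Notation N := (@Normc.normc R).
Local Notation Re := (@complex.Re R).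
Local Notation Im := (@complex.Im R).
Local Notation mu := (@lebesgue_measure R).
Local Notation mR := (measurableTypeR R).
Local Notation half := (`[0, +oo[%classic : set mR).
Variables (D : set C) (m : C -> C) (a : R -> C) (s c0 alpha : R) (k : nat).
Let w0 (g : C) : R := N (m g) * ((1 + N g ^+ 2) ^+ k.+1)^-1.
Hypotheses (s0 : 0 <= s) (sc : s <= c0) (alpha0 : 0 < alpha)
  (c0alpha : alpha <= 2 * pi * c0).
Hypothesis Ds : forall g, D g -> `|Im g| <= s.
Hypothesis ws : wsummable D w0.
Hypothesis FS : forall phi : R -> C, test_function phi ->
  csum setT (fun l => a l * phi l) = csum D (fun g => m g * fourier phi g).
Hypothesis wa : wsummable setT (fun l => N (a l) * expR (- alpha * `|l|)).
Hypotheses (DJ : forall g, D g -> D (conjc g)) (mJ : forall g, D g -> m (conjc g) = m g)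
  (mr : forall g, D g -> conjc (m g) = m g) (aJ : forall l, conjc (a l) = a (- l)).

Lemma cvg_sumC (J : eqType) (r : seq J) (f : J -> nat -> C) (v : J -> C) :
  (forall i, i \in r -> f i n @[n --> \oo] --> v i) ->
  \sum_(i <- r) f i n @[n --> \oo] --> \sum_(i <- r) v i.
Proof.
elim: r => [|i r IH] H.
  by rewrite big_nil; under eq_fun do rewrite big_nil; exact: cvg_cst.
rewrite big_cons; under eq_fun do rewrite big_cons.
apply: (@cvgD C); first by apply: H; rewrite mem_head.
by apply: IH => j jr; apply: H; rewrite in_cons jr orbT.
Qed.

Lemma conjCV (z : C) : conjc (z^-1) = (conjc z)^-1 :> C.
Proof. exact: (fmorphV (@conjc R)). Qed.

Lemma conjCB (z w : C) : conjc (z - w) = conjc z - conjc w :> C.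
Proof. exact: (rmorphB (@conjc R)). Qed.

Let w00 g : 0 <= w0 g.
Proof. by rewrite mulr_ge0 ?normc_ge0// invr_ge0 exprn_ge0// addr_ge0// sqr_ge0. Qed.

Let wa0 l : 0 <= N (a l) * expR (- alpha * `|l|).
Proof. by rewrite mulr_ge0 ?normc_ge0// expR_ge0. Qed.

Lemma strip_dist g w : D g -> s < `|Im w| -> `|Im w| - s <= N (g - w).
Proof.
move=> Dg sw; apply: le_trans (ler_Im_normc _); rewrite ImD ImN.
have := Ds Dg; have := ler_dist_dist (Im w) (Im g); rewrite distrC.
have := ler_norm (`|Im w| - `|Im g|); lra.
Qed.

Section Mollified.
Variables (e : R) (kap : R -> R).
Hypotheses (mk : mollifier e kap) (ele1 : e <= 1).
Let K (t : R) : C := (kap t)%:C.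

Lemma mollified_summable : exists2 c : R, 0 <= c &
  cdominated D (fun g => c * w0 g) (fun g => m g * fourier K g).
Proof.
have [c c0' Hc] := test_fourier_decay s k.+1 (mollifier_test mk).
exists c => // g Dg; rewrite Normc.normcM /w0 mulrCA ler_wpM2l ?normc_ge0//.
exact: Hc (Ds Dg).
Qed.

(** The truncated exponential has unbounded support, so the formula is applied to each translate
    [K (l - t)] and then integrated over [t >= 0] against [expo v]. On the side of the points the
    integral produces [1 / (g - w)], on the side of the frequencies it is [halft]; both are
    exchanges of a sum with an integral. *)
Lemma mollified_transform w : c0 < Im w ->
  (twopii R)^-1 * csum D (fun g => m g * fourier K g / (g - w)) =
  csum setT (fun l => a l * halft w kap l).
Proof.
move=> wc; have [c c_ge0 Hc] := mollified_summable.
have mh : measurable half by exact: measurable_itv.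
have sw : s < Im w by exact: le_lt_trans wc.
have p2 : 0 < 2 * pi :> R by rewrite mulr_gt0// pi_gt0.
have [[sk k0 ev supp _] _] := mk.
have FSt t : csum setT (fun l => a l * K (l - t)) =
    csum D (fun g => m g * fourier K g * expo (kz g) t).
  rewrite (FS (mollifier_shift_test mk t)); apply: eq_csum => g Dg.
  by rewrite (fourier_mollifier_shift mk) mulrA.
have cws : wsummable D (fun g => c * w0 g) by exact: wsummableZ.
have cw0 g : D g -> 0 <= c * w0 g by rewrite mulr_ge0.
pose v : C := twopii R * w.
have vE g : kz g + v = twopii R * (w - g).
  by apply: complex_ext; rewrite /kz /v /twopii; case: g => x y; case: (w) => x' y' /=; ring.
have Rev g : Re (kz g + v) = - (2 * pi * (Im w - Im g)) by rewrite vE Re_twopii ImD ImN.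
pose H1 (t : R) := expR (- (2 * pi * (Im w - s)) * t).
have iH1 : rintegrable mu half H1.
  by apply: rintegrable_exp; rewrite mulr_gt0// subr_gt0.
have bd1 g t : D g -> half t -> N (m g * fourier K g * expo (kz g + v) t) <= c * w0 g * H1 t.
  rewrite /= in_itv /= andbT => Dg t0; rewrite Normc.normcM ler_pM ?normc_ge0//.
    exact: Hc.
  rewrite normc_expo Rev ler_expR ler_wpM2r// lerN2 ler_pM2l// lerD2l lerN2.
  exact: le_trans (ler_norm _) (Ds Dg).
have mexp (c' : C) z : cmeasurable half (fun t => c' * expo z t).
  by apply: cmeasurable_continuous => //; apply: continuousMc; [exact: continuous_cstc|exact: continuous_expo].
have [_ E1] := cintegral_csum mh cws cw0 (fun g _ => mexp (m g * fourier K g) (kz g + v))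
  iH1 (fun t _ => expR_ge0 _) bd1.
have d0 : 0 < Im w - s by rewrite subr_gt0.
have dist g : D g -> Im w - s <= N (g - w).
  move=> Dg; have := @strip_dist g w Dg; rewrite ger0_norm; last exact: le_trans s0 (ltW sw).
  exact.
have gw0 g : D g -> g - w != 0.
  by move=> /dist h; rewrite -normc_gt0; exact: lt_le_trans h.
have int1 g : D g -> cintegral mu half (fun t => m g * fourier K g * expo (kz g + v) t) =
   (twopii R)^-1 * (m g * fourier K g / (g - w)).
  move=> Dg; have [|i1 i1E] := @cintegral_exp_half _ (kz g + v).
    rewrite Rev oppr_lt0 mulr_gt0// subr_gt0; apply: le_lt_trans sw.
    exact: le_trans (ler_norm _) (Ds Dg).
  rewrite cintegralZ// i1E vE -(opprB g w); field.
  by rewrite gw0// twopii_neq0.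
have dom1 : cdominated D (fun g => (Im w - s)^-1 * (c * w0 g))
    (fun g => m g * fourier K g / (g - w)).
  move=> g Dg; rewrite Normc.normcM Normc.normcV mulrC ler_pM ?invr_ge0 ?normc_ge0//.
    by rewrite lef_pV2 ?posrE//; [exact: dist|rewrite normc_gt0 gw0].
  exact: Hc.
have dom1s : wsummable D (fun g => (Im w - s)^-1 * (c * w0 g)).
  by apply: wsummableZ => //; rewrite invr_ge0 ltW.
rewrite -(csumZ _ dom1s dom1) -(eq_csum int1) -E1.
have [Mk supk] : exists M, csupp K M.
  by have /test_functionP[] := mollifier_test mk.
have [B B0 HB] := csupp_bounded (test_continuous (mollifier_test mk)) supk.
(* [K (l - t)] vanishes unless [|l| <= t + 1], so [exp (alpha |l|)] is then at most
   [exp (2 pi c0 (t + 1))]; what is left of the decay of [expo v] is [H2]. *)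
pose B2 := B * expR (2 * pi * c0).
have B20 : 0 <= B2 by rewrite mulr_ge0 ?expR_ge0.
pose H2 (t : R) := expR (- (2 * pi * (Im w - c0)) * t).
have iH2 : rintegrable mu half H2.
  by apply: rintegrable_exp; rewrite mulr_gt0// subr_gt0.
have B2w l : 0 <= B2 * (N (a l) * expR (- alpha * `|l|)) by rewrite mulr_ge0.
have B2s : wsummable setT (fun l => B2 * (N (a l) * expR (- alpha * `|l|))).
  exact: wsummableZ.
have c00 : 0 <= c0 by exact: le_trans sc.
have bd2 l t : [set: R] l -> half t ->
    N (a l * (K (l - t) * expo v t)) <= B2 * (N (a l) * expR (- alpha * `|l|)) * H2 t.
  move=> _; rewrite /= in_itv /= andbT => t0.
  rewrite [leRHS](_ : _ = N (a l) * (B * (expR (2 * pi * c0) * expR (- alpha * `|l|) * H2 t))); last first.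
    by rewrite /B2; ring.
  rewrite !Normc.normcM ler_wpM2l ?normc_ge0//.
  have [lt|lt] := leP `|l - t| e; last first.
    by rewrite /K supp// Normc.normc0 mul0r !mulr_ge0 ?expR_ge0.
  apply: ler_pM; [exact: normc_ge0|exact: normc_ge0|exact: HB|].
  rewrite normc_expo Re_twopii /H2 -!expRD ler_expR.
  have lt1 : `|l| <= t + 1.
    by move: (le_trans lt ele1); rewrite !ler_norml => /andP[? ?]; apply/andP; lra.
  have : 2 * pi * c0 * `|l| <= 2 * pi * c0 * (t + 1).
    by rewrite ler_wpM2l// mulr_ge0// ltW.
  have : alpha * `|l| <= 2 * pi * c0 * `|l| by rewrite ler_wpM2r.
  by lra.
have mexp2 l : [set: R] l -> cmeasurable half (fun t => a l * (K (l - t) * expo v t)).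
  move=> _; apply: cmeasurable_continuous => //; apply: continuousMc; first exact: continuous_cstc.
  apply: continuousMc; last exact: continuous_expo.
  move=> t; apply: (@continuous_comp _ _ _ (fun t : R => l - t) K).
    by apply: cvgB; [exact: cvg_cst|exact: cvg_id].
  exact: test_continuous (mollifier_test mk) _.
have [_ E2] := cintegral_csum mh B2s (fun l _ => B2w l) mexp2 iH2 (fun t _ => expR_ge0 _) bd2.
transitivity (csum setT (fun l => cintegral mu half (fun t => a l * (K (l - t) * expo v t)))); last first.
  apply: eq_csum => l _; rewrite cintegralZ//.
  apply: (@cintegrable_dom _ _ _ _ _ _ (fun t : mR => B * expR (- (2 * pi * Im w) * t))) => //.
  - apply: cmeasurable_continuous => //; apply: continuousMc; last exact: continuous_expo.
    move=> t; apply: (@continuous_comp _ _ _ (fun t : R => l - t) K).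
      by apply: cvgB; [exact: cvg_cst|exact: cvg_id].
    exact: test_continuous (mollifier_test mk) _.
  - apply: rintegrableZ => //; apply: rintegrable_exp; rewrite mulr_gt0//.
    exact: le_lt_trans sw.
  - move=> t _; rewrite Normc.normcM; apply: ler_pM; [exact: normc_ge0|exact: normc_ge0|exact: HB|].
    by rewrite normc_expo Re_twopii.
rewrite -E2; apply: eq_cintegral => t ht.
have s1 : wsummable D (fun g => expR (2 * pi * s * t) * (c * w0 g)).
  by apply: wsummableZ => //; exact: expR_ge0.
have d1 : cdominated D (fun g => expR (2 * pi * s * t) * (c * w0 g))
    (fun g => m g * fourier K g * expo (kz g) t).
  move=> g Dg; rewrite Normc.normcM mulrC ler_pM ?normc_ge0//; last exact: Hc.
  rewrite normc_expo Re_kz ler_expR; move: ht; rewrite /= in_itv /= andbT => ht.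
  by rewrite ler_wpM2r// ler_pM2l// (le_trans (ler_norm _))// Ds.
transitivity (expo v t * csum D (fun g => m g * fourier K g * expo (kz g) t)).
  rewrite -(csumZ _ s1 d1); apply: eq_csum => g _.
  by rewrite expo_add; ring.
rewrite -FSt.
have v0 : expo v t != 0 by rewrite /expo cexp_neq0.
rewrite (_ : csum setT (fun l => a l * K (l - t)) =
    (expo v t)^-1 * csum setT (fun l => a l * (K (l - t) * expo v t))).
  by rewrite mulrA divff// mul1r.
rewrite -(@csumZ _ _ _ _ (fun l => H2 t * (B2 * (N (a l) * expR (- alpha * `|l|))))).
- apply: eq_csum => l _; field.
  exact: v0.
- by apply: wsummableZ B2s => //; exact: expR_ge0.
- by move=> l _; rewrite [leRHS]mulrC; exact: bd2.
Qed.

End Mollified.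

Definition upper_series (w : C) : C :=
  csum setT (fun l => a l * (heaviside l * expo (twopii R * w) l)).

(** In the lower half-plane the value is dictated by the antisymmetry of the mollified transforms,
    see [transform_conj]. *)
Definition two_sided (w : C) : C :=
  if 0 < Im w then upper_series w else - conjc (upper_series (conjc w)).

Let c00 : 0 <= c0. Proof. exact: le_trans sc. Qed.

Lemma wsummable_growth (c : R) : 0 <= c ->
  wsummable setT (fun l => c * (N (a l) * expR (- alpha * `|l|))).
Proof. by move=> h; exact: wsummableZ. Qed.

Lemma heaviside_bound w l : c0 < Im w ->
  N (heaviside l * expo (twopii R * w) l) <= expR (- alpha * `|l|).
Proof.
move=> wc; rewrite /heaviside; have [l0|l0|<-] := ltgtP 0 l.
- rewrite mul1r normc_expo Re_twopii ler_expR gtr0_norm//.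
  rewrite ler_wpM2r ?(ltW l0)// lerN2 (le_trans c0alpha)// ler_wpM2l ?mulr_ge0 ?pi_ge0//.
  exact: ltW.
- by rewrite mul0r Normc.normc0 expR_ge0.
- rewrite normr0 mulr0 expR0 Normc.normcM normc_expo mulr0 expR0 mulr1.
  rewrite (_ : 2 = (2 : R)%:C :> C); last by rewrite rmorph_nat.
  by rewrite mul1r Normc.normcV normcR ger0_norm// invf_le1// ler1n.
Qed.

Lemma upper_series_dom w : c0 < Im w ->
  cdominated setT (fun l => N (a l) * expR (- alpha * `|l|))
    (fun l => a l * (heaviside l * expo (twopii R * w) l)).
Proof.
by move=> wc l _; rewrite Normc.normcM ler_wpM2l ?normc_ge0// heaviside_bound.
Qed.

Section Sequence.
Variable kap : nat -> R -> R.
Hypothesis mk : forall n, mollifier n.+1%:R^-1 (kap n).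
Let FK n := fourier (fun t => (kap n t)%:C).
Let T n w := (twopii R)^-1 * csum D (fun g => m g * FK n g / (g - w)).

Let n1 n : n.+1%:R^-1 <= 1 :> R.
Proof. by rewrite invf_le1 ?ler1n// ltr0n. Qed.

Lemma upper_transform_cvg w : c0 < Im w -> T n w @[n --> \oo] --> upper_series w.
Proof.
move=> wc; under eq_fun do rewrite /T /FK (mollified_transform (mk _) (n1 _) wc).
have B0 : 0 <= 2 * expR (2 * pi * c0) by rewrite mulr_ge0 ?expR_ge0.
(* [csum_cvg] asks for one majorant of the terms and of their limit; the latter is bounded with
   constant 1. *)
have E0 : 1 <= 2 * expR (2 * pi * c0) :> R.
  have : 1 <= expR (2 * pi * c0) by rewrite -expR0 ler_expR !mulr_ge0 ?pi_ge0.
  by lra.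
apply: (csum_cvg _ (wsummable_growth B0)).
- apply: nearW => n l _; rewrite Normc.normcM mulrCA ler_wpM2l ?normc_ge0//.
  by have := halft_bound alpha0 c0alpha wc l (mk n) (n1 n); rewrite mulrA.
- move=> l Tl; apply: le_trans (upper_series_dom wc Tl) _.
  by rewrite ler_peMl.
- move=> l _; apply: (@cvgM C); first exact: cvg_cst.
  exact: (halft_cvg alpha0 c0alpha wc).
Qed.

Let bijJ : set_bij D D (@conjc R : C -> C).
Proof.
split; first by move=> g /DJ.
  by move=> g h _ _; exact: (inv_inj (@conjcK R)).
by move=> g Dg; exists (conjc g); [exact: DJ|exact: conjcK].
Qed.

(** Points and masses are symmetric under conjugation and the mollifier is even; the sign comes from
    the conjugate of [2 i pi]. *)
Lemma transform_conj n w : conjc (T n (conjc w)) = - T n w.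
Proof.
rewrite /T conjCM -csum_conj -mulNr; congr (_ * _).
  by rewrite conjCV -invrN; congr (_^-1); apply: complex_ext; rewrite /twopii /= ?oppr0.
rewrite [RHS](reindex_csum _ bijJ); apply: eq_csum => g Dg /=.
rewrite conjCM conjCM mr// mJ// (mollifier_even_fourier (mk n)).
by rewrite conjCV conjCB conjcK.
Qed.

Lemma transform_cvg w : c0 < `|Im w| -> T n w @[n --> \oo] --> two_sided w.
Proof.
rewrite /two_sided; case: (ltP 0 (Im w)) => [w0'|w0'].
  by rewrite gtr0_norm//; exact: upper_transform_cvg.
rewrite ler0_norm// => wc.
have wc' : c0 < Im (conjc w) by case: (w) wc.
have H := upper_transform_cvg wc'.
have E n : T n w = - conjc (T n (conjc w)) by rewrite transform_conj opprK.
under eq_fun do rewrite E.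
apply/cvg_normcP => e e0; have /cvg_normcP/(_ _ e0) := H; apply: filterS => n.
by rewrite -opprD normcN -conjCB normc_J.
Qed.

End Sequence.

(** The nodes lie off the closed strip containing [D], so each factor [|g - w|] is at least a fixed
    multiple of [1 + |g|]. *)
Lemma Wpoly_lower (s' : seq C) : (forall w, w \in s' -> s < `|Im w|) ->
  exists2 c : R, 0 < c & forall g, D g -> (1 + N g) ^+ size s' <= c * N (Wpoly s').[g].
Proof.
elim: s' => [|w s' IH] H.
  by exists 1 => // g _; rewrite /Wpoly big_nil hornerC Normc.normc1 mulr1 expr0.
have [c c_gt0 Hc] := IH (fun w' h => H w' (mem_behead (s := w :: s') h)).
have d0 : 0 < `|Im w| - s by rewrite subr_gt0 H// mem_head.
pose K := 1 + (1 + N w + (`|Im w| - s)) / ((`|Im w| - s) / 2).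
have K0 : 0 < K.
  rewrite ltr_pwDl// divr_ge0 ?divr_ge0 ?(ltW d0)// addr_ge0 ?(ltW d0)//.
  by rewrite addr_ge0 ?normc_ge0.
exists (K * c); first by rewrite mulr_gt0.
move=> g Dg; have ww : N (w - w) <= (`|Im w| - s) / 2.
  by rewrite subrr Normc.normc0 divr_ge0 ?(ltW d0).
have [|_ h] := near_pole_bound d0 _ ww (g := g).
  by apply: strip_dist => //; rewrite -subr_gt0.
have p0 : 0 <= 1 + N g by rewrite addr_ge0 ?normc_ge0.
rewrite /= exprS /Wpoly big_cons hornerM hornerXsubC Normc.normcM.
rewrite mulrACA ler_pM ?exprn_ge0//; exact: Hc.
Qed.

Lemma sqr1_le (x : R) (j : nat) : 0 <= x -> (1 + x ^+ 2) ^+ j <= (1 + x) ^+ (2 * j).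
Proof.
move=> x0; rewrite exprM lerXn2r ?nnegrE ?exprn_ge0 ?addr_ge0 ?sqr_ge0//.
by rewrite sqrrD expr1n mul1r -addrA lerD2l lerDr mulrn_wge0.
Qed.

(* Divided difference of the formal identity
   [two_sided w = (2 i pi)^-1 * \sum_g m g / (g - w)], whose right-hand side
   need not converge: the weights [1 / (lag s' w).[w]] replace [1 / (g - w)] by
   a term of order [- 2 (k + 1)] in [g]. *)
Lemma nodes_identity (s' : seq C) : uniq s' -> size s' = (2 * k.+1)%N ->
  (forall w, w \in s' -> c0 < `|Im w|) ->
  \sum_(w <- s') ((lag s' w).[w])^-1 * two_sided w =
  (twopii R)^-1 * csum D (fun g => m g / (Wpoly s').[g]).
Proof.
move=> us ss Hs; have [kap mk] := mollifier_seq R.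
have n1 n : n.+1%:R^-1 <= 1 :> R by rewrite invf_le1 ?ler1n// ltr0n.
pose FK n := fourier (fun t => (kap n t)%:C).
have Hs' w : w \in s' -> s < `|Im w| by move=> /Hs; exact: le_lt_trans.
have gs g w : D g -> w \in s' -> g - w != 0.
  move=> Dg ws'; have sw := Hs' w ws'; rewrite -normc_gt0.
  by apply: lt_le_trans (strip_dist Dg sw); rewrite subr_gt0.
have gns g : D g -> g \notin s'.
  by move=> Dg; apply/negP => /(gs _ _ Dg); rewrite subrr eqxx.
have [c c_gt0 Hc] := Wpoly_lower Hs'.
pose B := 2 * expR (2 * pi * s).
have B1 : 1 <= B.
  have : 1 <= expR (2 * pi * s) by rewrite -expR0 ler_expR !mulr_ge0 ?pi_ge0.
  by rewrite /B; lra.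
have B0 : 0 <= B by exact: le_trans B1.
have cB : 0 <= B * c by rewrite mulr_ge0// ltW.
have wBc : wsummable D (fun g => B * c * w0 g) by exact: wsummableZ.
have Winv g : D g -> (N (Wpoly s').[g])^-1 <= c * ((1 + N g ^+ 2) ^+ k.+1)^-1.
  move=> Dg; have h := Hc g Dg; rewrite ss in h.
  have p0 : 0 < (1 + N g ^+ 2) ^+ k.+1 by rewrite exprn_gt0// ltr_pwDl ?sqr_ge0.
  have W0 : 0 < N (Wpoly s').[g] by rewrite normc_gt0 Wpoly_eq0 gns.
  rewrite ler_pdivlMr// mulrC ler_pdivrMr//; apply: le_trans h.
  by apply: sqr1_le; exact: normc_ge0.
(* With the mollifier present the sums over [D] converge absolutely and partial fractions apply
   termwise. The two forms of the result are then passed to the limit separately. *)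
have lim1 : \sum_(w <- s') ((lag s' w).[w])^-1 *
    ((twopii R)^-1 * csum D (fun g => m g * FK n g / (g - w))) @[n --> \oo] -->
    \sum_(w <- s') ((lag s' w).[w])^-1 * two_sided w.
  apply: (@cvg_sumC _ s' (fun w n => ((lag s' w).[w])^-1 *
    ((twopii R)^-1 * csum D (fun g => m g * FK n g / (g - w))))) => w ws'.
  apply: (@cvgM C); first exact: cvg_cst.
  by apply: transform_cvg => //; exact: Hs.
have lim2 : (twopii R)^-1 * csum D (fun g => m g * FK n g / (Wpoly s').[g]) @[n --> \oo] -->
    (twopii R)^-1 * csum D (fun g => m g / (Wpoly s').[g]).
  apply: (@cvgM C); first exact: cvg_cst.
  apply: (csum_cvg _ wBc).
  - apply: nearW => n g Dg; rewrite Normc.normcM Normc.normcV.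
    rewrite (_ : B * c * w0 g = (N (m g) * B) * (c * ((1 + N g ^+ 2) ^+ k.+1)^-1)); last by rewrite /w0; ring.
    rewrite ler_pM ?invr_ge0 ?normc_ge0//; last exact: Winv.
    rewrite Normc.normcM ler_wpM2l ?normc_ge0//.
    exact: (mollified_fourier s0 (Ds Dg) (mk n) (n1 n)).
  - move=> g Dg; rewrite Normc.normcM Normc.normcV.
    rewrite (_ : B * c * w0 g = (N (m g) * B) * (c * ((1 + N g ^+ 2) ^+ k.+1)^-1)); last by rewrite /w0; ring.
    rewrite ler_pM ?invr_ge0 ?normc_ge0//; last exact: Winv.
    by rewrite ler_peMr ?normc_ge0.
  - move=> g Dg; apply: (@cvgM C); last exact: cvg_cst.
    rewrite -[X in _ --> X]mulr1; apply: (@cvgM C); first exact: cvg_cst.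
    exact: mollified_fourier_cvg.
have E n : \sum_(w <- s') ((lag s' w).[w])^-1 *
    ((twopii R)^-1 * csum D (fun g => m g * FK n g / (g - w))) =
    (twopii R)^-1 * csum D (fun g => m g * FK n g / (Wpoly s').[g]).
  have [c' c'0 Hc'] := mollified_summable (mk n).
  have cw' : wsummable D (fun g => c' * w0 g) by exact: wsummableZ.
  (* [csum_big] asks for a bound at every index; terms off the nodes are set to 0. *)
  pose h w g : C := if w \in s' then ((lag s' w).[w])^-1 * (m g * FK n g / (g - w)) else 0.
  have Hd w : w \in s' -> cdominated D (fun g => (`|Im w| - s)^-1 * (c' * w0 g))
      (fun g => m g * FK n g / (g - w)).
    move=> ws' g Dg; rewrite Normc.normcM Normc.normcV mulrC ler_pM ?invr_ge0 ?normc_ge0//.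
      have sw := Hs' w ws'.
      rewrite lef_pV2 ?posrE ?subr_gt0//; first exact: strip_dist.
      by rewrite normc_gt0 gs.
    exact: Hc'.
  have Hw w : w \in s' -> wsummable D (fun g => (`|Im w| - s)^-1 * (c' * w0 g)).
    move=> ws'; apply: wsummableZ => // [g _|]; first by rewrite mulr_ge0.
    by rewrite invr_ge0 ltW// subr_gt0 Hs'.
  have dh w : exists2 d, 0 <= d & cdominated D (fun g => d * (c' * w0 g)) (h w).
    rewrite /h; have [ws'|ws'] := boolP (w \in s'); last first.
      by exists 0 => // g _; rewrite Normc.normc0 mul0r.
    exists (N ((lag s' w).[w])^-1 * (`|Im w| - s)^-1).
      by rewrite mulr_ge0 ?normc_ge0// invr_ge0 ltW// subr_gt0 Hs'.
    by move=> g Dg; rewrite Normc.normcM -[leRHS]mulrA ler_wpM2l ?normc_ge0//; exact: Hd.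
  have cw0 g : D g -> 0 <= c' * w0 g by rewrite mulr_ge0.
  under eq_bigr do rewrite mulrCA.
  rewrite -mulr_sumr; congr (_ * _).
  transitivity (\sum_(w <- s') csum D (h w)).
    rewrite big_seq [RHS]big_seq; apply: eq_bigr => w ws'.
    by rewrite -(csumZ _ (Hw w ws') (Hd w ws')); apply: eq_csum => g _; rewrite /h ws'.
  rewrite -(csum_big _ cw' cw0 dh); apply: eq_csum => g Dg.
  have s'0 : (0 < size s')%N by rewrite ss.
  rewrite (partial_fraction us s'0 (gns g Dg)) mulr_sumr big_seq [RHS]big_seq.
  by apply: eq_bigr => w ws'; rewrite /h ws'; ring.
have FE := funext E; rewrite FE in lim1.
exact: (@cvg_unique C (@norm_hausdorff _ C) _ _ _ _ lim1 lim2).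
Qed.

End DirectIdentity.

(** * The meromorphic extension and its representation *)

Section DirectExtension.
Variable R : realType.
Local Notation C := (cplx R).
Local Notation N := (@Normc.normc R).
Local Notation Re := (@complex.Re R).
Local Notation Im := (@complex.Im R).
Local Notation mu := (@lebesgue_measure R).
Local Notation mR := (measurableTypeR R).
Variables (D : set C) (m : C -> C) (a : R -> C) (s c0 alpha : R) (k : nat).
Let w0 (g : C) : R := N (m g) * ((1 + N g ^+ 2) ^+ k.+1)^-1.
Hypotheses (s0 : 0 <= s) (sc : s <= c0) (alpha0 : 0 < alpha)
  (c0alpha : alpha <= 2 * pi * c0).
Hypothesis Ds : forall g, D g -> `|Im g| <= s.
Hypothesis ws : wsummable D w0.
Hypothesis FS : forall phi : R -> C, test_function phi ->
  csum setT (fun l => a l * phi l) = csum D (fun g => m g * fourier phi g).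
Hypothesis wa : wsummable setT (fun l => N (a l) * expR (- alpha * `|l|)).
Hypotheses (DJ : forall g, D g -> D (conjc g)) (mJ : forall g, D g -> m (conjc g) = m g)
  (mr : forall g, D g -> conjc (m g) = m g).
Hypothesis D0 : limit_point D = set0.
Local Notation upper := (upper_series a).
Local Notation two_sided := (two_sided a).
Local Notation twopii := (twopii R).

Let w00 g : 0 <= w0 g.
Proof. by rewrite mulr_ge0 ?normc_ge0// invr_ge0 exprn_ge0// addr_ge0// sqr_ge0. Qed.

Let c00 : 0 <= c0. Proof. exact: le_trans sc. Qed.

Lemma csum_bigS (I : eqType) (r : seq I) (h : I -> C -> C) (w : C -> R) : wsummable D w ->
  (forall x, D x -> 0 <= w x) ->
  (forall i, i \in r -> exists2 c, 0 <= c & cdominated D (fun x => c * w x) (h i)) ->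
  csum D (fun x => \sum_(i <- r) h i x) = \sum_(i <- r) csum D (h i).
Proof.
move=> sw pw H; pose h' i x := if i \in r then h i x else 0.
transitivity (\sum_(i <- r) csum D (h' i)); last first.
  by rewrite big_seq [RHS]big_seq; apply: eq_bigr => i ir; apply: eq_csum => x _; rewrite /h' ir.
rewrite -(csum_big _ sw pw).
  by apply: eq_csum => x _; rewrite big_seq [RHS]big_seq; apply: eq_bigr => i ir; rewrite /h' ir.
move=> i; rewrite /h'; case: (boolP (i \in r)) => [/H//|_].
by exists 0 => // x _; rewrite Normc.normc0 mul0r.
Qed.

Lemma off_strip z : s < `|Im z| -> ~ D z.
Proof. by move=> sz /Ds; rewrite leNgt sz. Qed.

Section Nodes.
Variable nodes : seq C.
Hypotheses (un : uniq nodes) (sn : size nodes = (2 * k).+1)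
  (Hn : forall w, w \in nodes -> c0 < Im w).
Let W : {poly C} := Wpoly nodes.
Let p : {poly C} := \sum_(w <- nodes) (upper w / (lag nodes w).[w]) *: lag nodes w.
Let v (g : C) : C := twopii^-1 * (m g / W.[g]).

(* Solves [nodes_identity] for the value at [z], the nodes being the given ones
   together with [z]. *)
Definition extension (z : C) : C := p.[z] + W.[z] * cauchyt D v z.

Let Hn' w : w \in nodes -> c0 < `|Im w|.
Proof. by move=> /Hn h; rewrite gtr0_norm// (le_lt_trans c00). Qed.

Let pE z : p.[z] = \sum_(w <- nodes) upper w * ((lag nodes w).[z] / (lag nodes w).[w]).
Proof.
by rewrite horner_sum; apply: eq_bigr => w _; rewrite hornerZ mulrAC mulrA.
Qed.

Let p_node w : w \in nodes -> p.[w] = upper w.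
Proof.
move=> wn; rewrite pE (bigD1_seq w)//= big1_seq.
  by rewrite addr0 divff ?mulr1// lag_neq0.
move=> u /andP[uw un']; have wu : w != u by rewrite eq_sym.
by rewrite (lag_eq0 un wn wu) mul0r mulr0.
Qed.

Let Dnodes g w : D g -> w \in nodes -> g - w != 0.
Proof.
move=> Dg wn; rewrite subr_eq0; apply/eqP => gw; move: (Ds Dg); rewrite gw leNgt.
by rewrite (le_lt_trans sc) ?Hn'.
Qed.

Let Wg g : D g -> W.[g] != 0.
Proof.
by move=> Dg; rewrite Wpoly_eq0; apply/negP => /(Dnodes Dg); rewrite subrr eqxx.
Qed.

(** There are [2 * k + 1] nodes, one less than order [2 (k + 1)] calls for; the missing factor
    [1 + |g|] is left to the Cauchy kernel. *)
Let vbound : exists w : C -> R, [/\ forall g, D g -> 0 <= w g, wsummable D w &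
  forall g, D g -> N (v g) <= w g * (1 + N g)].
Proof.
have Hs w : w \in nodes -> s < `|Im w| by move=> /Hn'; exact: le_lt_trans.
have [c cp Hc] := Wpoly_lower Ds Hs.
pose d := N twopii^-1 * c.
have d0 : 0 <= d by rewrite mulr_ge0 ?normc_ge0 ?(ltW cp).
exists (fun g => d * w0 g); split=> [g _||g Dg]; first by rewrite mulr_ge0.
  by apply: wsummableZ => // g _; exact: w00.
have p1 : 0 < 1 + N g by rewrite ltr_pwDl ?normc_ge0.
have W0 : 0 < N W.[g] by rewrite normc_gt0 Wg.
have p2 : 0 < (1 + N g ^+ 2) ^+ k.+1 by rewrite exprn_gt0// ltr_pwDl ?sqr_ge0.
rewrite /v !Normc.normcM (Normc.normcV W.[g]) /d /w0.
rewrite [leRHS](_ : _ = N twopii^-1 * (N (m g) * (c * (1 + N g) / (1 + N g ^+ 2) ^+ k.+1))); last by ring.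
rewrite ler_wpM2l ?normc_ge0// ler_wpM2l ?normc_ge0//.
rewrite ler_pdivlMr// mulrC ler_pdivrMr//.
apply: le_trans (sqr1_le k.+1 (normc_ge0 g)) _.
rewrite (_ : (2 * k.+1)%N = (size nodes).+1); last by rewrite sn mulnS.
by rewrite exprS mulrAC mulrC ler_wpM2r ?(ltW p1)//; exact: Hc.
Qed.

Lemma extension_derivable z : ~ D z -> derivable extension z 1.
Proof. by have [w [h1 h2 h3]] := vbound; exact: (@pf_derivable _ _ _ _ p W h1 h2 h3 D0 z). Qed.

Lemma extension_meromorphic : meromorphic extension.
Proof. by have [w [h1 h2 h3]] := vbound; exact: (@pf_meromorphic _ _ _ _ p W h1 h2 h3 D0). Qed.

Lemma extension_pole g : D g -> m g != 0 ->
  simple_pole_with_residue extension g (- m g / twopii).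
Proof.
move=> Dg mg; have [w [h1 h2 h3]] := vbound.
have E : W.[g] * v g = m g / twopii by rewrite /v; field; rewrite Wg// twopii_neq0.
have := @pf_pole _ _ _ _ p W h1 h2 h3 D0 g Dg; rewrite E -mulNr; apply.
by rewrite mulf_neq0// invr_neq0// twopii_neq0.
Qed.

Let sepz z : ~ D z -> exists2 d : R, 0 < d & forall g, D g -> d <= N (g - z).
Proof.
move=> nz; have [d d0 Hd] := limit_point0_sep z D0; exists d => // g Dg.
by apply: Hd => //; apply/eqP => gz; apply: nz; rewrite -gz.
Qed.

(** At a node [W] vanishes and interpolation gives the value; elsewhere [z :: nodes] has the
    [2 (k + 1)] points that [nodes_identity] asks for. *)
Lemma extensionE z : c0 < `|Im z| -> extension z = two_sided z.
Proof.
move=> cz; have [zn|zn] := boolP (z \in nodes).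
  have W0 : W.[z] = 0 by apply/eqP; rewrite Wpoly_eq0.
  rewrite /extension W0 mul0r addr0 p_node// /two_sided ifT//.
  exact: le_lt_trans (Hn zn).
have us' : uniq (z :: nodes) by rewrite /= zn.
have ss' : size (z :: nodes) = (2 * k.+1)%N by rewrite /= sn mulnS.
have Hs' w : w \in z :: nodes -> c0 < `|Im w|.
  by rewrite in_cons => /predU1P[->//|/Hn'].
have := nodes_identity s0 sc alpha0 c0alpha Ds ws FS wa DJ mJ mr us' ss' Hs'.
rewrite big_cons lag_cons_head -/W.
have Wz : W.[z] != 0 by rewrite Wpoly_eq0.
have -> : csum D (fun g => m g / (Wpoly (z :: nodes)).[g]) = twopii * cauchyt D v z.
  rewrite /cauchyt; have [w [h1 h2 h3]] := vbound.
  have [d d0 Hd] := sepz (off_strip (le_lt_trans sc cz)).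
  rewrite -(csumZ _ (wsummable_cauchyt h1 h2 z d0) (cauchyt_summable h1 h3 d0 Hd)).
  apply: eq_csum => g Dg; rewrite /v /Wpoly big_cons hornerM hornerXsubC -/(Wpoly nodes) -/W.
  have gz : g - z != 0 by rewrite subr_eq0; apply/eqP => gz; move: (off_strip (le_lt_trans sc cz)); rewrite -gz.
  by field; rewrite gz Wg// twopii_neq0.
rewrite mulrA mulVf ?twopii_neq0// mul1r => E.
rewrite /extension -E mulrDr mulrA divff// mul1r addrCA -[RHS]addr0; congr (_ + _).
rewrite pE mulr_sumr -big_split /=; apply: big1_seq => w /andP[_ wn].
have zw : z != w by apply: contraNneq zn => ->.
rewrite (lag_cons _ zw) hornerM hornerXsubC /two_sided (le_lt_trans c00 (Hn wn)).
rewrite /W (Wpoly_lag wn) hornerM hornerXsubC.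
have wz : w - z != 0 by rewrite subr_eq0 eq_sym.
by field; rewrite wz lag_neq0.
Qed.

Section Represented.
Variable rad : C -> R.
Hypothesis radJ : forall g : C, rad (conjc g) = rad g.
Hypothesis rad0 : forall g, D g -> ((rad g) ^+ 2)%:C + g ^+ 2 != 0.
Hypothesis kdom : forall z d, 0 < d -> (forall g, D g -> d <= N (g - z)) ->
  exists2 B, 0 <= B & cdominated D (fun g => B * w0 g) (fun g => kern k (rad g) z g * m g).

Definition kern_sum (z : C) : C :=
  twopii^-1 * csum D (fun g => kern k (rad g) z g * m g).

Let P : {poly C} := \sum_(w <- nodes)
  ((upper w - kern_sum w) / (lag nodes w).[w]) *: lag nodes w.

Let PE z : P.[z] = \sum_(w <- nodes) (upper w - kern_sum w) * ((lag nodes w).[z] / (lag nodes w).[w]).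
Proof.
by rewrite horner_sum; apply: eq_bigr => w _; rewrite hornerZ mulrAC mulrA.
Qed.

Let P_node w : w \in nodes -> P.[w] = upper w - kern_sum w.
Proof.
move=> wn; rewrite PE (bigD1_seq w)//= big1_seq.
  by rewrite addr0 divff ?mulr1// lag_neq0.
move=> u /andP[uw un']; have wu : w != u by rewrite eq_sym.
by rewrite (lag_eq0 un wn wu) mul0r mulr0.
Qed.

Let P_size : (size P <= (2 * k).+1)%N.
Proof.
apply: leq_trans (size_sum _ _ _) _; apply/bigmax_leqP_seq => w wn _.
by apply: leq_trans (size_scale_leq _ _) _; rewrite size_lag// sn.
Qed.

(** [kern_nodes] is summed over [D] with the masses. Its first term gives the Cauchy transform; the
    values of the kernels at the nodes add up to [kern_sum] there, so that [P] interpolates the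
    difference of [upper] and [kern_sum]. *)
Lemma extension_kern z : ~ D z -> extension z = kern_sum z + P.[z].
Proof.
move=> nz; have [w [h1 h2 h3]] := vbound; have [d d0 Hd] := sepz nz.
have cd := cauchyt_summable h1 h3 d0 Hd; have cs := wsummable_cauchyt h1 h2 z d0.
set K := 1 + _ in cd cs.
have gz g : D g -> g - z != 0.
  by move=> Dg; rewrite subr_eq0; apply/eqP => E; apply: nz; rewrite -E.
have domn u : u \in nodes -> exists2 B, 0 <= B &
    cdominated D (fun g => B * w0 g) (fun g => kern k (rad g) u g * m g).
  move=> un'; have nu : ~ D u by apply: off_strip; exact: le_lt_trans (Hn' un').
  by have [d' d'0 Hd'] := sepz nu; exact: kdom Hd'.
pose h u g := kern k (rad g) u g * m g * ((lag nodes u).[z] / (lag nodes u).[u]).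
have hd u : u \in nodes -> exists2 B, 0 <= B & cdominated D (fun g => B * w0 g) (h u).
  move=> /domn[B B0 HB]; pose q := (lag nodes u).[z] / (lag nodes u).[u].
  exists (N q * B); first by rewrite mulr_ge0 ?normc_ge0.
  move=> g Dg; rewrite /h -/q mulrC Normc.normcM -[leRHS]mulrA ler_wpM2l ?normc_ge0//.
  exact: HB.
have KE : csum D (fun g => kern k (rad g) z g * m g) =
    twopii * W.[z] * cauchyt D v z + \sum_(u <- nodes) csum D (h u).
  have w0' g : D g -> 0 <= w0 g by move=> _; exact: w00.
  rewrite -(csum_bigS ws w0' hd) /cauchyt -(csumZ _ cs cd).
  have [B B0 HB] : exists2 B, 0 <= B & cdominated D (fun g => B * w0 g) (fun g => \sum_(u <- nodes) h u g).
    have : {subset nodes <= nodes} by [].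
    elim: {-2}nodes => [|u r IH] rn.
      by exists 0 => // g _; rewrite big_nil Normc.normc0 mul0r.
    have [B1 B10 HB1] := IH (fun x xr => rn x (mem_behead (s := u :: r) xr)).
    have [B2 B20 HB2] := hd u (rn u (mem_head u r)).
    exists (B2 + B1); first by rewrite addr_ge0.
    move=> g Dg; rewrite big_cons mulrDl; apply: ler_normcD; [exact: HB2|exact: HB1].
  pose Wt g := N (twopii * W.[z]) * (K * w g) + B * w0 g.
  have K0 : 0 <= K.
    by rewrite /K addr_ge0// divr_ge0 ?divr_ge0 ?addr_ge0 ?normc_ge0 ?(ltW d0).
  have t1 g : D g -> 0 <= N (twopii * W.[z]) * (K * w g).
    by move=> Dg; rewrite mulr_ge0 ?normc_ge0// mulr_ge0// h1.
  have t2 g : D g -> 0 <= B * w0 g by move=> _; rewrite mulr_ge0.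
  have Wts : wsummable D Wt.
    apply: wsummableD => //; last exact: wsummableZ.
    by apply: wsummableZ cs => [g Dg|]; [rewrite mulr_ge0// h1|exact: normc_ge0].
  rewrite -(csumD Wts); first last.
  - by move=> g Dg; apply: le_trans (HB g Dg) _; rewrite /Wt lerDr t1.
  - move=> g Dg; rewrite Normc.normcM (le_trans (_ : _ <= N (twopii * W.[z]) * (K * w g)))//.
      by rewrite ler_wpM2l ?normc_ge0//; exact: cd.
    by rewrite /Wt lerDl t2.
  apply: eq_csum => g Dg.
  have gn : g \notin nodes by apply/negP => /(Dnodes Dg); rewrite subrr eqxx.
  have zg : z != g by rewrite eq_sym -subr_eq0 gz.
  rewrite (kern_nodes un sn gn zg (rad0 Dg)) mulrDl; congr (_ + _).
    by rewrite /v -/W; field; rewrite Wg// gz// twopii_neq0.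
  by rewrite mulr_suml; apply: eq_bigr => u _; rewrite /h; ring.
rewrite /kern_sum KE mulrDr -(mulrA twopii) [twopii^-1 * (twopii * _)]mulrA mulVf ?twopii_neq0// mul1r.
rewrite /extension addrC -addrA; congr (_ + _).
rewrite PE pE mulr_sumr -big_split /=; rewrite big_seq [RHS]big_seq; apply: eq_bigr => u un'.
have [B B0 HB] := domn u un'.
have sB : wsummable D (fun g => B * w0 g) by exact: wsummableZ.
have -> : csum D (h u) = ((lag nodes u).[z] / (lag nodes u).[u]) * csum D (fun g => kern k (rad g) u g * m g).
  by rewrite -(csumZ _ sB HB); apply: eq_csum => g _; rewrite /h mulrC.
by rewrite /kern_sum; ring.
Qed.

Let bijJ : set_bij D D (@conjc R : C -> C).
Proof.
split; first by move=> g /DJ.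
  by move=> g h _ _; exact: (inv_inj (@conjcK R)).
by move=> g Dg; exists (conjc g); [exact: DJ|exact: conjcK].
Qed.

Lemma conjCX (z : C) n : conjc (z ^+ n) = conjc z ^+ n :> C.
Proof. exact: (rmorphXn (@conjc R)). Qed.

Lemma conjCD (z w : C) : conjc (z + w) = conjc z + conjc w :> C.
Proof. exact: (rmorphD (@conjc R)). Qed.

Lemma kern_conj r (z g : C) : conjc (kern k r (conjc z) g) = kern k r z (conjc g).
Proof.
rewrite /kern !(conjCM, conjCV, conjCX, conjCB, conjCD).
by rewrite !conjcK !conj_RC.
Qed.

Lemma kern_sum_conj z : conjc (kern_sum (conjc z)) = - kern_sum z.
Proof.
rewrite /kern_sum conjCM -csum_conj -mulNr; congr (_ * _).
  by rewrite conjCV -invrN; congr (_^-1); apply: complex_ext; rewrite /twopii /= ?oppr0.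
rewrite [RHS](reindex_csum _ bijJ); apply: eq_csum => g Dg /=.
by rewrite conjCM kern_conj mr// mJ// radJ.
Qed.

Lemma off_conj z : ~ D z -> ~ D (conjc z).
Proof. by move=> nz /DJ; rewrite conjcK. Qed.

Let conj_map (u : {poly C}) z : (map_poly (@conjc R) u).[z] = conjc u.[conjc z].
Proof. by rewrite -[z in LHS](@conjcK R z) (horner_map (@conjc R)). Qed.

(** The sum of [P] and its conjugate has size at most [2 * k + 1] and vanishes at the [2 * k + 1]
    conjugates of the nodes: at [conjc w] the extension is [- conjc (upper w)], and [kern_sum] is
    antisymmetric. *)
Let P_anti : map_poly (@conjc R) P = - P.
Proof.
apply/eqP; rewrite -subr_eq0 opprK; apply/negPn/negP => S0.
have uc : uniq [seq conjc w | w <- nodes] by rewrite map_inj_uniq//; exact: (inv_inj (@conjcK R)).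
have := max_poly_roots S0 _ uc; rewrite size_map sn ltnNge => /(_ _)/negP; apply; last first.
  apply: leq_trans (size_polyD _ _) _; rewrite geq_max P_size andbT.
  by rewrite (leq_trans (size_poly _ _)).
apply/allP => _ /mapP[w wn ->]; rewrite /root hornerD conj_map conjcK P_node//.
have cw : c0 < `|Im (conjc w)| by have := Hn' wn; case: (w) => x y /=; rewrite normrN.
have nw := off_strip (le_lt_trans sc cw).
have := extension_kern nw; rewrite extensionE//.
rewrite /two_sided ifF; last first.
  have := le_lt_trans c00 (Hn wn); case: (w) => x y /= y0.
  by apply/negbTE; rewrite -leNgt oppr_le0 ltW.
rewrite conjcK => E.
have -> : P.[conjc w] = - conjc (upper w) - kern_sum (conjc w) by rewrite E; ring.
rewrite conjCB -(kern_sum_conj (conjc w)) conjcK; apply/eqP; ring.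
Qed.

(** By [P_anti] the coefficients of [P] are purely imaginary; [Q] collects their imaginary parts. *)
Lemma extension_represented : exists Q : {poly R}, (size Q <= (2 * k).+1)%N /\
  forall z, ~ D z -> extension z = kern_sum z + (0 +i* 1) * (map_poly (real_complex R) Q).[z].
Proof.
exists (\poly_(i < (2 * k).+1) Im P`_i); split; first exact: size_poly.
move=> z nz; rewrite extension_kern//; congr (_ + _).
rewrite -hornerZ; congr (horner _ z); apply/polyP => i.
rewrite coefZ coef_map coef_poly.
have [ik|ki] := ltnP i (2 * k).+1; last first.
  by rewrite nth_default ?(leq_trans P_size)//= mulr0.
have := congr1 (fun u : {poly C} => u`_i) P_anti; rewrite coef_map coefN => /(congr1 Re).
case: (P`_i) => x y /= xx; have -> : x = 0 by lra.
by apply: complex_ext => /=; ring.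
Qed.

Lemma extension_conj z : ~ D z -> conjc (extension (conjc z)) = - extension z.
Proof.
move=> nz; rewrite (extension_kern (off_conj nz)) (extension_kern nz).
by rewrite conjCD kern_sum_conj -conj_map P_anti hornerN opprD.
Qed.

End Represented.

End Nodes.

Lemma upper_seriesE z : c0 < Im z ->
  csummable [set l : R | 0 < l] (fun l => a l * cexp ((0 +i* (2 * pi * l)) * z)) /\
  upper z = a 0 / 2 + csum [set l : R | 0 < l] (fun l => a l * cexp ((0 +i* (2 * pi * l)) * z)).
Proof.
move=> cz; have ud := upper_series_dom a c0alpha cz.
have E l : 0 < l -> a l * (heaviside l * expo (twopii * z) l) =
    a l * cexp ((0 +i* (2 * pi * l)) * z).
  move=> l0; rewrite /heaviside l0 mul1r /expo /twopii; congr (_ * cexp _).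
  by apply: complex_ext; case: (z) => x y /=; ring.
split.
  apply: (wsummable_le (w' := fun l => N (a l) * expR (- alpha * `|l|))).
    by move=> l l0; rewrite -E//; exact: ud.
  by apply: wsummable_sub wa => // l _; rewrite mulr_ge0 ?normc_ge0 ?expR_ge0.
rewrite /upper_series (csumD1 (t := 0) wa ud)//; congr (_ + _).
  by rewrite /heaviside ltxx expo0 mulr1 mul1r.
rewrite (csum_sub (E := [set l | 0 < l])).
- by apply: eq_csum => l; exact: E.
- by move=> l l0; split=> // l0'; move: l0; rewrite /= l0' ltxx.
move=> l [_ /eqP l0] /negP; rewrite -leNgt => ll0.
have {}ll0 : l < 0 by rewrite lt_neqAle l0.
by rewrite /heaviside ll0 (lt_gtF ll0) mul0r mulr0.
Qed.

Lemma derivable_shift (F : C -> C) (c z : C) : derivable F (z + c) 1 ->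
  derivable (fun x => F (x + c)) z 1.
Proof.
rewrite /derivable /=; under eq_fun do rewrite addrA.
by [].
Qed.

(** On each horizontal line above [c0] the function is an absolutely convergent trigonometric
    series, hence satisfies Bochner's condition; the common majorant bounds it on the whole
    half-plane. *)
Lemma series_AP (F : C -> C) : (forall z, c0 < Im z -> derivable F z 1) ->
  (forall z, c0 < Im z -> F z = upper z) -> AP (shift_up F c0).
Proof.
move=> dF FE; split.
- move=> z z0; apply: derivable_shift; apply: dF.
  by case: z z0 => x y /= y0; rewrite ltrDr.
- move=> al be al0 _; apply: (@le_lt_trans _ _ (2 * wsum setT (fun l => N (a l) * expR (- alpha * `|l|)))%:E); last exact: ltry.
  apply: ub_ereal_sup => _ [z /= /andP[zl _] <-]; rewrite lee_fin.
  have cz : c0 < Im (z + (0 +i* c0)).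
    by case: (z) zl => x y /= y0; rewrite ltrDr (lt_trans al0).
  rewrite /shift_up FE//; apply: normc_csum => //.
  exact: (upper_series_dom a c0alpha cz).
move=> y y0.
pose c (l : R) : C := a l * (heaviside l * (expR (- (2 * pi * l * (y + c0))))%:C).
have cE (x l : R) : a l * (heaviside l * expo (twopii * ((x +i* y) + (0 +i* c0))) l) = c l * e1 (l * x).
  rewrite /c -!mulrA; congr (_ * (_ * _)); rewrite /expo /e1 /cexp /twopii.
  by apply: complex_ext => /=; rewrite !(mul0r,mulr0,add0r,addr0,subr0,sub0r,expR0,mul1r);
    congr (expR _ * _); try congr (cos _); try congr (sin _); ring.
have cy (x : R) : c0 < Im ((x +i* y) + (0 +i* c0)) by rewrite /= ltrDr.
have wc : wsummable setT (fun l => N (c l)).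
  apply: wsummable_le wa => l Tl; have := upper_series_dom a c0alpha (cy 0) Tl.
  by rewrite cE mulr0 e1_0 mulr1.
rewrite (_ : (fun x : R => _) = (fun x => csum setT (fun l => c l * e1 (l * x)))); last first.
  by apply/funext => x; rewrite /shift_up FE//; apply: eq_csum => l _; exact: cE.
by apply: tb_ap; [exact: trig_series_continuous|exact: trig_series_tb].
Qed.

End DirectExtension.

Section PointSums.
Variable R : realType.
Local Notation C := (cplx R).
Local Notation N := (@Normc.normc R).
Local Notation Re := (@complex.Re R).
Local Notation Im := (@complex.Im R).
Local Notation mR := (measurableTypeR R).
Variables (I : set nat) (q p : nat -> R) (A : set C) (b : C -> C) (k : nat) (s : R).
Hypotheses (qi : {in I &, injective q}) (AI : forall g, A g -> Im g != 0).
Hypotheses (s0 : 0 <= s) (As : forall g, A g -> `|Im g| <= s).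
Local Notation D := (pts I q A).
Local Notation m := (mass I q p b).
Local Notation w := (pts_weight I q p b k).
Hypothesis ws : wsummable D w.

Lemma pts_test_bound phi : test_function phi ->
  exists2 c : R, 0 <= c & cdominated D (fun g => c * w g) (fun g => m g * fourier phi g).
Proof.
move=> tphi; have [c c0 Hc] := test_fourier_decay s k.+1 tphi.
exists c => // g Dg; rewrite Normc.normcM /pts_weight mulrCA ler_wpM2l ?normc_ge0//.
exact: Hc (pts_strip s0 As Dg).
Qed.

Lemma pts_formula phi : test_function phi ->
  csum D (fun g => m g * fourier phi g) =
  cm_integral (atomic_cmeasure I q p) setT (fun t => fourier phi t%:C) +
  csum A (fun g => b g * fourier phi g).
Proof.
move=> tphi; have [c c0 Hc] := pts_test_bound tphi.
have w0 g : 0 <= c * w g by rewrite mulr_ge0 ?pts_weight_ge0.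
have sw : wsummable D (fun g => c * w g).
  by apply: wsummableZ => // g _; exact: pts_weight_ge0.
rewrite (csum_pts qi AI sw Hc); congr (_ + _); last first.
  by apply: eq_csum => g Ag; rewrite (mass_strip _ _ _ _ AI Ag).
rewrite (cm_integral_atomic qi).
- by apply: eq_csum => n In; rewrite mass_real// mulrC.
- by apply: cmeasurable_continuous; [exact: measurableT|exact: (test_fourier_line 0 tphi).1].
apply: wsummable_le (wsummable_pts_real qi w0 sw) => n In.
have := Hc (q n)%:C; rewrite mass_real// Normc.normcM normcR mulrC; apply.
by left; exists n.
Qed.

Hypotheses (AJ : forall g, A g -> A (conjc g)) (bJ : forall g, A g -> b (conjc g) = b g)
  (br : forall g, A g -> conjc (b g) = b g).

Lemma pts_conj g : D g -> D (conjc g).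
Proof. by case=> [[n In <-]|/AJ]; [left; exists n => //; rewrite conj_RC|right]. Qed.

Lemma mass_conjc g : D g -> m (conjc g) = m g.
Proof.
case=> [[n In <-]|Ag]; first by rewrite conj_RC.
by rewrite (mass_strip _ _ _ _ AI Ag) (mass_strip _ _ _ _ AI (AJ Ag)) bJ.
Qed.

Lemma conjc_mass g : D g -> conjc (m g) = m g.
Proof.
case=> [[n In <-]|Ag]; first by rewrite mass_real// conj_RC.
by rewrite (mass_strip _ _ _ _ AI Ag) br.
Qed.

Lemma radius_conj rho (g : C) : radius rho (conjc g) = radius rho g.
Proof. by case: g => x y; rewrite /radius /= oppr_eq0. Qed.

End PointSums.

Section Direct.
Variable R : realType.
Local Notation C := (cplx R).
Local Notation N := (@Normc.normc R).
Local Notation Re := (@complex.Re R).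
Local Notation Im := (@complex.Im R).

Lemma direct_part (sigma : R) (I : set nat) (q p : nat -> R) (b : C -> C)
    (a : R -> C) (k : nat) (A := atoms b) (nu := atomic_cmeasure I q p) :
  {in I &, injective q} -> (forall n, I n -> p n != 0) ->
  FS_pair sigma nu b a -> R_symmetric b -> real_antipodal nu b a ->
  limit_point ([set t%:C | t in cm_support nu] `|` discrete_support b : set C) = set0 ->
  (ord nu <= 2 * k.+1)%N -> (discrete_ord b <= 2 * k.+1)%N ->
  finite_exponential_growth a ->
  exists F : C -> C,
   (exists c : R,
    (forall z : C, c < Im z ->
       csummable [set l : R | 0 < l] (fun l => a l * cexp ((0 +i* (2 * pi * l)) * z)) /\
       F z = a 0 / 2 + csum [set l : R | 0 < l] (fun l => a l * cexp ((0 +i* (2 * pi * l)) * z))) /\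
    AP (shift_up F c)) /\
   meromorphic F /\
   (forall z : C, ~ pts I q A z -> derivable F z 1) /\
   (forall g, A g -> simple_pole_with_residue F g (- b g / (0 +i* (2 * pi)))) /\
   (forall n, I n -> simple_pole_with_residue F (q n)%:C (- (p n)%:C / (0 +i* (2 * pi)))) /\
   (forall z : C, ~ pts I q A z -> conjc (F (conjc z)) = - F z) /\
   (forall rho : R, sigma < rho ->
     exists Q : {poly R}, (size Q <= (2 * k).+1)%N /\ represented F I q p A b k rho Q).
Proof.
move=> qi pn FSP [AJ0 bJ0] [_ br0 _] lp on ob [alpha alpha0 wa].
have s0 := FS_strip_ge0 FSP.
have AI := FS_atoms_nonreal FSP; have As g (Ag : atoms b g) := ltW (FS_atoms_strip FSP Ag).
have AJ g : A g -> A (conjc g) by move=> /AJ0.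
have bJ g : A g -> b (conjc g) = b g by move=> /bJ0.
have br g : A g -> conjc (b g) = b g.
  by move=> _; have := br0 g; case: (b g) => x y /= ->; rewrite oppr0.
pose D := pts I q A; pose m := mass I q p b.
have D0 : limit_point D = set0.
  apply: limit_point_sub lp => g [[n In <-]|Ag]; last by right; exact: subset_closure.
  by left; exists (q n) => //; apply: atomic_support => //; exact: pn.
have ws : wsummable D (pts_weight I q p b k).
  apply: pts_weight_summable => //.
    have /atomic_tempered_at := ord_tempered (FS_nu_tempered FSP) on.
    by apply: wsummable_le => n In; rewrite powR_half// sqr_ge0.
  have := discrete_ord_tempered (FS_eta_tempered FSP) ob.
  by apply: wsummable_le => g Ag; rewrite powR_half// sqr_ge0.
have FS phi : test_function phi ->
    csum setT (fun l => a l * phi l) = csum D (fun g => m g * fourier phi g).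
  by move=> tphi; rewrite (FS_formula FSP tphi) (pts_formula qi AI s0 As ws tphi).
have Ds g : D g -> `|Im g| <= sigma by exact: pts_strip.
have DJ g : D g -> D (conjc g) by exact: pts_conj.
have mJ g : D g -> m (conjc g) = m g by exact: mass_conjc.
have mr g : D g -> conjc (m g) = m g by exact: conjc_mass.
(* Above the strip of atoms, and high enough for [exp (- 2 pi c0 l)] to match the growth rate
   [alpha] of the coefficients. *)
pose c0 := Num.max sigma (alpha / (2 * pi)).
have sc : sigma <= c0 by rewrite le_max lexx.
have pi2 : 0 < 2 * pi :> R by rewrite mulr_gt0// pi_gt0.
have c0alpha : alpha <= 2 * pi * c0.
  by rewrite mulrC -ler_pdivrMr// le_max lexx orbT.
(* [2 * k + 1] distinct points above height [c0], taken on the imaginary axis. *)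
pose nodes : seq C := [seq 0 +i* (c0 + 1 + j%:R) | j <- iota 0 (2 * k).+1].
have un : uniq nodes.
  rewrite map_inj_in_uniq ?iota_uniq// => i j _ _ [] /addrI /eqP.
  by rewrite eqr_nat => /eqP.
have sn : size nodes = (2 * k).+1 by rewrite size_map size_iota.
have Hn w : w \in nodes -> c0 < Im w.
  by move=> /mapP[j _ ->] /=; rewrite -addrA ltrDl ltr_pwDl.
pose F := extension D m a nodes.
have c00 : 0 <= c0 by exact: le_trans sc.
have off z : c0 < Im z -> ~ D z.
  by move=> cz /Ds; rewrite leNgt (le_lt_trans sc)// (lt_le_trans cz)// ler_norm.
have dF z : ~ D z -> derivable F z 1.
  have := @extension_derivable _ D m a _ _ k s0 sc Ds ws D0 nodes sn Hn z.
  exact.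
have FE z : c0 < Im z -> F z = upper_series a z.
  move=> cz; rewrite /F (extensionE s0 sc alpha0 c0alpha Ds ws FS wa DJ mJ mr D0 un sn Hn).
    by rewrite /two_sided (le_lt_trans c00 cz).
  by rewrite (lt_le_trans cz)// ler_norm.
have rad_props rho : sigma < rho -> (forall g, D g -> ((radius rho g) ^+ 2)%:C + g ^+ 2 != 0) /\
    (forall z d, 0 < d -> (forall g, D g -> d <= N (g - z)) ->
  exists2 B, 0 <= B & cdominated D (fun g => B * pts_weight I q p b k g)
     (fun g => kern k (radius rho g) z g * m g)).
  move=> srho; have [_ [_ [_ _ h _ _]]] := @pts_kern1_bound _ I q p _ b AI k _ s0 As rho srho.
  split=> // z d d0 Hd.
  have [c [r1 [c1 r10 Hk]]] := @pts_kern_bound _ I q p _ b AI k _ s0 As rho srho.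
  exists ((N z ^+ 2 + r1 ^+ 2) ^+ k * (c * kern_growth r1 d z)); last first.
    by move=> g Dg; exact: Hk d0 Dg (Hd g Dg).
  rewrite mulr_ge0 ?exprn_ge0 ?addr_ge0 ?sqr_ge0// mulr_ge0 ?(ltW c1)//.
  by rewrite kern_growth_ge0// ltW.
exists F; split.
  exists c0; split; last first.
    by apply: (series_AP c0alpha wa _ FE) => z cz; apply: dF; exact: off.
  by move=> z cz; rewrite FE//; exact: (upper_seriesE c0alpha wa cz).
split; first by have := @extension_meromorphic _ D m a _ _ k s0 sc Ds ws D0 nodes sn Hn.
split; first exact: dF.
split.
  move=> g Ag; have Dg : D g by right.
  have := @extension_pole _ D m a _ _ k s0 sc Ds ws D0 nodes sn Hn _ Dg; rewrite /m (mass_strip _ _ _ _ AI Ag).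
  exact.
split.
  move=> n In; have Dg : D (q n)%:C by left; exists n.
  have := @extension_pole _ D m a _ _ k s0 sc Ds ws D0 nodes sn Hn _ Dg; rewrite /m mass_real//.
  apply; rewrite eq_complex /= eqxx andbT; exact: pn.
split.
  (* The extension does not depend on the radius, so its antisymmetry is read off at one admissible
     radius. *)
  have s1 : sigma < sigma + 1 by rewrite ltrDl.
  have [h1 h2] := rad_props _ s1.
  exact: (extension_conj s0 sc alpha0 c0alpha Ds ws FS wa DJ mJ mr D0 un sn Hn
    (radius_conj (sigma + 1)) h1 h2).
move=> rho srho; have [h1 h2] := rad_props rho srho.
have [Q [sQ HQ]] := extension_represented s0 sc alpha0 c0alpha Ds ws FS wa DJ mJ mr D0 un sn Hn
    (radius_conj rho) h1 h2.
exists Q; split=> //.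
exact: ((@representedP _ I q p A b qi AI k _ s0 As ws rho Q F srho D0).2 HQ).
Qed.

End Direct.

(** * From a meromorphic function to a summation pair *)

Section LineIntegrals.
Variable R : realType.
Local Notation C := (cplx R).
Local Notation N := (@Normc.normc R).
Local Notation Re := (@complex.Re R).
Local Notation Im := (@complex.Im R).
Local Notation mu := (@lebesgue_measure R).
Local Notation mR := (measurableTypeR R).
Local Notation half := (`[0, +oo[%classic : set mR).
Local Notation twopii := (twopii R).
Implicit Types (phi psi : R -> C) (g z : C) (y : R).

Definition line y (h : C -> C) : C := cintegral mu (setT : set mR) (fun x => h (x +i* y)).

Definition line_integrable y (h : C -> C) :=
  cintegrable mu (setT : set mR) (fun x => h (x +i* y)).

Lemma test_flip phi : test_function phi -> test_function (fun t => phi (- t)).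
Proof.
have H (f : R -> R) : smooth f -> smooth (fun t => f (- t)).
  by move=> /(@smooth_affine _ f (-1) 0); under eq_fun do rewrite addr0 mulN1r.
move=> [s1 s2 [M HM]]; split; [exact: H s1|exact: H s2|].
by exists M => x xM; apply: HM; rewrite normrN.
Qed.

Lemma fourier_flip phi z : test_function phi ->
  fourier (fun t => phi (- t)) z = fourier phi (- z).
Proof.
move=> tphi; rewrite !fourierE -(cintegral_opp (test_fourier_integrable z (test_flip tphi))).
apply: eq_cintegral => t _; rewrite opprK; congr (_ * _).
by rewrite /kz mulrN /expo (rmorphN (real_complex R)) mulrN mulNr.
Qed.

Lemma continuous_line y : continuous (fun x : R => x +i* y : C).
Proof. by apply: continuous_ReIm => x /=; [exact: cvg_id|exact: cvg_cst]. Qed.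

Lemma off_line g y (x : R) : Im g != y -> `|y - Im g| <= N (g - (x +i* y)) /\ g - (x +i* y) != 0.
Proof.
move=> gy; have h : `|y - Im g| <= N (g - (x +i* y)).
  by rewrite distrC; apply: le_trans (ler_Im_normc _); case: (g).
split=> //; rewrite -normc_gt0; apply: lt_le_trans h.
by rewrite normr_gt0 subr_eq0 eq_sym.
Qed.

Lemma line_cauchy_integrable psi g y : test_function psi -> Im g != y ->
  line_integrable y (fun z => fourier psi z / (g - z)).
Proof.
move=> tpsi gy; apply: (@cintegrable_mul _ _ (fun x : R => (g - (x +i* y))^-1) (`|y - Im g|^-1)).
- exact: cintegrable_test_fourier.
- move=> x; apply: (@cvgV C); first exact: (off_line x gy).2.
  by apply: (continuousBc (f := fun=> g)); [exact: continuous_cstc|exact: continuous_line].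
move=> x; have [h gx] := off_line x gy.
rewrite Normc.normcV lef_pV2 ?posrE ?normc_gt0//.
by rewrite normr_gt0 subr_eq0 eq_sym.
Qed.

Lemma cexp_real (r : R) : (expR r)%:C = cexp r%:C.
Proof. by rewrite /cexp /= cos0 sin0 mulr1 mulr0. Qed.

Lemma e1_line (t x y : R) :
  e1 (x * t) = (expR (2 * pi * y * t))%:C * cexp ((0 +i* (2 * pi * t)) * (x +i* y)).
Proof.
by rewrite cexp_real -cexpD /e1; congr cexp; apply: complex_ext => /=; ring.
Qed.

(* For [Im g < Im z], [(g - z)^-1] is [2 i pi] times the integral over [t >= 0]
   of [exp (2 i pi t (z - g))]. *)
Lemma line_cauchy psi g y : test_function psi -> Im g < y ->
  line y (fun z => fourier psi z / (g - z)) =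
  twopii * cintegral mu half (fun t => psi t * expo (kz g) t).
Proof.
move=> tpsi gy; have mh : measurable half by exact: measurable_itv.
(* The frequency for abscissa 0. The abscissa [x] contributes the separate factor [e1 (x * t)], so
   that the other factors depend on [x] or on [t] alone. *)
pose w : C := twopii * ((0 +i* y) - g).
have Rw : Re w < 0.
  have -> : Re w = - (2 * pi * (y - Im g)).
    by rewrite /w /twopii; case: (g) => u v /=; ring.
  by rewrite oppr_lt0 mulr_gt0 ?subr_gt0// mulr_gt0// pi_gt0.
pose u := crestrict half (expo w).
have iu : cintegrable mu (setT : set mR) u.
  exact: (cintegrable_restrict mu _ mh).1 (cintegral_exp_half Rw).1.
have iF := cintegrable_test_fourier y tpsi.
pose f (xt : mR * mR) : C := fourier psi (xt.1 +i* y) * (u xt.2 * e1 (xt.1 * xt.2)).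
have m1 : cmeasurable (setT : set mR) (fun x => fourier psi (x +i* y)).
  exact: cintegrable_measurable iF.
have m2 : cmeasurable (setT : set mR) u by exact: cintegrable_measurable iu.
have mf : cmeasurable setT f.
  apply: cmeasurableM.
    by split; [exact: measurableT_comp m1.1 measurable_fst|exact: measurableT_comp m1.2 measurable_fst].
  apply: cmeasurableM; last exact: cmeasurable_e1M.
  by split; [exact: measurableT_comp m2.1 measurable_snd|exact: measurableT_comp m2.2 measurable_snd].
have [fub _ _] := cfubini mf (cintegrable_norm measurableT iF) (cintegrable_norm measurableT iu)
  (fun x t => ltac:(by rewrite /f !Normc.normcM normc_e1 mulr1)).
have E1 x : cintegral mu (setT : set mR) (fun t => f (x, t)) =
    twopii^-1 * (fourier psi (x +i* y) / (g - (x +i* y))).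
  rewrite /f /= (cintegralZ _ measurableT (cintegrableMe1 x iu)).
  have gx : g - (x +i* y) != 0.
    rewrite subr_eq0; apply/eqP => E; move: gy; rewrite E /= ltxx; exact: notF.
  have Rwx : Re (twopii * ((x +i* y) - g)) < 0.
    by move: Rw; rewrite /w /twopii; case: (g) => a b /=; rewrite !mul0r !sub0r.
  have Ew : twopii * ((x +i* y) - g) = w + (0 +i* (2 * pi * x)).
    by rewrite /w /twopii; case: (g) => a b; apply: complex_ext => /=; ring.
  have := (cintegral_exp_half Rwx).2.
  have -> : cintegral mu half (expo (twopii * ((x +i* y) - g))) =
      cintegral mu (setT : set mR) (fun t => u t * e1 (x * t)).
    rewrite cintegral_restrict; apply: eq_cintegral => t _; rewrite /u /crestrict.
    case: ifP => _; last by rewrite mul0r.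
    by rewrite Ew expo_add (e1_expo x t).
  move=> ->; rewrite -invrN -mulrN opprB.
  by field; rewrite twopii_neq0 gx.
(* The inner integral over [x] is Fourier inversion at height [y]. *)
have E2 t : cintegral mu (setT : set mR) (fun x => f (x, t)) =
    crestrict half (fun t => psi t * expo (kz g) t) t.
  rewrite /f /=.
  have -> : cintegral mu (setT : set mR) (fun x => fourier psi (x +i* y) * (u t * e1 (x * t))) =
     cintegral mu (setT : set mR) (fun x => u t * (expR (2 * pi * y * t))%:C *
       (fourier psi (x +i* y) * cexp ((0 +i* (2 * pi * t)) * (x +i* y)))).
    by apply: eq_cintegral => x _; rewrite (e1_line t x y) mulrCA -!mulrA; congr (_ * _); rewrite mulrCA.
  rewrite (cintegralZ _ measurableT); last first.
    have := @cintegrable_mul R _ (fun x => e1 (t * x)) 1 iF (@continuous_e1 _ _) (fun x => ltac:(by rewrite normc_e1)).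
    move=> /(cintegrableZ (expR (- (2 * pi * y * t)))%:C measurableT).
    apply: (eq_cintegrable measurableT) => x _; rewrite mulrCA.
    rewrite [t * x]mulrC (e1_line t x y) [X in _ * X]mulrA -(rmorphM (real_complex R)) -expRD.
    by rewrite addNr expR0 mul1r.
  rewrite (fourier_inversion y t tpsi) /u /crestrict.
  case: (t \in half); last by rewrite !mul0r.
  rewrite mulrC; congr (_ * _); rewrite cexp_real /expo -cexpD; congr cexp.
  by rewrite /w /kz /twopii; case: (g) => a b; apply: complex_ext => /=; ring.
rewrite (cintegral_restrict _ half) /line.
under [X in _ = _ * X]eq_cintegral do rewrite -E2.
rewrite -fub; under [X in _ = _ * X]eq_cintegral do rewrite E1.
have gy' : Im g != y by rewrite lt_eqF.
rewrite (cintegralZ twopii^-1 measurableT (line_cauchy_integrable tpsi gy')).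
by rewrite mulrA (mulfV (twopii_neq0 R)) mul1r.
Qed.

Lemma line_cauchy_lower psi g y : test_function psi -> - y < Im g ->
  line (- y) (fun z => fourier psi z / (g - z)) =
  - (twopii * cintegral mu half (fun t => psi (- t) * expo (kz g) (- t))).
Proof.
move=> tpsi gy; have gy' : Im (- g) < y by rewrite ImN ltrNl.
have gy'' : Im g != - y by rewrite gt_eqF.
have E : cintegral mu half (fun t => psi (- t) * expo (kz g) (- t)) =
    cintegral mu half (fun t => psi (- t) * expo (kz (- g)) t).
  apply: eq_cintegral => t _; congr (_ * _).
  by rewrite /kz mulrN /expo (rmorphN (real_complex R)) mulrN mulNr.
rewrite E -(line_cauchy (test_flip tpsi) gy') /line.
have il := line_cauchy_integrable (test_flip tpsi) (negbT (lt_eqF gy')).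
rewrite -(cintegralN measurableT il) -[LHS](cintegral_opp (line_cauchy_integrable tpsi gy'')).
apply: eq_cintegral => x _; rewrite (fourier_flip _ tpsi) -mulrN -invrN; congr (fourier psi _ / _).
by case: (g) => a b; apply: complex_ext => /=; ring.
Qed.

(** The upper line sees [psi] on [t >= 0] and the lower one, with the opposite sign, on [t <= 0];
    the difference is the full Fourier integral. This takes the place of the residue theorem. *)
Lemma line_cauchy_jump psi g y : test_function psi -> `|Im g| < y ->
  line y (fun z => fourier psi z / (g - z)) - line (- y) (fun z => fourier psi z / (g - z)) =
  twopii * fourier psi g.
Proof.
move=> tpsi; rewrite ltr_norml => /andP[g1 g2].
rewrite line_cauchy// line_cauchy_lower// opprK -mulrDr; congr (_ * _).
by rewrite fourierE (cintegral_halves (test_fourier_integrable g tpsi)).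
Qed.

End LineIntegrals.

(** * Line integrals of the kernels *)

Section KernelLines.
Variable R : realType.
Local Notation C := (cplx R).
Local Notation N := (@Normc.normc R).
Local Notation Re := (@complex.Re R).
Local Notation Im := (@complex.Im R).
Local Notation mu := (@lebesgue_measure R).
Local Notation mR := (measurableTypeR R).
Local Notation half := (`[0, +oo[%classic : set mR).
Local Notation twopii := (twopii R).
Implicit Types (phi psi chi : R -> C) (g z : C) (y : R).

(** Inversion at frequency 0. The value does not depend on [y], so polynomial terms cancel in the
    difference of two lines. *)
Lemma line_fourier chi y : test_function chi -> line y (fourier chi) = chi 0.
Proof.
move=> tchi; rewrite -(fourier_inversion y 0 tchi); apply: eq_cintegral => x _.
by rewrite mulr0 mul0r cexp0 mulr1.
Qed.

(** The polynomial factors of the kernel act on [phi] as differential operators. What is left is a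
    bare Cauchy kernel and the transform of a test function, both with known line integrals. *)
Lemma kern_fourier k (r : R) g phi : test_function phi -> (r ^+ 2)%:C + g ^+ 2 != 0 ->
  exists psi chi, [/\ test_function psi, test_function chi,
    forall U : set R, open U -> (forall x, U x -> phi x = 0) ->
      forall x, U x -> psi x = 0 /\ chi x = 0,
    fourier psi g = ((r ^+ 2)%:C + g ^+ 2) ^+ k.+1 * fourier phi g &
    forall z, g != z -> kern k r z g * fourier phi z =
      (((r ^+ 2)%:C + g ^+ 2) ^+ k.+1)^-1 * (fourier psi z / (g - z) + fourier chi z)].
Proof.
move=> tphi rg; pose p : {poly C} := 'X ^+ 2 + ((r ^+ 2)%:C)%:P.
have pE z : p.[z] = z ^+ 2 + (r ^+ 2)%:C by rewrite /p !hornerE.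
have [psi [t1 s1 E1]] := fourier_poly (p ^+ k.+1) tphi.
have [chi [t2 s2 E2]] := fourier_poly ('X * p ^+ k) tphi.
exists psi, chi; split=> //.
- by move=> U oU HU x Ux; split; [exact: s1 oU HU x Ux|exact: s2 oU HU x Ux].
- by rewrite E1 horner_exp pE addrC.
move=> z gz; rewrite kernE (kern1E _ _ gz) E1 E2 hornerM !horner_exp hornerX pE (exprS (z ^+ 2 + _)).
by ring.
Qed.

Lemma line_off y (x : R) g : Im g != y -> g != x +i* y.
Proof. by move=> gy; apply/eqP => E; move: gy; rewrite E /= eqxx. Qed.

Lemma line_kern_integrable k (r : R) g phi y : test_function phi ->
  (r ^+ 2)%:C + g ^+ 2 != 0 -> Im g != y ->
  line_integrable y (fun z => kern k r z g * fourier phi z).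
Proof.
move=> tphi rg gy; have [psi [chi [t1 t2 _ _ E]]] := kern_fourier k tphi rg.
have i1 := line_cauchy_integrable t1 gy; have i2 := cintegrable_test_fourier y t2.
have := cintegrableZ (((r ^+ 2)%:C + g ^+ 2) ^+ k.+1)^-1 measurableT (cintegrableD measurableT i1 i2).
by apply: (eq_cintegrable measurableT) => x _; rewrite E//; exact: line_off.
Qed.

Lemma line_kernE k (r : R) g phi psi chi y : test_function psi -> test_function chi ->
  Im g != y ->
  (forall z, g != z -> kern k r z g * fourier phi z =
      (((r ^+ 2)%:C + g ^+ 2) ^+ k.+1)^-1 * (fourier psi z / (g - z) + fourier chi z)) ->
  line y (fun z => kern k r z g * fourier phi z) =
  (((r ^+ 2)%:C + g ^+ 2) ^+ k.+1)^-1 * (line y (fun z => fourier psi z / (g - z)) + chi 0).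
Proof.
move=> t1 t2 gy E; have i1 := line_cauchy_integrable t1 gy.
have i2 := cintegrable_test_fourier y t2.
rewrite -(line_fourier y t2) -(cintegralD measurableT i1 i2).
rewrite -(cintegralZ _ measurableT (cintegrableD measurableT i1 i2)).
by apply: eq_cintegral => x _; rewrite E//; exact: line_off.
Qed.

Lemma line_kern_jump k (r : R) g phi y : test_function phi ->
  (r ^+ 2)%:C + g ^+ 2 != 0 -> `|Im g| < y ->
  line y (fun z => kern k r z g * fourier phi z) -
    line (- y) (fun z => kern k r z g * fourier phi z) = twopii * fourier phi g.
Proof.
move=> tphi rg gy; have [psi [chi [t1 t2 _ E0 E]]] := kern_fourier k tphi rg.
have /andP[g1 g2] : - y < Im g < y by rewrite -ltr_norml.
rewrite (line_kernE t1 t2 _ E) ?(lt_eqF g2)// (line_kernE t1 t2 _ E) ?(gt_eqF g1)//.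
move: (line_cauchy_jump t1 gy); rewrite E0; move: (line y _) (line (- y) _) => a1 a2 J.
rewrite -mulrBr (_ : _ + chi 0 - _ = a1 - a2); last by ring.
by rewrite J mulrCA (mulrA _^-1) mulVf ?expf_neq0// mul1r.
Qed.

(** On a line above [g] only the values of [psi] on [t >= 0] and [chi 0] enter, and both vanish when
    [phi] vanishes near that half-line. *)
Lemma line_kern_top k (r : R) g phi y (U : set R) : test_function phi ->
  (r ^+ 2)%:C + g ^+ 2 != 0 -> Im g < y -> open U -> (forall x, U x -> phi x = 0) ->
  (forall x, 0 <= x -> U x) ->
  line y (fun z => kern k r z g * fourier phi z) = 0.
Proof.
move=> tphi rg gy oU phiU HU; have [psi [chi [t1 t2 s12 _ E]]] := kern_fourier k tphi rg.
rewrite (line_kernE t1 t2 _ E) ?(lt_eqF gy)// (line_cauchy t1 gy).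
rewrite (s12 U oU phiU 0 (HU 0 (lexx 0))).2 addr0.
have -> : cintegral mu half (fun t => psi t * expo (kz g) t) = cintegral mu half (fun=> 0).
  apply: eq_cintegral => t; rewrite /= in_itv /= andbT => t0.
  by rewrite (s12 U oU phiU t (HU t t0)).1 mul0r.
by rewrite cintegral0 !mulr0.
Qed.

End KernelLines.

(** * Summation over the points along a line *)

Section LineSums.
Variable R : realType.
Local Notation C := (cplx R).
Local Notation N := (@Normc.normc R).
Local Notation Re := (@complex.Re R).
Local Notation Im := (@complex.Im R).
Local Notation mu := (@lebesgue_measure R).
Local Notation mR := (measurableTypeR R).
Local Notation twopii := (twopii R).
Variables (D : set C) (m : C -> C) (rad w : C -> R) (k : nat) (c y c1 r1 : R) (P : {poly C}).
Hypotheses (Dc : forall g, D g -> `|Im g| <= c) (cy : c < y) (y0 : 0 <= y).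
Hypotheses (w0 : forall g, 0 <= w g) (ws : wsummable D w).
Hypothesis rad0 : forall g, D g -> ((rad g) ^+ 2)%:C + g ^+ 2 != 0.
Hypotheses (c10 : 0 <= c1) (kb : forall z d g, 0 < d -> D g -> d <= N (g - z) ->
  N (kern k (rad g) z g * m g) <= (N z ^+ 2 + r1 ^+ 2) ^+ k * (c1 * kern_growth r1 d z) * w g).

Definition kernel_series (z : C) : C := csum D (fun g => kern k (rad g) z g * m g).

Section OneLine.
Variables (phi : R -> C) (y' : R).
Hypotheses (tphi : test_function phi) (yy : `|y'| = y).

Lemma line_growth : exists2 B : R, 0 <= B & forall x : R,
  (N (x +i* y') ^+ 2 + r1 ^+ 2) ^+ k * (c1 * kern_growth r1 (y - c) (x +i* y')) *
    N (fourier phi (x +i* y')) <= B * (1 + x ^+ 2)^-1.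
Proof.
have d0 : 0 < y - c by rewrite subr_gt0.
(* Of the [k + 2] powers of [1 + x ^+ 2], [k] compensate [(z^2 + r1^2)^k], one compensates
   [kern_growth], and one makes the result integrable. *)
have [_ /(_ k.+2)[cp cp0 Hcp]] := test_fourier_line y' tphi.
pose e := 1 + y' ^+ 2 + r1 ^+ 2.
have e0 : 0 <= e by rewrite !addr_ge0// sqr_ge0.
exists (e ^+ k * (c1 * (e * ((y - c)^-1 + 1))) * cp).
  by rewrite mulr_ge0// mulr_ge0 ?exprn_ge0// mulr_ge0// mulr_ge0// addr_ge0// invr_ge0 ltW.
move=> x; set z := x +i* y'; pose T := 1 + x ^+ 2.
have T1 : 1 <= T by rewrite lerDl sqr_ge0.
have T0 : 0 < T by exact: lt_le_trans T1.
have Nz : N z ^+ 2 = x ^+ 2 + y' ^+ 2 by rewrite normc_sqr.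
have s1 := sqr_ge0 x; have s2 := sqr_ge0 y'; have s3 := sqr_ge0 r1.
have h1 : N z ^+ 2 + r1 ^+ 2 <= e * T.
  by rewrite Nz /e /T; have := mulr_ge0 s1 s2; have := mulr_ge0 s1 s3; lra.
have h2 : N z <= e * T.
  have : 0 <= (N z - 1) ^+ 2 by exact: sqr_ge0.
  have := normc_ge0 z; rewrite sqrrB1 Nz /e /T.
  by have := mulr_ge0 s1 s2; have := mulr_ge0 s1 s3; lra.
have h3 : kern_growth r1 (y - c) z <= e * ((y - c)^-1 + 1) * T.
  rewrite /kern_growth [leRHS](_ : _ = e * T / (y - c) + e * T); last by ring.
  by rewrite lerD// ler_pM2r ?invr_gt0.
have q0 : 0 <= N z ^+ 2 + r1 ^+ 2 by rewrite addr_ge0 ?sqr_ge0.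
apply: (@le_trans _ _ ((e * T) ^+ k * (c1 * (e * ((y - c)^-1 + 1) * T)) * (cp * (T ^+ k.+2)^-1))).
  apply: ler_pM; last exact: Hcp.
  - rewrite mulr_ge0 ?exprn_ge0// mulr_ge0// kern_growth_ge0// ltW//.
  - exact: normc_ge0.
  apply: ler_pM.
  - by rewrite exprn_ge0.
  - by rewrite mulr_ge0// kern_growth_ge0// ltW.
  - by rewrite lerXn2r ?nnegrE ?mulr_ge0// ltW.
  - exact: ler_wpM2l.
rewrite le_eqVlt; apply/orP; left; apply/eqP; rewrite -/T exprMn !exprS.
by field; rewrite gt_eqF//= expf_neq0// gt_eqF.
Qed.

Let Dy g : D g -> Im g != y'.
Proof.
move=> /Dc gc; apply/eqP => E; move: gc; rewrite E yy; exact/negP/negbT/lt_geF.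
Qed.

(** On both lines all points are at distance at least [y - c], which gives the product majorant
    [w g * H x] that [cintegral_csum] asks for. *)
Lemma line_sum : [/\ line_integrable y' (fun z => kernel_series z * fourier phi z),
  line y' (fun z => kernel_series z * fourier phi z) =
    csum D (fun g => m g * line y' (fun z => kern k (rad g) z g * fourier phi z)) &
  exists2 B : R, 0 <= B & cdominated D (fun g => B * w g)
    (fun g => m g * line y' (fun z => kern k (rad g) z g * fourier phi z))].
Proof.
have d0 : 0 < y - c by rewrite subr_gt0.
have [B B0 HB] := line_growth.
pose H (x : R) := B * (1 + x ^+ 2)^-1.
have iH : rintegrable mu (setT : set mR) H by exact: rintegrable_cauchyZ.
have H0 x : 0 <= H x by rewrite mulr_ge0// invr_ge0 addr_ge0// sqr_ge0.
pose f g (x : R) : C := m g * (kern k (rad g) (x +i* y') g * fourier phi (x +i* y')).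
have dist g x : D g -> y - c <= N (g - (x +i* y')).
  move=> Dg; apply: le_trans (off_line x (Dy Dg)).1; rewrite -yy.
  have := Dc Dg; have := ler_norm (`|y'| - `|Im g|); have := ler_dist_dist y' (Im g); lra.
have kd (x : R) : cdominated D
    (fun g => (N (x +i* y') ^+ 2 + r1 ^+ 2) ^+ k * (c1 * kern_growth r1 (y - c) (x +i* y')) * w g)
    (fun g => kern k (rad g) (x +i* y') g * m g).
  by move=> g Dg; exact: kb d0 Dg (dist g x Dg).
have fb g x : D g -> N (f g x) <= w g * H x.
  move=> Dg; rewrite /f mulrCA mulrA Normc.normcM.
  apply: (@le_trans _ _ ((N (x +i* y') ^+ 2 + r1 ^+ 2) ^+ k *
     (c1 * kern_growth r1 (y - c) (x +i* y')) * w g * N (fourier phi (x +i* y')))).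
    by rewrite ler_wpM2r ?normc_ge0//; exact: kd.
  by rewrite mulrAC mulrC ler_wpM2l// HB.
have fi g : D g -> cintegrable mu (setT : set mR) (f g).
  by move=> Dg; apply: cintegrableZ; [exact: measurableT|exact: line_kern_integrable (rad0 Dg) (Dy Dg)].
have fE g : D g -> cintegral mu (setT : set mR) (f g) =
    m g * line y' (fun z => kern k (rad g) z g * fourier phi z).
  by move=> Dg; exact: cintegralZ measurableT (line_kern_integrable k tphi (rad0 Dg) (Dy Dg)).
have [i1 E1] := cintegral_csum measurableT ws (fun g _ => w0 g)
  (fun g Dg => cintegrable_measurable (fi g Dg)) iH (fun x _ => H0 x)
  (fun g x Dg _ => fb g x Dg).
have sE x : csum D (fun g => f g x) = kernel_series (x +i* y') * fourier phi (x +i* y').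
  rewrite mulrC /kernel_series -(csumZ _ _ (kd x)).
    by apply: eq_csum => g _; rewrite /f; ring.
  apply: wsummableZ => //; rewrite mulr_ge0 ?exprn_ge0 ?addr_ge0 ?sqr_ge0//.
  by rewrite mulr_ge0// kern_growth_ge0// ltW.
split.
- by apply: (eq_cintegrable measurableT) i1 => x _; exact: sE.
- rewrite /line -(eq_csum fE) -E1; apply: eq_cintegral => x _; exact: esym (sE x).
exists (2 * Rintegral mu (setT : set mR) H); first by rewrite mulr_ge0//; apply: Rintegral_ge0 => x _; exact: H0.
move=> g Dg; rewrite -fE//.
have iw := rintegrableZ (w g) measurableT iH.
apply: le_trans (normc_cintegral measurableT (cintegrable_measurable (fi g Dg)) iw (fun x _ => fb g x Dg)) _.
by rewrite RintegralZl// mulrA mulrAC.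
Qed.

End OneLine.

Definition represented_sum (z : C) : C := twopii^-1 * kernel_series z + P.[z].

Lemma represented_line phi chi y' : test_function phi -> test_function chi ->
  (forall z, fourier chi z = P.[z] * fourier phi z) -> `|y'| = y ->
  line_integrable y' (fun z => represented_sum z * fourier phi z) /\
  line y' (fun z => represented_sum z * fourier phi z) =
    twopii^-1 * csum D (fun g => m g * line y' (fun z => kern k (rad g) z g * fourier phi z)) + chi 0.
Proof.
move=> tphi tchi E yy; have [i1 E1 _] := line_sum tphi yy.
have i2 := cintegrable_test_fourier y' tchi.
have i3 := cintegrableZ twopii^-1 measurableT i1.
have SE (x : R) : twopii^-1 * (kernel_series (x +i* y') * fourier phi (x +i* y')) +
    fourier chi (x +i* y') = represented_sum (x +i* y') * fourier phi (x +i* y').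
  by rewrite E /represented_sum; ring.
split.
  by apply: (eq_cintegrable measurableT) (cintegrableD measurableT i3 i2) => x _; exact: SE.
rewrite -E1 -(line_fourier y' tchi) /line -(cintegralZ _ measurableT i1).
rewrite -(cintegralD measurableT i3 i2); apply: eq_cintegral => x _; exact: esym (SE x).
Qed.

Lemma represented_jump phi : test_function phi ->
  line y (fun z => represented_sum z * fourier phi z) -
    line (- y) (fun z => represented_sum z * fourier phi z) =
  csum D (fun g => m g * fourier phi g).
Proof.
move=> tphi; have [chi [tchi _ E]] := fourier_poly P tphi.
have yy : `|y| = y by rewrite ger0_norm.
have yN : `|- y| = y by rewrite normrN.
pose f s g := m g * line s (fun z => kern k (rad g) z g * fourier phi z).
have E1 : _ = twopii^-1 * csum D (f y) + chi 0 := (represented_line tphi tchi E yy).2.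
have E2 : _ = twopii^-1 * csum D (f (- y)) + chi 0 := (represented_line tphi tchi E yN).2.
have [_ _ [B1 B10 d1]] := line_sum tphi yy; have [_ _ [B2 B20 d2]] := line_sum tphi yN.
have alg (u v s x : C) : s * u + x - (s * v + x) = s * (u + (-1) * v) by ring.
rewrite E1 E2 alg.
have sw : wsummable D (fun g => (B1 + B2) * w g) by apply: wsummableZ; rewrite ?addr_ge0.
rewrite -(csum_lin _ sw).
- transitivity (twopii^-1 * csum D (fun g => twopii * (m g * fourier phi g))).
    congr (_ * _); apply: eq_csum => g Dg.
    have gy : `|Im g| < y by exact: le_lt_trans (Dc Dg) cy.
    by rewrite mulN1r -mulrBr (line_kern_jump k tphi (rad0 Dg) gy) mulrCA.
  have [B B0 Bd] : exists2 B : R, 0 <= B & cdominated D (fun g => B * w g) (fun g => m g * fourier phi g).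
    exists (N twopii^-1 * (B1 + B2)); first by rewrite mulr_ge0 ?normc_ge0 ?addr_ge0.
    move=> g Dg; have gy : `|Im g| < y by exact: le_lt_trans (Dc Dg) cy.
    have -> : m g * fourier phi g = twopii^-1 * (m g * (twopii * fourier phi g)).
      by field; exact: twopii_neq0.
    rewrite -(line_kern_jump k tphi (rad0 Dg) gy) Normc.normcM -mulrA ler_wpM2l ?normc_ge0//.
    rewrite mulrBr mulrDl; apply: ler_normcD; first exact: d1.
    by rewrite normcN; exact: d2.
  have sB : wsummable D (fun g => B * w g) by apply: wsummableZ.
  by rewrite (csumZ _ sB Bd) mulrA mulVf ?twopii_neq0// mul1r.
- by move=> g Dg; apply: le_trans (d1 g Dg) _; rewrite ler_wpM2r// lerDl.
- by move=> g Dg; apply: le_trans (d2 g Dg) _; rewrite ler_wpM2r// lerDr.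
Qed.

Lemma represented_top phi (U : set R) : test_function phi -> open U ->
  (forall x, U x -> phi x = 0) -> (forall x, 0 <= x -> U x) ->
  line y (fun z => represented_sum z * fourier phi z) = 0.
Proof.
move=> tphi oU phiU HU; have [chi [tchi schi E]] := fourier_poly P tphi.
have yy : `|y| = y by rewrite ger0_norm.
have [_ ->] := represented_line tphi tchi E yy.
rewrite (schi U oU phiU 0 (HU 0 (lexx 0))) addr0.
rewrite (eq_csum (g := fun=> 0)) ?csum0 ?mulr0// => g Dg.
have gy : Im g < y by apply: le_lt_trans cy; apply: le_trans (Dc Dg); exact: ler_norm.
by rewrite (line_kern_top k tphi (rad0 Dg) gy oU phiU HU) mulr0.
Qed.

End LineSums.

(** * Points where the function is regular carry no mass *)

Section KernelPoles.
Variable R : realType.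
Local Notation C := (cplx R).
Local Notation N := (@Normc.normc R).
Local Notation Re := (@complex.Re R).
Local Notation Im := (@complex.Im R).

Lemma derivable_cvg (F : C -> C) z : derivable F z 1 -> F x @[x --> z] --> F z.
Proof. by move=> h; apply: differentiable_continuous; exact/derivable1_diffP. Qed.

Lemma punctured_eq (u v : C -> C) z : u x @[x --> z] --> u z -> v x @[x --> z] --> v z ->
  (\forall x \near z^', u x = v x) -> u z = v z.
Proof.
move=> cu cv /dnbhs_normcP[d d0 uv]; apply/eqP; rewrite -subr_eq0 -normc0P; apply/eqP.
apply: ge0_lt_eq0; first exact: normc_ge0.
move=> e e0; have e20 : 0 < e / 2 by rewrite divr_gt0.
have /cvg_normcP/(_ _ e20)/nbhs_normcP[d1 d10 H1] := cu.
have /cvg_normcP/(_ _ e20)/nbhs_normcP[d2 d20 H2] := cv.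
pose t := Num.min d (Num.min d1 d2) / 2.
have m0 : 0 < Num.min d (Num.min d1 d2) by rewrite !lt_min d0 d10.
have t0 : 0 < t by rewrite divr_gt0.
have tm : t < Num.min d (Num.min d1 d2) by rewrite /t ltr_pdivrMr// mulr_natr mulr2n ltrDl.
pose x : C := z + t%:C.
have Nx : N (z - x) = t by rewrite /x opprD addrA subrr add0r normcN normcR gtr0_norm.
move: tm; rewrite !lt_min => /and3P[td td1 td2].
have xz : x != z.
  by rewrite -subr_eq0 -normc_gt0 normcB Nx.
have E := uv x; rewrite Nx in E; have {}E := E td xz.
have h1 := H1 x; rewrite Nx in h1; have {}h1 := h1 td1.
have h2 := H2 x; rewrite Nx in h2; have {}h2 := h2 td2.
rewrite (_ : u z - v z = (u z - u x) + - (v z - v x)); last by rewrite E; ring.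
rewrite (splitr e); apply: ler_normcD; first exact: ltW.
by rewrite normcN ltW.
Qed.

(** After multiplication by [x - z] the polar part is the constant [r], whereas the difference of
    two regular functions tends to 0. *)
Lemma no_pole (F : C -> C) z r : simple_pole_with_residue F z r -> ~
  (exists2 u : C -> C, derivable u z 1 & \forall x \near z^', F x = u x).
Proof.
move=> [r0 [h [hh Fh]]] [u du Fu]; have dh : derivable h z 1 := nbhs_singleton hh.
pose v x := (x - z) * (u x - h x).
have dv : derivable v z 1.
  apply: derivableM; last by apply: (derivableB (f := u)); [exact: du|exact: dh].
  by apply: derivableB; [exact: derivable_id|exact: derivable_cst].
have dc : derivable (fun _ : C => r : C) z 1 by exact: derivable_cst.
have : v z = r.
  apply: (@punctured_eq v (fun=> r) z (derivable_cvg dv) (derivable_cvg dc)).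
  have [d d0 Hd] := (dnbhs_normcP _ _).1 Fh; have [d' d'0 Hd'] := (dnbhs_normcP _ _).1 Fu.
  apply/dnbhs_normcP; exists (Num.min d d'); first by rewrite lt_min d0.
  move=> x; rewrite lt_min => /andP[xd xd'] xz; rewrite /v -(Hd' x xd' xz) (Hd x xd xz).
  by field; rewrite subr_eq0.
by rewrite /v subrr mul0r => E; move: r0; rewrite -E eqxx.
Qed.

Variables (D : set C) (m : C -> C) (s : R) (k : nat) (rad : C -> R).
Let w0 (g : C) : R := N (m g) * ((1 + N g ^+ 2) ^+ k.+1)^-1.
Hypotheses (s0 : 0 <= s) (Ds : forall g, D g -> `|Im g| <= s) (ws : wsummable D w0).
Hypothesis rad0 : forall g, D g -> ((rad g) ^+ 2)%:C + g ^+ 2 != 0.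
Hypothesis kdom : forall z d, 0 < d -> (forall g, D g -> d <= N (g - z)) ->
  exists2 B, 0 <= B & cdominated D (fun g => B * w0 g) (fun g => kern k (rad g) z g * m g).
Hypothesis D0 : limit_point D = set0.

(* Partial fractions at arbitrary nodes exhibit the poles of the kernels. *)
Lemma kern_sum_poles : exists (X : C -> C) (P : {poly C}),
  [/\ forall z, ~ D z -> kern_sum D m k rad z = X z + P.[z],
      forall z, ~ D z -> derivable X z 1 &
      forall g, D g -> m g != 0 -> simple_pole_with_residue X g (- m g / twopii R)].
Proof.
pose nodes : seq C := [seq 0 +i* (s + 1 + j%:R) | j <- iota 0 (2 * k).+1].
have un : uniq nodes.
  rewrite map_inj_in_uniq ?iota_uniq// => i j _ _ [] /addrI /eqP.
  by rewrite eqr_nat => /eqP.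
have sn : size nodes = (2 * k).+1 by rewrite size_map size_iota.
have Hn w : w \in nodes -> s < Im w.
  by move=> /mapP[j _ ->] /=; rewrite -addrA ltrDl ltr_pwDl.
have ss := lexx s.
(* The decomposition [extension_kern] holds for any coefficient function; the zero function is
   chosen, as the poles depend on the masses. *)
exists (extension D m (fun=> 0) nodes); exists (- \sum_(w <- nodes)
  ((upper_series (fun=> 0) w - kern_sum D m k rad w) / (lag nodes w).[w]) *: lag nodes w).
split; last 2 first.
- have := @extension_derivable _ D m (fun=> 0) _ _ k s0 ss Ds ws D0 nodes sn Hn; exact.
- have := @extension_pole _ D m (fun=> 0) _ _ k s0 ss Ds ws D0 nodes sn Hn; exact.
move=> z nz.
rewrite (extension_kern (fun=> 0) s0 ss Ds ws D0 un sn Hn rad0 kdom nz) hornerN.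
by rewrite addrK.
Qed.

Lemma derivable_kern_sum (P : {poly C}) z : ~ D z ->
  derivable (fun z => kern_sum D m k rad z + P.[z]) z 1.
Proof.
move=> nz; have [X [P0 [XE dX _]]] := kern_sum_poles.
have dY : derivable (fun x => X x + P0.[x] + P.[x]) z 1.
  by apply: derivableD; [apply: derivableD; [exact: dX|]|]; exact: poly_derivable.
apply: (near_eq_derivable _ dY); apply: filterS (notin_near z D0) => x xD.
have [Dx|nx] := pselect (D x); last by rewrite XE.
by exfalso; apply: nz; rewrite -(xD Dx).
Qed.

Section Regular.
Variables (P : {poly C}) (F : C -> C) (g : C).
Hypothesis FE : forall z, ~ D z -> F z = kern_sum D m k rad z + P.[z].
Hypothesis dF : derivable F g 1.

Let punctured : \forall x \near g^', ~ D x.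
Proof.
have [d d0 Hd] := (nbhs_normcP _ _).1 (notin_near g D0).
apply/dnbhs_normcP; exists d => // x xd xg Dx.
by move: xg; rewrite (Hd x xd Dx) eqxx.
Qed.

(** The representation constrains [F] only off [D]; derivability at [g] rules out the pole that a
    nonzero mass would create. *)
Lemma regular_mass0 : D g -> m g = 0.
Proof.
move=> Dg; apply/eqP; apply: contrapT => /negP mg.
have [X [P0 [XE dX pX]]] := kern_sum_poles.
apply: (no_pole (pX g Dg mg)); exists (fun x => F x - P.[x] - P0.[x]).
  by apply: derivableB; [apply: derivableB; [exact: dF|]|]; exact: poly_derivable.
by apply: filterS punctured => x nx; rewrite FE// XE//; ring.
Qed.

End Regular.

End KernelPoles.

(** * Fourier coefficients and line integrals *)

Section LinePairing.
Variable R : realType.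
Local Notation C := (cplx R).
Local Notation N := (@Normc.normc R).
Local Notation Re := (@complex.Re R).
Local Notation Im := (@complex.Im R).
Local Notation mu := (@lebesgue_measure R).
Local Notation mR := (measurableTypeR R).
Variables (F : C -> C) (y : R).
Hypothesis apF : almost_periodic (fun x : R => F (x +i* y)).
Local Notation coef := (fourier_coef F y).
Hypothesis sF : locally_summable coef.
Local Notation ball0 M := [set l : R | `|l| <= M].

Lemma coef_summable M : wsummable (ball0 M) (fun l => N (coef l)).
Proof.
have p : 0 < Num.max M 1 by rewrite lt_max ltr01 orbT.
apply: wsummable_sub (sF.2 _ p) => [l _|l lM]; first exact: normc_ge0.
by apply: le_trans lM _; rewrite le_max lexx.
Qed.

(** [ap_pairing] at height [y] for the gauged test function; the weight of [gauge] cancels the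
    factor found in [fourier_coefE]. *)
Lemma line_pairing phi M : test_function phi -> csupp phi M ->
  line y (fun z => F z * fourier phi z) = csum (ball0 M) (fun l => coef l * phi l).
Proof.
move=> tphi sphi; pose f x := F (x +i* y).
have cf : continuous f := apF.1; have tf := ap_tb apF.
have mean l : exists c : C, has_mean (fun x => f x * e1 (- l * x)) c.
  apply: tb_has_mean; first by apply: continuousMc; [exact: cf|exact: continuous_e1].
  by apply: tbM; [exact: tf|exact: tb_e1].
pose c l := projT1 (cid (mean l)).
have cP l : has_mean (fun x => f x * e1 (- l * x)) (c l) := projT2 (cid (mean l)).
have cE l : coef l = (expR (2 * pi * l * y))%:C * c l by exact: fourier_coefE (cP l) cf.
have cE' l : c l = (expR (- (2 * pi * l * y)))%:C * coef l.
  by rewrite cE mulrA -(rmorphM (real_complex R)) -expRD addNr expR0 mul1r.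
have sg : csupp (gauge phi y) M by exact: csuppM.
have wc : wsummable (ball0 M) (fun l => N (c l)).
  apply: (@wsummable_le _ _ _ _ (fun l => expR (2 * pi * `|M| * `|y|) * N (coef l))).
    move=> l lM; rewrite cE' Normc.normcM normcR ger0_norm ?expR_ge0//.
    rewrite ler_wpM2r ?normc_ge0// ler_expR -mulNr -mulrN -!mulrA ler_wpM2l// ler_wpM2l ?pi_ge0//.
    apply: le_trans (ler_norm _) _; rewrite normrM normrN ler_wpM2r//.
    exact: le_trans lM (ler_norm _).
  by apply: wsummableZ => [l _||]; [exact: normc_ge0|exact: expR_ge0|exact: coef_summable].
have := ap_pairing cf tf (test_gauge y tphi) sg wc (fun l _ => cP l).
rewrite /line => H; transitivity (cintegral mu (setT : set mR) (fun x => f x * ft (gauge phi y) (- x))).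
  by apply: eq_cintegral => x _; rewrite fourier_ft.
rewrite H; apply: eq_csum => l _; rewrite cE' /gauge.
have -> : expo (2 * pi * y)%:C l = (expR (2 * pi * l * y))%:C :> C.
  rewrite cexp_real /expo -(rmorphM (real_complex R)); congr (cexp (_%:C)); ring.
have e1 : (expR (- (2 * pi * l * y)))%:C * (expR (2 * pi * l * y))%:C = 1 :> C.
  by rewrite -(rmorphM (real_complex R)) -expRD addNr expR0.
rewrite -[RHS]mul1r -e1; ring.
Qed.

(* Test functions concentrating at [l]. *)
Lemma coef_lt0 : (forall (phi : R -> C) (e : R), test_function phi -> e < 0 ->
    (forall x, e < x -> phi x = 0) -> line y (fun z => F z * fourier phi z) = 0) ->
  forall l, l < 0 -> coef l = 0.
Proof.
move=> H l l0.
have [kap [[skap kap0 _ supp kap00] _]] := exists_mollifier (@ltr01 R).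
have ckap : continuous (fun t => (kap t)%:C : C).
  by apply: csmooth_continuous; exact: csmooth_real.
have skap1 : csupp (fun t => (kap t)%:C) 1 by move=> t t1; rewrite supp.
have [B B0 HB] := csupp_bounded ckap skap1.
(* The bumps shrink to [l] at constant height [kap 0], so the sums tend to [coef l] times that
   height. *)
pose phi n (t : R) : C := (kap (n.+1%:R * t + - (n.+1%:R * l)))%:C.
have phiE n t : phi n t = (kap (n.+1%:R * (t - l)))%:C by rewrite /phi mulrBr.
have n1 n : 1 <= n.+1%:R :> R by rewrite ler1n.
have phi0 n t : 1 < n.+1%:R * `|t - l| -> phi n t = 0.
  by move=> h; rewrite phiE supp// normrM ger0_norm.
have sphi n : csupp (phi n) (`|l| + 1).
  move=> t tl; apply: phi0; apply: (@lt_le_trans _ _ `|t - l|); last by rewrite ler_peMl.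
  have := ler_dist_dist t l; have := ler_norm (`|t| - `|l|); lra.
have tphi n : test_function (phi n).
  apply/test_functionP; split; last by exists (`|l| + 1); exact: sphi.
  apply: (csmooth_real (f := fun t => kap (n.+1%:R * t + - (n.+1%:R * l)))).
  exact: (@smooth_affine R kap n.+1%:R (- (n.+1%:R * l)) skap).
pose D := ball0 (`|l| + 1); pose w t := B * N (coef t).
have ws : wsummable D w.
  by apply: wsummableZ => [t _||]; [exact: normc_ge0| |exact: coef_summable].
have dom n : cdominated D w (fun t => coef t * phi n t).
  by move=> t _; rewrite Normc.normcM mulrC ler_wpM2r ?normc_ge0// HB.
pose lim t : C := coef t * (kap 0)%:C * (t - l == 0)%:R.
have domL : cdominated D w lim.
  move=> t _; rewrite /lim Normc.normcM Normc.normcM; case: (_ == _); rewrite ?mulr1n ?mulr0n.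
    by rewrite Normc.normc1 mulr1 mulrC ler_wpM2r ?normc_ge0// HB.
  by rewrite Normc.normc0 mulr0 mulr_ge0 ?normc_ge0.
have cv t : D t -> coef t * phi n t @[n --> \oo] --> lim t.
  move=> _; apply/cvg_normcP => e e0; rewrite /lim.
  have [tl|tl] := eqVneq (t - l) 0.
    by apply: nearW => n; rewrite phiE tl mulr0 mulr1 subrr Normc.normc0.
  have t0 : 0 < `|t - l| by rewrite normr_gt0.
  near=> n; rewrite phi0 ?mulr0 ?subrr ?Normc.normc0//.
  rewrite -ltr_pdivrMr// mul1r -[X in X < _]invrK -[X in _ < X]invrK ltf_pV2 ?posrE ?invr_gt0 ?invrK//.
  by near: n; exact: (near_infty_natSinv_lt (PosNum t0)).
have : csum D (fun t => coef t * phi n t) @[n --> \oo] --> csum D lim.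
  apply: (csum_cvg _ ws); [exact: nearW|exact: domL|exact: cv].
have -> : csum D lim = coef l * (kap 0)%:C.
  by apply: (@csum_delta R D (fun t => coef t * (kap 0)%:C) l); rewrite /D /= lerDl.
move=> cvl; have cv0 : csum D (fun t => coef t * phi n t) @[n --> \oo] --> (0 : C).
  apply/cvg_normcP => e e0.
  have l20 : 0 < - l / 2 by rewrite divr_gt0// oppr_gt0.
  near=> n; rewrite -(line_pairing (tphi n) (@sphi n)) (H _ (l / 2) (tphi n)).
  - by rewrite subrr Normc.normc0.
  - by rewrite pmulr_llt0// invr_gt0.
  move=> x lx; apply: phi0.
  have ln : n.+1%:R^-1 < - l / 2 by near: n; exact: (near_infty_natSinv_lt (PosNum l20)).
  rewrite -ltr_pdivrMl// mulr1; apply: lt_le_trans ln _.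
  by have := ler_norm (x - l); lra.
have E : coef l * (kap 0)%:C = 0 by exact: (cvg_unique _ cvl cv0).
move/eqP: E; rewrite mulf_eq0 => /orP[/eqP//|]; rewrite eq_complex /= eqxx andbT.
by rewrite gt_eqF.
Unshelve. all: by end_near. Qed.

End LinePairing.

(** * Comparison of the upper and lower lines *)

Section ConverseIdentity.
Variable R : realType.
Local Notation C := (cplx R).
Local Notation N := (@Normc.normc R).
Local Notation Re := (@complex.Re R).
Local Notation Im := (@complex.Im R).
Local Notation mu := (@lebesgue_measure R).
Local Notation mR := (measurableTypeR R).
Variables (D : set C) (m : C -> C) (rad : C -> R) (k : nat) (s c y c1 r1 : R) (P : {poly C}).
Variable F : C -> C.
Let w (g : C) : R := N (m g) * ((1 + N g ^+ 2) ^+ k.+1)^-1.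
Hypotheses (s0 : 0 <= s) (c0 : 0 < c) (cy : c < y) (c10 : 0 <= c1).
Hypotheses (Ds : forall g, D g -> `|Im g| <= s) (ws : wsummable D w) (D0 : limit_point D = set0).
Hypothesis rad0 : forall g, D g -> ((rad g) ^+ 2)%:C + g ^+ 2 != 0.
Hypothesis kb : forall z d g, 0 < d -> D g -> d <= N (g - z) ->
  N (kern k (rad g) z g * m g) <= (N z ^+ 2 + r1 ^+ 2) ^+ k * (c1 * kern_growth r1 d z) * w g.
Hypotheses (DJ : forall g, D g -> D (conjc g)) (mJ : forall g, D g -> m (conjc g) = m g)
  (mr : forall g, D g -> conjc (m g) = m g) (radJ : forall g : C, rad (conjc g) = rad g).
Hypothesis PJ : forall z, conjc (P.[conjc z]) = - P.[z].
Hypothesis FE : forall z, ~ D z -> F z = kern_sum D m k rad z + P.[z].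
Hypothesis dF : forall z, c < Im z -> derivable F z 1.
Hypothesis apF : almost_periodic (fun x : R => F (x +i* y)).
Local Notation coef := (fourier_coef F y).
Hypothesis sF : locally_summable coef.
Local Notation a := (antipodal_coef F y).

Let y0 : 0 <= y. Proof. exact/ltW/(lt_trans c0). Qed.

Let w0 g : 0 <= w g.
Proof. by rewrite mulr_ge0 ?normc_ge0// invr_ge0 exprn_ge0// addr_ge0// sqr_ge0. Qed.

(** [D] may reach above height [c], where the lines at heights [y] and [- y] need not enclose it.
    Points of nonzero mass cannot lie there, and by symmetry not below [- c] either. *)
Definition mass_points : set C := [set g | D g /\ m g != 0].
Local Notation E := mass_points.
Local Notation S := (represented_sum E m rad k P).

Let ED : E `<=` D. Proof. by move=> g []. Qed.

Let kdom (D' : set C) : D' `<=` D ->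
  forall z d, 0 < d -> (forall g, D' g -> d <= N (g - z)) ->
  exists2 B, 0 <= B & cdominated D' (fun g => B * w g) (fun g => kern k (rad g) z g * m g).
Proof.
move=> D'D z d d0 Hd; exists ((N z ^+ 2 + r1 ^+ 2) ^+ k * (c1 * kern_growth r1 d z)).
  by rewrite mulr_ge0 ?exprn_ge0 ?addr_ge0 ?sqr_ge0// mulr_ge0// kern_growth_ge0// ltW.
by move=> g D'g; exact: kb d0 (D'D g D'g) (Hd g D'g).
Qed.

Let E0 : limit_point E = set0. Proof. exact: limit_point_sub ED D0. Qed.

Let wsE : wsummable E w. Proof. by apply: wsummable_sub ws => // g _; exact: w0. Qed.

Let mass0 g : c < Im g -> D g -> m g = 0.
Proof.
move=> cg Dg; exact: (regular_mass0 s0 Ds ws rad0 (kdom (@subset_refl _ D)) D0 FE (dF cg) Dg).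
Qed.

Let EJ g : E g -> E (conjc g).
Proof. by move=> [Dg mg]; split; [exact: DJ|rewrite mJ]. Qed.

Let mJE g : E g -> m (conjc g) = m g. Proof. by move=> [/mJ]. Qed.

Let mrE g : E g -> conjc (m g) = m g. Proof. by move=> [/mr]. Qed.

Lemma mass_points_strip g : E g -> `|Im g| <= c.
Proof.
have half h : E h -> Im h <= c.
  by move=> [Dh mh]; rewrite leNgt; apply/negP => /mass0/(_ Dh) mh0; rewrite mh0 eqxx in mh.
move=> Eg; have h1 := half g Eg; have := half _ (EJ Eg).
by rewrite ler_norml h1 andbT; case: (g) => u v /=; rewrite lerNl.
Qed.

Lemma kern_sum_mass_points z : kern_sum D m k rad z = kern_sum E m k rad z.
Proof.
rewrite /kern_sum; congr (_ * _); apply: csum_sub => // g Dg nE.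
have [->|mg] := eqVneq (m g) 0; first by rewrite mulr0.
by exfalso; apply: nE.
Qed.

(** At a point of [D] of mass 0 the representation says nothing about [F]; both sides are continuous
    there and agree nearby. *)
Lemma upper_half_represented z : c < Im z -> F z = S z.
Proof.
move=> cz; have [Dz|nz] := pselect (D z); last first.
  by rewrite FE// kern_sum_mass_points.
have nE : ~ E z by move=> [_]; rewrite mass0// eqxx.
apply: (@punctured_eq _ F S z); first exact: derivable_cvg (dF cz).
  apply: derivable_cvg.
  have := @derivable_kern_sum _ E m s k rad s0 (fun g Eg => Ds (ED Eg)) wsE
    (fun g Eg => rad0 (ED Eg)) (kdom ED) E0 P z nE.
  exact.
have [d d0 Hd] := (nbhs_normcP _ _).1 (notin_near z D0).
apply/dnbhs_normcP; exists d => // x xd xz.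
have nx : ~ D x by move=> Dx; move: xz; rewrite (Hd x xd Dx) eqxx.
by rewrite FE// kern_sum_mass_points.
Qed.

Lemma represented_conj z : conjc (S (conjc z)) = - S z.
Proof.
rewrite /represented_sum conjCD PJ opprD; congr (_ + _).
exact: (kern_sum_conj k EJ mJE mrE radJ z).
Qed.

Lemma line_upper phi : line y (fun z => F z * fourier phi z) = line y (fun z => S z * fourier phi z).
Proof. by apply: eq_cintegral => x _; rewrite upper_half_represented. Qed.

(** The test function whose transform at [z] is [conjc (fourier phi (conjc z))]; it transports the
    lower line to the upper one. *)
Definition antiflip (phi : R -> C) (t : R) : C := conjc (phi (- t)).

Lemma test_antiflip phi : test_function phi -> test_function (antiflip phi).
Proof.
move=> /test_flip[h1 h2 [M HM]]; split.
- rewrite (_ : (fun x => _) = (fun x => Re (phi (- x)))); first exact: h1.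
  by apply/funext => x; rewrite /antiflip; case: (phi _).
- rewrite (_ : (fun x => _) = (fun x => -1 * Im (phi (- x)))).
    by apply: smoothM; [exact: smooth_cst|exact: h2].
  by apply/funext => x; rewrite /antiflip mulN1r; case: (phi _).
by exists M => x xM; rewrite /antiflip HM// conj_RC.
Qed.

Lemma fourier_antiflip phi z : test_function phi ->
  fourier phi (conjc z) = conjc (fourier (antiflip phi) z).
Proof.
move=> tphi; rewrite !fourierE -cintegral_conj; last 2 first.
- exact: measurableT.
- exact: test_fourier_integrable (test_antiflip tphi).
rewrite -[LHS](cintegral_opp (test_fourier_integrable (conjc z) tphi)).
apply: eq_cintegral => t _; rewrite /antiflip conjCM conjcK; congr (_ * _).
rewrite /expo conj_cexp; congr cexp; rewrite /kz; case: (z) => u v.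
by apply: complex_ext => /=; ring.
Qed.

Lemma line_lower phi : test_function phi ->
  line (- y) (fun z => S z * fourier phi z) =
  - conjc (line y (fun z => F z * fourier (antiflip phi) z)).
Proof.
move=> tphi; have ta := test_antiflip tphi.
have yy : `|y| = y by rewrite ger0_norm.
have [chi [tchi _ chiE]] := fourier_poly P ta.
have [i1 _] := represented_line mass_points_strip cy w0 wsE (fun g Eg => rad0 (ED Eg)) c10
  (fun z d g d0 Eg => kb d0 (ED Eg)) ta tchi chiE yy.
rewrite line_upper -(cintegral_conj measurableT i1) -cintegralN; last 2 first.
- exact: measurableT.
- by apply: cintegrable_conj => //; exact: measurableT.
apply: eq_cintegral => x _.
rewrite (_ : x +i* - y = conjc (x +i* y))// (fourier_antiflip _ tphi) conjCM.
have -> : S (conjc (x +i* y)) = - conjc (S (x +i* y)).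
  by rewrite -[LHS](@conjcK R) represented_conj (rmorphN (@conjc R)).
by rewrite mulNr.
Qed.

(* The integral along the lower line is minus the conjugate of one along the
   upper line, since [F] is anti-symmetric under [z |-> conj z]. *)
Lemma represented_formula phi : test_function phi ->
  line y (fun z => F z * fourier phi z) +
    conjc (line y (fun z => F z * fourier (antiflip phi) z)) =
  csum D (fun g => m g * fourier phi g).
Proof.
move=> tphi; rewrite -[X in _ + X]opprK -line_lower// line_upper.
rewrite (represented_jump _ mass_points_strip cy y0 w0 wsE (fun g Eg => rad0 (ED Eg)) c10
  (fun z d g d0 Eg => kb d0 (ED Eg)) tphi).
apply/esym; apply: csum_sub => // g Dg nE.
have [->|mg] := eqVneq (m g) 0; first by rewrite mul0r.
by exfalso; apply: nE.
Qed.

Lemma coef_negative l : l < 0 -> coef l = 0.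
Proof.
apply: (coef_lt0 apF sF) => phi e tphi e0 Hphi; rewrite line_upper.
apply: (represented_top _ mass_points_strip cy y0 w0 wsE (fun g Eg => rad0 (ED Eg)) c10
  (fun z d g d0 Eg => kb d0 (ED Eg)) (U := [set x | e < x]) tphi).
- exact: open_gt.
- exact: Hphi.
- by move=> x x0; exact: lt_le_trans x0.
Qed.

(** The three cases of [antipodal_coef] merge because coefficients at negative frequencies vanish;
    the two line integrals deliver the sum in this form. *)
Lemma antipodalE l : a l = coef l + conjc (coef (- l)).
Proof.
rewrite /antipodal_coef; have [l0|l0|<-] := ltgtP 0 l.
- by rewrite (@coef_negative (- l)) ?oppr_lt0// conj_RC addr0.
- by rewrite (coef_negative l0) add0r.
by rewrite oppr0; case: (coef 0) => u v; apply: complex_ext => /=; ring.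
Qed.

Lemma antipodal_conj l : conjc (a l) = a (- l).
Proof. by rewrite !antipodalE conjCD conjcK opprK addrC. Qed.

Let opp_bij M : set_bij [set l : R | `|l| <= M] [set l : R | `|l| <= M] -%R.
Proof.
split; first by move=> l /=; rewrite normrN.
  by move=> l l' _ _; exact: oppr_inj.
by move=> l /= lM; exists (- l); [rewrite /= normrN|rewrite opprK].
Qed.

Let coef_summableN M : wsummable [set l : R | `|l| <= M] (fun l => N (coef (- l))).
Proof.
exact: (reindex_wsummable (w := fun l => N (coef l)) (fun l => normc_ge0 _) (opp_bij M) (coef_summable sF M)).
Qed.

Let bound l : N (a l) <= N (coef l) + N (coef (- l)).
Proof. by rewrite antipodalE; apply: ler_normcD => //; rewrite normc_J. Qed.

Lemma antipodal_locally_summable : locally_summable a.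
Proof.
split; last first.
  move=> T T0; apply: (@wsummable_le _ _ _ _ (fun l => N (coef l) + N (coef (- l)))).
    by move=> l _; exact: bound.
  by apply: wsummableD; [move=> ? _; exact: normc_ge0|move=> ? _; exact: normc_ge0|exact: coef_summable|exact: coef_summableN].
apply: (@sub_countable _ _ _ (\bigcup_(l in [set l | coef l != 0]) [set l; - l])).
  apply: subset_card_le => l al; have [cl|cl] := eqVneq (coef l) 0.
    exists (- l); last by right; rewrite opprK.
    by move: al; rewrite /= antipodalE cl add0r; apply: contraNneq => ->; rewrite conj_RC.
  by exists l => //; left.
apply: bigcup_countable; first exact: sF.1.
by move=> l _; apply: finite_set_countable; exact: finite_set2.
Qed.

(** The two line integrals are paired separately; in the second the substitution of [- l] for [l]
    turns [conjc (coef l * antiflip phi l)] into [conjc (coef (- l)) * phi l]. *)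
Lemma converse_formula phi : test_function phi ->
  csum setT (fun l => a l * phi l) = csum D (fun g => m g * fourier phi g).
Proof.
move=> tphi; rewrite -represented_formula//.
have [_ [M HM]] := (test_functionP _).1 tphi.
have HM' : csupp (antiflip phi) M by move=> x xM; rewrite /antiflip HM ?normrN// conj_RC.
have [T T0 HT] := csupp_bounded (test_continuous tphi) HM.
rewrite (line_pairing apF sF tphi HM) (line_pairing apF sF (test_antiflip tphi) HM').
rewrite -csum_conj [X in _ + X](reindex_csum _ (opp_bij M)).
pose v l := T * N (coef l) + T * N (coef (- l)).
have v1 l : 0 <= T * N (coef l) by rewrite mulr_ge0 ?normc_ge0.
have sv : wsummable [set l : R | `|l| <= M] v.
  have n0 (h : R -> R) l : `|l| <= M -> 0 <= N (coef (h l)) by move=> _; exact: normc_ge0.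
  apply: wsummableD => [l _|l _||]; [exact: v1|exact: v1| |].
    exact: wsummableZ (n0 id) T0 (coef_summable sF M).
  exact: wsummableZ (n0 -%R) T0 (coef_summableN M).
rewrite -(csumD sv).
- rewrite (@csum_sub _ _ setT [set l : R | `|l| <= M])//.
    apply: eq_csum => l _; have fl : antiflip phi (- l) = conjc (phi l) by rewrite /antiflip opprK.
    by rewrite antipodalE /= fl conjCM conjcK mulrDl.
  by move=> l _ /negP; rewrite -ltNge => Ml; rewrite HM// mulr0.
- move=> l _; rewrite Normc.normcM mulrC /v; apply: (@le_trans _ _ (T * N (coef l))).
    by rewrite ler_wpM2r ?normc_ge0.
  by rewrite lerDl.
move=> l _; have fl : antiflip phi (- l) = conjc (phi l) by rewrite /antiflip opprK.
rewrite /= fl normc_J Normc.normcM normc_J mulrC /v.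
apply: (@le_trans _ _ (T * N (coef (- l)))); last by rewrite lerDr.
by rewrite ler_wpM2r ?normc_ge0.
Qed.

End ConverseIdentity.

Section Converse.
Variable R : realType.
Local Notation C := (cplx R).
Local Notation N := (@Normc.normc R).
Local Notation Re := (@complex.Re R).
Local Notation Im := (@complex.Im R).

Lemma horner_real_conj (Q : {poly R}) (z : C) :
  conjc (map_poly (real_complex R) Q).[conjc z] = (map_poly (real_complex R) Q).[z].
Proof.
rewrite -[X in X.[z]](_ : map_poly (@conjc R) (map_poly (real_complex R) Q) = _); last first.
  by apply/polyP => i; rewrite (coef_map (@conjc R)) (coef_map (real_complex R)); exact: conj_RC.
by rewrite -[z in RHS](@conjcK R z) (horner_map (@conjc R)).
Qed.

Lemma converse_part (sigma : R) (I : set nat) (q p : nat -> R) (A : set C)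
    (b : C -> R) (k : nat) (rho : R) (Q : {poly R}) (F : C -> C) (c y : R)
    (nu := atomic_cmeasure I q p) (eta := mass_function A b) (a := antipodal_coef F y) :
  0 <= sigma -> sigma < rho -> {in I &, injective q} ->
  (forall g, A g -> `|Im g| < sigma) -> (forall g, A g -> Im g != 0) ->
  limit_point (pts I q A) = set0 ->
  (forall g, A g -> A (conjc g)) -> (forall g, A g -> b (conjc g) = b g) ->
  (\esum_(n in I) (`|p n| / (1 + q n ^+ 2) ^+ k.+1)%:E < +oo)%E ->
  (\esum_(g in A) (`|b g| / (1 + N g ^+ 2) ^+ k.+1)%:E < +oo)%E ->
  represented F I q p A (fun g => (b g)%:C) k rho Q ->
  0 < c -> AP (shift_up F c) -> c < y -> locally_summable (fourier_coef F y) ->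
  [/\ FS_pair sigma nu eta a,
    (forall g : C, atoms eta g <-> atoms eta (conjc g)) /\
      (forall g : C, atoms eta g -> eta (conjc g) = eta g),
    [/\ forall B : set R, Im (cm_val nu B) = 0, forall g, Im (eta g) = 0 &
      forall l, conjc (a l) = a (- l)],
    (ord nu <= 2 * k.+1)%N & (discrete_ord eta <= 2 * k.+1)%N].
Proof.
move=> s0 srho qi As' AI D0 AJ bJ wp wb repF c0 [dFs _ apFs] cy sF.
have As g (Ag : A g) := ltW (As' g Ag).
pose b' (g : C) : C := (b g)%:C; pose D := pts I q A; pose m := mass I q p b'.
have ws : wsummable D (pts_weight I q p b' k).
  apply: pts_weight_summable => //; apply: wsummable_le wb => g Ag.
  by rewrite /b' normcR.
have Ds g : D g -> `|Im g| <= sigma by exact: pts_strip.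
have bJ' g : A g -> b' (conjc g) = b' g by move=> Ag; rewrite /b' bJ.
have br' g : A g -> conjc (b' g) = b' g by move=> Ag; rewrite conj_RC.
have DJ g : D g -> D (conjc g) by exact: pts_conj.
have mJ g : D g -> m (conjc g) = m g by exact: mass_conjc.
have mr g : D g -> conjc (m g) = m g by exact: conjc_mass.
pose P : {poly C} := (0 +i* 1 : C) *: map_poly (real_complex R) Q.
have PJ z : conjc P.[conjc z] = - P.[z].
  rewrite /P !hornerZ conjCM horner_real_conj -mulNr; congr (_ * _).
  by apply: complex_ext; rewrite /= ?oppr0.
have FE z : ~ D z -> F z = kern_sum D m k (radius rho) z + P.[z].
  move=> nz; rewrite /P hornerZ.
  exact: ((@representedP _ I q p A b' qi AI k _ s0 As ws rho Q F srho D0).1 repF z nz).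
have dF z : c < Im z -> derivable F z 1.
  move=> cz; have -> : F = fun x => shift_up F c (x + (0 +i* - c)).
    apply/funext => x; rewrite /shift_up -addrA; congr F.
    by apply: complex_ext; case: (x) => u v /=; ring.
  apply: (derivable_shift (F := shift_up F c)); apply: dFs.
  by case: (z) cz => u v /=; rewrite subr_gt0.
have apF : almost_periodic (fun x : R => F (x +i* y)).
  have := apFs (y - c); rewrite subr_gt0 => /(_ cy).
  rewrite (_ : (fun x : R => _) = (fun x => F (x +i* y)))//.
  by apply/funext => x; rewrite /shift_up; congr F; apply: complex_ext => /=; ring.
have [_ [_ [_ _ rad0 _ _]]] := @pts_kern1_bound _ I q p _ b' AI k _ s0 As rho srho.
have [c1 [r1 [c10 r10 kb]]] := @pts_kern_bound _ I q p _ b' AI k _ s0 As rho srho.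
have formula := converse_formula s0 c0 cy (ltW c10) Ds ws D0 rad0 kb DJ mJ mr
  (radius_conj rho) PJ FE dF apF sF.
have lsum := antipodal_locally_summable s0 c0 cy (ltW c10) Ds ws D0 rad0 kb DJ mJ
  FE dF apF sF.
have aJ := antipodal_conj s0 c0 cy (ltW c10) Ds ws D0 rad0 kb DJ mJ
  FE dF apF sF.
have etaE g : A g -> eta g = b' g by move=> Ag; rewrite /eta /mass_function mem_set.
have eta0 g : ~ A g -> eta g = 0.
  by move=> nA; rewrite /eta /mass_function memNset.
have etaA g : atoms eta g -> A g.
  by move=> ag; apply: contrapT => /eta0 e0; move: ag; rewrite /atoms /= e0 eqxx.
have etaJ g : eta (conjc g) = eta g.
  have [Ag|nA] := pselect (A g); first by rewrite !etaE ?bJ'//; exact: AJ.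
  by rewrite !eta0// => /AJ; rewrite conjcK.
have tnu : tempered_at nu (2 * k.+1).
  apply/atomic_tempered_at; apply: wsummable_le wp => n In.
  by rewrite powR_half// sqr_ge0.
have teta : discrete_tempered_at eta (2 * k.+1).
  have h : wsummable (atoms eta) (fun g => `|b g| / (1 + N g ^+ 2) ^+ k.+1).
    apply: wsummable_sub wb => [g _|g]; last exact: etaA.
    by rewrite divr_ge0// exprn_ge0// addr_ge0// sqr_ge0.
  apply: wsummable_le h => g /etaA Ag; rewrite powR_half ?sqr_ge0//.
  by rewrite etaE// /b' normcR.
split.
- split=> //.
  + by exists (2 * k.+1)%N.
  + by exists (2 * k.+1)%N.
  + by move=> g /etaA /AI.
  + move=> g; have : limit_point (atoms eta) = set0.
      by apply: limit_point_sub D0 => h /etaA; right.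
    by move=> ->.
  + by move=> g /etaA /As'.
  move=> phi tphi; rewrite formula// (pts_formula qi AI s0 As ws tphi); congr (_ + _).
  (* [b] may vanish at points of [A], so the atoms of [eta] can form a smaller set. *)
  rewrite (csum_sub (E := atoms eta)).
  * by apply: eq_csum => g /etaA Ag; rewrite etaE.
  * exact: etaA.
  move=> g Ag; rewrite /atoms /= => /negP; rewrite negbK etaE// => /eqP ->.
  by rewrite mul0r.
- by split=> g; rewrite /atoms /= etaJ.
- split=> //; first by move=> B; exact: atomic_real.
  by move=> g; rewrite /eta /mass_function; case: ifP.
- by have [_] := leastP (ex_intro _ _ tnu); apply.
by have [_] := leastP (ex_intro _ _ teta); apply.
Qed.

End Converse.

Theorem corollary4 (R : realType) :
  (* Direct part *)
  (forall (sigma : R) (N : set nat) (q p : nat -> R) (b : cplx R -> cplx R)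
     (a : R -> cplx R) (k : nat),
   {in N &, injective q} ->
   (forall n, N n -> p n != 0) ->
   let nu := atomic_cmeasure N q p in
   let A := atoms b in
   FS_pair sigma nu b a ->
   R_symmetric b ->
   real_antipodal nu b a ->
   limit_point ([set t%:C | t in cm_support nu] `|` discrete_support b
     : set (cplx R)) = set0 ->
   (ord nu <= 2 * k.+1)%N ->
   (discrete_ord b <= 2 * k.+1)%N ->
   finite_exponential_growth a ->
   let term := fun (z : cplx R) (l : R) =>
     a l * cexp ((0 +i* (2 * pi * l)) * z) in
   let poles := [set (q n)%:C | n in N] `|` A in
   exists F : cplx R -> cplx R,
     (exists c : R,
        (forall z : cplx R, c < complex.Im z ->
           csummable [set l : R | 0 < l] (term z) /\
           F z = a 0 / 2 + csum [set l : R | 0 < l] (term z)) /\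
        AP (shift_up F c)) /\
     meromorphic F /\
     (forall z : cplx R, ~ poles z -> derivable F z 1) /\
     (forall g, A g ->
        simple_pole_with_residue F g (- b g / (0 +i* (2 * pi)))) /\
     (forall n, N n ->
        simple_pole_with_residue F (q n)%:C (- (p n)%:C / (0 +i* (2 * pi)))) /\
     (forall z : cplx R, ~ poles z -> (F z^*)^* = - F z) /\
     (forall rho : R, sigma < rho ->
        exists Q : {poly R}, (size Q <= (2 * k).+1)%N /\
          represented F N q p A b k rho Q))
  /\
  (* Converse part *)
  (forall (sigma : R) (N : set nat) (q p : nat -> R) (A : set (cplx R))
     (b : cplx R -> R) (k : nat) (rho : R) (Q : {poly R})
     (F : cplx R -> cplx R) (c : R),
   0 <= sigma ->
   sigma < rho ->
   (size Q <= (2 * k).+1)%N ->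
   {in N &, injective q} ->
   (forall g, A g -> `|complex.Im g| < sigma) ->
   (forall g, A g -> complex.Im g != 0) ->
   limit_point ([set (q n)%:C | n in N] `|` A : set (cplx R)) = set0 ->
   A = [set g^* | g in A] ->
   (forall g, A g -> b g = b g^*) ->
   (\esum_(n in N) (`|p n| / (1 + q n ^+ 2) ^+ k.+1)%:E < +oo)%E ->
   (\esum_(g in A) (`|b g| / (1 + Normc.normc g ^+ 2) ^+ k.+1)%:E < +oo)%E ->
   meromorphic F ->
   represented F N q p A (fun g => (b g)%:C) k rho Q ->
   0 < c ->
   AP (shift_up F c) ->
   forall y : R, c < y ->
   locally_summable (fourier_coef F y) ->
   let nu := atomic_cmeasure N q p in
   let eta := mass_function A b in
   let a := antipodal_coef F y in
   [/\ FS_pair sigma nu eta a, R_symmetric eta, real_antipodal nu eta a,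
       (ord nu <= 2 * k.+1)%N & (discrete_ord eta <= 2 * k.+1)%N]).
Proof.
split.
  move=> sigma I q p b a k qi pn nu A FSP bsym ra lp on ob ga term poles.
  have [F [F1 [F2 [F3 [F4 [F5 [F6 F7]]]]]]] := direct_part qi pn FSP bsym ra lp on ob ga.
  by exists F.
move=> sigma I q p A b k rho Q F c s0 srho _ qi As AI D0 AE bJ wp wb _ repF c0 apF y cy sF nu eta a.
have AJ g : A g -> A (conjc g) by move=> Ag; rewrite AE; exists g.
have bJ' g : A g -> b (conjc g) = b g by move=> Ag; exact: esym (bJ g Ag).
have [h1 h2 [r1 r2 r3] h4 h5] := converse_part s0 srho qi As AI D0 AJ bJ' wp wb repF c0 apF cy sF.
by split=> //; split=> // B _ _; exact: r1.
Qed.
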